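(* Let $\mu\in\{1,-1\}$, let $d\geq 1$ be an integer and let $s$ be a real number such that $s\leq -\frac12$ if $d=1$, and $s<0$ if $d\geq 2$. Then the equation $$i\partial_t u+\Delta^2 u+\mu|u|^4u=0 \quad\text{on }\mathbb{R}^d$$ exhibits the norm inflation phenomenon at every $u_0\in H^s(\mathbb{R}^d)$; that is, for every $u_0\in H^s(\mathbb{R}^d)$ and every $\epsilon>0$ there exist a solution $u$ of the equation and a time $t\in(0,\epsilon)$ such that $$\|u(\cdot,0)-u_0\|_{H^s}<\epsilon\quad\text{and}\quad \|u(\cdot,t)\|_{H^s}>\epsilon^{-1}.$$
   Context: $H^s(\mathbb{R}^d)$ is the inhomogeneous $L^2$-based Sobolev space, $\|f\|_{H^s}=\|\langle\xi\rangle^s\hat f\|_{L^2}$, $\langle \xi\rangle=(1+|\xi|^2)^{1/2}$. The unknown $u$ is complex-valued. Solutions are understood through the Duhamel formula $u(t)=S(t)u(0)+i\mu\int_0^tS(t-\tau)\big(|u(\tau)|^4u(\tau)\big)\,d\tau$ with $S(t)=e^{it\Delta^2}$, on a time interval containing $[0,t]$. *)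

(* Defs.v *)
From HB Require Import structures.
From mathcomp Require Import all_boot all_order all_algebra.
From mathcomp Require Import complex.
From mathcomp Require Import all_classical all_reals all_analysis.

Set Implicit Arguments.
Unset Strict Implicit.
Unset Printing Implicit Defensive.

Import Order.TTheory GRing.Theory Num.Theory.
Import numFieldNormedType.Exports.

Local Open Scope classical_set_scope.
Local Open Scope ring_scope.
Local Open Scope complex_scope.

Section lebesgue_measure_tuple.
Context {R : realType}.

Definition tcons n (p : measurableTypeR R * n.-tuple R) : n.+1.-tuple R :=
  [the n.+1.-tuple R of p.1 :: p.2].

Lemma measurable_tcons n : measurable_fun [set: measurableTypeR R * n.-tuple R] (@tcons n).
Proof. by apply: measurable_cons; [exact: measurable_fst|exact: measurable_snd]. Qed.

Lemma measurable_tuncons n :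
  measurable_fun [set: n.+1.-tuple R] (fun x => (thead x, [tuple of behead x])).
Proof.
by apply/measurable_fun_pair; [exact: measurable_tnth|exact: measurable_behead].
Qed.

Section tcons_measure.
Variables (n : nat) (m : {sigma_finite_measure set (n.-tuple R) -> \bar R}).

Definition tcons_measure : set (n.+1.-tuple R) -> \bar R :=
  pushforward (@lebesgue_measure R \x m)%E (@tcons n).

Let tm0 : tcons_measure set0 = 0%E.
Proof. by rewrite /tcons_measure /pushforward preimage_set0 measure0. Qed.

Let tm_ge0 A : (0 <= tcons_measure A)%E.
Proof. by rewrite /tcons_measure /pushforward measure_ge0. Qed.

Let tm_sigma_additive : semi_sigma_additive tcons_measure.
Proof.
have mT A : measurable A -> measurable (@tcons n @^-1` A).
  by move=> mA; rewrite -[X in measurable X]setTI; exact: measurable_tcons.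
move=> F mF tF mUF; rewrite /tcons_measure /pushforward preimage_bigcup.
apply: measure_semi_sigma_additive.
- by move=> i; exact: mT.
- apply/trivIsetP => /= i j _ _ ij; rewrite -preimage_setI.
  by move/trivIsetP : tF => /(_ _ _ _ _ ij) ->//; rewrite preimage_set0.
- by rewrite -preimage_bigcup; exact: mT.
Qed.

HB.instance Definition _ := isMeasure.Build _ _ _ tcons_measure
  tm0 tm_ge0 tm_sigma_additive.

Let tm_sigma_finite : sigma_finite setT tcons_measure.
Proof.
have /sigma_finiteP[F [TF ndF Foo]] := sigma_finiteT (@lebesgue_measure R).
have /sigma_finiteP[G [TG ndG Goo]] := sigma_finiteT m.
pose g (x : n.+1.-tuple R) : measurableTypeR R * n.-tuple R :=
  (thead x, [tuple of behead x]).
have gK p : g (tcons p) = p.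
  by case: p => a t; congr pair; apply/val_inj.
exists (fun i => g @^-1` (F i `*` G i)).
  rewrite -preimage_bigcup (_ : \bigcup_i _ = setT) ?preimage_setT//.
  apply/seteqP; split=> // -[x y] _.
  have [i _ Fix] : (\bigcup_i F i) x by rewrite -TF.
  have [k _ Gky] : (\bigcup_i G i) y by rewrite -TG.
  exists (maxn i k) => //; split => /=.
  - by move: x Fix; exact/subsetPset/ndF/leq_maxl.
  - by move: y Gky; exact/subsetPset/ndG/leq_maxr.
move=> i; have [mF Fi] := Foo i; have [mG Gi] := Goo i; split.
  rewrite -[X in measurable X]setTI; apply: measurable_tuncons => //.
  exact: measurableX.
rewrite /tcons_measure /pushforward (_ : _ @^-1` _ = F i `*` G i).
  by rewrite product_measure1E// lte_mul_pinfty// ge0_fin_numE.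
by apply/funext => p; rewrite /preimage /mkset gK.
Qed.

HB.instance Definition _ := Measure_isSigmaFinite.Build _ _ _ tcons_measure
  tm_sigma_finite.

End tcons_measure.

(* Lebesgue measure on R^d, the [d]-fold product of [lebesgue_measure]. *)
Fixpoint leb (d : nat) : {sigma_finite_measure set (d.-tuple R) -> \bar R} :=
  match d with
  | 0%N => dirac [tuple]
  | n.+1 => tcons_measure (leb n)
  end.

End lebesgue_measure_tuple.

Section complex_valued.
Context {R : realType}.

Definition expi (t : R) : R[i] := cos t +i* sin t.

Section integral.
Context {disp : measure_display} {T : measurableType disp}.

Definition cmeasurable (f : T -> R[i]) : Prop :=
  measurable_fun setT (fun x => complex.Re (f x)) /\
  measurable_fun setT (fun x => complex.Im (f x)).

Definition cintegrable (m : {measure set T -> \bar R}) (f : T -> R[i]) : Prop :=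
  m.-integrable setT (fun x => (complex.Re (f x))%:E) /\
  m.-integrable setT (fun x => (complex.Im (f x))%:E).

Definition cintegral (m : {measure set T -> \bar R}) (D : set T)
    (f : T -> R[i]) : R[i] :=
  (\int[m]_(x in D) complex.Re (f x)) +i* (\int[m]_(x in D) complex.Im (f x)).

Definition cLnorm (m : {measure set T -> \bar R}) (p : \bar R)
    (f : T -> R[i]) : \bar R :=
  Lnorm m p (fun x => (Normc.normc (f x))%:E).

End integral.
End complex_valued.

Section Rd.
Context {R : realType} {d : nat}.
Local Notation Rd := (d.-tuple R).
Implicit Types (x xi : Rd) (phi : Rd -> R[i]).

Definition dot x xi : R := \sum_(j < d) tnth x j * tnth xi j.

Definition japanese xi : R := Num.sqrt (1 + dot xi xi).

Definition translate (i : 'I_d) x (h : R) : Rd :=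
  [tuple tnth x j + (if j == i then h else 0) | j < d].

Definition partial (i : 'I_d) (f : Rd -> R) x : R :=
  derive1 (fun h : R => f (translate i x h)) 0.

Definition partials (l : seq 'I_d) (f : Rd -> R) : Rd -> R :=
  foldr partial f l.

Definition has_partials (f : Rd -> R) : Prop :=
  forall (l : seq 'I_d) (i : 'I_d) x,
    derivable (fun h : R => partials l f (translate i x h)) 0 1.

Definition cpartials (l : seq 'I_d) phi x : R[i] :=
  partials l (fun y => complex.Re (phi y)) x +i*
  partials l (fun y => complex.Im (phi y)) x.

(* No continuity is asked of the iterated partial derivatives: since all of
   them exist and are bounded, they are all Lipschitz, so [phi] is C^oo. *)
Definition schwartz phi : Prop :=
  [/\ has_partials (fun x => complex.Re (phi x)),
      has_partials (fun x => complex.Im (phi x)) &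
      forall (l : seq 'I_d) (k : nat), exists M : R, forall x,
        (1 + dot x x) ^+ k * Normc.normc (cpartials l phi x) <= M].

(* hat phi (xi) = \int e^{-i x.xi} phi(x) dx, with no normalizing factor; the
   factor (2 pi)^{-d} is in the inverse transform. *)
Definition fourier phi : Rd -> R[i] :=
  fun xi => cintegral (leb d) setT (fun x => expi (- dot x xi) * phi x).

Definition inv_fourier phi : Rd -> R[i] :=
  fun x => (((2 * pi) ^- d)%:C : R[i]) *
           cintegral (leb d) setT (fun xi => expi (dot x xi) * phi xi).

(* A distribution is a functional on all functions, of which only the values
   on the Schwartz class are meaningful. *)
Definition distrib : Type := (Rd -> R[i]) -> R[i].
Implicit Types T : distrib.

Definition tempered T : Prop :=
  (forall (a : R[i]) phi psi, schwartz phi -> schwartz psi ->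
     T (fun x => a * phi x + psi x) = a * T phi + T psi) /\
  (exists (C : R) (m k : nat), forall phi (M : R), schwartz phi ->
     (forall (l : seq 'I_d) x, (size l <= m)%N ->
        (1 + dot x x) ^+ k * Normc.normc (cpartials l phi x) <= M) ->
     Normc.normc (T phi) <= C * M).

Definition of_fun (f : Rd -> R[i]) : distrib :=
  fun phi => cintegral (leb d) setT (fun x => f x * phi x).

Definition dfourier T : distrib := fun phi => T (fourier phi).

Definition inv_dfourier T : distrib := fun phi => T (inv_fourier phi).

Definition dmul (a : Rd -> R[i]) T : distrib :=
  fun phi => T (fun x => a x * phi x).

Definition dfourier_is T (g : Rd -> R[i]) : Prop :=
  cmeasurable g /\
  forall phi, schwartz phi ->
    cintegrable (leb d) (fun xi => g xi * phi xi) /\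
    dfourier T phi = of_fun g phi.

(* The function g representing the Fourier transform of T, if any, is unique
   up to a null set, so the infimum is over at most one value; it is +oo when
   the Fourier transform of T is not a function. *)
Definition Hs_norm (s : R) T : \bar R :=
  ereal_inf [set cLnorm (leb d) 2%:E
                   (fun xi => ((japanese xi `^ s)%:C : R[i]) * g xi)
            | g in [set g | dfourier_is T g]].

Definition in_Hs (s : R) T : Prop := tempered T /\ (Hs_norm s T < +oo)%E.

(* e^{i t Delta^2} : Fourier multiplier of symbol e^{i t |xi|^4}. *)
Definition propagator (t : R) T : distrib :=
  inv_dfourier (dmul (fun xi => expi (t * dot xi xi ^+ 2)) (dfourier T)).

Definition quintic (v : Rd -> R[i]) : Rd -> R[i] :=
  fun x => ((Normc.normc (v x) ^+ 4)%:C : R[i]) * v x.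

Definition in_L2Loo (v : Rd -> R[i]) : Prop :=
  [/\ cmeasurable v, (cLnorm (leb d) 2%:E v < +oo)%E
    & (cLnorm (leb d) +oo%E v < +oo)%E].

(* u in C([0, T0]; L^2 cap L^oo); then |u|^4 u is in C([0, T0]; L^1 cap L^2)
   and the Duhamel integral below is that of a continuous function of tau. *)
Definition continuous_L2Loo (T0 : R) (u : R -> Rd -> R[i]) : Prop :=
  (forall t : R, 0 <= t <= T0 -> in_L2Loo (u t)) /\
  (forall t : R, 0 <= t <= T0 -> forall e : R, 0 < e ->
     exists2 delta : R, 0 < delta &
       forall r : R, 0 <= r <= T0 -> `|r - t| < delta ->
         (cLnorm (leb d) 2%:E (fun x => (u r x - u t x)%R) < e%:E)%E /\
         (cLnorm (leb d) +oo%E (fun x => (u r x - u t x)%R) < e%:E)%E).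

(* u(t) = S(t) u(0) + i mu \int_0^t S(t - tau) (|u|^4 u)(tau) dtau as tempered
   distributions, for all t in [0, T0]. *)
Definition duhamel (mu T0 : R) (u : R -> Rd -> R[i]) : Prop :=
  forall t : R, 0 <= t <= T0 -> forall phi, schwartz phi ->
    of_fun (u t) phi =
      propagator t (of_fun (u 0)) phi +
      (0 +i* mu) *
        cintegral lebesgue_measure `[0, t]
          (fun tau => propagator (t - tau) (of_fun (quintic (u tau))) phi).

Definition solution (mu T0 : R) (u : R -> Rd -> R[i]) : Prop :=
  continuous_L2Loo T0 u /\ duhamel mu T0 u.

End Rd.

Arguments distrib : clear implicits.

(* Main.v *)
Require Import Defs.
From HB Require Import structures.
From mathcomp Require Import all_boot all_order all_algebra.
From mathcomp Require Import complex.
From mathcomp Require Import all_classical all_reals all_analysis.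
From mathcomp Require Import measurable_realfun ess_sup_inf ring lra.

Set Implicit Arguments.
Unset Strict Implicit.
Unset Printing Implicit Defensive.

Import Order.TTheory GRing.Theory Num.Theory.
Import numFieldNormedType.Exports.

Local Open Scope classical_set_scope.
Local Open Scope ring_scope.
Local Open Scope complex_scope.
Import ComplexField.Normc.

(** Everything takes place on the Fourier side.  A solution is sought as
    [u t = inv_fourier (h t)] with [h t] bounded and integrable.  Products become
    convolutions, so that the nonlinearity is the fivefold convolution [cquint]
    ([quintic_inv_fourier]), and [h] is the limit of the Picard iterates [hn] of
    the Duhamel formula.  All estimates are made on real majorants: [cdom] says
    that two complex functions and their difference are dominated by two real
    majorants and their difference, and [cquint] preserves this relation
    ([cdom_quint]) because it is multilinear with a nonnegative kernel.  Bounds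
    in L^1 and in L^oo on the iterated majorants ([rpair_iter]) thus give at the
    same time the solution ([sol_solution]), its continuous dependence on the
    data ([hlim_dist]) and its distance to any iterate ([cdom_hlim]).  The
    passage from functions to tempered distributions rests on Parseval's
    identity ([parseval]), obtained by inserting the weight
    [exp (- del * \sum_j |x_j|)], whose transform is a Poisson kernel, and letting
    [del] tend to zero; and on the fact that transforms of Schwartz functions
    are bounded and integrable ([inv_fourier_good]).

    Inflation is a transfer from high to low frequencies.  First [u0] is replaced
    by a function whose transform [V] is bounded and integrable
    ([bounded_dense]).  To [V] is added the function [F], equal to [al] on the
    two boxes of radius [A] centred at [(N, ..., N)] and [(2 N, ..., 2 N)].
    The height [al] is such that [F] has Sobolev norm at most [eps / 4]; since
    [s < 0], its mass, of order [S = al (2 A) ^ d], is nevertheless large when [N] and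
    [A] are.  The frequencies of [F] interact as
    [(N - 2 N) + (N - N) + N = 0], which makes the quintic term at least of order
    [al S ^ 4] on a box of radius [A / 8] around the origin ([rquint_twobox]).
    At time [T = rho / S ^ 4] the phases [exp (i t |xi| ^ 4)] have hardly turned
    on the frequencies involved, so that these contributions add up
    ([second_iterate]) to a function of size [rho al] near the origin, while the
    later iterates only contribute [rho ^ 2 al] and the presence of [V] changes
    the result by a quantity that depends on [V] alone ([core_lower],
    [spread_pairing]).

    The norm of the solution at time [T] is bounded below by duality against a
    nonnegative Schwartz function [psi] ([Hs_norm_lower]); this leads to the
    ratio of [rho al \int psi] to the L^2 norm of [<x> ^ (- s) psi].  With
    [al ^ 2 A ^ d] of order [eps ^ 2 N ^ (- 2 s)] and [psi] a Gaussian at scale [A],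
    the ratio is of order [rho eps (N / A) ^ (- s)].  The phases are under control
    when [T N ^ 4], that is [rho N ^ 4 / (eps ^ 4 (N ^ (- 2 s) A ^ d) ^ 2)], is small.
    For [d >= 2] both requirements are met with [A = N / L], [L] a large constant
    and then [N] large ([inflation_high]).  For [d = 1] one takes [A] comparable
    to [N]; the phases are then controlled for small [rho] exactly when
    [s <= - 1 / 2].  If [s < - 1 / 2], a fixed Gaussian suffices as [N] grows.
    If [s = - 1 / 2], scaling gives nothing and the gain is logarithmic: with
    [psi] a sum of Gaussians at [J] dyadic scales, the mass of [psi] grows like [J]
    and its weighted L^2 norm like the square root of [J] ([inflation_one]). *)

(** * Complex numbers and complex-valued measurable functions *)

Section normc.
Context {R : realType}.
Implicit Types (z w : R[i]) (t : R).

Lemma normC_E z : `|z| = (normc z)%:C. Proof. by []. Qed.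

Lemma normc_ge0 z : 0 <= normc z.
Proof. by case: z => a b; exact: sqrtr_ge0. Qed.

Lemma normcD z w : normc (z + w) <= normc z + normc w.
Proof. by rewrite -lecR rmorphD -!normC_E; exact: ler_normD. Qed.

Lemma normcN z : normc (- z) = normc z.
Proof. by case: z => a b /=; rewrite !sqrrN. Qed.

Lemma normcBC z w : normc (z - w) = normc (w - z).
Proof. by rewrite -normcN opprB. Qed.

Lemma normcB z w : normc (z - w) <= normc z + normc w.
Proof. by rewrite -(normcN w); exact: normcD. Qed.

Lemma normc_real t : normc t%:C = `|t|.
Proof. by rewrite /= expr0n/= addr0 sqrtr_sqr. Qed.

Lemma normc_conj z : normc (conjc z) = normc z.
Proof. by case: z => a b /=; rewrite sqrrN. Qed.

Lemma sqr_normc z : normc z ^+ 2 = complex.Re z ^+ 2 + complex.Im z ^+ 2.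
Proof. by case: z => a b /=; rewrite sqr_sqrtr// addr_ge0 ?sqr_ge0. Qed.

Lemma Re_le_normc z : `|complex.Re z| <= normc z.
Proof.
rewrite -(@ler_pXn2r _ 2) ?nnegrE ?normc_ge0// real_normK ?num_real//.
by rewrite sqr_normc lerDl sqr_ge0.
Qed.

Lemma Im_le_normc z : `|complex.Im z| <= normc z.
Proof.
rewrite -(@ler_pXn2r _ 2) ?nnegrE ?normc_ge0// real_normK ?num_real//.
by rewrite sqr_normc lerDr sqr_ge0.
Qed.

Lemma normc_le_ReIm z : normc z <= `|complex.Re z| + `|complex.Im z|.
Proof.
rewrite -(@ler_pXn2r _ 2) ?nnegrE ?normc_ge0 ?addr_ge0// sqr_normc sqrrD.
by rewrite !real_normK ?num_real// lerD2r lerDl mulrn_wge0 ?mulr_ge0.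
Qed.

Lemma conjcM z w : conjc (z * w) = conjc z * conjc w.
Proof.
case: z => a b; case: w => p q; apply/eqP; rewrite eq_complex /=.
by apply/andP; split; apply/eqP; ring.
Qed.

Lemma mulc_conj z : z * (conjc z) = (normc z ^+ 2)%:C.
Proof.
rewrite sqr_normc; case: z => a b /=; simpc.
by rewrite !expr2 [b * a]mulrC addNr.
Qed.

Lemma expi0 : expi (0 : R) = 1.
Proof. by rewrite /expi cos0 sin0. Qed.

Lemma expiD s t : expi (s + t) = expi s * expi t.
Proof. by rewrite /expi cosD sinD; simpc; rewrite [sin s * cos t + _]addrC. Qed.

Lemma expiN t : expi (- t) = (conjc (expi t)).
Proof. by rewrite /expi cosN sinN. Qed.

Lemma normc_expi t : normc (expi t) = 1.
Proof. by rewrite /= cos2Dsin2 sqrtr1. Qed.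

Lemma normc_expiM t z : normc (expi t * z) = normc z.
Proof. by rewrite normcM normc_expi mul1r. Qed.

(** A convergence of complex sequences, expressed on coordinates so that the
    real theory applies to each of them. *)
Definition ccvg (u : nat -> R[i]) (l : R[i]) : Prop :=
  (fun n => complex.Re (u n)) @ \oo --> complex.Re l /\
  (fun n => complex.Im (u n)) @ \oo --> complex.Im l.

Lemma ccvg_cst z : ccvg (fun=> z) z.
Proof. by split; exact: cvg_cst. Qed.

Lemma ccvgD u v a b : ccvg u a -> ccvg v b -> ccvg (fun n => u n + v n) (a + b).
Proof.
move=> [u1 u2] [v1 v2]; split.
  rewrite (_ : (fun n => _) = (fun n => complex.Re (u n) + complex.Re (v n))).
    rewrite (_ : complex.Re (a + b) = complex.Re a + complex.Re b).
      exact: cvgD.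
    by case: a {u1 u2} => ? ?; case: b {v1 v2} => ? ?.
  by apply/funext => n; case: (u n) => ? ?; case: (v n).
rewrite (_ : (fun n => _) = (fun n => complex.Im (u n) + complex.Im (v n))).
  rewrite (_ : complex.Im (a + b) = complex.Im a + complex.Im b).
    exact: cvgD.
  by case: a {u1 u2} => ? ?; case: b {v1 v2} => ? ?.
by apply/funext => n; case: (u n) => ? ?; case: (v n).
Qed.

Lemma ccvgM u v a b : ccvg u a -> ccvg v b -> ccvg (fun n => u n * v n) (a * b).
Proof.
move=> [u1 u2] [v1 v2]; split.
  rewrite (_ : (fun n => _) = (fun n => complex.Re (u n) * complex.Re (v n) -
      complex.Im (u n) * complex.Im (v n))).
    rewrite (_ : complex.Re (a * b) =
        complex.Re a * complex.Re b - complex.Im a * complex.Im b).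
      by apply: cvgB; apply: cvgM.
    by case: a {u1 u2} => ? ?; case: b {v1 v2} => ? ?.
  by apply/funext => n; case: (u n) => ? ?; case: (v n).
rewrite (_ : (fun n => _) = (fun n => complex.Re (u n) * complex.Im (v n) +
    complex.Im (u n) * complex.Re (v n))).
  rewrite (_ : complex.Im (a * b) =
      complex.Re a * complex.Im b + complex.Im a * complex.Re b).
    by apply: cvgD; apply: cvgM.
  by case: a {u1 u2} => ? ?; case: b {v1 v2} => ? ?.
by apply/funext => n; case: (u n) => ? ?; case: (v n).
Qed.

Lemma ccvgN u a : ccvg u a -> ccvg (fun n => - u n) (- a).
Proof.
move=> ua; rewrite -mulN1r (_ : (fun n => _) = (fun n => -1 * u n)).
  by apply: ccvgM => //; exact: ccvg_cst.
by apply/funext => n; rewrite mulN1r.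
Qed.

Lemma ccvg_real (u : nat -> R) (l : R) : u @ \oo --> l -> ccvg (fun n => (u n)%:C) l%:C.
Proof. by move=> ul; split => //; exact: cvg_cst. Qed.

Lemma ccvg_expi (u : nat -> R) (l : R) : u @ \oo --> l ->
  ccvg (fun n => expi (u n)) (expi l).
Proof.
move=> ul; split => /=; apply: continuous_cvg => //.
  exact: continuous_cos.
exact: continuous_sin.
Qed.

Lemma ccvg_unique u a b : ccvg u a -> ccvg u b -> a = b.
Proof.
move=> [u1 u2] [v1 v2].
have e1 := cvg_unique _ u1 v1; have e2 := cvg_unique _ u2 v2.
by case: a {u1 u2} e1 e2 => ? ?; case: b {v1 v2} => ? ? /= -> // ->.
Qed.

Lemma ccvg_dist u l : ccvg u l <-> (fun n => normc (u n - l)) @ \oo --> (0 : R).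
Proof.
split=> [ul|ul].
  have [h1 h2] := ccvgD ul (ccvg_cst (- l)).
  apply: (@squeeze_cvgr _ _ _ _ (fun=> 0) (fun n => `|complex.Re (u n - l)| +
     `|complex.Im (u n - l)|)).
  - by near=> n; rewrite normc_ge0 normc_le_ReIm.
  - exact: cvg_cst.
  - have {}h1 : (fun n => complex.Re (u n - l)) @ \oo --> (0 : R).
      by rewrite subrr in h1.
    have {}h2 : (fun n => complex.Im (u n - l)) @ \oo --> (0 : R).
      by rewrite subrr in h2.
    by rewrite -(addr0 0) -{1 2}(normr0 R); apply: cvgD; exact: cvg_norm.
split.
  apply/subr_cvg0/norm_cvg0P; apply: (@squeeze_cvgr _ _ _ _ (fun=> 0) _ _ _ _ (cvg_cst 0) ul).
  near=> n; rewrite normr_ge0/= (le_trans _ (Re_le_normc _))//.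
  by case: (u n); case: (l).
apply/subr_cvg0/norm_cvg0P; apply: (@squeeze_cvgr _ _ _ _ (fun=> 0) _ _ _ _ (cvg_cst 0) ul).
near=> n; rewrite normr_ge0/= (le_trans _ (Im_le_normc _))//.
by case: (u n); case: (l).
Unshelve. all: by end_near. Qed.

End normc.

Section cmeasurable.
Context {R : realType} {d : measure_display} {T : measurableType d}.
Implicit Types f g : T -> R[i].

Lemma cmeasurable_cst (z : R[i]) : cmeasurable (fun _ : T => z).
Proof. by split; exact: measurable_cst. Qed.

Lemma cmeasurableD f g : cmeasurable f -> cmeasurable g ->
  cmeasurable (fun x => f x + g x).
Proof.
move=> [f1 f2] [g1 g2]; split.
  rewrite (_ : (fun x => _) = (fun x => complex.Re (f x) + complex.Re (g x))).
    exact: measurable_funD.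
  by apply/funext => x; case: (f x) => ? ?; case: (g x).
rewrite (_ : (fun x => _) = (fun x => complex.Im (f x) + complex.Im (g x))).
  exact: measurable_funD.
by apply/funext => x; case: (f x) => ? ?; case: (g x).
Qed.

Lemma cmeasurableM f g : cmeasurable f -> cmeasurable g ->
  cmeasurable (fun x => f x * g x).
Proof.
move=> [f1 f2] [g1 g2]; split.
  rewrite (_ : (fun x => _) = (fun x => complex.Re (f x) * complex.Re (g x) -
      complex.Im (f x) * complex.Im (g x))).
    by apply: measurable_funB; exact: measurable_funM.
  by apply/funext => x; case: (f x) => ? ?; case: (g x).
rewrite (_ : (fun x => _) = (fun x => complex.Re (f x) * complex.Im (g x) +
    complex.Im (f x) * complex.Re (g x))).
  by apply: measurable_funD; exact: measurable_funM.
by apply/funext => x; case: (f x) => ? ?; case: (g x).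
Qed.

Lemma cmeasurableN f : cmeasurable f -> cmeasurable (fun x => - f x).
Proof.
move=> mf; rewrite (_ : (fun x => _) = (fun x => -1 * f x)).
  by apply: cmeasurableM => //; exact: cmeasurable_cst.
by apply/funext => x; rewrite mulN1r.
Qed.

Lemma cmeasurableB f g : cmeasurable f -> cmeasurable g ->
  cmeasurable (fun x => f x - g x).
Proof. by move=> mf mg; apply: cmeasurableD => //; exact: cmeasurableN. Qed.

Lemma cmeasurable_conj f : cmeasurable f -> cmeasurable (fun x => (conjc (f x))).
Proof.
move=> [f1 f2]; split.
  by rewrite (_ : (fun x => _) = (fun x => complex.Re (f x)))//;
    apply/funext => x; case: (f x).
rewrite (_ : (fun x => _) = (fun x => - complex.Im (f x))).
  exact: measurable_funN.
by apply/funext => x; case: (f x).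
Qed.

Lemma cmeasurable_real (h : T -> R) : measurable_fun setT h ->
  cmeasurable (fun x => (h x)%:C).
Proof. by split => //; exact: measurable_cst. Qed.

Lemma cmeasurable_expi (h : T -> R) : measurable_fun setT h ->
  cmeasurable (fun x => expi (h x)).
Proof.
move=> mh; split => /=; apply: measurableT_comp => //;
  apply: continuous_measurable_fun.
  exact: continuous_cos.
exact: continuous_sin.
Qed.

Lemma measurable_normc f : cmeasurable f ->
  measurable_fun setT (fun x => normc (f x)).
Proof.
move=> [f1 f2]; rewrite (_ : (fun x => _) =
    (fun x => Num.sqrt (complex.Re (f x) ^+ 2 + complex.Im (f x) ^+ 2))).
  apply: (measurableT_comp (f := @Num.sqrt R)).
    exact: continuous_measurable_fun (@sqrt_continuous R).
  by apply: measurable_funD; exact: measurable_funX.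
by apply/funext => x; case: (f x).
Qed.

Lemma cmeasurable_cvg (u : nat -> T -> R[i]) f :
  (forall n, cmeasurable (u n)) -> (forall x, ccvg (u ^~ x) (f x)) ->
  cmeasurable f.
Proof.
move=> mu uf; split.
  apply: (measurable_fun_cvg (h := fun n x => complex.Re (u n x))) => //.
    by move=> n; case: (mu n).
  by move=> x _; case: (uf x).
apply: (measurable_fun_cvg (h := fun n x => complex.Im (u n x))) => //.
  by move=> n; case: (mu n).
by move=> x _; case: (uf x).
Qed.

End cmeasurable.

Lemma cmeasurable_comp (R : realType) (d1 d2 : measure_display)
  (T1 : measurableType d1) (T2 : measurableType d2) (f : T2 -> R[i]) (h : T1 -> T2) :
  cmeasurable f -> measurable_fun setT h -> cmeasurable (fun x => f (h x)).
Proof.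
move=> [f1 f2] mh; split.
  exact: (measurableT_comp f1 mh).
exact: (measurableT_comp f2 mh).
Qed.

Section integrals.
Context {R : realType} {d : measure_display} {T : measurableType d}.
Variable m : {measure set T -> \bar R}.
Implicit Types (f g : T -> R[i]) (F G : T -> R).

Lemma integrable_dom F G : measurable_fun setT F -> (forall x, `|F x| <= G x) ->
  m.-integrable setT (EFin \o G) -> m.-integrable setT (EFin \o F).
Proof.
move=> mF FG iG; apply: le_integrable iG => //; first exact/measurable_EFinP.
by move=> x _ /=; rewrite lee_fin (le_trans (FG x))// ler_norm.
Qed.

Lemma ge0_integrableP F : measurable_fun setT F -> (forall x, 0 <= F x) ->
  (\int[m]_x (F x)%:E < +oo)%E -> m.-integrable setT (EFin \o F).
Proof.
move=> mF F0 Foo; apply/integrableP; split; first exact/measurable_EFinP.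
by under eq_integral do rewrite /= ger0_norm//.
Qed.

Lemma EFin_Rintegral F : m.-integrable setT (EFin \o F) ->
  (\int[m]_x F x)%:E = (\int[m]_x (F x)%:E)%E.
Proof. by move=> iF; rewrite /Rintegral fineK//; exact: integrable_fin_num. Qed.

Lemma le_Rint F G : measurable_fun setT F -> (forall x, 0 <= F x) ->
  m.-integrable setT (EFin \o G) -> (forall x, F x <= G x) ->
  (\int[m]_x F x <= \int[m]_x G x)%R.
Proof.
move=> mF F0 iG FG; apply: le_Rintegral => //.
by apply: (integrable_dom mF _ iG) => x; rewrite ger0_norm.
Qed.

Lemma integrableDr F G : m.-integrable setT (EFin \o F) ->
  m.-integrable setT (EFin \o G) ->
  m.-integrable setT (EFin \o (fun x => F x + G x)).
Proof. by move=> iF iG; exact: (integrableD measurableT iF iG). Qed.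

Lemma cintegrable_dom f G : cmeasurable f -> (forall x, normc (f x) <= G x) ->
  m.-integrable setT (EFin \o G) -> cintegrable m f.
Proof.
move=> [f1 f2] fG iG; split; apply: (integrable_dom _ _ iG) => // x.
  exact: le_trans (Re_le_normc _) (fG x).
exact: le_trans (Im_le_normc _) (fG x).
Qed.

Lemma cintegrable_cmeasurable f : cintegrable m f -> cmeasurable f.
Proof.
by move=> [/integrableP[f1 _] /integrableP[f2 _]]; split; apply/measurable_EFinP.
Qed.

Lemma integrable_normc f : cintegrable m f ->
  m.-integrable setT (EFin \o (fun x => normc (f x))).
Proof.
move=> cf; have [f1 f2] := cf.
apply: (integrable_dom (G := fun x => `|complex.Re (f x)| + `|complex.Im (f x)|)).
- exact: measurable_normc (cintegrable_cmeasurable cf).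
- by move=> x; rewrite ger0_norm ?normc_ge0 ?normc_le_ReIm.
- by apply: integrableDr; apply: integrable_norm.
Qed.

Lemma cintegrableD f g : cintegrable m f -> cintegrable m g ->
  cintegrable m (fun x => f x + g x).
Proof.
move=> cf cg; apply: (cintegrable_dom (G := fun x => normc (f x) + normc (g x))).
- by apply: cmeasurableD; exact: cintegrable_cmeasurable.
- by move=> x; exact: normcD.
- by apply: integrableDr; exact: integrable_normc.
Qed.

Lemma integrable_mull F (c : R) : m.-integrable setT (EFin \o F) ->
  m.-integrable setT (EFin \o (fun x => c * F x)).
Proof. by move=> iF; exact: (integrableZl measurableT c iF). Qed.

Lemma cintegrableMb f g (B : R) : cmeasurable f ->
  (forall x, normc (f x) <= B) -> cintegrable m g ->
  cintegrable m (fun x => f x * g x).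
Proof.
move=> mf fB cg; apply: (cintegrable_dom (G := fun x => B * normc (g x))).
- by apply: cmeasurableM => //; exact: cintegrable_cmeasurable.
- by move=> x; rewrite normcM ler_wpM2r ?normc_ge0.
- exact/integrable_mull/integrable_normc.
Qed.

Lemma cintegrableZ (c : R[i]) f : cintegrable m f ->
  cintegrable m (fun x => c * f x).
Proof.
by move=> cf; apply: (cintegrableMb (B := normc c)) => //; exact: cmeasurable_cst.
Qed.

Lemma cintegrableB f g : cintegrable m f -> cintegrable m g ->
  cintegrable m (fun x => f x - g x).
Proof.
move=> cf cg; apply: cintegrableD => //.
rewrite (_ : (fun x => _) = (fun x => -1 * g x)); first exact: cintegrableZ.
by apply/funext => x; rewrite mulN1r.
Qed.

Lemma eq_cintegral f g : f =1 g -> cintegral m setT f = cintegral m setT g.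
Proof. by move=> fg; rewrite (funext fg). Qed.

Lemma cintegralD f g : cintegrable m f -> cintegrable m g ->
  cintegral m setT (fun x => f x + g x) =
  cintegral m setT f + cintegral m setT g.
Proof.
move=> [f1 f2] [g1 g2]; rewrite /cintegral; simpc; congr (_ +i* _).
  rewrite -RintegralD//; congr Rintegral.
  by apply/funext => x; case: (f x) => ? ?; case: (g x).
rewrite -RintegralD//; congr Rintegral.
by apply/funext => x; case: (f x) => ? ?; case: (g x).
Qed.

Lemma cintegralZ (c : R[i]) f : cintegrable m f ->
  cintegral m setT (fun x => c * f x) = c * cintegral m setT f.
Proof.
move=> [f1 f2]; rewrite /cintegral; case: c => a b; simpc; congr (_ +i* _).
  rewrite -!RintegralZl// -RintegralB//; do ?exact: integrable_mull.
  by congr Rintegral; apply/funext => x; case: (f x).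
rewrite -!RintegralZl// -RintegralD//; do ?exact: integrable_mull.
by congr Rintegral; apply/funext => x; case: (f x).
Qed.

Lemma cintegralB f g : cintegrable m f -> cintegrable m g ->
  cintegral m setT (fun x => f x - g x) =
  cintegral m setT f - cintegral m setT g.
Proof.
move=> cf cg; rewrite -[- cintegral m setT g]mulN1r -cintegralZ//.
rewrite -cintegralD//; last exact: cintegrableZ.
by apply: eq_cintegral => x; rewrite mulN1r.
Qed.

Lemma cintegral_real F : cintegral m setT (fun x => (F x)%:C) = (\int[m]_x F x)%:C.
Proof.
rewrite /cintegral /=; congr (_ +i* _).
by rewrite Rintegral_cst// mul0r.
Qed.

Lemma cintegral_conj f : cintegrable m f ->
  cintegral m setT (fun x => (conjc (f x))) = (conjc (cintegral m setT f)).
Proof.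
move=> [f1 f2]; rewrite /cintegral /=; congr (_ +i* _).
  by congr Rintegral; apply/funext => x; case: (f x).
rewrite -[RHS]mulN1r -RintegralZl//.
by congr Rintegral; apply/funext => x; rewrite mulN1r; case: (f x).
Qed.

(** The phase of the integral is rotated away: the integral of [f] has the
    same modulus as a real integral of a function bounded by [normc f]. *)
Lemma normc_cintegral_le f G : cintegrable m f ->
  m.-integrable setT (EFin \o G) -> (forall x, normc (f x) <= G x) ->
  normc (cintegral m setT f) <= \int[m]_x G x.
Proof.
move=> cf iG fG; set z := cintegral m setT f.
have [z0|z0] := eqVneq (normc z) 0.
  by rewrite z0; apply: Rintegral_ge0 => x _; exact: le_trans (normc_ge0 _) (fG x).
pose c : R[i] := ((normc z)^-1)%:C * (conjc z).
have cz : (normc z)%:C = c * z.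
  rewrite /c -mulrA [(conjc z) * z]mulrC mulc_conj -rmorphM; congr (_%:C).
  by rewrite expr2 mulrA mulVf// mul1r.
have nc : normc c = 1.
  by rewrite normcM normc_real normc_conj ger0_norm ?invr_ge0 ?normc_ge0// mulVf.
rewrite [leLHS](_ : _ = complex.Re (c * z)); last by rewrite -cz.
rewrite -cintegralZ//; apply: le_Rintegral => //.
  by have [] := cintegrableZ c cf.
move=> x _; apply: le_trans (ler_norm _) _; apply: le_trans (Re_le_normc _) _.
by rewrite normcM nc mul1r.
Qed.

Lemma normc_cintegral f : cintegrable m f ->
  normc (cintegral m setT f) <= \int[m]_x normc (f x).
Proof. by move=> cf; apply: normc_cintegral_le => //; exact: integrable_normc. Qed.

Lemma Rintegral_cvg (u : nat -> T -> R) F G :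
  (forall n, measurable_fun setT (u n)) ->
  (forall x, u ^~ x @ \oo --> F x) ->
  (forall n x, `|u n x| <= G x) -> m.-integrable setT (EFin \o G) ->
  (fun n => \int[m]_x u n x) @ \oo --> \int[m]_x F x.
Proof.
move=> mu uF uG iG; apply/fine_cvg.
have mF : measurable_fun setT F by apply: (measurable_fun_cvg mu) => x _; exact: uF.
rewrite EFin_Rintegral; last first.
  apply: (integrable_dom mF _ iG) => x.
  have cn : (fun n => `|u n x|) @ \oo --> `|F x| by apply: cvg_norm; exact: uF.
  rewrite -(cvg_lim _ cn)//.
  by apply: limr_le; [exact: cvgP cn|near=> n; exact: uG].
apply: (@dominated_cvg _ _ _ m setT measurableT _ _ (EFin \o G)) => //.
- by move=> n; apply/measurable_EFinP.
- by move=> x _; apply: cvg_EFin; [near=> n|exact: uF].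
- by move=> n x _ /=; rewrite lee_fin.
Unshelve. all: by end_near. Qed.

Lemma cintegral_cvg (u : nat -> T -> R[i]) f G :
  (forall n, cmeasurable (u n)) ->
  (forall x, ccvg (u ^~ x) (f x)) ->
  (forall n x, normc (u n x) <= G x) -> m.-integrable setT (EFin \o G) ->
  ccvg (fun n => cintegral m setT (u n)) (cintegral m setT f).
Proof.
move=> mu uf uG iG; split => /=.
  apply: (Rintegral_cvg (G := G)) => //.
  - by move=> n; case: (mu n).
  - by move=> x; case: (uf x).
  - by move=> n x; exact: le_trans (Re_le_normc _) _.
apply: (Rintegral_cvg (G := G)) => //.
- by move=> n; case: (mu n).
- by move=> x; case: (uf x).
- by move=> n x; exact: le_trans (Im_le_normc _) _.
Qed.

End integrals.

Section fubini.
Context {R : realType} {d1 d2 : measure_display}.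
Context {T1 : measurableType d1} {T2 : measurableType d2}.
Variables (m1 : {sigma_finite_measure set T1 -> \bar R}).
Variables (m2 : {sigma_finite_measure set T2 -> \bar R}).
Implicit Types (f : T1 * T2 -> R[i]) (F : T1 * T2 -> R).

Lemma measurable_Rintegral2 F : measurable_fun setT F ->
  measurable_fun setT (fun x => \int[m2]_y F (x, y))%R.
Proof.
move=> mF; apply: (measurableT_comp (f := fine)) => //.
have mE : measurable_fun setT (EFin \o F) by exact/measurable_EFinP.
rewrite (_ : (fun x => _) = (fun x => \int[m2]_y (EFin \o F)^\+ (x, y))%E \-
   (fun x => \int[m2]_y (EFin \o F)^\- (x, y))%E)%E.
  apply: emeasurable_funB; apply: measurable_fun_fubini_tonelli_F => //.
    exact: measurable_funepos.
  exact: measurable_funeneg.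
apply/funext => x; rewrite [LHS]integralE; congr (_ - _)%E;
  by apply: eq_integral => y _; rewrite !unlock.
Qed.

Lemma cmeasurable_cintegral2 f : cmeasurable f ->
  cmeasurable (fun x => cintegral m2 setT (fun y => f (x, y))).
Proof.
move=> [f1 f2]; split => /=.
  exact: (measurable_Rintegral2 f1).
exact: (measurable_Rintegral2 f2).
Qed.

(** Everywhere integrable sections are asked for, instead of almost everywhere,
    because the real-valued integral truncates infinite values. *)
Lemma Rintegral_swap F G : measurable_fun setT F -> measurable_fun setT G ->
  (forall z, `|F z| <= G z) ->
  (forall x, m2.-integrable setT (fun y => (G (x, y))%:E)) ->
  (forall y, m1.-integrable setT (fun x => (G (x, y))%:E)) ->
  m1.-integrable setT (fun x => (\int[m2]_y G (x, y))%:E) ->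
  \int[m1]_x \int[m2]_y F (x, y) = \int[m2]_y \int[m1]_x F (x, y).
Proof.
move=> mF mG FG i2 i1 ii.
have mF2 x : measurable_fun setT (fun y => F (x, y)).
  by apply: measurableT_comp => //; exact: measurable_pair1.
have mF1 y : measurable_fun setT (fun x => F (x, y)).
  by apply: measurableT_comp => //; exact: measurable_pair2.
have iF2 x : m2.-integrable setT (fun y => (F (x, y))%:E).
  by apply: (integrable_dom _ _ (i2 x)).
have iF1 y : m1.-integrable setT (fun x => (F (x, y))%:E).
  by apply: (integrable_dom _ _ (i1 y)).
have iF : (m1 \x m2)%E.-integrable setT (EFin \o F).
  apply/integrable12ltyP; first exact/measurable_EFinP.
  case/integrableP : ii => _; apply: le_lt_trans; apply: ge0_le_integral => //.
  - by move=> x _; exact: integral_ge0.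
  - apply: (measurable_fun_fubini_tonelli_F (fun z => `|(EFin \o F) z|)%E) => //.
    by apply: measurableT_comp => //; exact/measurable_EFinP.
  - apply/measurable_EFinP; apply: measurableT_comp => //.
    exact: measurable_Rintegral2.
  - move=> x _; apply: (@le_trans _ _ (\int[m2]_y (G (x, y))%:E)%E).
      apply: ge0_le_integral => //=.
      - by apply/measurable_EFinP; exact: measurableT_comp.
      - by case/integrableP : (i2 x).
      - by move=> y _; rewrite lee_fin.
    by rewrite -(EFin_Rintegral (i2 x)); exact: lee_abs.
apply: EFin_inj.
transitivity (\int[m1]_x \int[m2]_y (EFin \o F) (x, y))%E.
  rewrite /Rintegral fineK; last first.
    rewrite (_ : (fun x => _) = fubini_F m2 (EFin \o F)).
      by apply: integrable_fin_num => //; exact: integrable_fubini_F.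
    by apply/funext => x; rewrite /fubini_F /= -(EFin_Rintegral (iF2 x)).
  by apply: eq_integral => x _; rewrite -(EFin_Rintegral (iF2 x)).
rewrite Fubini// [in RHS]/Rintegral fineK; last first.
  rewrite (_ : (fun x => _) = fubini_G m1 (EFin \o F)).
    by rewrite integral21_prod_meas1//; exact: integrable_fin_num.
  by apply/funext => y; rewrite /fubini_G /= -(EFin_Rintegral (iF1 y)).
by apply: eq_integral => y _; rewrite -(EFin_Rintegral (iF1 y)).
Qed.

Lemma cintegral_swap f G : cmeasurable f -> measurable_fun setT G ->
  (forall z, normc (f z) <= G z) ->
  (forall x, m2.-integrable setT (fun y => (G (x, y))%:E)) ->
  (forall y, m1.-integrable setT (fun x => (G (x, y))%:E)) ->
  m1.-integrable setT (fun x => (\int[m2]_y G (x, y))%:E) ->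
  cintegral m1 setT (fun x => cintegral m2 setT (fun y => f (x, y))) =
  cintegral m2 setT (fun y => cintegral m1 setT (fun x => f (x, y))).
Proof.
move=> [f1 f2] mG fG i2 i1 ii; rewrite /cintegral /=; congr (_ +i* _).
  apply: (Rintegral_swap f1 mG) => // z.
  exact: le_trans (Re_le_normc _) _.
apply: (Rintegral_swap f2 mG) => // z.
exact: le_trans (Im_le_normc _) _.
Qed.

(** Fubini; the bound on the kernel makes the double integral absolutely
    convergent. *)
Lemma cintegral_kernel_swap (k : T1 * T2 -> R[i]) (B : R)
    (f : T1 -> R[i]) (g : T2 -> R[i]) :
  cmeasurable k -> (forall z, normc (k z) <= B) ->
  cintegrable m1 f -> cintegrable m2 g ->
  cintegral m1 setT (fun x => f x * cintegral m2 setT (fun y => k (x, y) * g y)) =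
  cintegral m2 setT (fun y => g y * cintegral m1 setT (fun x => k (x, y) * f x)).
Proof.
move=> mk kB cf cg.
have mf := cintegrable_cmeasurable cf; have mg := cintegrable_cmeasurable cg.
have nf := integrable_normc cf; have ng := integrable_normc cg.
have kx x : cmeasurable (fun y => k (x, y)).
  exact: cmeasurable_comp mk (measurable_pair1 _).
have ky y : cmeasurable (fun x => k (x, y)).
  exact: cmeasurable_comp mk (measurable_pair2 _).
transitivity (cintegral m1 setT (fun x => cintegral m2 setT
    (fun y => f x * (k (x, y) * g y)))).
  apply: eq_cintegral => x; rewrite cintegralZ//.
  exact: (cintegrableMb (B := B)).
transitivity (cintegral m2 setT (fun y => cintegral m1 setT
    (fun x => f x * (k (x, y) * g y)))); last first.
  apply: eq_cintegral => y; rewrite -cintegralZ; last first.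
    exact: (cintegrableMb (B := B)).
  by apply: eq_cintegral => x; rewrite mulrA mulrC [k _ * _]mulrC.
apply: (cintegral_swap (f := fun z => f z.1 * (k z * g z.2))
  (G := fun z => B * (normc (f z.1) * normc (g z.2)))).
- apply: cmeasurableM; first exact: (cmeasurable_comp mf).
  by apply: cmeasurableM => //; exact: (cmeasurable_comp mg).
- apply: measurable_funM => //; apply: measurable_funM.
    by apply: (measurableT_comp (measurable_normc mf)).
  by apply: (measurableT_comp (measurable_normc mg)).
- move=> [x y] /=; rewrite !normcM mulrCA ler_wpM2r//.
  by rewrite mulr_ge0 ?normc_ge0.
- move=> x /=; under eq_fun do rewrite mulrA; exact: integrable_mull.
- move=> y /=; under eq_fun do rewrite [X in B * X]mulrC mulrA; exact: integrable_mull.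
- rewrite (_ : (fun x => _) = EFin \o (fun x => B * (\int[m2]_y normc (g y)) * normc (f x))).
    exact: integrable_mull.
  apply/funext => x /=; congr EFin; under eq_Rintegral do rewrite mulrA.
  by rewrite RintegralZl// mulrAC.
Qed.

End fubini.

(** * Lebesgue measure under coordinatewise maps *)

Section line.
Context {R : realType}.
Notation mu := (@lebesgue_measure R).

Lemma ge0_integral_opp (f : R -> \bar R) : measurable_fun setT f ->
  (forall x, 0 <= f x)%E -> (\int[mu]_x f (- x)%R = \int[mu]_x f x)%E.
Proof.
move=> mf f0.
have mN : measurable_fun setT (-%R : measurableTypeR R -> measurableTypeR R).
  exact: oppr_measurable.
have := @ge0_integral_pushforward _ _ _ _ R _ mN mu setT f measurableT mf
  (fun x _ => f0 x).
rewrite preimage_setT /= => <-.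
by apply: eq_measure_integral => //= A mA _; rewrite -lebesgue_measureN.
Qed.

(** Intervals have the right measure under [a * x + b], and this determines
    Lebesgue measure. *)
Lemma ge0_integral_affine (a b : R) (f : R -> \bar R) : 0 < a ->
  measurable_fun setT f -> (forall x, 0 <= f x)%E ->
  (\int[mu]_x f (a * x + b)%R = a^-1%:E * \int[mu]_x f x)%E.
Proof.
move=> a0 mf f0.
have mphi : measurable_fun setT ((fun x => a * x + b) : measurableTypeR R -> measurableTypeR R).
  by apply: measurable_funD => //; exact: measurable_funM.
pose nu : {measure set (measurableTypeR R) -> \bar R} :=
  measure_function_pushforward__canonical__measure_function_Measure mu mphi.
have E A : measurable A -> mu A = mscale (NngNum (ltW a0)) nu A.
  move=> mA; apply: lebesgue_measure_unique mA => _ [[x y] _ <-].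
  transitivity (a%:E * mu ((fun t : R => a * t + b)%R @^-1` `]x, y]))%E; last by [].
  rewrite (_ : _ @^-1` _ = `](x - b) / a, (y - b) / a]%classic); last first.
    apply/seteqP; split => t /=; rewrite !in_itv/=;
      by rewrite ltr_pdivrMr// ler_pdivlMr// ltrBlDr lerBrDr [t * a]mulrC.
  rewrite !lebesgue_measure_itv/= !lte_fin ltr_pM2r ?invr_gt0// ltrD2r.
  case: ifPn => _; last by rewrite mule0.
  by rewrite -!EFinB -EFinM; congr EFin; field; rewrite gt_eqF.
have ai : 0 <= a^-1 by rewrite invr_ge0 ltW.
rewrite -[X in (X%:E * _)%E]/((NngNum ai)%:num) -ge0_integral_mscale//.
have := @ge0_integral_pushforward _ _ _ _ R _ mphi mu setT f measurableT mf
  (fun x _ => f0 x).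
rewrite preimage_setT /= => <-.
apply: eq_measure_integral => A mA _.
by rewrite /= /mscale /= E// /mscale /= muleA -EFinM mulVf ?gt_eqF// mul1e.
Qed.

End line.

Section tuples.
Context {R : realType}.

Lemma tnth_tcons0 n (p : measurableTypeR R * n.-tuple R) : tnth (tcons p) ord0 = p.1.
Proof. by []. Qed.

Lemma tnth_tconsS n (p : measurableTypeR R * n.-tuple R) i :
  tnth (tcons p) (lift ord0 i) = tnth p.2 i.
Proof. by rewrite /tcons tnthS. Qed.

Lemma measurable_mktuple (d1 : measure_display) (T : measurableType d1) n
  (f : T -> 'I_n -> R) : (forall j, measurable_fun setT (f ^~ j)) ->
  measurable_fun setT (fun x => [tuple f x j | j < n]).
Proof.
move=> mf; apply/measurable_fun_tnthP => i.
by rewrite (_ : _ \o _ = f ^~ i)//; apply/funext => x /=; rewrite tnth_mktuple.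
Qed.

Lemma leb0 (f : (0%N).-tuple R -> \bar R) :
  measurable_fun setT f -> (\int[leb 0]_x f x = f [tuple])%E.
Proof. by move=> mf; rewrite /leb integral_dirac// diracT mul1e. Qed.

Lemma ge0_integral_lebS n (f : n.+1.-tuple R -> \bar R) :
  measurable_fun setT f -> (forall x, 0 <= f x)%E ->
  (\int[leb n.+1]_x f x =
   \int[lebesgue_measure]_x \int[leb n]_t f (tcons (x, t)))%E.
Proof.
move=> mf f0.
have := @ge0_integral_pushforward _ _ _ _ R _ (@measurable_tcons R n)
  (@lebesgue_measure R \x leb n)%E setT f measurableT mf (fun x _ => f0 x).
rewrite preimage_setT => h; transitivity (\int[(@lebesgue_measure R \x leb n)%E]_x (f \o @tcons R n) x)%E.
  refine (etrans _ h); apply: eq_measure_integral; first exact: measurable_tcons.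
  by [].
rewrite fubini_tonelli1// => [|p]; last exact: f0.
exact: (measurableT_comp mf (@measurable_tcons R n)).
Qed.

(** Shifts, reflections and dilations of R^n are all of this form; by Tonelli
    each coordinate contributes one factor [c]. *)
Lemma ge0_integral_tmap (c : R) n (phi : 'I_n -> R -> R) (f : n.-tuple R -> \bar R) :
  0 <= c -> (forall j, measurable_fun setT (phi j)) ->
  (forall j (g : R -> \bar R), measurable_fun setT g -> (forall x, 0 <= g x)%E ->
    \int[lebesgue_measure]_x g (phi j x) = c%:E * \int[lebesgue_measure]_x g x)%E ->
  measurable_fun setT f -> (forall x, 0 <= f x)%E ->
  (\int[leb n]_x f [tuple phi j (tnth x j) | j < n] = (c ^+ n)%:E * \int[leb n]_x f x)%E.
Proof.
move=> c0; elim: n => [|n IH] in phi f *.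
  move=> mphi cphi mf f0; rewrite expr0 mul1e; apply: eq_integral => x _.
  by congr f; apply: eq_from_tnth => -[].
move=> mphi cphi mf f0.
have mT : measurable_fun setT (fun x : n.+1.-tuple R => [tuple phi j (tnth x j) | j < n.+1]).
  by apply: measurable_mktuple => j; apply: measurableT_comp => //; exact: measurable_tnth.
have mft x : measurable_fun setT (fun t : n.-tuple R => f (tcons (x, t))).
  apply: measurableT_comp => //; apply: measurableT_comp; first exact: measurable_tcons.
  exact: measurable_pair1.
rewrite !ge0_integral_lebS//; last exact: (measurableT_comp mf mT).
pose g x := (\int[leb n]_t f (tcons (x, t)))%E.
have mg : measurable_fun setT g.
  apply: (measurable_fun_fubini_tonelli_F (fun p => f (tcons p))) => //.
  by apply: measurableT_comp => //; exact: measurable_tcons.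
have g0 x : (0 <= g x)%E by apply: integral_ge0.
transitivity (\int[lebesgue_measure]_x ((c ^+ n)%:E * g (phi ord0 x)))%E.
  apply: eq_integral => x _.
  rewrite -(IH (fun j => phi (lift ord0 j)) (fun t => f (tcons (phi ord0 x, t))))//.
  - apply: eq_integral => t _; congr f; apply: eq_from_tnth => i.
    rewrite tnth_mktuple; case: (unliftP ord0 i) => [j|] ->.
      by rewrite !tnth_tconsS /= tnth_mktuple.
    by rewrite !tnth_tcons0.
  - by move=> j g' mg' g'0; exact: cphi.
rewrite ge0_integralZl; first last.
- by rewrite lee_fin exprn_ge0.
- by move=> x _; exact: g0.
- exact: (measurableT_comp mg (mphi ord0)).
- exact: measurableT.
by rewrite cphi// muleA -EFinM exprSr.
Qed.

End tuples.

Section space.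
Context {R : realType} {d : nat}.
Local Notation Rd := (d.-tuple R).

Definition tadd (x y : Rd) : Rd := [tuple tnth x j + tnth y j | j < d].
Definition tsub (x y : Rd) : Rd := [tuple tnth x j - tnth y j | j < d].
Definition topp (x : Rd) : Rd := [tuple - tnth x j | j < d].
Definition tscale (a : R) (x : Rd) : Rd := [tuple a * tnth x j | j < d].
Definition tcst (a : R) : Rd := [tuple a | j < d].

Lemma tnth_tadd x y j : tnth (tadd x y) j = tnth x j + tnth y j.
Proof. by rewrite tnth_mktuple. Qed.
Lemma tnth_tsub x y j : tnth (tsub x y) j = tnth x j - tnth y j.
Proof. by rewrite tnth_mktuple. Qed.
Lemma tnth_topp x j : tnth (topp x) j = - tnth x j.
Proof. by rewrite tnth_mktuple. Qed.
Lemma tnth_tscale a x j : tnth (tscale a x) j = a * tnth x j.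
Proof. by rewrite tnth_mktuple. Qed.
Definition tnthE := (tnth_tadd, tnth_tsub, tnth_topp, tnth_tscale).

Lemma taddK x y : tsub (tadd x y) y = x.
Proof. by apply: eq_from_tnth => j; rewrite !tnthE addrK. Qed.
Lemma tsubK x y : tadd (tsub x y) y = x.
Proof. by apply: eq_from_tnth => j; rewrite !tnthE subrK. Qed.
Lemma tsub_sub x y : tsub x (tsub x y) = y.
Proof. by apply: eq_from_tnth => j; rewrite !tnthE opprB addrCA subrr addr0. Qed.
Lemma toppK x : topp (topp x) = x.
Proof. by apply: eq_from_tnth => j; rewrite !tnthE opprK. Qed.

Lemma dotC (x y : Rd) : dot x y = dot y x.
Proof. by apply: eq_bigr => j _; rewrite mulrC. Qed.
Lemma dotDr (x y b : Rd) : dot x (tadd y b) = dot x y + dot x b.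
Proof. by rewrite /dot -big_split; apply: eq_bigr => j _; rewrite tnthE mulrDr. Qed.
Lemma dotDl (x y b : Rd) : dot (tadd x y) b = dot x b + dot y b.
Proof. by rewrite dotC dotDr !(dotC b). Qed.
Lemma dotNr (x y : Rd) : dot x (topp y) = - dot x y.
Proof. by rewrite /dot -sumrN; apply: eq_bigr => j _; rewrite tnthE mulrN. Qed.

Lemma dotZr (a : R) (x y : Rd) : dot x (tscale a y) = a * dot x y.
Proof. by rewrite /dot mulr_sumr; apply: eq_bigr => j _; rewrite tnthE mulrCA. Qed.
Lemma dotZl (a : R) (x y : Rd) : dot (tscale a x) y = a * dot x y.
Proof. by rewrite dotC dotZr dotC. Qed.
Lemma dotBr (x y b : Rd) : dot x (tsub y b) = dot x y - dot x b.
Proof. by rewrite /dot -sumrB; apply: eq_bigr => j _; rewrite tnthE mulrBr. Qed.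
Lemma dotBl (x y b : Rd) : dot (tsub x y) b = dot x b - dot y b.
Proof. by rewrite dotC dotBr !(dotC b). Qed.
Lemma dot_ge0 (x : Rd) : 0 <= dot x x.
Proof. by apply: sumr_ge0 => j _; rewrite -expr2 sqr_ge0. Qed.
Lemma tnth_sqr_le_dot (x : Rd) j : tnth x j ^+ 2 <= dot x x.
Proof.
rewrite /dot (bigD1 j)//= expr2 lerDl.
by apply: sumr_ge0 => i _; rewrite -expr2 sqr_ge0.
Qed.

Section measurable_ops.
Context {d1 : measure_display} {T : measurableType d1}.
Implicit Types (f g : T -> Rd).

Lemma measurable_tnth_comp f j : measurable_fun setT f ->
  measurable_fun setT (fun x => tnth (f x) j).
Proof. by move=> mf; apply: (measurableT_comp (measurable_tnth j)). Qed.

Lemma measurable_tadd f g : measurable_fun setT f -> measurable_fun setT g ->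
  measurable_fun setT (fun x => tadd (f x) (g x)).
Proof.
by move=> mf mg; apply: measurable_mktuple => j;
  apply: measurable_funD; exact: measurable_tnth_comp.
Qed.

Lemma measurable_tsub f g : measurable_fun setT f -> measurable_fun setT g ->
  measurable_fun setT (fun x => tsub (f x) (g x)).
Proof.
by move=> mf mg; apply: measurable_mktuple => j;
  apply: measurable_funB; exact: measurable_tnth_comp.
Qed.

Lemma measurable_topp f : measurable_fun setT f ->
  measurable_fun setT (fun x => topp (f x)).
Proof.
by move=> mf; apply: measurable_mktuple => j;
  apply: measurable_funN; exact: measurable_tnth_comp.
Qed.

Lemma measurable_tscale a f : measurable_fun setT f ->
  measurable_fun setT (fun x => tscale a (f x)).
Proof.
by move=> mf; apply: measurable_mktuple => j;
  apply: measurable_funM => //; exact: measurable_tnth_comp.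
Qed.

Lemma measurable_dot f g : measurable_fun setT f -> measurable_fun setT g ->
  measurable_fun setT (fun x => dot (f x) (g x)).
Proof.
move=> mf mg; apply: measurable_sum => j.
by apply: measurable_funM; exact: measurable_tnth_comp.
Qed.

End measurable_ops.

Lemma ge0_integral_tadd (b : Rd) (f : Rd -> \bar R) : measurable_fun setT f ->
  (forall x, 0 <= f x)%E -> (\int[leb d]_x f (tadd x b) = \int[leb d]_x f x)%E.
Proof.
move=> mf f0; rewrite -[RHS]mul1e -(expr1n R d).
rewrite -(ge0_integral_tmap (phi := fun j x => x + tnth b j))//.
  move=> j; exact: measurable_funD.
move=> j g mg g0; rewrite -[X in (X%:E * _)%E]invr1 -(ge0_integral_affine (tnth b j))//.
by apply: eq_integral => x _; rewrite mul1r.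
Qed.

Lemma ge0_integral_topp (f : Rd -> \bar R) : measurable_fun setT f ->
  (forall x, 0 <= f x)%E -> (\int[leb d]_x f (topp x) = \int[leb d]_x f x)%E.
Proof.
move=> mf f0; rewrite -[RHS]mul1e -(expr1n R d).
rewrite -(ge0_integral_tmap (phi := fun j x => - x))//.
  by move=> j; exact: oppr_measurable.
by move=> j g mg g0; rewrite mul1e ge0_integral_opp.
Qed.

Lemma ge0_integral_tscale (a : R) (f : Rd -> \bar R) : 0 < a -> measurable_fun setT f ->
  (forall x, 0 <= f x)%E ->
  (\int[leb d]_x f (tscale a x) = (a^-1 ^+ d)%:E * \int[leb d]_x f x)%E.
Proof.
move=> a0 mf f0; rewrite -(ge0_integral_tmap (phi := fun j x => a * x))//.
- by rewrite invr_ge0 ltW.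
- by move=> j; exact: measurable_funM.
move=> j g mg g0; rewrite -(ge0_integral_affine 0)//.
by apply: eq_integral => x _; rewrite addr0.
Qed.

(** The change of variables formula passes from nonnegative functions to real
    and complex integrable ones. *)
Section transfer.
Variable phi : Rd -> Rd.
Hypothesis mphi : measurable_fun setT phi.
Variable c : R.
Hypothesis c0 : 0 <= c.
Hypothesis phiE : forall f : Rd -> \bar R, measurable_fun setT f ->
  (forall x, 0 <= f x)%E -> (\int[leb d]_x f (phi x) = c%:E * \int[leb d]_x f x)%E.

Lemma transfer_integrable (f : Rd -> R) : (leb d).-integrable setT (EFin \o f) ->
  (leb d).-integrable setT (EFin \o (fun x => f (phi x))).
Proof.
move=> /integrableP[mf foo]; apply/integrableP; split.
  exact: (measurableT_comp mf mphi).
rewrite (phiE (f := fun x => `|(f x)%:E|%E))//; last exact: measurableT_comp.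
by apply: lte_mul_pinfty.
Qed.

Lemma transfer_Rintegral (f : Rd -> R) : (leb d).-integrable setT (EFin \o f) ->
  \int[leb d]_x f (phi x) = c * \int[leb d]_x f x.
Proof.
move=> intf; have := intf => /integrableP[mf foo].
apply: EFin_inj; rewrite EFinM !EFin_Rintegral//; last exact: transfer_integrable.
rewrite [in LHS]integralE [in RHS]integralE.
have fp := integrable_fin_num measurableT (integrable_funepos measurableT intf).
have fn := integrable_fin_num measurableT (integrable_funeneg measurableT intf).
rewrite muleBr//; last first.
  by apply: fin_num_adde_defl; rewrite fin_numN.
by congr (_ - _)%E; rewrite -phiE//;
  [apply: eq_integral => x _; rewrite !unlock|exact: measurable_funepos|
   apply: eq_integral => x _; rewrite !unlock|exact: measurable_funeneg].
Qed.

Lemma transfer_cintegrable (f : Rd -> R[i]) : cintegrable (leb d) f ->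
  cintegrable (leb d) (fun x => f (phi x)).
Proof.
move=> [f1 f2]; split.
  exact: (transfer_integrable (f := fun x => complex.Re (f x))).
exact: (transfer_integrable (f := fun x => complex.Im (f x))).
Qed.

Lemma transfer_cintegral (f : Rd -> R[i]) : cintegrable (leb d) f ->
  cintegral (leb d) setT (fun x => f (phi x)) = c%:C * cintegral (leb d) setT f.
Proof.
move=> [f1 f2]; rewrite /cintegral.
rewrite (transfer_Rintegral (f := fun x => complex.Re (f x)))//.
rewrite (transfer_Rintegral (f := fun x => complex.Im (f x)))//.
by simpc.
Qed.

End transfer.

Lemma integrable_tadd (b : Rd) (f : Rd -> R) : (leb d).-integrable setT (EFin \o f) ->
  (leb d).-integrable setT (EFin \o (fun x => f (tadd x b))).
Proof.
apply: (transfer_integrable _ (c := 1)) => //; first exact: measurable_tadd.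
by move=> g mg g0; rewrite mul1e ge0_integral_tadd.
Qed.

Lemma cintegrable_tadd (b : Rd) (f : Rd -> R[i]) : cintegrable (leb d) f ->
  cintegrable (leb d) (fun x => f (tadd x b)).
Proof.
apply: (transfer_cintegrable _ (c := 1)) => //; first exact: measurable_tadd.
by move=> g mg g0; rewrite mul1e ge0_integral_tadd.
Qed.

Lemma cintegrable_topp (f : Rd -> R[i]) : cintegrable (leb d) f ->
  cintegrable (leb d) (fun x => f (topp x)).
Proof.
apply: (transfer_cintegrable _ (c := 1)) => //; first exact: measurable_topp.
by move=> g mg g0; rewrite mul1e ge0_integral_topp.
Qed.

Lemma cintegral_tadd (b : Rd) (f : Rd -> R[i]) : cintegrable (leb d) f ->
  cintegral (leb d) setT (fun x => f (tadd x b)) = cintegral (leb d) setT f.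
Proof.
move=> cf; rewrite (transfer_cintegral _ (c := 1) (phi := tadd ^~ b))// ?mul1r//.
  exact: measurable_tadd.
by move=> g mg g0; rewrite mul1e ge0_integral_tadd.
Qed.

Lemma cintegral_topp (f : Rd -> R[i]) : cintegrable (leb d) f ->
  cintegral (leb d) setT (fun x => f (topp x)) = cintegral (leb d) setT f.
Proof.
move=> cf; rewrite (transfer_cintegral _ (c := 1) (phi := topp))// ?mul1r//.
  exact: measurable_topp.
by move=> g mg g0; rewrite mul1e ge0_integral_topp.
Qed.

Lemma ge0_integral_tsub (b : Rd) (f : Rd -> \bar R) : measurable_fun setT f ->
  (forall x, 0 <= f x)%E -> (\int[leb d]_x f (tsub b x) = \int[leb d]_x f x)%E.
Proof.
move=> mf f0.
have mfb : measurable_fun setT (fun x => f (tadd x b)).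
  by apply: measurableT_comp => //; exact: measurable_tadd.
rewrite -[RHS](ge0_integral_tadd b)// -[RHS](ge0_integral_topp mfb)//.
by apply: eq_integral => x _; congr f; apply: eq_from_tnth => j; rewrite !tnthE addrC.
Qed.

Lemma integrable_tsub (b : Rd) (f : Rd -> R) : (leb d).-integrable setT (EFin \o f) ->
  (leb d).-integrable setT (EFin \o (fun x => f (tsub b x))).
Proof.
apply: (transfer_integrable _ (c := 1)) => //; first exact: measurable_tsub.
by move=> g mg g0; rewrite mul1e ge0_integral_tsub.
Qed.

Lemma Rintegral_tsub (b : Rd) (f : Rd -> R) : (leb d).-integrable setT (EFin \o f) ->
  \int[leb d]_x f (tsub b x) = \int[leb d]_x f x.
Proof.
move=> cf; rewrite (transfer_Rintegral _ (c := 1) (phi := tsub b))// ?mul1r//.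
  exact: measurable_tsub.
by move=> g mg g0; rewrite mul1e ge0_integral_tsub.
Qed.

End space.

Section products.
Context {R : realType}.

Lemma prod_EFin n (u : 'I_n -> R) :
  (\prod_(j < n) (u j)%:E)%E = (\prod_(j < n) u j)%:E.
Proof. by rewrite (big_morph EFin (@EFinM R) (erefl _)). Qed.

Lemma ge0_integral_prod n (f : 'I_n -> R -> R) :
  (forall j, measurable_fun setT (f j)) -> (forall j x, 0 <= f j x) ->
  (\int[leb n]_x (\prod_(j < n) f j (tnth x j))%:E =
   \prod_(j < n) \int[lebesgue_measure]_x (f j x)%:E)%E.
Proof.
have mp k (g : 'I_k -> R -> R) : (forall j, measurable_fun setT (g j)) ->
    measurable_fun setT (fun x : k.-tuple R => \prod_(j < k) g j (tnth x j)).
  move=> mg; apply: measurable_prod => j _.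
  by apply: measurableT_comp => //; exact: measurable_tnth.
have p0 k (g : 'I_k -> R -> R) : (forall j x, 0 <= g j x) ->
    forall x : k.-tuple R, (0 <= (\prod_(j < k) g j (tnth x j))%:E)%E.
  by move=> g0 x; rewrite lee_fin; apply: prodr_ge0.
elim: n => [|n IH] in f * => mf f0.
  rewrite leb0; last by apply/measurable_EFinP; exact: mp.
  by rewrite !big_ord0.
rewrite ge0_integral_lebS; [|by apply/measurable_EFinP; exact: (mp _ f)|by move=> x; exact: (p0 _ f)].
rewrite big_ord_recl -IH//.
have I0 : (0 <= \int[leb n]_x (\prod_(j < n) f (lift ord0 j) (tnth x j))%:E)%E.
  by apply: integral_ge0 => x _; apply: (p0 _ (fun j => f (lift ord0 j))).
transitivity (\int[lebesgue_measure]_x ((\int[leb n]_x (\prod_(j < n) f (lift ord0 j) (tnth x j))%:E) * (f ord0 x)%:E))%E.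
  apply: eq_integral => x _; rewrite muleC -ge0_integralZl//.
  - apply: eq_integral => t _; rewrite big_ord_recl EFinM tnth_tcons0.
    by under eq_bigr do rewrite tnth_tconsS.
  - by apply/measurable_EFinP; exact: (mp _ (fun j => f (lift ord0 j))).
  - by move=> t _; apply: (p0 _ (fun j => f (lift ord0 j))).
  - by rewrite lee_fin.
rewrite ge0_integralZl//; first by rewrite muleC.
- by apply/measurable_EFinP; exact: mf.
- by move=> x _; rewrite lee_fin.
Qed.

Lemma integrable_prod n (f : 'I_n -> R -> R) :
  (forall j, lebesgue_measure.-integrable setT (EFin \o f j)) ->
  (forall j x, 0 <= f j x) ->
  (leb n).-integrable setT (EFin \o (fun x => \prod_(j < n) f j (tnth x j))).
Proof.
move=> fi f0; have mf j : measurable_fun setT (f j).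
  by case/integrableP : (fi j) => /measurable_EFinP.
apply: ge0_integrableP.
- apply: measurable_prod => j _.
  by apply: measurableT_comp => //; exact: measurable_tnth.
- by move=> x; apply: prodr_ge0.
rewrite ge0_integral_prod// (eq_bigr (fun j => (\int[lebesgue_measure]_x f j x)%:E)).
  by rewrite prod_EFin ltry.
by move=> j _; rewrite EFin_Rintegral.
Qed.

Lemma Rintegral_prod n (f : 'I_n -> R -> R) :
  (forall j, lebesgue_measure.-integrable setT (EFin \o f j)) ->
  (forall j x, 0 <= f j x) ->
  \int[leb n]_x (\prod_(j < n) f j (tnth x j)) =
  \prod_(j < n) \int[lebesgue_measure]_x f j x.
Proof.
move=> fi f0; have mf j : measurable_fun setT (f j).
  by case/integrableP : (fi j) => /measurable_EFinP.
apply: EFin_inj; rewrite EFin_Rintegral; last exact: integrable_prod.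
rewrite ge0_integral_prod// -prod_EFin; apply: eq_bigr => j _.
by rewrite EFin_Rintegral.
Qed.

End products.

(** * The Poisson kernel *)

Section poisson.
Context {R : realType}.
Notation mu := (@lebesgue_measure R).
Implicit Types (del xi x : R).

Lemma cvgy_mull del : 0 < del -> (fun x : R => del * x) x @[x --> +oo] --> +oo.
Proof.
move=> del0; rewrite (_ : (fun x => _) = (fun x => x * del)); last first.
  by apply/funext => x; rewrite mulrC.
exact: (gt0_cvgMly del0 cvg_id).
Qed.

Lemma cvg_expRNM del : 0 < del -> expR (- (del * x)) @[x --> +oo] --> (0 : R).
Proof.
move=> del0; apply: (cvg_comp (fun x => del * x) (fun y => expR (- y)) _ (@cvgr_expR R)).
exact: cvgy_mull.
Qed.

Let F del xi x := - (expR (- (del * x)) / del) +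
  expR (- (del * x)) * (xi * sin (xi * x) - del * cos (xi * x)) / (del ^+ 2 + xi ^+ 2).

Let dF del xi x : 0 < del ->
  is_derive x 1 (F del xi) (expR (- (del * x)) * (1 + cos (xi * x))).
Proof.
move=> d0.
have d2 : del ^+ 2 + xi ^+ 2 != 0 by rewrite gt_eqF// ltr_pwDl ?exprn_gt0// sqr_ge0.
have dE : is_derive x 1 (fun x => expR (- (del * x))) (- del * expR (- (del * x))).
  apply: is_derive_eq; rewrite /GRing.scale/= !mulr1; ring.
have dS : is_derive x 1 (fun x => sin (xi * x)) (xi * cos (xi * x)).
  apply: is_derive_eq; rewrite /GRing.scale/= !mulr1; ring.
have dC : is_derive x 1 (fun x => cos (xi * x)) (- xi * sin (xi * x)).
  apply: is_derive_eq; rewrite /GRing.scale/= !mulr1; ring.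
rewrite /F; apply: is_derive_eq; rewrite /GRing.scale/=.
by field; rewrite d2 gt_eqF.
Qed.

Definition wexp del x : R := expR (- (del * `|x|)).

Lemma wexp_ge0 del x : 0 <= wexp del x. Proof. exact: expR_ge0. Qed.

Lemma continuous_wexp del : continuous (wexp del).
Proof.
move=> x; rewrite /wexp; apply: continuous_comp; last exact: continuous_expR.
by apply: cvgN; apply: cvgMl_tmp; exact: norm_continuous.
Qed.

Lemma continuous_cosM xi : continuous (fun x => cos (xi * x)).
Proof.
move=> x; apply: (@continuous_comp _ _ _ (fun y => xi * y) cos).
  exact: mulrl_continuous.
exact: continuous_cos.
Qed.

Lemma continuous_sinM xi : continuous (fun x => sin (xi * x)).
Proof.
move=> x; apply: (@continuous_comp _ _ _ (fun y => xi * y) sin).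
  exact: mulrl_continuous.
exact: continuous_sin.
Qed.

(** Adding [1] to the cosine keeps the integrand nonnegative, as the fundamental
    theorem of calculus on a half-line requires; the case [xi = 0] later
    isolates the cosine. *)
Lemma integral0y_wexp_cos del xi : 0 < del ->
  (\int[mu]_(x in `[0%R, +oo[) (expR (- (del * x)) * (1 + cos (xi * x)))%:E =
  (del^-1 + del / (del ^+ 2 + xi ^+ 2))%:E)%E.
Proof.
move=> d0.
have d2 : del ^+ 2 + xi ^+ 2 != 0 by rewrite gt_eqF// ltr_pwDl ?exprn_gt0// sqr_ge0.
rewrite (@ge0_continuous_FTC2y _ _ (F del xi) 0 0).
- rewrite -EFinB; congr EFin; rewrite /F !mulr0 oppr0 expR0 sin0 cos0.
  by field; rewrite d2 gt_eqF.
- by move=> x _; rewrite mulr_ge0 ?expR_ge0// -lerBlDl sub0r cos_geN1.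
- apply: continuous_subspaceT => x; apply: cvgM.
    apply: continuous_comp; last exact: continuous_expR.
    by apply: cvgN; exact: mulrl_continuous.
  by apply: cvgD; [exact: cvg_cst|exact: continuous_cosM].
- pose C := del^-1 + (`|xi| + `|del|) / (del ^+ 2 + xi ^+ 2).
  have h : C * expR (- (del * x)) @[x --> +oo] --> (0 : R).
    by rewrite -(mulr0 C); apply: cvgMl_tmp; exact: cvg_expRNM.
  have hN : - (C * expR (- (del * x))) @[x --> +oo] --> (0 : R).
    by rewrite -oppr0; exact: cvgN.
  apply: (squeeze_cvgr _ hN h); near=> x.
  rewrite -ler_norml /F (le_trans (ler_normD _ _))//.
  rewrite normrN !normrM normfV !(ger0_norm (expR_ge0 _)) (gtr0_norm d0).
  rewrite /C mulrDl [_^-1 * _]mulrC lerD2l normfV.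
  rewrite [in leRHS]mulrAC [in leLHS]mulrC mulrA.
  have d2p : 0 < del ^+ 2 + xi ^+ 2 by rewrite lt_neqAle eq_sym d2 addr_ge0 ?sqr_ge0.
  rewrite (gtr0_norm d2p) [leLHS]mulrC mulrA [in leLHS]mulrAC.
  rewrite ler_wpM2r ?invr_ge0 ?(ltW d2p)// ler_wpM2r ?expR_ge0//.
  rewrite (le_trans (ler_normB _ _))// !normrM (gtr0_norm d0) lerD//.
    by rewrite ler_piMr// ler_norml sin_geN1 sin_le1.
  by rewrite ler_piMr ?(ltW d0)// ler_norml cos_geN1 cos_le1.
- by move=> x _; have [] := dF xi x d0.
- apply: cvg_at_right_filter; apply: differentiable_continuous.
  by apply/derivable1_diffP; have [] := dF xi 0 d0.
- by move=> x _; rewrite derive1E; have [_ ->] := dF xi x d0.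
Unshelve. all: by end_near. Qed.

Lemma integral_wexp_cos del xi : 0 < del ->
  (\int[mu]_x (wexp del x * (1 + cos (xi * x)))%:E =
  (2 * (del^-1 + del / (del ^+ 2 + xi ^+ 2)))%:E)%E.
Proof.
move=> d0; rewrite ge0_symfun_integralT.
- rewrite EFinM -(integral0y_wexp_cos xi d0) set_itvcy; congr (_ * _)%E.
  by apply: eq_integral => x; rewrite inE/= /wexp => x0; rewrite ger0_norm.
- by move=> x; rewrite mulr_ge0 ?wexp_ge0// -lerBlDl sub0r cos_geN1.
- move=> x; apply: continuousM; first exact: continuous_wexp.
  by apply: continuousD; [exact: cst_continuous|exact: continuous_cosM].
- by move=> x /=; rewrite /wexp normrN mulrN cosN.
Qed.

Lemma integrable_wexp del : 0 < del -> mu.-integrable setT (EFin \o wexp del).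
Proof.
move=> d0; apply: ge0_integrableP.
- by apply: continuous_measurable_fun; exact: continuous_wexp.
- exact: wexp_ge0.
- apply: (@le_lt_trans _ _ (\int[mu]_x (wexp del x * (1 + cos (0 * x)))%:E)%E).
    apply: ge0_le_integral => //.
    + by move=> x _; rewrite lee_fin wexp_ge0.
    + apply/measurable_EFinP; apply: continuous_measurable_fun.
      exact: continuous_wexp.
    + apply/measurable_EFinP; apply: continuous_measurable_fun => x.
      apply: continuousM; first exact: continuous_wexp.
      by apply: continuousD; [exact: cst_continuous|exact: continuous_cosM].
    + by move=> x _; rewrite lee_fin mul0r cos0 ler_peMr ?wexp_ge0// lerDl.
  by rewrite integral_wexp_cos// ltry.
Qed.

Lemma Rintegral_wexp_cos del xi : 0 < del ->
  \int[mu]_x (wexp del x * cos (xi * x)) = 2 * del / (del ^+ 2 + xi ^+ 2).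
Proof.
move=> d0.
have ic z : mu.-integrable setT (EFin \o (fun x => wexp del x * cos (z * x))).
  apply: (integrable_dom _ _ (integrable_wexp d0)).
    apply: continuous_measurable_fun => x.
    by apply: continuousM; [exact: continuous_wexp|exact: continuous_cosM].
  move=> x; rewrite normrM (ger0_norm (wexp_ge0 _ _)) ler_piMr ?wexp_ge0//.
  by rewrite ler_norml cos_geN1 cos_le1.
have E z : \int[mu]_x wexp del x + \int[mu]_x (wexp del x * cos (z * x)) =
    2 * (del^-1 + del / (del ^+ 2 + z ^+ 2)).
  rewrite -RintegralD//; last exact: integrable_wexp.
  rewrite -[RHS]/(fine (2 * (del^-1 + del / (del ^+ 2 + z ^+ 2)))%:E).
  rewrite -integral_wexp_cos// /Rintegral; congr fine.
  by apply: eq_integral => x _; rewrite mulrDr mulr1.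
have := E 0; rewrite (_ : \int[mu]_x (wexp del x * cos (0 * x)) = \int[mu]_x wexp del x); last first.
  by apply: eq_Rintegral => x _; rewrite mul0r cos0 mulr1.
have d2 : del ^+ 2 + xi ^+ 2 != 0 by rewrite gt_eqF// ltr_pwDl ?exprn_gt0// sqr_ge0.
move=> E0; have := E xi.
have -> : \int[mu]_x wexp del x = 2 * del^-1.
  have : 2 * \int[mu]_x wexp del x = 2 * (2 * del^-1).
    rewrite mulr_natl mulr2n E0 expr0n/= addr0; field; by rewrite gt_eqF.
  by apply: mulfI; rewrite pnatr_eq0.
by move=> /(canRL (addKr _)) ->; field; rewrite d2 gt_eqF.
Qed.

(** The integrand is odd: [wexp * (1 + sin)] and its reflection [wexp * (1 -
    sin)] have the same integral. *)
Lemma Rintegral_wexp_sin del xi : 0 < del ->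
  \int[mu]_x (wexp del x * sin (xi * x)) = 0.
Proof.
move=> d0.
have ms : measurable_fun setT (fun x => wexp del x * sin (xi * x)).
  apply: continuous_measurable_fun => x.
  by apply: continuousM; [exact: continuous_wexp|exact: continuous_sinM].
have mw : measurable_fun setT (wexp del).
  by apply: continuous_measurable_fun; exact: continuous_wexp.
have s1 x : `|sin (xi * x)| <= 1 by rewrite ler_norml sin_geN1 sin_le1.
have is' : mu.-integrable setT (EFin \o (fun x => wexp del x * sin (xi * x))).
  apply: (integrable_dom _ _ (integrable_wexp d0)) => [|x]; first exact: ms.
  by rewrite normrM (ger0_norm (wexp_ge0 _ _)) ler_piMr ?wexp_ge0.
have : \int[mu]_x (wexp del x + wexp del x * sin (xi * x)) =
       \int[mu]_x (wexp del x - wexp del x * sin (xi * x)).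
  rewrite /Rintegral -(ge0_integral_opp (f := fun x => (wexp del x + wexp del x * sin (xi * x))%:E)).
  - by congr fine; apply: eq_integral => x _; rewrite /wexp normrN mulrN sinN mulrN.
  - by apply/measurable_EFinP; exact: measurable_funD.
  - move=> x; rewrite lee_fin.
    have -> : wexp del x + wexp del x * sin (xi * x) = wexp del x * (1 + sin (xi * x)) by ring.
    by apply: mulr_ge0; [exact: wexp_ge0|have := sin_geN1 (xi * x); lra].
rewrite RintegralD ?RintegralB//; try exact: integrable_wexp.
move=> /addrI /eqP; rewrite -subr_eq0 opprK -mulr2n mulrn_eq0/= => /eqP//.
Qed.

Lemma cintegrable_wexp del xi : 0 < del ->
  cintegrable mu (fun x => expi (xi * x) * (wexp del x)%:C).
Proof.
move=> d0; apply: (cintegrable_dom _ _ (integrable_wexp d0)).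
  apply: cmeasurableM.
    by apply: cmeasurable_expi; exact: measurable_funM.
  by apply: cmeasurable_real; apply: continuous_measurable_fun; exact: continuous_wexp.
by move=> x; rewrite normc_expiM normc_real ger0_norm ?wexp_ge0.
Qed.

Lemma cintegral_wexp del xi : 0 < del ->
  cintegral mu setT (fun x => expi (xi * x) * (wexp del x)%:C) =
  (2 * del / (del ^+ 2 + xi ^+ 2))%:C.
Proof.
move=> d0; rewrite /cintegral; congr (_ +i* _).
  rewrite -Rintegral_wexp_cos//; congr Rintegral; apply/funext => x /=.
  by rewrite mulr0 subr0 mulrC.
rewrite -(Rintegral_wexp_sin xi d0); congr Rintegral; apply/funext => x /=.
by rewrite mulr0 add0r mulrC.
Qed.

(** The Poisson kernel of the line: the Fourier transform of [wexp del], up to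
    the factor [2 * pi]. *)
Definition pois del xi : R := del / (pi * (del ^+ 2 + xi ^+ 2)).

Lemma pois_ge0 del xi : 0 < del -> 0 <= pois del xi.
Proof.
move=> d0; rewrite /pois divr_ge0 ?(ltW d0)// mulr_ge0 ?pi_ge0//.
by rewrite addr_ge0 ?sqr_ge0.
Qed.

Lemma continuous_pois del : 0 < del -> continuous (pois del).
Proof.
move=> d0 x; rewrite /pois; apply: cvgMl_tmp; apply: cvgV.
  by rewrite mulf_neq0 ?gt_eqF ?pi_gt0// ltr_pwDl ?exprn_gt0// sqr_ge0.
apply: cvgMl_tmp; apply: cvgD; first exact: cvg_cst.
exact: exprn_continuous.
Qed.

Let dA del x : 0 < del -> is_derive x 1 (fun x => atan (del^-1 * x) / pi) (pois del x).
Proof.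
move=> d0.
have p0 : (pi : R) != 0 by rewrite gt_eqF ?pi_gt0.
have d2 : del ^+ 2 + x ^+ 2 != 0 by rewrite gt_eqF// ltr_pwDl ?exprn_gt0// sqr_ge0.
apply: is_derive_eq; rewrite /GRing.scale/= /pois.
have d3 : 1 + (del^-1 * x) ^+ 2 != 0 by rewrite gt_eqF// ltr_pwDl// sqr_ge0.
have -> : (1 + (del^-1 * x) ^+ 2) = (del ^+ 2 + x ^+ 2) / del ^+ 2.
  by field; rewrite gt_eqF.
by move: (pi) p0 => p p0; field; rewrite d2 p0 gt_eqF.
Qed.

Lemma integral_pois del : 0 < del -> (\int[mu]_x (pois del x)%:E = 1)%E.
Proof.
move=> d0.
have p0 : (pi : R) != 0 by rewrite gt_eqF ?pi_gt0.
rewrite ge0_symfun_integralT.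
- rewrite -set_itvcy (@ge0_continuous_FTC2y _ _ (fun x => atan (del^-1 * x) / pi) 0 (2^-1)).
  + by rewrite mulr0 atan0 mul0r sube0 -EFinM divff ?pnatr_eq0.
  + by move=> x _; exact: pois_ge0.
  + by apply: continuous_subspaceT; exact: continuous_pois.
  + have -> : 2^-1 = (pi / 2) / pi :> R by move: (pi) p0 => p p0; field.
    apply: cvgMr_tmp; apply: (cvg_comp (fun x => del^-1 * x) atan _ (@cvgy_atan R)).
    by apply: cvgy_mull; rewrite invr_gt0.
  + by move=> x _; have [] := dA x d0.
  + apply: cvg_at_right_filter; apply: cvgMr_tmp.
    apply: (@continuous_comp _ _ _ (fun x => del^-1 * x) atan).
      exact: mulrl_continuous.
    exact: continuous_atan.
  + by move=> x _; rewrite derive1E; have [_ ->] := dA x d0.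
- by move=> x; exact: pois_ge0.
- exact: continuous_pois.
- by move=> x /=; rewrite /pois sqrrN.
Qed.

Lemma integrable_pois del : 0 < del -> mu.-integrable setT (EFin \o pois del).
Proof.
move=> d0; apply: ge0_integrableP.
- by apply: continuous_measurable_fun; exact: continuous_pois.
- by move=> x; exact: pois_ge0.
- by rewrite integral_pois// ltry.
Qed.

Lemma Rintegral_pois del : 0 < del -> \int[mu]_x pois del x = 1.
Proof. by move=> d0; rewrite /Rintegral integral_pois. Qed.

End poisson.

Section cproducts.
Context {R : realType}.
Notation mu := (@lebesgue_measure R).

(** Integrable sections are required at every point, so that the inner integrals
    are meaningful everywhere; the proof splits [f] into its positive and
    negative parts and uses Tonelli. *)
Lemma Rintegral_lebS n (f G : n.+1.-tuple R -> R) : measurable_fun setT f ->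
  (forall x, `|f x| <= G x) -> (leb n.+1).-integrable setT (EFin \o G) ->
  (forall x, (leb n).-integrable setT (fun t => (G (tcons (x, t)))%:E)) ->
  \int[leb n.+1]_x f x = \int[mu]_x \int[leb n]_t f (tcons (x, t)).
Proof.
move=> mf fG iG iGx.
have mG : measurable_fun setT G by case/integrableP : iG => /measurable_EFinP.
have G0 x : 0 <= G x by exact: le_trans (fG x).
have intf := integrable_dom mf fG iG.
have mt := @measurable_tcons R n.
have mft x : measurable_fun setT (fun t : n.-tuple R => f (tcons (x, t))).
  by apply: measurableT_comp => //; apply: measurableT_comp => //; exact: measurable_pair1.
have ift x : (leb n).-integrable setT (fun t => (f (tcons (x, t)))%:E).
  by apply: (integrable_dom _ _ (iGx x)).
have part (g : n.+1.-tuple R -> R) : measurable_fun setT g ->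
    (forall x, 0 <= g x) -> (forall x, g x <= G x) ->
    (\int[leb n.+1]_x g x = \int[mu]_x \int[leb n]_t g (tcons (x, t))) /\
    mu.-integrable setT (EFin \o (fun x => \int[leb n]_t g (tcons (x, t)))).
  move=> mg g0 gG.
  have mgt x : measurable_fun setT (fun t : n.-tuple R => g (tcons (x, t))).
    by apply: measurableT_comp => //; apply: measurableT_comp => //; exact: measurable_pair1.
  have igt x : (leb n).-integrable setT (fun t => (g (tcons (x, t)))%:E).
    by apply: (integrable_dom _ _ (iGx x)) => // t; rewrite ger0_norm.
  have E : (\int[leb n.+1]_x (g x)%:E = \int[mu]_x (\int[leb n]_t g (tcons (x, t)))%:E)%E.
    rewrite ge0_integral_lebS//; last exact/measurable_EFinP.
    by apply: eq_integral => x _; rewrite (EFin_Rintegral (igt x)).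
  split; first by rewrite /Rintegral E.
  apply: ge0_integrableP.
  - apply: (@measurable_Rintegral2 _ _ _ (measurableTypeR R) _ (leb n) (fun p => g (tcons p))).
    exact: measurableT_comp.
  - by move=> x; apply: Rintegral_ge0.
  - rewrite -E; have [_] := integrableP _ _ _ iG; apply: le_lt_trans.
    apply: ge0_le_integral => //.
    + by move=> x _; rewrite lee_fin.
    + exact/measurable_EFinP.
    + by apply/measurable_EFinP; exact: measurableT_comp.
    + by move=> x _; rewrite /= lee_fin (le_trans (gG x))// ler_norm.
pose fp x := Num.max (f x) 0; pose fn x := Num.max (- f x) 0.
have fE x : f x = fp x - fn x.
  rewrite /fp /fn; have [f0|/ltW f0] := leP (f x) 0.
    by rewrite max_l ?oppr_ge0// sub0r opprK.
  by rewrite max_r ?oppr_le0// subr0.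
have [Ep ip] : (\int[leb n.+1]_x fp x = \int[mu]_x \int[leb n]_t fp (tcons (x, t))) /\
    mu.-integrable setT (EFin \o (fun x => \int[leb n]_t fp (tcons (x, t)))).
  apply: part; first exact: measurable_maxr.
    by move=> x; rewrite le_max lexx orbT.
  by move=> x; rewrite ge_max G0 (le_trans (ler_norm _)).
have [En ie] : (\int[leb n.+1]_x fn x = \int[mu]_x \int[leb n]_t fn (tcons (x, t))) /\
    mu.-integrable setT (EFin \o (fun x => \int[leb n]_t fn (tcons (x, t)))).
  apply: part; first by apply: measurable_maxr => //; exact: measurable_funN.
    by move=> x; rewrite le_max lexx orbT.
  by move=> x; rewrite ge_max G0 (le_trans (ler_norm _))// normrN.
have mfp : measurable_fun setT fp by exact: measurable_maxr.
have mfn : measurable_fun setT fn by apply: measurable_maxr => //; exact: measurable_funN.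
have bp x : `|fp x| <= G x.
  by rewrite ger0_norm ?le_max ?lexx ?orbT// ge_max G0 (le_trans (ler_norm _)).
have bn x : `|fn x| <= G x.
  by rewrite ger0_norm ?le_max ?lexx ?orbT// ge_max G0 (le_trans (ler_norm _))// normrN.
rewrite (_ : \int[leb n.+1]_x f x = \int[leb n.+1]_x (fp x - fn x)); last first.
  by apply: eq_Rintegral => x _; exact: fE.
rewrite (RintegralB measurableT (integrable_dom mfp bp iG) (integrable_dom mfn bn iG)).
rewrite Ep En -(RintegralB measurableT ip ie); apply: eq_Rintegral => x _.
rewrite -RintegralB//.
- by apply: eq_Rintegral => t _; rewrite -fE.
- apply: (integrable_dom _ _ (iGx x)) => // ; apply: measurableT_comp => //.
  by apply: measurableT_comp => //; exact: measurable_pair1.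
- apply: (integrable_dom _ _ (iGx x)) => // ; apply: measurableT_comp => //.
  by apply: measurableT_comp => //; exact: measurable_pair1.
Qed.

Lemma cintegral_lebS n (f : n.+1.-tuple R -> R[i]) (G : n.+1.-tuple R -> R) :
  cmeasurable f -> (forall x, normc (f x) <= G x) ->
  (leb n.+1).-integrable setT (EFin \o G) ->
  (forall x, (leb n).-integrable setT (fun t => (G (tcons (x, t)))%:E)) ->
  cintegral (leb n.+1) setT f =
  cintegral mu setT (fun x => cintegral (leb n) setT (fun t => f (tcons (x, t)))).
Proof.
move=> [f1 f2] fG iG iGx; rewrite /cintegral /=; congr (_ +i* _).
  by apply: (Rintegral_lebS f1 _ iG) => // x; exact: le_trans (Re_le_normc _) (fG x).
by apply: (Rintegral_lebS f2 _ iG) => // x; exact: le_trans (Im_le_normc _) (fG x).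
Qed.

Lemma cmeasurable_prod (d1 : measure_display) (T : measurableType d1) n
  (f : 'I_n -> T -> R[i]) : (forall j, cmeasurable (f j)) ->
  cmeasurable (fun x => \prod_(j < n) f j x).
Proof.
move=> mf; elim: n => [|n IH] in f mf *.
  by under eq_fun do rewrite big_ord0; exact: cmeasurable_cst.
under eq_fun do rewrite big_ord_recl; apply: cmeasurableM => //.
exact: (IH (fun j => f (lift ord0 j))).
Qed.

Lemma normc_prod n (u : 'I_n -> R[i]) :
  normc (\prod_(j < n) u j) = \prod_(j < n) normc (u j).
Proof.
elim/big_ind2 : _ => [|z x w y <- <-|//]; first exact: normc1.
exact: normcM.
Qed.

Lemma cintegral_prod n (f : 'I_n -> R -> R[i]) :
  (forall j, cintegrable mu (f j)) ->
  cintegral (leb n) setT (fun x => \prod_(j < n) f j (tnth x j)) =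
  \prod_(j < n) cintegral mu setT (f j).
Proof.
elim: n => [|n IH] in f * => cf.
  rewrite big_ord0; under eq_cintegral do rewrite big_ord0.
  rewrite (cintegral_real (leb 0) (fun=> 1)) Rintegral_cst//.
  rewrite (_ : fine _ = 1) ?mulr1//.
  have h : (\int[leb 0]_x (1%:E : \bar R) = 1)%E by rewrite leb0//; exact: measurable_cst.
  rewrite integral_cst// mul1e in h.
  by rewrite -[RHS]/(fine 1%E); congr fine; exact: h.
have mf j : cmeasurable (f j) by exact: cintegrable_cmeasurable (cf j).
have inf j := integrable_normc (cf j).
rewrite (cintegral_lebS (G := fun x => \prod_(j < n.+1) normc (f j (tnth x j)))).
- rewrite big_ord_recl -IH// mulrC -cintegralZ//; apply: eq_cintegral => x.
  rewrite [RHS]mulrC -cintegralZ; last first.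
    apply: (cintegrable_dom (G := fun x => \prod_(j < n) normc (f (lift ord0 j) (tnth x j)))).
    + apply: cmeasurable_prod => j; apply: cmeasurable_comp => //.
      exact: measurable_tnth.
    + by move=> t; rewrite normc_prod.
    + by apply: (integrable_prod (f := fun j x => normc (f (lift ord0 j) x))) => // *; exact: normc_ge0.
  apply: eq_cintegral => t; rewrite big_ord_recl tnth_tcons0; congr (_ * _).
  by apply: eq_bigr => j _; rewrite tnth_tconsS.
- apply: cmeasurable_prod => j; apply: cmeasurable_comp => //.
  exact: measurable_tnth.
- by move=> t; rewrite normc_prod.
- by apply: (integrable_prod (f := fun j x => normc (f j x))) => // *; exact: normc_ge0.
- move=> x; rewrite (_ : (fun t => _) = EFin \o (fun t => normc (f ord0 x) *
     \prod_(j < n) normc (f (lift ord0 j) (tnth t j)))).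
    apply: (integrable_mull (F := fun t : n.-tuple R => \prod_(j < n) normc (f (lift ord0 j) (tnth t j)))).
    by apply: (integrable_prod (f := fun j x => normc (f (lift ord0 j) x))) => // *; exact: normc_ge0.
  apply/funext => t /=; rewrite big_ord_recl tnth_tcons0; congr (_ * _)%:E.
  by apply: eq_bigr => j _; rewrite tnth_tconsS.
Qed.

End cproducts.

Section poissond.
Context {R : realType} {d : nat}.
Local Notation Rd := (d.-tuple R).
Implicit Types (del : R).

Definition wexpd del (x : Rd) : R := \prod_(j < d) wexp del (tnth x j).
Definition poisd del (x : Rd) : R := \prod_(j < d) pois del (tnth x j).

Lemma wexpd_ge0 del x : 0 <= wexpd del x.
Proof. by apply: prodr_ge0 => j _; exact: wexp_ge0. Qed.

Lemma wexpd_le1 del x : 0 <= del -> wexpd del x <= 1.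
Proof.
move=> d0; apply: prodr_ile1 => j _; rewrite wexp_ge0/= /wexp expR_le1 oppr_le0.
by rewrite mulr_ge0.
Qed.

Lemma poisd_ge0 del x : 0 < del -> 0 <= poisd del x.
Proof. by move=> d0; apply: prodr_ge0 => j _; exact: pois_ge0. Qed.

Lemma integrable_wexpd del : 0 < del -> (leb d).-integrable setT (EFin \o wexpd del).
Proof.
move=> d0; apply: (integrable_prod (f := fun j => wexp del)) => *.
  exact: integrable_wexp.
exact: wexp_ge0.
Qed.

Lemma integrable_poisd del : 0 < del -> (leb d).-integrable setT (EFin \o poisd del).
Proof.
move=> d0; apply: (integrable_prod (f := fun j => pois del)) => *.
  exact: integrable_pois.
exact: pois_ge0.
Qed.

Lemma Rintegral_poisd del : 0 < del -> \int[leb d]_x poisd del x = 1.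
Proof.
move=> d0; rewrite /poisd (Rintegral_prod (f := fun j => pois del)).
- by apply: big1 => j _; exact: Rintegral_pois.
- by move=> *; exact: integrable_pois.
- by move=> *; exact: pois_ge0.
Qed.

Lemma expi_sum n (u : 'I_n -> R) :
  expi (\sum_(j < n) u j) = \prod_(j < n) expi (u j).
Proof. exact: (big_morph expi (@expiD R) (@expi0 R)). Qed.

Lemma cintegral_wexpd del (xi : Rd) : 0 < del ->
  cintegral (leb d) setT (fun x => expi (dot x xi) * (wexpd del x)%:C) =
  ((2 * pi) ^+ d * poisd del xi)%:C.
Proof.
move=> d0.
transitivity (cintegral (leb d) setT (fun x => \prod_(j < d)
    (expi (tnth xi j * tnth x j) * (wexp del (tnth x j))%:C))).
  apply: eq_cintegral => x; rewrite big_split /= -expi_sum /wexpd rmorph_prod.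
  by congr (expi _ * _); apply: eq_bigr => j _; rewrite mulrC.
rewrite (cintegral_prod (f := fun j x => expi (tnth xi j * x) * (wexp del x)%:C)).
  have -> : (2 * pi) ^+ d = \prod_(j < d) (2 * pi) :> R by rewrite prodr_const card_ord.
  rewrite -big_split rmorph_prod; apply: eq_bigr => j _.
  rewrite cintegral_wexp//; congr (_%:C); rewrite /= /pois.
  have p0 : (pi : R) != 0 by rewrite gt_eqF ?pi_gt0.
  have d2 : del ^+ 2 + tnth xi j ^+ 2 != 0.
    by rewrite gt_eqF// ltr_pwDl ?exprn_gt0// sqr_ge0.
  by move: (pi) p0 => p p0; field; rewrite d2.
by move=> j; exact: cintegrable_wexp.
Qed.

Lemma wexpdE del (x : Rd) : wexpd del x = expR (- (del * \sum_(j < d) `|tnth x j|)).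
Proof. by rewrite mulr_sumr -sumrN expR_sum. Qed.

Lemma invn_cvg0 : (fun n => n.+1%:R^-1 : R) @ \oo --> (0 : R).
Proof. exact: cvg_harmonic. Qed.

Lemma wexpd_cvg (x : Rd) : (fun n => wexpd n.+1%:R^-1 x) @ \oo --> (1 : R).
Proof.
under eq_fun do rewrite wexpdE.
set S := \sum_(j < d) _.
suff : (fun n => expR (- (n.+1%:R^-1 * S))) @ \oo --> expR (- (0 * S)).
  by rewrite mul0r oppr0 expR0.
apply: continuous_cvg; first exact: continuous_expR.
by apply: cvgN; apply: cvgMr_tmp; exact: invn_cvg0.
Qed.

Lemma measurable_wexpd del : measurable_fun setT (wexpd del).
Proof.
apply: measurable_prod => j _.
apply: (measurableT_comp (f := wexp del)); last exact: measurable_tnth.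
by apply: continuous_measurable_fun; exact: continuous_wexp.
Qed.

Lemma measurable_poisd del : 0 < del -> measurable_fun setT (poisd del).
Proof.
move=> d0; apply: measurable_prod => j _.
apply: (measurableT_comp (f := pois del)); last exact: measurable_tnth.
by apply: continuous_measurable_fun; exact: continuous_pois.
Qed.

Lemma poisd_scale del (x : Rd) : 0 < del ->
  poisd del (tscale del x) = (del^-1) ^+ d * poisd 1 x.
Proof.
move=> d0; have -> : (del^-1) ^+ d = \prod_(j < d) del^-1 by rewrite prodr_const card_ord.
rewrite -big_split; apply: eq_bigr => j _ /=; rewrite tnthE /pois.
have p0 : (pi : R) != 0 by rewrite gt_eqF ?pi_gt0.
have d2 : 1 + tnth x j ^+ 2 != 0 by rewrite gt_eqF// ltr_pwDl ?exprn_gt0// sqr_ge0.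
rewrite expr1n exprMn -[X in X + _ * _]mulr1 -mulrDr.
by move: (pi) p0 => p p0; field; rewrite d2 p0 gt_eqF.
Qed.

End poissond.

(** * The Fourier transform on bounded integrable functions *)

Local Opaque Rintegral cintegral.

Section fourier.
Context {R : realType} {d : nat}.
Local Notation Rd := (d.-tuple R).
Local Notation mu := (@leb R d).
Implicit Types (f g psi : Rd -> R[i]).

Definition cpi : R := (2 * pi) ^- d.

Lemma cpi_gt0 : 0 < cpi.
Proof. by rewrite invr_gt0 exprn_gt0// mulr_gt0// pi_gt0. Qed.

Lemma cpi_le1 : cpi <= 1.
Proof.
rewrite invf_le1 ?exprn_gt0 ?mulr_gt0 ?pi_gt0// exprn_ege1//.
by have := pi_ge2 R; lra.
Qed.

Lemma cpiK : cpi * (2 * pi) ^+ d = 1.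
Proof. by rewrite /cpi mulVf// expf_neq0// mulf_neq0// gt_eqF// pi_gt0. Qed.

(** The class of frequency functions in which the equation is solved: an algebra
    for convolution, on which both Plancherel's inequality and absolutely
    convergent inversion integrals are available. *)
Definition good g := cintegrable mu g /\ exists B : R, forall x, normc (g x) <= B.

Lemma cmeasurable_phase1 (x : Rd) : cmeasurable (fun y : Rd => expi (dot x y)).
Proof. by apply: cmeasurable_expi; apply: measurable_dot => //; exact: measurable_cst. Qed.

Lemma cmeasurable_phaseN1 (x : Rd) : cmeasurable (fun y : Rd => expi (- dot y x)).
Proof.
apply: cmeasurable_expi; apply: measurable_funN.
by apply: measurable_dot => //; exact: measurable_cst.
Qed.

Lemma cintegrable_phase g (x : Rd) : cintegrable mu g ->
  cintegrable mu (fun y => expi (dot x y) * g y).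
Proof.
move=> cg; apply: (cintegrableMb (B := 1)) => //; first exact: cmeasurable_phase1.
by move=> y; rewrite normc_expi.
Qed.

Lemma cintegrable_phaseN g (x : Rd) : cintegrable mu g ->
  cintegrable mu (fun y => expi (- dot y x) * g y).
Proof.
move=> cg; apply: (cintegrableMb (B := 1)) => //; first exact: cmeasurable_phaseN1.
by move=> y; rewrite normc_expi.
Qed.

Lemma fourierE g x : cintegrable mu g ->
  fourier g x = ((2 * pi) ^+ d)%:C * (conjc (inv_fourier (fun y => (conjc (g y))) x)).
Proof.
move=> cg; rewrite /inv_fourier.
have -> : cintegral mu setT (fun xi => expi (dot x xi) * (conjc (g xi))) = (conjc (fourier g x)).
  rewrite /fourier -cintegral_conj; last exact: cintegrable_phaseN.
  apply: eq_cintegral => y; by rewrite dotC expiN conjcM conjcK.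
have -> (z : R[i]) (a : R) : (conjc (a%:C * (conjc z))) = a%:C * z by case: z => ? ?; simpc.
by rewrite mulrA -rmorphM [_ * _ ^- _]mulrC cpiK mul1r.
Qed.

Lemma normc_fourier g x : cintegrable mu g ->
  normc (fourier g x) <= \int[mu]_y normc (g y).
Proof.
move=> cg; rewrite /fourier.
have := normc_cintegral (cintegrable_phaseN x cg).
by under eq_Rintegral do rewrite normc_expiM.
Qed.

Lemma normc_inv_fourier g x : cintegrable mu g ->
  normc (inv_fourier g x) <= cpi * \int[mu]_y normc (g y).
Proof.
move=> cg; rewrite /inv_fourier normcM normc_real ger0_norm ?(ltW cpi_gt0)//.
rewrite ler_wpM2l ?(ltW cpi_gt0)//.
have := normc_cintegral (cintegrable_phase x cg).
by under eq_Rintegral do rewrite normc_expiM.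
Qed.

Lemma normc_inv_fourier1 g x : cintegrable mu g ->
  normc (inv_fourier g x) <= \int[mu]_y normc (g y).
Proof.
move=> cg; apply: (le_trans (normc_inv_fourier x cg)).
rewrite ler_piMl ?cpi_le1//; apply: Rintegral_ge0 => *; exact: normc_ge0.
Qed.

Lemma cmeasurable_fourier g : cmeasurable g -> cmeasurable (fourier g).
Proof.
move=> mg; apply: (@cmeasurable_cintegral2 _ _ _ Rd Rd mu
  (fun z => expi (- dot z.2 z.1) * g z.2)).
apply: cmeasurableM; last exact: cmeasurable_comp.
by apply: cmeasurable_expi; apply: measurable_funN; exact: measurable_dot.
Qed.

Lemma cmeasurable_inv_fourier g : cmeasurable g -> cmeasurable (inv_fourier g).
Proof.
move=> mg; apply: cmeasurableM; first exact: cmeasurable_cst.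
apply: (@cmeasurable_cintegral2 _ _ _ Rd Rd mu (fun z => expi (dot z.1 z.2) * g z.2)).
apply: cmeasurableM; last exact: cmeasurable_comp.
by apply: cmeasurable_expi; exact: measurable_dot.
Qed.

(** The kernel [expi (dot x y)] is bounded and symmetric, so Fubini applies. *)
Lemma mul_inv_fourier f g : cintegrable mu f -> cintegrable mu g ->
  cintegral mu setT (fun x => f x * inv_fourier g x) =
  cintegral mu setT (fun x => g x * inv_fourier f x).
Proof.
move=> cf cg.
have cfe (u v : Rd -> R[i]) : cintegrable mu u -> cintegrable mu v ->
    cintegral mu setT (fun x => u x * inv_fourier v x) =
    cpi%:C * cintegral mu setT (fun x => u x * cintegral mu setT (fun y => expi (dot x y) * v y)).
  move=> cu cv; rewrite -cintegralZ; first by apply: eq_cintegral => x; rewrite mulrCA.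
  under eq_fun do rewrite mulrC; apply: (cintegrableMb (B := \int[mu]_y normc (v y))) => //.
    apply: (@cmeasurable_cintegral2 _ _ _ Rd Rd mu (fun z => expi (dot z.1 z.2) * v z.2)).
    apply: cmeasurableM; last by apply: cmeasurable_comp => //; exact: cintegrable_cmeasurable cv.
    by apply: cmeasurable_expi; exact: measurable_dot.
  move=> x; have := normc_cintegral (cintegrable_phase x cv).
  by under eq_Rintegral do rewrite normc_expiM.
rewrite (cfe _ _ cf cg) (cfe _ _ cg cf); congr (_ * _).
have mk : cmeasurable (fun z : Rd * Rd => expi (dot z.1 z.2)).
  by apply: cmeasurable_expi; exact: measurable_dot.
have bk (z : Rd * Rd) : normc (expi (dot z.1 z.2)) <= 1 by rewrite normc_expi.
apply: (etrans (cintegral_kernel_swap mk bk cf cg)).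
apply: eq_cintegral => y; congr (_ * _); apply: eq_cintegral => x.
by rewrite dotC.
Qed.

Lemma mul_fourier f g : cintegrable mu f -> cintegrable mu g ->
  cintegral mu setT (fun x => f x * fourier g x) =
  cintegral mu setT (fun x => g x * fourier f x).
Proof.
move=> cf cg.
have mk : cmeasurable (fun z : Rd * Rd => expi (- dot z.2 z.1)).
  by apply: cmeasurable_expi; apply: measurable_funN; exact: measurable_dot.
have bk (z : Rd * Rd) : normc (expi (- dot z.2 z.1)) <= 1 by rewrite normc_expi.
apply: (etrans (cintegral_kernel_swap mk bk cf cg)).
apply: eq_cintegral => y; congr (_ * _); apply: eq_cintegral => x.
by rewrite dotC.
Qed.

(** Inserting the weight [wexpd del] makes every integral absolutely
    convergent, and turns the product of two oscillating integrals into a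
    double integral against the Poisson kernel. *)
Lemma regularized_parseval del g psi : 0 < del ->
  cintegrable mu g -> cintegrable mu psi ->
  cintegral mu setT (fun x => (fourier psi x * (wexpd del x)%:C) * inv_fourier g x) =
  cintegral mu setT (fun x => g x *
    cintegral mu setT (fun y => psi y * (poisd del (tsub x y))%:C)).
Proof.
move=> d0 cg cp.
have cw : cintegrable mu (fun x => (wexpd del x)%:C).
  apply: (cintegrable_dom _ _ (integrable_wexpd d0)).
    by apply: cmeasurable_real; exact: measurable_wexpd.
  by move=> x; rewrite normc_real ger0_norm ?wexpd_ge0.
have mfp := cmeasurable_fourier (cintegrable_cmeasurable cp).
have cP : cintegrable mu (fun x => fourier psi x * (wexpd del x)%:C).
  apply: (cintegrableMb (B := \int[mu]_y normc (psi y))) => // x.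
  exact: normc_fourier.
rewrite mul_inv_fourier//; apply: eq_cintegral => xi; congr (_ * _).
rewrite /inv_fourier.
transitivity (cpi%:C * cintegral mu setT (fun x =>
    (expi (dot xi x) * (wexpd del x)%:C) * fourier psi x)).
  by congr (_ * _); apply: eq_cintegral => x; rewrite mulrA mulrAC.
rewrite mul_fourier//; last exact: cintegrable_phase.
rewrite -cintegralZ.
  apply: eq_cintegral => y; rewrite mulrCA; congr (_ * _).
  rewrite /fourier (_ : cintegral _ _ _ = cintegral mu setT
      (fun x => expi (dot x (tsub xi y)) * (wexpd del x)%:C)).
    by rewrite cintegral_wexpd// -rmorphM mulrA cpiK mul1r.
  apply: eq_cintegral => x; rewrite mulrA -expiD; congr (expi _ * _).
  by rewrite dotBr addrC [dot xi x]dotC.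
under eq_fun do rewrite mulrC.
apply: (cintegrableMb (B := \int[mu]_y normc ((expi (dot xi y) * (wexpd del y)%:C)))) => //.
  apply: cmeasurable_fourier; apply: cintegrable_cmeasurable.
  exact: cintegrable_phase.
by move=> x; apply: normc_fourier; exact: cintegrable_phase.
Qed.

Local Opaque fourier inv_fourier.

Lemma integrable_poisd_sub del (x : Rd) : 0 < del ->
  mu.-integrable setT (EFin \o (fun y => poisd del (tsub x y))).
Proof. by move=> d0; apply: integrable_tsub; exact: integrable_poisd. Qed.

Lemma Rintegral_poisd_sub del (x : Rd) : 0 < del ->
  \int[mu]_y poisd del (tsub x y) = 1.
Proof.
by move=> d0; rewrite Rintegral_tsub ?Rintegral_poisd//; exact: integrable_poisd.
Qed.

Lemma poisd_average_le del psi (B : R) (x : Rd) : 0 < del -> cintegrable mu psi ->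
  (forall y, normc (psi y) <= B) ->
  normc (cintegral mu setT (fun y => psi y * (poisd del (tsub x y))%:C)) <= B.
Proof.
move=> d0 cp pB.
have ip := integrable_poisd_sub x d0.
have mp : measurable_fun setT (fun y : Rd => poisd del (tsub x y)).
  by case/integrableP : ip => /measurable_EFinP.
have nle y : normc (psi y * (poisd del (tsub x y))%:C) <= B * poisd del (tsub x y).
  by rewrite normcM normc_real ger0_norm ?poisd_ge0// ler_wpM2r ?poisd_ge0.
apply: (@le_trans _ _ (\int[mu]_y (B * poisd del (tsub x y)))).
  apply: normc_cintegral_le => //; last exact: integrable_mull.
  apply: (cintegrable_dom (G := fun y => B * poisd del (tsub x y))) => //.
    apply: cmeasurableM; first exact: cintegrable_cmeasurable cp.
    exact: cmeasurable_real.
  exact: integrable_mull.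
by rewrite RintegralZl// Rintegral_poisd_sub// mulr1.
Qed.

(** Half of Plancherel: since [wexpd] has a positive Fourier transform of total
    mass one, the energy of [inv_fourier g] is controlled by the sup and the
    mass of [g]. *)
Lemma plancherel_le g (B : R) : cintegrable mu g -> (forall x, normc (g x) <= B) ->
  mu.-integrable setT (EFin \o (fun x => normc (inv_fourier g x) ^+ 2)) /\
  \int[mu]_x (normc (inv_fourier g x) ^+ 2) <= B * \int[mu]_x normc (g x).
Proof.
move=> cg gB; set v := inv_fourier g.
have B0 : 0 <= B by apply: le_trans (gB (tcst 0)); exact: normc_ge0.
have mv : cmeasurable v by apply: cmeasurable_inv_fourier; exact: cintegrable_cmeasurable cg.
have mv2 : measurable_fun setT (fun x => normc (v x) ^+ 2).
  by apply: measurable_funX; exact: measurable_normc.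
have cgc : cintegrable mu (fun x => (conjc (g x))).
  apply: (cintegrable_dom _ _ (integrable_normc cg)) => [|x].
    by apply: cmeasurable_conj; exact: cintegrable_cmeasurable cg.
  by rewrite normc_conj.
set K := B * \int[mu]_x normc (g x).
have ing := integrable_normc cg.
have K0 : 0 <= K by rewrite mulr_ge0// Rintegral_ge0// => *; exact: normc_ge0.
have vb x : normc (v x) ^+ 2 <= (\int[mu]_y normc (g y)) ^+ 2.
  rewrite ler_pXn2r ?nnegrE ?normc_ge0//; first exact: normc_inv_fourier1.
  by apply: Rintegral_ge0 => *; exact: normc_ge0.
(* With [conjc g] in the role of the test function, the regularized identity
    computes a weighted energy of [v]. *)
have key del : 0 < del ->
    (\int[mu]_x (normc (v x) ^+ 2 * wexpd del x)%:E <= K%:E)%E.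
  move=> d0; have h := regularized_parseval d0 cg cgc.
  have iw : mu.-integrable setT (EFin \o (fun x => normc (v x) ^+ 2 * wexpd del x)).
    apply: (integrable_dom (G := fun x => (\int[mu]_y normc (g y)) ^+ 2 * wexpd del x)).
    - by apply: measurable_funM => //; exact: measurable_wexpd.
    - move=> x; rewrite normrM (ger0_norm (sqr_ge0 _)) (ger0_norm (wexpd_ge0 _ _)).
      by rewrite ler_wpM2r ?wexpd_ge0.
    - exact/integrable_mull/integrable_wexpd.
  rewrite -EFin_Rintegral// lee_fin.
  have e1 : cintegral mu setT (fun x => (fourier (fun y => (conjc (g y))) x *
      (wexpd del x)%:C) * inv_fourier g x) =
      ((2 * pi) ^+ d * \int[mu]_x (normc (v x) ^+ 2 * wexpd del x))%:C.
    rewrite -RintegralZl// -cintegral_real; apply: eq_cintegral => x.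
    rewrite fourierE//.
    rewrite (_ : (fun y => _) = g); last by apply/funext => y; rewrite conjcK.
    have -> : ((2 * pi) ^+ d * (normc (v x) ^+ 2 * wexpd del x))%:C =
        ((2 * pi) ^+ d)%:C * (v x * conjc (v x)) * (wexpd del x)%:C :> R[i].
      by rewrite mulc_conj -!rmorphM mulrA.
    by rewrite -/(v x); ring.
  have : normc (((2 * pi) ^+ d * \int[mu]_x (normc (v x) ^+ 2 * wexpd del x))%:C) <= K.
    rewrite -e1 h.
    apply: (@le_trans _ _ (\int[mu]_x (B * normc (g x)))).
      have mP : cmeasurable (fun x : Rd => cintegral mu setT
          (fun y => (conjc (g y)) * (poisd del (tsub x y))%:C)).
        apply: (@cmeasurable_cintegral2 _ _ _ Rd Rd mu
          (fun z => (conjc (g z.2)) * (poisd del (tsub z.1 z.2))%:C)).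
        apply: cmeasurableM.
          by apply: (cmeasurable_comp (f := fun y => (conjc (g y)))) => //; exact: cintegrable_cmeasurable cgc.
        apply: cmeasurable_real; apply: (measurableT_comp (f := poisd del)).
          exact: measurable_poisd.
        exact: measurable_tsub.
      have b x : normc (cintegral mu setT
          (fun y => (conjc (g y)) * (poisd del (tsub x y))%:C)) <= B.
        by apply: poisd_average_le => // y; rewrite normc_conj.
      apply: normc_cintegral_le.
      - by under eq_fun do rewrite mulrC; exact: (cintegrableMb (B := B)).
      - exact: integrable_mull.
      - by move=> x; rewrite normcM mulrC ler_wpM2r ?normc_ge0.
    by rewrite RintegralZl.
  rewrite normc_real ger0_norm; last first.
    rewrite mulr_ge0 ?exprn_ge0 ?mulr_ge0 ?pi_ge0// Rintegral_ge0// => x _.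
    by rewrite mulr_ge0 ?sqr_ge0 ?wexpd_ge0.
  apply: le_trans; rewrite ler_peMl//.
    by apply: Rintegral_ge0 => x _; rewrite mulr_ge0 ?sqr_ge0 ?wexpd_ge0.
  by rewrite exprn_ege1//; have := pi_ge2 R; lra.
have final : (\int[mu]_x (normc (v x) ^+ 2)%:E <= K%:E)%E.
  pose gn n x := (normc (v x) ^+ 2 * wexpd n.+1%:R^-1 x)%:E.
  have gnnd x : {homo gn ^~ x : n m / (n <= m)%N >-> (n <= m)%E}.
    move=> n k nk; rewrite /gn lee_fin ler_wpM2l ?sqr_ge0// !wexpdE ler_expR lerN2.
    rewrite ler_wpM2r ?sumr_ge0// lef_pV2 ?posrE// ler_nat ltnS//.
  have lgn x : limn (gn ^~ x) = (normc (v x) ^+ 2)%:E.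
    apply/cvg_lim => //; apply: cvg_EFin; first by near=> n.
    rewrite -[X in _ --> X]mulr1; apply: cvgMl_tmp; exact: wexpd_cvg.
  have -> : (\int[mu]_x (normc (v x) ^+ 2)%:E = \int[mu]_x limn (gn ^~ x))%E.
    by apply: eq_integral => x _; rewrite lgn.
  rewrite monotone_convergence//.
  - apply: lime_le.
      apply: ereal_nondecreasing_is_cvgn => n k nk; apply: ge0_le_integral => //.
      + by move=> x _; rewrite lee_fin mulr_ge0 ?sqr_ge0 ?wexpd_ge0.
      + by apply/measurable_EFinP; apply: measurable_funM => //; exact: measurable_wexpd.
      + by apply/measurable_EFinP; apply: measurable_funM => //; exact: measurable_wexpd.
      + by move=> x _; exact: gnnd.
    by near=> n; exact: key.
  - by move=> n; apply/measurable_EFinP; apply: measurable_funM => //; exact: measurable_wexpd.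
  - by move=> n x _; rewrite lee_fin mulr_ge0 ?sqr_ge0 ?wexpd_ge0.
have iv : mu.-integrable setT (EFin \o (fun x => normc (v x) ^+ 2)).
  apply: ge0_integrableP => //; first by move=> x; exact: sqr_ge0.
  by apply: (le_lt_trans final); rewrite ltry.
by split => //; rewrite -lee_fin EFin_Rintegral.
Unshelve. all: by end_near. Qed.

(** Continuity along the rays [x - y / n]; this is all the regularity that the
    Poisson average needs in order to converge. *)
Definition ray_continuous psi := forall x y : Rd,
  ccvg (fun n => psi (tsub x (tscale n.+1%:R^-1 y))) (psi x).

Lemma poisd_average_cvg psi (x : Rd) : good psi -> ray_continuous psi ->
  ccvg (fun n => cintegral mu setT (fun y => psi y * (poisd n.+1%:R^-1 (tsub x y))%:C))
       (psi x).
Proof.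
move=> [cp [B pB]] rc.
have mp := cintegrable_cmeasurable cp.
(* The substitution [y := x - del * y] moves the parameter from the kernel to
    the argument of [psi], where dominated convergence applies. *)
have E n : cintegral mu setT (fun y => psi y * (poisd n.+1%:R^-1 (tsub x y))%:C) =
    cintegral mu setT (fun y => psi (tsub x (tscale n.+1%:R^-1 y)) * (poisd 1 y)%:C).
  set del := _^-1; have d0 : 0 < del by rewrite invr_gt0 ltr0n.
  pose h y := psi (tsub x y) * (poisd del y)%:C.
  have ch : cintegrable mu h.
    apply: (cintegrable_dom (G := fun y => B * poisd del y)).
    - apply: cmeasurableM; first by apply: (cmeasurable_comp mp); apply: measurable_tsub => //; exact: measurable_cst.
      by apply: cmeasurable_real; exact: measurable_poisd.
    - by move=> y; rewrite normcM normc_real ger0_norm ?poisd_ge0// ler_wpM2r ?poisd_ge0.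
    - exact/integrable_mull/integrable_poisd.
  transitivity (cintegral mu setT h).
    have -> : (fun y => psi y * (poisd del (tsub x y))%:C) = (fun y => h (tsub x y)).
      by apply/funext => y; rewrite /h tsub_sub.
    rewrite (transfer_cintegral _ (c := 1))// ?mul1r//.
      by apply: measurable_tsub => //; exact: measurable_cst.
    by move=> f mf f0; rewrite mul1e ge0_integral_tsub.
  have di : 0 <= del^-1 by rewrite invr_ge0 ltW.
  have tr := @transfer_cintegral R d (tscale del)
    (measurable_tscale del (@measurable_id _ _ setT)) (del^-1 ^+ d)
    (exprn_ge0 d di) (fun u mu0 u0 => ge0_integral_tscale d0 mu0 u0) h ch.
  have dd : (del^-1 ^+ d) != 0 by rewrite expf_neq0// invr_neq0// gt_eqF.
  apply: (@mulfI _ ((del^-1 ^+ d)%:C)); first by rewrite (inj_eq (@complexI _) _ 0).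
  rewrite -tr -cintegralZ.
    apply: eq_cintegral => y; rewrite /h poisd_scale// rmorphM.
    by rewrite mulrCA.
  apply: (cintegrable_dom (G := fun y => B * poisd 1 y)).
  - apply: cmeasurableM.
      apply: (cmeasurable_comp mp); apply: measurable_tsub; first exact: measurable_cst.
      by apply: measurable_tscale.
    by apply: cmeasurable_real; exact: measurable_poisd.
  - by move=> y; rewrite normcM normc_real ger0_norm ?poisd_ge0// ler_wpM2r ?poisd_ge0.
  - exact/integrable_mull/integrable_poisd.
rewrite (funext E).
have -> : psi x = cintegral mu setT (fun y => psi x * (poisd 1 y)%:C).
  rewrite cintegralZ; first by rewrite cintegral_real Rintegral_poisd ?mulr1.
  apply: (cintegrable_dom (G := poisd 1)).
  - by apply: cmeasurable_real; exact: measurable_poisd.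
  - by move=> y; rewrite normc_real ger0_norm ?poisd_ge0.
  - exact: integrable_poisd.
apply: (cintegral_cvg (G := fun y => B * poisd 1 y)).
- move=> n; apply: cmeasurableM.
    apply: (cmeasurable_comp mp); apply: measurable_tsub; first exact: measurable_cst.
    by apply: measurable_tscale.
  by apply: cmeasurable_real; exact: measurable_poisd.
- by move=> y; apply: ccvgM; [exact: rc|exact: ccvg_cst].
- by move=> n y; rewrite normcM normc_real ger0_norm ?poisd_ge0// ler_wpM2r ?poisd_ge0.
- exact/integrable_mull/integrable_poisd.
Qed.

(** The regularized identity at [del = 1 / (n + 1)]: the left side converges by
    dominated convergence, the product of the two transforms being integrable by
    [plancherel_le], and on the right the Poisson averages of [psi] converge to
    [psi]. *)
Lemma parseval g psi : good g -> good psi -> ray_continuous psi ->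
  cintegrable mu (fun x => inv_fourier g x * fourier psi x) /\
  cintegral mu setT (fun x => inv_fourier g x * fourier psi x) =
  cintegral mu setT (fun x => g x * psi x).
Proof.
move=> [cg [Bg gB]] gp rc; have [cp [B pB]] := gp.
have mg := cintegrable_cmeasurable cg; have mp := cintegrable_cmeasurable cp.
have cpc : cintegrable mu (fun x => (conjc (psi x))).
  apply: (cintegrable_dom _ _ (integrable_normc cp)) => [|x].
    exact: cmeasurable_conj.
  by rewrite normc_conj.
have [i1 _] := plancherel_le cg gB.
have [i2 _] := plancherel_le (B := B) cpc (fun x => eq_ind_r (fun t => t <= B) (pB x) (normc_conj (psi x))).
set A := (2 * pi) ^+ d : R.
have A0 : 0 <= A by rewrite exprn_ge0// mulr_ge0 ?pi_ge0.
pose D x := A * (normc (inv_fourier g x) ^+ 2 +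
   normc (inv_fourier (fun y => (conjc (psi y))) x) ^+ 2).
have iD : mu.-integrable setT (EFin \o D).
  by apply: integrable_mull; exact: integrableDr.
have bD x : normc (inv_fourier g x * fourier psi x) <= D x.
  rewrite normcM (fourierE x cp) /D; set a := normc (inv_fourier g x).
  rewrite normcM normc_real normc_conj; set b := normc _.
  have -> : `|(2 * pi) ^+ d| = A :> R by rewrite ger0_norm.
  rewrite mulrCA ler_wpM2l//.
  have a0 : 0 <= a := normc_ge0 _; have b0 : 0 <= b := normc_ge0 _.
  by have := sqr_ge0 (a - b); nra.
have mi := cmeasurable_inv_fourier mg; have mf := cmeasurable_fourier mp.
have cP : cintegrable mu (fun x => inv_fourier g x * fourier psi x).
  by apply: (cintegrable_dom _ bD iD); exact: cmeasurableM.
split => //.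
apply: (@ccvg_unique _ (fun n => cintegral mu setT (fun x =>
  (fourier psi x * (wexpd n.+1%:R^-1 x)%:C) * inv_fourier g x))).
  apply: (cintegral_cvg (G := D)) => //.
  - move=> n; apply: cmeasurableM => //; apply: cmeasurableM => //.
    by apply: cmeasurable_real; exact: measurable_wexpd.
  - move=> x; rewrite [inv_fourier g x * _]mulrC.
    apply: ccvgM; last exact: ccvg_cst.
    rewrite -[X in ccvg _ X]mulr1; apply: ccvgM; first exact: ccvg_cst.
    by apply: ccvg_real; exact: wexpd_cvg.
  - move=> n x; apply: le_trans (bD x).
    move: (inv_fourier g x) (fourier psi x) => a b.
    rewrite !normcM normc_real ger0_norm ?wexpd_ge0// mulrC ler_wpM2l ?normc_ge0//.
    by rewrite ler_piMr ?normc_ge0// wexpd_le1// invr_ge0.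
rewrite (_ : (fun n => _) = (fun n => cintegral mu setT (fun x => g x *
    cintegral mu setT (fun y => psi y * (poisd n.+1%:R^-1 (tsub x y))%:C)))); last first.
  by apply/funext => n; apply: regularized_parseval.
apply: (cintegral_cvg (G := fun x => B * normc (g x))).
- move=> n; apply: cmeasurableM => //.
  apply: (@cmeasurable_cintegral2 _ _ _ Rd Rd mu
    (fun z => psi z.2 * (poisd n.+1%:R^-1 (tsub z.1 z.2))%:C)).
  apply: cmeasurableM; first exact: cmeasurable_comp.
  apply: cmeasurable_real; apply: (measurableT_comp (f := poisd _)).
    exact: measurable_poisd.
  exact: measurable_tsub.
- move=> x; apply: ccvgM; first exact: ccvg_cst.
  exact: poisd_average_cvg.
- move=> n x; rewrite normcM mulrC ler_wpM2r ?normc_ge0//.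
  exact: poisd_average_le.
- exact/integrable_mull/integrable_normc.
Qed.

End fourier.

Local Transparent fourier inv_fourier.

(** * Convolutions and their majorants *)

Section convolution.
Context {R : realType} {d : nat}.
Local Notation Rd := (d.-tuple R).
Local Notation mu := (@leb R d).
Implicit Types (f g : Rd -> R[i]) (F G : Rd -> R).

(** Convolution is normalized so that [inv_fourier] turns it into a product. *)
Definition cconv f g (x : Rd) : R[i] :=
  (@cpi R d)%:C * cintegral mu setT (fun y => f (tsub x y) * g y).
Definition rconv F G (x : Rd) : R :=
  @cpi R d * \int[mu]_y (F (tsub x y) * G y).
Definition crefl f (x : Rd) : R[i] := conjc (f (topp x)).
Definition rrefl F (x : Rd) : R := F (topp x).

Local Notation cpi := (@cpi R d).
Let c0 : 0 < cpi := cpi_gt0.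
Let c1 : cpi <= 1 := cpi_le1.
Let c0' : 0 <= cpi. Proof. exact: ltW. Qed.

(** The norms that control the Picard iteration, recorded together for a
    majorant [F] and a smaller one [F'] in order to be propagated at once
    through convolutions. *)
Record rpair F F' (K B del eps : R) : Prop := RPair {
  rp_meas : measurable_fun setT F;
  rp_meas' : measurable_fun setT F';
  rp_ge0 : forall x, 0 <= F' x;
  rp_le : forall x, F' x <= F x;
  rp_sup : forall x, F x <= B;
  rp_int : mu.-integrable setT (EFin \o F);
  rp_mass : \int[mu]_x F x <= K;
  rp_dsup : forall x, F x - F' x <= del;
  rp_dmass : \int[mu]_x (F x - F' x) <= eps }.

Lemma measurable_rconv F G : measurable_fun setT F -> measurable_fun setT G ->
  measurable_fun setT (rconv F G).
Proof.
move=> mF mG; apply: measurable_funM => //.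
apply: (@measurable_Rintegral2 _ _ _ Rd Rd mu (fun z => F (tsub z.1 z.2) * G z.2)).
apply: measurable_funM; last exact: measurableT_comp.
by apply: measurableT_comp => //; exact: measurable_tsub.
Qed.

Section conv_nonneg.
Variables (F G : Rd -> R) (B : R).
Hypotheses (mF : measurable_fun setT F) (F0 : forall x, 0 <= F x)
  (FB : forall x, F x <= B).
Hypotheses (iG : mu.-integrable setT (EFin \o G)) (G0 : forall x, 0 <= G x).

Let mG : measurable_fun setT G.
Proof. by case/integrableP : iG => /measurable_EFinP. Qed.

Lemma integrable_rconv_sec (x : Rd) :
  mu.-integrable setT (EFin \o (fun y => F (tsub x y) * G y)).
Proof.
apply: (integrable_dom (G := fun y => B * G y)).
- apply: measurable_funM => //; apply: measurableT_comp => //.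
  by apply: measurable_tsub => //; exact: measurable_cst.
- by move=> y; rewrite ger0_norm ?mulr_ge0// ler_wpM2r.
- exact: integrable_mull.
Qed.

Lemma rconv_ge0 (x : Rd) : 0 <= rconv F G x.
Proof. by rewrite mulr_ge0// Rintegral_ge0// => y _; rewrite mulr_ge0. Qed.

Lemma rconv_le_sup (x : Rd) : rconv F G x <= B * \int[mu]_y G y.
Proof.
apply: (@le_trans _ _ (\int[mu]_y (F (tsub x y) * G y))).
  by rewrite ler_piMl// Rintegral_ge0// => y _; rewrite mulr_ge0.
rewrite -RintegralZl//; apply: le_Rintegral => //.
- exact: integrable_rconv_sec.
- exact: integrable_mull.
- by move=> y _; rewrite ler_wpM2r.
Qed.

Lemma rconv_le_sup' (B' : R) (x : Rd) : mu.-integrable setT (EFin \o F) ->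
  (forall y, G y <= B') -> rconv F G x <= B' * \int[mu]_y F y.
Proof.
move=> iF GB; apply: (@le_trans _ _ (\int[mu]_y (F (tsub x y) * G y))).
  by rewrite ler_piMl// Rintegral_ge0// => y _; rewrite mulr_ge0.
rewrite -(Rintegral_tsub x iF) -RintegralZl//; last exact: integrable_tsub.
apply: le_Rintegral => //.
- exact: integrable_rconv_sec.
- by apply: integrable_mull; exact: integrable_tsub.
- by move=> y _; rewrite mulrC ler_wpM2r.
Qed.

Let mF2 : measurable_fun setT (fun z : Rd * Rd => F (tsub z.1 z.2) * G z.2).
Proof.
apply: measurable_funM; last exact: measurableT_comp.
by apply: measurableT_comp => //; exact: measurable_tsub.
Qed.

Lemma integral_rconv : mu.-integrable setT (EFin \o F) ->
  mu.-integrable setT (EFin \o (fun x => \int[mu]_y (F (tsub x y) * G y))) /\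
  \int[mu]_x (\int[mu]_y (F (tsub x y) * G y)) =
     (\int[mu]_x F x) * (\int[mu]_y G y).
Proof.
move=> iF.
have E : (\int[mu]_x (\int[mu]_y (F (tsub x y) * G y))%:E =
   ((\int[mu]_x F x) * (\int[mu]_y G y))%:E)%E.
  transitivity (\int[mu]_x \int[mu]_y (F (tsub x y) * G y)%:E)%E.
    by apply: eq_integral => x _; rewrite (EFin_Rintegral (integrable_rconv_sec x)).
  rewrite (fubini_tonelli (fun z => (F (tsub z.1 z.2) * G z.2)%:E))//=; last 2 first.
    by apply/measurable_EFinP; exact: mF2.
    by move=> z; rewrite lee_fin mulr_ge0.
  rewrite EFinM -[RHS]/(_ * _)%E EFin_Rintegral// EFin_Rintegral//.
  transitivity (\int[mu]_y ((\int[mu]_x (F x)%:E) * (G y)%:E))%E.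
    apply: eq_integral => y _; rewrite muleC -(ge0_integral_tadd (topp y)); last 2 first.
      exact/measurable_EFinP.
      by move=> x; rewrite lee_fin.
    rewrite -ge0_integralZl//; last 3 first.
      apply/measurable_EFinP; apply: measurableT_comp => //.
      by apply: measurable_tadd => //; exact: measurable_cst.
      by move=> x _; rewrite lee_fin.
      by rewrite lee_fin.
    apply: eq_integral => x _; rewrite -EFinM mulrC; congr (_ * F _)%:E.
    by apply: eq_from_tnth => j; rewrite !tnthE.
  rewrite ge0_integralZl//.
  - exact/measurable_EFinP.
  - by move=> y _; rewrite lee_fin.
  - by apply: integral_ge0 => x _; rewrite lee_fin.
split.
  apply: ge0_integrableP.
  - exact: (@measurable_Rintegral2 _ _ _ Rd Rd mu (fun z => F (tsub z.1 z.2) * G z.2)).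
  - by move=> x; apply: Rintegral_ge0 => y _; rewrite mulr_ge0.
  - by rewrite E ltry.
by apply: EFin_inj; rewrite -E EFin_Rintegral//; apply: ge0_integrableP;
  [exact: (@measurable_Rintegral2 _ _ _ Rd Rd mu (fun z => F (tsub z.1 z.2) * G z.2))|
   by move=> x; apply: Rintegral_ge0 => y _; rewrite mulr_ge0|rewrite E ltry].
Qed.

Lemma integrable_rconv : mu.-integrable setT (EFin \o F) ->
  mu.-integrable setT (EFin \o rconv F G).
Proof. by move=> iF; have [i _] := integral_rconv iF; exact: integrable_mull. Qed.

Lemma Rintegral_rconv_le : mu.-integrable setT (EFin \o F) ->
  \int[mu]_x rconv F G x <= (\int[mu]_x F x) * (\int[mu]_y G y).
Proof.
move=> iF; have [i <-] := integral_rconv iF.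
rewrite RintegralZl// ler_piMl// Rintegral_ge0// => x _.
by apply: Rintegral_ge0 => y _; rewrite mulr_ge0.
Qed.

End conv_nonneg.

Lemma rpair_int' F F' K B del eps : rpair F F' K B del eps ->
  mu.-integrable setT (EFin \o F').
Proof.
move=> p; apply: (integrable_dom (rp_meas' p) _ (rp_int p)) => x.
by rewrite ger0_norm ?(rp_ge0 p)// (rp_le p).
Qed.

Lemma rpair_ge0 F F' K B del eps : rpair F F' K B del eps -> forall x, 0 <= F x.
Proof. by move=> p x; exact: le_trans (rp_ge0 p x) (rp_le p x). Qed.

Lemma rpair_intB F F' K B del eps : rpair F F' K B del eps ->
  mu.-integrable setT (EFin \o (fun x => F x - F' x)).
Proof.
move=> p; apply: (integrable_dom _ _ (rp_int p)).
  by apply: measurable_funB; [exact: rp_meas p|exact: rp_meas' p].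
move=> x; rewrite ger0_norm ?subr_ge0 ?(rp_le p)//.
by rewrite lerBlDr lerDl (rp_ge0 p).
Qed.

(** The difference of two products splits as [(F - F') G + F' (G - G')], a sum
    of nonnegative terms. *)
Lemma rconv_telescope F F' G G' K1 B1 d1 e1 K2 B2 d2 e2 (x : Rd) :
  rpair F F' K1 B1 d1 e1 -> rpair G G' K2 B2 d2 e2 ->
  rconv F G x - rconv F' G' x =
  rconv (fun y => F y - F' y) G x + rconv F' (fun y => G y - G' y) x.
Proof.
move=> p q.
have FB' y : F' y <= B1 by exact: le_trans (rp_le p y) (rp_sup p y).
have dB y : F y - F' y <= B1.
  by rewrite lerBlDr (le_trans (rp_sup p y))// lerDl (rp_ge0 p).
have dF0 y : 0 <= F y - F' y by rewrite subr_ge0 (rp_le p).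
have dG0 y : 0 <= G y - G' y by rewrite subr_ge0 (rp_le q).
have mD : measurable_fun setT (fun y => F y - F' y).
  by apply: measurable_funB; [exact: rp_meas p|exact: rp_meas' p].
have i1 := integrable_rconv_sec (rp_meas p) (rpair_ge0 p) (rp_sup p) (rp_int q) (rpair_ge0 q) x.
have i2 := integrable_rconv_sec (rp_meas' p) (rp_ge0 p) FB' (rpair_int' q) (rp_ge0 q) x.
have i3 := integrable_rconv_sec mD dF0 dB (rp_int q) (rpair_ge0 q) x.
have i4 := integrable_rconv_sec (rp_meas' p) (rp_ge0 p) FB' (rpair_intB q) dG0 x.
rewrite /rconv -mulrBr -mulrDr -RintegralB// -RintegralD//; congr (_ * _).
by apply: eq_Rintegral => y _; ring.
Qed.

Lemma rpair_conv F F' G G' K1 B1 d1 e1 K2 B2 d2 e2 :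
  rpair F F' K1 B1 d1 e1 -> rpair G G' K2 B2 d2 e2 ->
  rpair (rconv F G) (rconv F' G') (K1 * K2) (B1 * K2)
    (d1 * K2 + d2 * K1) (e1 * K2 + e2 * K1).
Proof.
move=> p q.
have FB' y : F' y <= B1 by exact: le_trans (rp_le p y) (rp_sup p y).
have dF0 y : 0 <= F y - F' y by rewrite subr_ge0 (rp_le p).
have dG0 y : 0 <= G y - G' y by rewrite subr_ge0 (rp_le q).
have mD : measurable_fun setT (fun y => F y - F' y).
  by apply: measurable_funB; [exact: rp_meas p|exact: rp_meas' p].
have mD2 : measurable_fun setT (fun y => G y - G' y).
  by apply: measurable_funB; [exact: rp_meas q|exact: rp_meas' q].
have I0 : 0 <= \int[mu]_x F x by apply: Rintegral_ge0 => x _; exact: rpair_ge0 p _.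
have J0 : 0 <= \int[mu]_x G x by apply: Rintegral_ge0 => x _; exact: rpair_ge0 q _.
have I0' : \int[mu]_x F' x <= K1.
  apply: le_trans (rp_mass p); apply: le_Rint (rp_int p) (rp_le p).
    exact: rp_meas' p.
  exact: rp_ge0 p.
have B10 : 0 <= B1 by apply: le_trans (rp_sup p (tcst 0)); exact: rpair_ge0 p _.
have d10 : 0 <= d1 by apply: le_trans (rp_dsup p (tcst 0)); exact: dF0.
have d20 : 0 <= d2 by apply: le_trans (rp_dsup q (tcst 0)); exact: dG0.
have K10 : 0 <= K1 := le_trans I0 (rp_mass p).
have e10 : 0 <= e1 by apply: le_trans (rp_dmass p); apply: Rintegral_ge0 => x _.
have e20 : 0 <= e2 by apply: le_trans (rp_dmass q); apply: Rintegral_ge0 => x _.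
have dd y : F y - F' y <= d1 by exact: rp_dsup p y.
split.
- by apply: measurable_rconv; [exact: rp_meas p|exact: rp_meas q].
- by apply: measurable_rconv; [exact: rp_meas' p|exact: rp_meas' q].
- by move=> x; apply: rconv_ge0; [exact: rp_ge0 p|exact: rp_ge0 q].
- move=> x; rewrite -subr_ge0 (rconv_telescope x p q) addr_ge0//; apply: rconv_ge0 => //.
    exact: rpair_ge0 q.
  exact: rp_ge0 p.
- move=> x; apply: (le_trans (rconv_le_sup (rp_meas p) (rpair_ge0 p) (rp_sup p) (rp_int q) (rpair_ge0 q) x)).
  by rewrite ler_wpM2l// (rp_mass q).
- by apply: integrable_rconv => //; [exact: rp_meas p|exact: rpair_ge0 p|exact: rp_sup p|
    exact: rp_int q|exact: rpair_ge0 q|exact: rp_int p].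
- apply: (le_trans (Rintegral_rconv_le (rp_meas p) (rpair_ge0 p) (rp_sup p) (rp_int q) (rpair_ge0 q) (rp_int p))).
  by apply: ler_pM => //; [exact: rp_mass p|exact: rp_mass q].
- move=> x; rewrite (rconv_telescope x p q); apply: lerD.
    apply: (le_trans (rconv_le_sup mD dF0 dd (rp_int q) (rpair_ge0 q) x)).
    by rewrite ler_wpM2l// (rp_mass q).
  apply: (le_trans (rconv_le_sup' (rp_meas' p) (rp_ge0 p) FB' (rpair_intB q) dG0 x (rpair_int' p) (rp_dsup q))).
  by rewrite ler_wpM2l.
- under eq_Rintegral do rewrite (rconv_telescope _ p q).
  rewrite RintegralD//; first last.
  + exact: (integrable_rconv (rp_meas' p) (rp_ge0 p) FB' (rpair_intB q) dG0 (rpair_int' p)).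
  + exact: (integrable_rconv mD dF0 dd (rp_int q) (rpair_ge0 q) (rpair_intB p)).
  apply: lerD.
    apply: (le_trans (Rintegral_rconv_le mD dF0 dd (rp_int q) (rpair_ge0 q) (rpair_intB p))).
    by apply: ler_pM => //; [exact: Rintegral_ge0|exact: rp_dmass p|exact: rp_mass q].
  apply: (le_trans (Rintegral_rconv_le (rp_meas' p) (rp_ge0 p) FB' (rpair_intB q) dG0 (rpair_int' p))).
  rewrite mulrC; apply: ler_pM => //; [exact: Rintegral_ge0| |exact: rp_dmass q].
  by apply: Rintegral_ge0 => x _; exact: (rp_ge0 p x).
Qed.

Lemma rpair_refl F F' K B del eps : rpair F F' K B del eps ->
  rpair (rrefl F) (rrefl F') K B del eps.
Proof.
have mt : measurable_fun setT (@topp R d) by exact: measurable_topp.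
have tr (u : Rd -> \bar R) : measurable_fun setT u -> (forall x, 0 <= u x)%E ->
    (\int[mu]_x u (topp x) = 1%:E * \int[mu]_x u x)%E.
  by move=> mu0 u0; rewrite mul1e ge0_integral_topp.
move=> p; split.
- by apply: measurableT_comp mt; exact: rp_meas p.
- by apply: measurableT_comp mt; exact: rp_meas' p.
- by move=> x; exact: rp_ge0 p _.
- by move=> x; exact: rp_le p _.
- by move=> x; exact: rp_sup p _.
- exact: (transfer_integrable mt _ tr (rp_int p)).
- by rewrite (transfer_Rintegral mt _ tr (rp_int p))// mul1r (rp_mass p).
- by move=> x; exact: rp_dsup p _.
- rewrite (transfer_Rintegral mt _ tr (f := fun x => F x - F' x))//.
    by rewrite mul1r (rp_dmass p).
  exact: rpair_intB p.
Qed.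

(** [|v| ^ 4 * v] is [(v * conj v) * (v * conj v) * v]; on the Fourier side
    conjugation is the reflection [crefl]. *)
Definition cquint f : Rd -> R[i] :=
  cconv (cconv (cconv f (crefl f)) (cconv f (crefl f))) f.
Definition rquint F : Rd -> R :=
  rconv (rconv (rconv F (rrefl F)) (rconv F (rrefl F))) F.

Lemma rpair_quint F F' K B del eps : rpair F F' K B del eps ->
  rpair (rquint F) (rquint F') (K ^+ 5) (K ^+ 4 * B)
    (5 * K ^+ 4 * del) (5 * K ^+ 4 * eps).
Proof.
move=> p; have q := rpair_conv p (rpair_refl p); have qq := rpair_conv q q.
have n := rpair_conv qq p.
have -> : K ^+ 5 = (K * K * (K * K) * K) by ring.
have -> : K ^+ 4 * B = (B * K * (K * K) * K) by ring.
have -> : 5 * K ^+ 4 * del = (((del * K + del * K) * (K * K) + (del * K + del * K) * (K * K)) * K + del * (K * K * (K * K))) by ring.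
have -> : 5 * K ^+ 4 * eps = (((eps * K + eps * K) * (K * K) + (eps * K + eps * K) * (K * K)) * K + eps * (K * K * (K * K))) by ring.
exact: n.
Qed.

(** Multilinear expressions preserve this relation, since [F G - F' G'] expands
    into the nonnegative terms [(F - F') G] and [F' (G - G')]. *)
Definition cdom f f' F F' : Prop :=
  [/\ cmeasurable f, cmeasurable f', forall x, normc (f' x) <= F' x &
      forall x, normc (f x - f' x) <= F x - F' x].

Lemma cdom_le f f' F F' : cdom f f' F F' -> forall x, normc (f x) <= F x.
Proof.
move=> [_ _ h h'] x.
rewrite (_ : f x = (f x - f' x) + f' x); last by rewrite subrK.
by apply: le_trans (normcD _ _) _; have := h x; have := h' x; lra.
Qed.

Lemma cmeasurable_cconv_param (d1 : measure_display) (T : measurableType d1)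
  (f g : T -> Rd -> R[i]) :
  cmeasurable (fun z : T * Rd => f z.1 z.2) ->
  cmeasurable (fun z : T * Rd => g z.1 z.2) ->
  cmeasurable (fun z : T * Rd => cconv (f z.1) (g z.1) z.2).
Proof.
move=> mf mg; apply: cmeasurableM; first exact: cmeasurable_cst.
apply: (@cmeasurable_cintegral2 _ _ _ (T * Rd)%type Rd mu
  (fun z => f z.1.1 (tsub z.1.2 z.2) * g z.1.1 z.2)).
apply: cmeasurableM.
  apply: (cmeasurable_comp (h := fun z : (T * Rd) * Rd => (z.1.1, tsub z.1.2 z.2)) mf).
  apply: measurable_fun_pair; first exact: measurableT_comp.
  by apply: measurable_tsub => //; exact: measurableT_comp.
apply: (cmeasurable_comp (h := fun z : (T * Rd) * Rd => (z.1.1, z.2)) mg).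
by apply: measurable_fun_pair => //; exact: measurableT_comp.
Qed.

Lemma cmeasurable_crefl_param (d1 : measure_display) (T : measurableType d1)
  (f : T -> Rd -> R[i]) :
  cmeasurable (fun z : T * Rd => f z.1 z.2) ->
  cmeasurable (fun z : T * Rd => crefl (f z.1) z.2).
Proof.
move=> mf; apply: cmeasurable_conj.
apply: (cmeasurable_comp (h := fun z : T * Rd => (z.1, topp z.2)) mf).
by apply: measurable_fun_pair => //; exact: measurable_topp.
Qed.

Lemma cmeasurable_cquint_param (d1 : measure_display) (T : measurableType d1)
  (f : T -> Rd -> R[i]) :
  cmeasurable (fun z : T * Rd => f z.1 z.2) ->
  cmeasurable (fun z : T * Rd => cquint (f z.1) z.2).
Proof.
move=> mf; have mr := cmeasurable_crefl_param mf.
pose q t := cconv (f t) (crefl (f t)).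
have mq : cmeasurable (fun z : T * Rd => q z.1 z.2).
  exact: (@cmeasurable_cconv_param _ _ f (fun t => crefl (f t)) mf mr).
apply: (@cmeasurable_cconv_param _ _ (fun t => cconv (q t) (q t)) f) => //.
exact: (@cmeasurable_cconv_param _ _ q q).
Qed.

Let cst_param f : cmeasurable f -> cmeasurable (fun z : Rd * Rd => f z.2).
Proof. by move=> mf; exact: cmeasurable_comp. Qed.

Let diag_meas : measurable_fun setT (fun x : Rd => (x, x)).
Proof. exact: measurable_fun_pair. Qed.

Lemma cmeasurable_cconv f g : cmeasurable f -> cmeasurable g ->
  cmeasurable (cconv f g).
Proof.
move=> mf mg; exact: (cmeasurable_comp (@cmeasurable_cconv_param _ Rd (fun=> f)
  (fun=> g) (cst_param mf) (cst_param mg)) diag_meas).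
Qed.

Lemma cmeasurable_crefl f : cmeasurable f -> cmeasurable (crefl f).
Proof.
move=> mf; exact: (cmeasurable_comp (@cmeasurable_crefl_param _ Rd (fun=> f)
  (cst_param mf)) diag_meas).
Qed.

Lemma cdom_refl f f' F F' : cdom f f' F F' ->
  cdom (crefl f) (crefl f') (rrefl F) (rrefl F').
Proof.
move=> [m m' h h']; split; [exact: cmeasurable_crefl|exact: cmeasurable_crefl| |].
  by move=> x; rewrite /crefl normc_conj.
move=> x; rewrite /crefl; apply: le_trans (h' (topp x)).
have -> : conjc (f (topp x)) - conjc (f' (topp x)) = conjc (f (topp x) - f' (topp x)).
  by rewrite rmorphB.
by rewrite normc_conj.
Qed.

Lemma cintegrable_cconv_sec f g (B : R) (x : Rd) : cmeasurable f ->
  (forall y, normc (f y) <= B) -> cintegrable mu g ->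
  cintegrable mu (fun y => f (tsub x y) * g y).
Proof.
move=> mf fB cg; apply: (cintegrableMb (B := B)) => //.
by apply: (cmeasurable_comp mf); apply: measurable_tsub => //; exact: measurable_cst.
Qed.

Lemma cdom_conv f f' g g' F F' G G' K1 B1 d1 e1 K2 B2 d2 e2 :
  rpair F F' K1 B1 d1 e1 -> rpair G G' K2 B2 d2 e2 ->
  cdom f f' F F' -> cdom g g' G G' ->
  cdom (cconv f g) (cconv f' g') (rconv F G) (rconv F' G').
Proof.
move=> p q cf cg; have [mf mf' lf' df] := cf; have [mg mg' lg' dg] := cg.
have lf := cdom_le cf; have lg := cdom_le cg.
have FB' y : F' y <= B1 by exact: le_trans (rp_le p y) (rp_sup p y).
have i1 x := integrable_rconv_sec (rp_meas p) (rpair_ge0 p) (rp_sup p) (rp_int q) (rpair_ge0 q) x.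
have i2 x := integrable_rconv_sec (rp_meas' p) (rp_ge0 p) FB' (rpair_int' q) (rp_ge0 q) x.
have cig : cintegrable mu g by apply: (cintegrable_dom mg lg (rp_int q)).
have cig' : cintegrable mu g' by apply: (cintegrable_dom mg' lg' (rpair_int' q)).
have j1 x : cintegrable mu (fun y => f (tsub x y) * g y).
  by apply: (cintegrable_cconv_sec (B := B1)) => // y; exact: le_trans (lf y) (rp_sup p y).
have j2 x : cintegrable mu (fun y => f' (tsub x y) * g' y).
  by apply: (cintegrable_cconv_sec (B := B1)) => // y; exact: le_trans (lf' y) (FB' y).
split; [exact: cmeasurable_cconv|exact: cmeasurable_cconv| |].
  move=> x; rewrite /cconv normcM normc_real ger0_norm// /rconv ler_wpM2l//.
  apply: normc_cintegral_le => // y; rewrite normcM.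
  by apply: ler_pM; rewrite ?normc_ge0.
move=> x; rewrite /cconv /rconv -!mulrBr normcM normc_real ger0_norm// ler_wpM2l//.
rewrite -cintegralB// -RintegralB//; apply: normc_cintegral_le.
- exact: cintegrableB.
- exact: (integrableB measurableT (i1 x) (i2 x)).
- move=> y.
  have -> : f (tsub x y) * g y - f' (tsub x y) * g' y =
      (f (tsub x y) - f' (tsub x y)) * g y + f' (tsub x y) * (g y - g' y) by ring.
  have -> : F (tsub x y) * G y - F' (tsub x y) * G' y =
      (F (tsub x y) - F' (tsub x y)) * G y + F' (tsub x y) * (G y - G' y) by ring.
  apply: le_trans (normcD _ _) _; rewrite !normcM.
  by apply: lerD; apply: ler_pM; rewrite ?normc_ge0.
Qed.

Lemma cdom_quint f f' F F' K B del eps : rpair F F' K B del eps ->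
  cdom f f' F F' -> cdom (cquint f) (cquint f') (rquint F) (rquint F').
Proof.
move=> p c; have q := rpair_conv p (rpair_refl p).
have cq := cdom_conv p (rpair_refl p) c (cdom_refl c).
exact: cdom_conv (rpair_conv q q) p (cdom_conv q q cq cq) c.
Qed.

(** Fubini, after splitting the phase [dot x xi] as [dot x (xi - y) + dot x y].
    *)
Lemma inv_fourier_cconv f g (x : Rd) : good f -> good g ->
  inv_fourier (cconv f g) x = inv_fourier f x * inv_fourier g x.
Proof.
move=> [cf [B fB]] [cg _].
have mf := cintegrable_cmeasurable cf; have mg := cintegrable_cmeasurable cg.
have nf := integrable_normc cf; have ng := integrable_normc cg.
have mnf := measurable_normc mf; have mng := measurable_normc mg.
have sec y : cintegrable mu (fun z => f (tsub y z) * g z).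
  exact: (cintegrable_cconv_sec (B := B)).
rewrite /inv_fourier mulrACA -mulrA; congr (_ * _).
transitivity (cpi%:C * cintegral mu setT (fun xi => cintegral mu setT
    (fun y => expi (dot x xi) * (f (tsub xi y) * g y)))).
  rewrite -cintegralZ.
    apply: eq_cintegral => xi; rewrite /cconv mulrCA; congr (_ * _).
    by rewrite -cintegralZ.
  have [ii _] := integral_rconv mnf (fun y => normc_ge0 _) fB ng (fun y => normc_ge0 _) nf.
  apply: (cintegrable_dom _ _ ii).
    apply: (@cmeasurable_cintegral2 _ _ _ Rd Rd mu
      (fun z => expi (dot x z.1) * (f (tsub z.1 z.2) * g z.2))).
    apply: cmeasurableM.
      by apply: cmeasurable_expi; apply: measurable_dot => //; exact: measurable_cst.
    apply: cmeasurableM; last exact: cmeasurable_comp.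
    by apply: (cmeasurable_comp mf); exact: measurable_tsub.
  move=> xi; apply: normc_cintegral_le.
  - apply: (cintegrableMb (B := 1) _ _ (sec xi)); first exact: cmeasurable_cst.
    by move=> y; rewrite normc_expi.
  - exact: (integrable_rconv_sec mnf (fun y => normc_ge0 _) fB ng (fun y => normc_ge0 _)).
  - by move=> y; rewrite normc_expiM normcM.
congr (_ * _).
rewrite (cintegral_swap (m1 := mu) (m2 := mu)
  (f := fun z => expi (dot x z.1) * (f (tsub z.1 z.2) * g z.2))
  (G := fun z => normc (f (tsub z.1 z.2)) * normc (g z.2))).
- rewrite -cintegralZ; last exact: cintegrable_phase.
  apply: eq_cintegral => y /=.
  rewrite mulrC -[X in _ = _ * X](cintegral_tadd (topp y)); last exact: cintegrable_phase.
  rewrite -cintegralZ; last exact: (cintegrable_tadd _ (cintegrable_phase x cf)).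
  apply: eq_cintegral => z.
  have -> : tadd z (topp y) = tsub z y by apply: eq_from_tnth => j; rewrite !tnthE.
  rewrite -[in LHS](tsubK z y) dotDr expiD tsubK; ring.
- apply: cmeasurableM.
    by apply: cmeasurable_expi; apply: measurable_dot => //; exact: measurable_cst.
  apply: cmeasurableM; last exact: cmeasurable_comp.
  by apply: (cmeasurable_comp mf); exact: measurable_tsub.
- apply: measurable_funM; last exact: (measurableT_comp mng).
  by apply: (measurableT_comp mnf); exact: measurable_tsub.
- by move=> z; rewrite normc_expiM normcM.
- move=> xi; exact: (integrable_rconv_sec mnf (fun y => normc_ge0 _) fB ng (fun y => normc_ge0 _)).
- move=> y /=; rewrite (_ : (fun _ => _) = EFin \o (fun z => normc (g y) * normc (f (tadd z (topp y))))).
    apply: (integrable_mull (F := fun z => normc (f (tadd z (topp y))))).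
    exact: (integrable_tadd _ nf).
  apply/funext => z /=; rewrite mulrC; congr (_ * normc (f _))%:E.
  by apply: eq_from_tnth => j; rewrite !tnthE.
- by have [] := integral_rconv mnf (fun y => normc_ge0 _) fB ng (fun y => normc_ge0 _) nf.
Qed.

Lemma inv_fourier_crefl f (x : Rd) : cintegrable mu f ->
  inv_fourier (crefl f) x = conjc (inv_fourier f x).
Proof.
move=> cf; rewrite /inv_fourier conjcM.
have -> : conjc (cpi%:C) = cpi%:C by simpc.
congr (_ * _); rewrite -cintegral_conj; last exact: cintegrable_phase.
rewrite -cintegral_topp.
  apply: eq_cintegral => y; rewrite /crefl toppK dotNr conjcM.
  by rewrite expiN.
have cr : cintegrable mu (crefl f).
  have ct := cintegrable_topp cf.
  apply: (cintegrable_dom _ _ (integrable_normc ct)).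
    by apply: cmeasurable_conj; exact: cintegrable_cmeasurable ct.
  by move=> y; rewrite /crefl normc_conj.
exact: cintegrable_phase.
Qed.

Lemma rpair_diag F K B : measurable_fun setT F -> (forall x, 0 <= F x) ->
  (forall x, F x <= B) -> mu.-integrable setT (EFin \o F) -> \int[mu]_x F x <= K ->
  rpair F F K B 0 0.
Proof.
move=> mF F0 FB iF FK; split => //; first by move=> x; rewrite subrr.
under eq_Rintegral do rewrite subrr.
by rewrite Rintegral_cst// mul0r.
Qed.

Lemma cdom_diag f F : cmeasurable f -> (forall x, normc (f x) <= F x) -> cdom f f F F.
Proof.
move=> mf fF; split => // x; rewrite !subrr.
by rewrite (_ : 0 = (0 : R)%:C)// normc_real normr0.
Qed.

Lemma rpair_good f F F' K B del eps : rpair F F' K B del eps -> cmeasurable f ->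
  (forall x, normc (f x) <= F x) -> good f.
Proof.
move=> p mf fF; split; first exact: (cintegrable_dom mf fF (rp_int p)).
by exists B => x; exact: le_trans (fF x) (rp_sup p x).
Qed.

Lemma quintic_inv_fourier f : good f ->
  quintic (inv_fourier f) = inv_fourier (cquint f).
Proof.
move=> gf; have [cf [B fB]] := gf.
have mf := cintegrable_cmeasurable cf.
have p := rpair_diag (measurable_normc mf) (fun y => normc_ge0 _) fB (integrable_normc cf) (lexx _).
have c := cdom_diag mf (fun x => lexx (normc (f x))).
have p1 := rpair_refl p; have c1' := cdom_refl c.
have p2 := rpair_conv p p1; have c2 := cdom_conv p p1 c c1'.
have p3 := rpair_conv p2 p2; have c3 := cdom_conv p2 p2 c2 c2.
have g1 : good (crefl f) by case: (c1') => m _ _ _; exact: rpair_good p1 m (cdom_le c1').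
have g2 : good (cconv f (crefl f)) by case: (c2) => m _ _ _; exact: rpair_good p2 m (cdom_le c2).
have g3 : good (cconv (cconv f (crefl f)) (cconv f (crefl f))).
  by case: (c3) => m _ _ _; exact: rpair_good p3 m (cdom_le c3).
apply/funext => x; rewrite /quintic /cquint.
rewrite (inv_fourier_cconv x g3 gf) (inv_fourier_cconv x g2 g2).
rewrite (inv_fourier_cconv x gf g1) (inv_fourier_crefl x cf) mulc_conj.
by congr (_ * _); rewrite -rmorphM -exprD.
Qed.

End convolution.

(** * Picard iterates of the Duhamel formula *)

Section picard.
Context {R : realType} {d : nat}.
Local Notation Rd := (d.-tuple R).
Local Notation mu := (@leb R d).
Local Notation lam := (@lebesgue_measure R).
Local Notation time := (measurableTypeR R).
Implicit Types (f : Rd -> R[i]) (F G : Rd -> R).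

Lemma alg_sub2 (z w a a' u u' : R[i]) :
  z * a + w * u - (z * a' + w * u') = z * (a - a') + w * (u - u').
Proof. by ring. Qed.

Definition quart (x : Rd) : R := dot x x ^+ 2.

Lemma measurable_quart : measurable_fun setT quart.
Proof. by apply: measurable_funX; exact: measurable_dot. Qed.

(** The cut-off extends the Duhamel integral over [[0, t]] to all real times, in
    such a way that it is bounded by [T] times the supremum of the integrand. *)
Definition cut (T t tau : R) : R := ((0 <= tau <= T) && (tau <= t))%:R.

Lemma cut_ge0 T t tau : 0 <= cut T t tau.
Proof. by rewrite /cut ler0n. Qed.

Lemma measurable_cut T : measurable_fun setT (fun z : time * time => cut T z.1 z.2).
Proof.
apply: (measurableT_comp (f := fun b : bool => b%:R : R)) => //.
apply: measurable_and; first apply: measurable_and.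
- by apply: measurable_fun_ler => //; exact: measurable_cst.
- by apply: measurable_fun_ler => //; exact: measurable_cst.
- exact: measurable_fun_ler.
Qed.

Lemma cut_le T t tau : cut T t tau <= \1_(`[0, T]%classic) tau.
Proof.
rewrite /cut indicE mem_setE in_itv/=.
by case: (0 <= tau <= T) => //=; case: (tau <= t) => //=; rewrite ler01.
Qed.

Lemma integral_itv T : (\int[lam]_x (\1_(`[0%R, T]%classic) x)%:E =
  (if (0 < T)%R then T%:E else 0))%E.
Proof.
have E : (lam (`[0%R, T]%classic `&` setT) = if (0 < T)%R then T%:E else 0)%E.
  by rewrite setIT lebesgue_measure_itv/= lte_fin; case: ifP; rewrite // sube0.
rewrite -E; apply: integral_indic => //; exact: measurable_itv.
Qed.

Lemma integrable_itv T : lam.-integrable setT (EFin \o (\1_(`[0, T]%classic) : R -> R)).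
Proof.
apply: ge0_integrableP; first exact: measurable_indic.
  by move=> x; rewrite indicE.
by rewrite integral_itv; case: ifP => _; rewrite ltry.
Qed.

Lemma integrable_cut T t : lam.-integrable setT (EFin \o cut T t).
Proof.
apply: (integrable_dom _ _ (integrable_itv T)).
  exact: (measurableT_comp (measurable_cut T) (@measurable_pair1 _ _ time time t)).
by move=> tau; rewrite ger0_norm ?cut_ge0// cut_le.
Qed.

Lemma Rintegral_cut_le T t : 0 <= T -> \int[lam]_tau cut T t tau <= T.
Proof.
move=> T0; apply: (@le_trans _ _ (\int[lam]_tau (\1_(`[0, T]%classic) tau))).
  apply: le_Rintegral => //; [exact: integrable_cut|exact: integrable_itv|].
  by move=> tau _; exact: cut_le.
rewrite -lee_fin EFin_Rintegral; last exact: integrable_itv.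
by rewrite integral_itv; case: ifP => _; rewrite lee_fin.
Qed.

Lemma cintegrable_cut T t (g : R -> R[i]) (B : R) : cmeasurable (g : time -> R[i]) ->
  (forall tau, normc (g tau) <= B) -> cintegrable lam (fun tau => (cut T t tau)%:C * g tau).
Proof.
move=> mg gB; apply: (@cintegrable_dom R _ time lam _ (fun tau => B * cut T t tau)).
- apply: cmeasurableM => //; apply: cmeasurable_real.
  exact: (measurableT_comp (measurable_cut T) (@measurable_pair1 _ _ time time t)).
- by move=> tau; rewrite normcM normc_real ger0_norm ?cut_ge0// mulrC ler_wpM2r ?cut_ge0.
- exact/integrable_mull/integrable_cut.
Qed.

Lemma normc_cut_le T t (g : R -> R[i]) (B : R) : 0 <= T -> cmeasurable (g : time -> R[i]) ->
  (forall tau, normc (g tau) <= B) ->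
  normc (cintegral lam setT (fun tau => (cut T t tau)%:C * g tau)) <= T * B.
Proof.
move=> T0 mg gB.
have B0 : 0 <= B by apply: le_trans (gB 0); exact: normc_ge0.
apply: (@le_trans _ _ (\int[lam]_tau (B * cut T t tau))).
  apply: normc_cintegral_le; first exact: (@cintegrable_cut _ _ _ B).
    exact/integrable_mull/integrable_cut.
  by move=> tau; rewrite normcM normc_real ger0_norm ?cut_ge0// mulrC ler_wpM2r ?cut_ge0.
rewrite RintegralZl//; last exact: integrable_cut.
by rewrite mulrC ler_wpM2r// Rintegral_cut_le.
Qed.

Section iteration.
Variables (m T : R).
Hypothesis m1 : `|m| = 1.
Hypothesis T0 : 0 <= T.

Definition phase (t : R) (x : Rd) : R[i] := expi (t * quart x).

Definition duh (g : R -> Rd -> R[i]) (t : R) (x : Rd) : R[i] :=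
  cintegral lam setT (fun tau => (cut T t tau)%:C * (phase (t - tau) x * g tau x)).

Definition jmeas (g : R -> Rd -> R[i]) : Prop :=
  cmeasurable (fun z : time * Rd => g z.1 z.2).

(** The Duhamel formula on the Fourier side, and below it the map [Psi] that it
    induces on majorants. *)
Definition Phi f (h : R -> Rd -> R[i]) (t : R) (x : Rd) : R[i] :=
  phase t x * f x + (0 +i* m) * duh (fun tau => cquint (h tau)) t x.

Definition Psi b (M : Rd -> R) (x : Rd) : R := b x + T * rquint M x.

Lemma normc_im : normc (0 +i* m) = 1.
Proof. by rewrite /= expr0n/= add0r sqrtr_sqr m1. Qed.

Lemma jmeas_phase : jmeas (fun t x => phase t x).
Proof.
apply: cmeasurable_expi; apply: measurable_funM => //.
exact: (measurableT_comp measurable_quart).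
Qed.

Lemma jmeas_cst f : cmeasurable f -> jmeas (fun=> f).
Proof. by move=> mf; exact: cmeasurable_comp. Qed.

Lemma jmeas_sec (g : R -> Rd -> R[i]) t : jmeas g -> cmeasurable (g t).
Proof. by move=> mg; exact: (cmeasurable_comp mg (@measurable_pair1 _ _ time Rd t)). Qed.

Lemma jmeas_quint (h : R -> Rd -> R[i]) : jmeas h -> jmeas (fun tau => cquint (h tau)).
Proof. by move=> mh; exact: (@cmeasurable_cquint_param R d _ time h mh). Qed.

Lemma jmeas_duh (g : R -> Rd -> R[i]) : jmeas g -> jmeas (duh g).
Proof.
move=> mg; apply: (@cmeasurable_cintegral2 _ _ _ (time * Rd)%type time lam
  (fun z => (cut T z.1.1 z.2)%:C * (phase (z.1.1 - z.2) z.1.2 * g z.2 z.1.2))).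
have p1 : measurable_fun setT (fun z : (time * Rd) * time => z.1.1 : time) by exact: measurableT_comp.
have p2 : measurable_fun setT (fun z : (time * Rd) * time => z.1.2) by exact: measurableT_comp.
have p3 : measurable_fun setT (fun z : (time * Rd) * time => z.2 : time) by exact: measurable_snd.
apply: cmeasurableM.
  apply: cmeasurable_real; apply: (measurableT_comp (measurable_cut T)
    (g := fun z : (time * Rd) * time => (z.1.1, z.2))).
  exact: measurable_fun_pair.
apply: cmeasurableM.
  apply: cmeasurable_expi; apply: measurable_funM; first exact: measurable_funB.
  exact: (measurableT_comp measurable_quart).
by apply: (cmeasurable_comp mg (h := fun z : (time * Rd) * time => (z.2, z.1.2)));
  exact: measurable_fun_pair.
Qed.

Lemma jmeas_Phi f h : cmeasurable f -> jmeas h -> jmeas (Phi f h).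
Proof.
move=> mf mh; apply: cmeasurableD.
  by apply: cmeasurableM; [exact: jmeas_phase|exact: cmeasurable_comp].
apply: cmeasurableM; first exact: cmeasurable_cst.
exact: jmeas_duh (jmeas_quint mh).
Qed.

Lemma cmeasurable_duh_arg (g : R -> Rd -> R[i]) t x : jmeas g ->
  cmeasurable ((fun tau => phase (t - tau) x * g tau x) : time -> R[i]).
Proof.
move=> mg; apply: cmeasurableM.
  by apply: cmeasurable_expi; apply: measurable_funM => //; exact: measurable_funB.
exact: (cmeasurable_comp mg (@measurable_pair2 _ _ time Rd x)).
Qed.

Lemma normc_duh_le (g : R -> Rd -> R[i]) t x (c : R) : jmeas g -> (forall tau, normc (g tau x) <= c) ->
  normc (duh g t x) <= T * c.
Proof.
move=> mg gc; apply: normc_cut_le => //; first exact: cmeasurable_duh_arg.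
by move=> tau; rewrite normc_expiM.
Qed.

Lemma duhB (g g' : R -> Rd -> R[i]) t x (c c' : R) : jmeas g -> jmeas g' ->
  (forall tau, normc (g tau x) <= c) -> (forall tau, normc (g' tau x) <= c') ->
  duh g t x - duh g' t x = duh (fun tau y => g tau y - g' tau y) t x.
Proof.
move=> mg mg' gc gc'; rewrite /duh -cintegralB.
- by apply: eq_cintegral => tau; rewrite -!mulrBr.
- apply: (@cintegrable_cut _ _ _ c); first exact: cmeasurable_duh_arg.
  by move=> tau; rewrite normc_expiM.
- apply: (@cintegrable_cut _ _ _ c'); first exact: cmeasurable_duh_arg.
  by move=> tau; rewrite normc_expiM.
Qed.

(** The phases have modulus one and the time integral is over a set of length at
    most [T], so [Phi] is dominated by [Psi], and the quintic term is
    multilinear. *)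
Lemma cdom_step f f' b b' h h' M M' K B del eps :
  cdom f f' b b' -> rpair M M' K B del eps -> jmeas h -> jmeas h' ->
  (forall tau, cdom (h tau) (h' tau) M M') ->
  forall t, cdom (Phi f h t) (Phi f' h' t) (Psi b M) (Psi b' M').
Proof.
move=> cf p mh mh' ch t; have [mf mf' lf' df] := cf.
have cq tau := cdom_quint p (ch tau).
have b1 tau x : normc (cquint (h tau) x) <= rquint M x := cdom_le (cq tau) x.
have b2 tau x : normc (cquint (h' tau) x) <= rquint M' x by case: (cq tau).
have b3 tau x : normc (cquint (h tau) x - cquint (h' tau) x) <= rquint M x - rquint M' x.
  by case: (cq tau).
have mq := jmeas_quint mh; have mq' := jmeas_quint mh'.
split.
- by apply: jmeas_sec; exact: jmeas_Phi.
- by apply: jmeas_sec; exact: jmeas_Phi.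
- move=> x; apply: le_trans (normcD _ _) _; apply: lerD.
    by rewrite normc_expiM.
  by rewrite normcM normc_im mul1r; exact: normc_duh_le.
- move=> x; rewrite /Phi /Psi.
  rewrite alg_sub2.
  rewrite (duhB t mq mq' (fun tau => b1 tau x) (fun tau => b2 tau x)).
  have -> : b x + T * rquint M x - (b' x + T * rquint M' x) =
    (b x - b' x) + T * (rquint M x - rquint M' x) by ring.
  apply: le_trans (normcD _ _) _; apply: lerD; first by rewrite normc_expiM.
  rewrite normcM normc_im mul1r; apply: normc_duh_le => // .
  exact: cmeasurableB.
Qed.

Lemma rpair_step b b' M M' K B del eps K1 B1 d1 e1 :
  rpair b b' K B del eps -> rpair M M' K1 B1 d1 e1 ->
  rpair (Psi b M) (Psi b' M') (K + T * K1 ^+ 5) (B + T * (K1 ^+ 4 * B1))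
    (del + T * (5 * K1 ^+ 4 * d1)) (eps + T * (5 * K1 ^+ 4 * e1)).
Proof.
move=> p q; have n := rpair_quint q.
have iq := rp_int n; have iqB := rpair_intB n; have ib := rp_int p; have ibB := rpair_intB p.
have e x : Psi b M x - Psi b' M' x = (b x - b' x) + T * (rquint M x - rquint M' x).
  by rewrite /Psi; ring.
split.
- by apply: measurable_funD; [exact: rp_meas p|apply: measurable_funM => //; exact: rp_meas n].
- by apply: measurable_funD; [exact: rp_meas' p|apply: measurable_funM => //; exact: rp_meas' n].
- move=> x; apply: addr_ge0; first exact: (rp_ge0 p x).
  by apply: mulr_ge0 => //; exact: (rp_ge0 n x).
- by move=> x; rewrite lerD ?(rp_le p)// ler_wpM2l// (rp_le n).
- by move=> x; rewrite lerD ?(rp_sup p)// ler_wpM2l// (rp_sup n).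
- by apply: integrableDr => //; exact: integrable_mull.
- rewrite RintegralD//; last exact: integrable_mull.
  by rewrite RintegralZl// lerD ?(rp_mass p)// ler_wpM2l// (rp_mass n).
- by move=> x; rewrite e lerD ?(rp_dsup p)// ler_wpM2l// (rp_dsup n).
- under eq_Rintegral do rewrite e.
  rewrite RintegralD//; last exact: integrable_mull.
  by rewrite RintegralZl// lerD ?(rp_dmass p)// ler_wpM2l// (rp_dmass n).
Qed.

Lemma rpair_weaken F F' K B del eps K1 B1 d1 e1 : rpair F F' K B del eps ->
  K <= K1 -> B <= B1 -> del <= d1 -> eps <= e1 -> rpair F F' K1 B1 d1 e1.
Proof.
by move=> [p1 p2 p3 p4 p5 p6 p7 p8 p9] hK hB hd he; split => // [x||x|];
  [exact: le_trans (p5 x) _|exact: le_trans p7 _|exact: le_trans (p8 x) _|exact: le_trans p9 _].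
Qed.

Lemma ler_eq (x y : R) : x = y -> x <= y. Proof. by move=> ->. Qed.

Lemma rpair0 : rpair (fun _ : Rd => 0 : R) (fun _ : Rd => 0 : R) 0 0 0 0.
Proof.
apply: rpair_diag => //; last by rewrite Rintegral_cst// mul0r.
by apply: ge0_integrableP => //; rewrite integral0_eq// ltry.
Qed.

Lemma normc0R : normc (0 : R[i]) = 0.
Proof. by rewrite (_ : 0 = (0 : R)%:C)// normc_real normr0. Qed.

Let normc0_le : normc (0 : R[i]) <= 0. Proof. by rewrite normc0R. Qed.

(** Starting from zero makes all the differences of iterates nonnegative on the
    side of the majorants. *)
Definition hn f := fix hn (n : nat) : R -> Rd -> R[i] :=
  match n with 0%N => fun _ _ => 0 | n'.+1 => Phi f (hn n') end.
Definition Mn b := fix Mn (n : nat) : Rd -> R :=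
  match n with 0%N => fun=> 0 | n'.+1 => Psi b (Mn n') end.

Lemma hnS f n : hn f n.+1 = Phi f (hn f n). Proof. by []. Qed.

Lemma jmeas_hn f n : cmeasurable f -> jmeas (hn f n).
Proof.
move=> mf; elim: n => [|n IH]; first exact: cmeasurable_cst.
exact: jmeas_Phi.
Qed.

Section bounds.
Variables (K : R).
Hypothesis K0 : 0 <= K.
(** The Lipschitz constant of [M |-> T * rquint M] on majorants of mass at most
    [2 * K]. *)
Definition theta : R := 5 * T * (2 * K) ^+ 4.
Hypothesis th : theta <= 2^-1.

Let th0 : 0 <= theta.
Proof. by rewrite /theta !mulr_ge0// exprn_ge0// mulr_ge0. Qed.

Let tK : T * (2 * K) ^+ 4 <= 10^-1.
Proof. by have := th; rewrite /theta; lra. Qed.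

Let tK0 : 0 <= T * (2 * K) ^+ 4.
Proof. by rewrite mulr_ge0// exprn_ge0// mulr_ge0. Qed.

(** The smallness of [theta] closes the bootstrap: mass, sup norm and both
    distances at most double. *)
Lemma rpair_iter b b' B del eps n : rpair b b' K B del eps ->
  0 <= B -> 0 <= del -> 0 <= eps ->
  rpair (Mn b n) (Mn b' n) (2 * K) (2 * B) (2 * del) (2 * eps).
Proof.
move=> p B0 d0 e0; elim: n => [|n IH].
  by apply: (rpair_weaken rpair0); rewrite ?mulr_ge0.
apply: (rpair_weaken (rpair_step p IH)).
- by rewrite exprSr mulrA; have := tK; have := K0; nra.
- by rewrite mulrA; have := tK; nra.
- have -> : T * (5 * (2 * K) ^+ 4 * (2 * del)) = theta * (2 * del) by rewrite /theta; ring.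
  by have := th; nra.
- have -> : T * (5 * (2 * K) ^+ 4 * (2 * eps)) = theta * (2 * eps) by rewrite /theta; ring.
  by have := th; nra.
Qed.

Lemma cdom_iter f f' b b' B del eps n t : rpair b b' K B del eps ->
  0 <= B -> 0 <= del -> 0 <= eps -> cdom f f' b b' ->
  cdom (hn f n t) (hn f' n t) (Mn b n) (Mn b' n).
Proof.
move=> p B0 d0 e0 c; have [mf mf' _ _] := c.
elim: n t => [t|n IH t].
  by apply: cdom_diag; [exact: (cmeasurable_cst 0)|move=> x; exact: normc0_le].
by apply: (cdom_step c (rpair_iter n p B0 d0 e0)) => //; exact: jmeas_hn.
Qed.

Variables (f : Rd -> R[i]) (b : Rd -> R) (B : R).
Hypotheses (mf : cmeasurable f) (fb : forall x, normc (f x) <= b x).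
Hypotheses (mb : measurable_fun setT b) (b0 : forall x, 0 <= b x)
  (bB : forall x, b x <= B) (ib : mu.-integrable setT (EFin \o b))
  (bK : \int[mu]_x b x <= K).

Let pb : rpair b b K B 0 0. Proof. exact: rpair_diag. Qed.
Let B0 : 0 <= B. Proof. exact: le_trans (b0 (tcst 0)) (bB _). Qed.
Let cf : cdom f f b b. Proof. exact: cdom_diag. Qed.

(** Iterates contract with ratio [theta], simultaneously in L^1 and in L^oo. *)
Lemma rpair_Mn n k : rpair (Mn b (n + k)) (Mn b n) (2 * K) (2 * B)
  (2 * B * theta ^+ n) (2 * K * theta ^+ n).
Proof.
elim: n => [|n IH].
  have [p1 p2 p3 p4 p5 p6 p7 p8 p9] := rpair_iter k pb B0 (lexx 0) (lexx 0).
  rewrite add0n !expr0 !mulr1; split => //.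
  - exact: measurable_cst.
  - by move=> x; rewrite /= subr0.
  - by rewrite (_ : (fun x => _) = Mn b k)//; apply/funext => x; rewrite /= subr0.
rewrite addSn; apply: (rpair_weaken (rpair_step pb IH)).
- by rewrite exprSr mulrA; have := tK; have := K0; nra.
- by rewrite mulrA; have := tK; have := B0; nra.
- by rewrite add0r (exprS theta n); apply/ler_eq; move: (theta ^+ n) => u; rewrite /theta; ring.
- by rewrite add0r (exprS theta n); apply/ler_eq; move: (theta ^+ n) => u; rewrite /theta; ring.
Qed.

Lemma cdom_hn n k t : cdom (hn f (n + k) t) (hn f n t) (Mn b (n + k)) (Mn b n).
Proof.
elim: n t => [t|n IH t].
  have [m1' m2' b1 _] := cdom_iter k t pb B0 (lexx 0) (lexx 0) cf.
  rewrite add0n; split => // x.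
  by rewrite /= !subr0.
rewrite addSn; apply: (cdom_step cf (rpair_Mn n k)) => //; exact: jmeas_hn.
Qed.

End bounds.
End iteration.
End picard.

(** * The limit of the Picard iterates *)

Section complex_limits.
Context {R : realType}.
Implicit Types (u : nat -> R[i]).

Lemma real_cauchy_cvg (u e : nat -> R) : e @ \oo --> (0 : R) ->
  (forall n k, `|u (n + k)%N - u n| <= e n) -> cvgn u.
Proof.
move=> e0 ue; apply/cauchy_cvgP/cauchy_exP => eps eps0.
have [N _ NP] : \forall n \near \oo, `|0 - e n| < eps by move/cvgr_dist_lt : e0; exact.
exists (u N); exists N => // n /= Nn.
rewrite /ball/= distrC -(subnKC Nn); apply: le_lt_trans (ue _ _) _.
by apply: le_lt_trans (NP N (leqnn N)); rewrite sub0r normrN ler_norm.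
Qed.

Definition clim u : R[i] :=
  limn (fun n => complex.Re (u n)) +i* limn (fun n => complex.Im (u n)).

Lemma ccvg_cauchy u (e : nat -> R) : e @ \oo --> (0 : R) ->
  (forall n k, normc (u (n + k)%N - u n) <= e n) -> ccvg u (clim u).
Proof.
move=> e0 ue; split => /=; apply: (real_cauchy_cvg e0) => n k.
  apply: le_trans (ue n k); apply: le_trans (Re_le_normc _).
  by case: (u (n + k)%N) => a b; case: (u n).
apply: le_trans (ue n k); apply: le_trans (Im_le_normc _).
by case: (u (n + k)%N) => a b; case: (u n).
Qed.

Lemma ccvg_squeeze u l (e : nat -> R) : e @ \oo --> (0 : R) ->
  (forall n, normc (l - u n) <= e n) -> ccvg u l.
Proof.
move=> e0 ue; apply/ccvg_dist.
apply: (@squeeze_cvgr _ _ _ _ (fun=> 0) e) => //; last exact: cvg_cst.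
by near=> n; rewrite normc_ge0/= normcBC ue.
Unshelve. all: by end_near. Qed.

Lemma ccvg_normcB_le u v l w (c : R) : ccvg u l -> ccvg v w ->
  (forall n, normc (u n - v n) <= c) -> normc (l - w) <= c.
Proof.
move=> ul vl uc.
have /ccvg_dist h : ccvg (fun n => u n - v n) (l - w) by apply: ccvgD => //; exact: ccvgN.
have h2 : (fun n => normc (u n - v n - (l - w)) + c) @ \oo --> 0 + c.
  by apply: cvgD => //; exact: cvg_cst.
rewrite add0r in h2; apply: (cvgr_to_ge h2); near=> n.
have -> : l - w = (u n - v n) - ((u n - v n) - (l - w)) by rewrite subKr.
apply: le_trans (normcB _ _) _; rewrite addrC lerD//.
by rewrite subKr.
Unshelve. all: by end_near. Qed.

End complex_limits.

Section solution_limit.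
Context {R : realType} {d : nat}.
Local Notation Rd := (d.-tuple R).
Local Notation mu := (@leb R d).
Implicit Types (f : Rd -> R[i]) (F G : Rd -> R).
Variables (m T K : R).
Hypothesis m1 : `|m| = 1.
Hypothesis T0 : 0 <= T.
Hypothesis K0 : 0 <= K.
Hypothesis th : theta T K <= 2^-1.
Local Notation theta := (theta T K).
Local Notation Mn := (@Mn R d T).
Local Notation hn := (@hn R d m T).

Definition hlim f t x : R[i] := clim (fun n => hn f n t x).
Definition Mlim b x : R := limn (fun n => Mn b n x).

Let th0 : 0 <= theta.
Proof. by rewrite /theta !mulr_ge0// exprn_ge0// mulr_ge0. Qed.

Lemma theta_cvg0 (c : R) : (fun n => c * theta ^+ n) @ \oo --> (0 : R).
Proof.
apply: (cvg_geometric c (z := theta)); rewrite ger0_norm//.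
by apply: le_lt_trans th _; rewrite invf_lt1// ltr1n.
Qed.

Section datum.
Variables (b : Rd -> R) (B : R).
Hypotheses (mb : measurable_fun setT b) (b0 : forall x, 0 <= b x)
  (bB : forall x, b x <= B) (ib : mu.-integrable setT (EFin \o b))
  (bK : \int[mu]_x b x <= K).

Let B0 : 0 <= B. Proof. exact: le_trans (b0 (tcst 0)) (bB _). Qed.

Let pM n k := rpair_Mn T0 K0 th mb b0 bB ib bK n k.

Lemma Mn_le n k x : Mn b n x <= Mn b (n + k) x.
Proof. exact: (rp_le (pM n k) x). Qed.

Lemma Mn_cvg x : (fun n => Mn b n x) @ \oo --> Mlim b x.
Proof.
apply: nondecreasing_is_cvgn.
  by move=> n k nk; rewrite -(subnKC nk); exact: Mn_le.
exists (2 * B) => _ [n _ <-]; exact: (rp_sup (pM 0 n) x).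
Qed.

Lemma Mn_Mlim n x : Mn b n x <= Mlim b x.
Proof.
apply: (cvgr_to_ge (@Mn_cvg x)); exists n => // k /= nk.
by rewrite -(subnKC nk); exact: Mn_le.
Qed.

Lemma Mlim_le x : Mlim b x <= 2 * B.
Proof.
by apply: (cvgr_to_le (@Mn_cvg x)); near=> n; exact: (rp_sup (pM 0 n) x).
Unshelve. all: by end_near. Qed.

Lemma Mn_ge0 n x : 0 <= Mn b n x.
Proof. exact: (rp_ge0 (pM n 0) x). Qed.

Let mM n : measurable_fun setT (Mn b n). Proof. exact: (rp_meas' (pM n 0)). Qed.

Lemma measurable_Mlim : measurable_fun setT (Mlim b).
Proof. by apply: (measurable_fun_cvg (fun n => mM n)) => x _; exact: Mn_cvg. Qed.

Let iM n : mu.-integrable setT (EFin \o Mn b n).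
Proof. exact: (rp_int (pM 0 n)). Qed.

Lemma integrable_Mlim : mu.-integrable setT (EFin \o Mlim b).
Proof.
apply: ge0_integrableP; first exact: measurable_Mlim.
  by move=> x; apply: le_trans (Mn_ge0 0 x) (Mn_Mlim 0 x).
apply: (@le_lt_trans _ _ (2 * K)%:E); last by rewrite ltry.
have h := @cvg_monotone_convergence _ _ R mu setT measurableT
  (fun n x => (Mn b n x)%:E) (fun n => proj2 (measurable_EFinP _ _) (mM n))
  (fun n x _ => Mn_ge0 n x).
have e : (fun x => limn (fun n => (Mn b n x)%:E)) = (fun x => (Mlim b x)%:E).
  by apply/funext => x; apply: cvg_lim => //; apply: cvg_EFin; [near=> n|exact: Mn_cvg].
rewrite e in h; apply: (cvge_to_le (h _)).
  by move=> x _ n k nk; rewrite lee_fin -(subnKC nk); exact: Mn_le.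
near=> n; rewrite -EFin_Rintegral ?lee_fin; first exact: (rp_mass (pM 0 n)).
exact: iM.
Unshelve. all: by end_near. Qed.

Lemma rpair_Mlim n : rpair (Mlim b) (Mn b n) (2 * K) (2 * B)
  (2 * B * theta ^+ n) (2 * K * theta ^+ n).
Proof.
have iL := integrable_Mlim; have mL := measurable_Mlim.
have c k x : `|Mn b k x| <= Mlim b x by rewrite ger0_norm ?Mn_Mlim ?Mn_ge0.
have c0 x : (fun k => Mn b (n + k) x - Mn b n x) @ \oo --> Mlim b x - Mn b n x.
  apply: cvgB; last exact: cvg_cst.
  rewrite (_ : (fun k => _) = (fun k => Mn b (k + n) x)); last by apply/funext => k; rewrite addnC.
  by rewrite (cvg_shiftn n (fun k => Mn b k x)); exact: Mn_cvg.
split => //.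
- exact: Mn_ge0.
- exact: Mn_Mlim.
- exact: Mlim_le.
- have h := Rintegral_cvg mM Mn_cvg c iL.
  by apply: (cvgr_to_le h); near=> k; exact: (rp_mass (pM 0 k)).
- by move=> x; apply: (cvgr_to_le (c0 x)); near=> k; exact: (rp_dsup (pM n k) x).
- have h := @Rintegral_cvg _ _ _ mu (fun k x => Mn b (n + k) x - Mn b n x)
    (fun x => Mlim b x - Mn b n x) (Mlim b) _ c0 _ iL.
  apply: (cvgr_to_le (h _ _)).
  + by move=> k; exact: measurable_funB.
  + move=> k x; rewrite ger0_norm ?subr_ge0 ?Mn_le// lerBlDr.
    by rewrite (le_trans (Mn_Mlim _ _))// lerDl Mn_ge0.
  + by near=> k; exact: (rp_dmass (pM n k)).
Unshelve. all: by end_near. Qed.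

Section data_function.
Variables (f : Rd -> R[i]).
Hypotheses (mf : cmeasurable f) (fb : forall x, normc (f x) <= b x).

Let cM n k t := cdom_hn m1 T0 K0 th mf fb mb b0 bB ib bK n k t.

Lemma hn_cvg t x : ccvg (fun n => hn f n t x) (hlim f t x).
Proof.
apply: (ccvg_cauchy (theta_cvg0 (2 * B))) => n k.
have [_ _ _ h] := cM n k t.
exact: le_trans (h x) (rp_dsup (pM n k) x).
Qed.

Lemma jmeas_hlim : jmeas (hlim f).
Proof.
apply: (cmeasurable_cvg (u := fun n z => hn f n z.1 z.2)).
  by move=> n; exact: jmeas_hn.
by move=> z; exact: hn_cvg.
Qed.

Lemma cdom_hlim n t : cdom (hlim f t) (hn f n t) (Mlim b) (Mn b n).
Proof.
have [_ c2 c3 _] := cM n 0 t.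
split => //; first exact: jmeas_sec jmeas_hlim.
move=> x.
apply: (ccvg_normcB_le (u := fun k => hn f (k + n) t x) (v := fun=> hn f n t x)).
- have [r i] := hn_cvg t x; split.
    by rewrite (cvg_shiftn n (fun k => complex.Re (hn f k t x))).
  by rewrite (cvg_shiftn n (fun k => complex.Im (hn f k t x))).
- exact: ccvg_cst.
- move=> k; rewrite addnC; have [_ _ _ h] := cM n k t.
  by apply: le_trans (h x) _; rewrite lerD2r Mn_Mlim.
Qed.

Lemma hlim_le t x : normc (hlim f t x) <= Mlim b x.
Proof. exact: (cdom_le (cdom_hlim 0 t)). Qed.

(** One more step takes [hlim] and the iterate [n] to functions at distance of
    order [theta ^ n.+1], and the latter is the iterate [n.+1]. *)
Lemma hlim_fixpoint t x : hlim f t x = Phi m T f (hlim f) t x.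
Proof.
apply: (@ccvg_unique _ (fun n => hn f n.+1 t x)).
  have [r i] := hn_cvg t x; split.
    by rewrite (cvg_shiftS (fun k => complex.Re (hn f k t x))).
  by rewrite (cvg_shiftS (fun k => complex.Im (hn f k t x))).
apply: (ccvg_squeeze (theta_cvg0 (2 * B * theta))) => n.
have cf : cdom f f b b by exact: cdom_diag.
have pb : rpair b b K B 0 0 by exact: rpair_diag.
have p := rpair_step T0 pb (rpair_Mlim n).
have [_ _ _ h] := cdom_step m1 T0 cf (rpair_Mlim n) jmeas_hlim (jmeas_hn m T n mf) (fun tau => cdom_hlim n tau) t.
apply: le_trans (h x) _; apply: le_trans (rp_dsup p x) _.
by rewrite add0r; apply: ler_eq; move: (theta ^+ n) => u; rewrite /theta; ring.
Qed.

End data_function.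
End datum.

Section comparison.
Variables (b b' : Rd -> R) (f f' : Rd -> R[i]) (B del eps : R).
Hypotheses (p : rpair b b' K B del eps) (B0 : 0 <= B) (del0 : 0 <= del) (eps0 : 0 <= eps).
Hypothesis c : cdom f f' b b'.

Let mb := rp_meas p.
Let mb' := rp_meas' p.
Let ge := rpair_ge0 p.
Let ge' := rp_ge0 p.
Let sup' : forall x, b' x <= B.
Proof. by move=> x; exact: le_trans (rp_le p x) (rp_sup p x). Qed.
Let int' := rpair_int' p.
Let mass' : \int[mu]_x b' x <= K.
Proof. by apply: le_trans (rp_mass p); apply: le_Rint => //; [exact: (rp_int p)|exact: (rp_le p)]. Qed.

Let cb := Mn_cvg mb ge (rp_sup p) (rp_int p) (rp_mass p).
Let cb' := Mn_cvg mb' ge' sup' int' mass'.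
Let q n := rpair_iter T0 K0 th n p B0 del0 eps0.

Let cB (x : Rd) : (fun n => Mn b n x - Mn b' n x) @ \oo --> Mlim b x - Mlim b' x.
Proof. by apply: cvgB; [exact: cb|exact: cb']. Qed.

Lemma Mlim_le_data x : Mlim b' x <= Mlim b x.
Proof.
rewrite -subr_ge0; have h := @cB x; apply: (cvgr_to_ge h).
by near=> n; rewrite subr_ge0; exact: (rp_le (q n)).
Unshelve. all: by end_near. Qed.

Lemma Mlim_dsup x : Mlim b x - Mlim b' x <= 2 * del.
Proof.
have h := @cB x; apply: (cvgr_to_le h).
by near=> n; exact: (rp_dsup (q n)).
Unshelve. all: by end_near. Qed.

Lemma Mlim_dmass : \int[mu]_x (Mlim b x - Mlim b' x) <= 2 * eps.
Proof.
have iL := integrable_Mlim mb ge (rp_sup p) (rp_int p) (rp_mass p).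
have h := @Rintegral_cvg _ _ _ mu (fun k x => Mn b k x - Mn b' k x)
    (fun x => Mlim b x - Mlim b' x) (Mlim b) _ cB _ iL.
apply: (cvgr_to_le (h _ _)).
- by move=> k; apply: measurable_funB; [exact: (rp_meas (q k))|exact: (rp_meas' (q k))].
- move=> k x; rewrite ger0_norm ?subr_ge0 ?(rp_le (q k))// lerBlDr.
  rewrite (le_trans (Mn_Mlim mb ge (rp_sup p) (rp_int p) (rp_mass p) _ _))// lerDl.
  exact: (rp_ge0 (q k)).
- by near=> k; exact: (rp_dmass (q k)).
Unshelve. all: by end_near. Qed.

(** Lipschitz dependence on the data, pointwise in frequency, with the
    difference of the limit majorants as modulus. *)
Lemma hlim_dist t x : normc (hlim f t x - hlim f' t x) <= Mlim b x - Mlim b' x.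
Proof.
have [mf mf' fb' _] := c; have fb := cdom_le c.
have h : ccvg (fun n => hn f n t x - hn f' n t x) (hlim f t x - hlim f' t x).
  apply: ccvgD; first exact: (hn_cvg mb ge (rp_sup p) (rp_int p) (rp_mass p)).
  by apply: ccvgN; exact: (hn_cvg mb' ge' sup' int' mass').
have /ccvg_dist g := h.
have e : (fun n => normc (hn f n t x - hn f' n t x - (hlim f t x - hlim f' t x)) +
   (Mn b n x - Mn b' n x)) @ \oo --> 0 + (Mlim b x - Mlim b' x).
  by apply: cvgD => //; exact: cB.
rewrite add0r in e; apply: (cvgr_to_ge e); near=> n.
set u := hn f n t x - hn f' n t x; set l := _ - _.
have -> : l = u - (u - l) by rewrite subKr.
apply: le_trans (normcB _ _) _; rewrite addrC lerD//; first by rewrite subKr.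
by have [_ _ _] := cdom_iter m1 T0 K0 th n t p B0 del0 eps0 c; exact.
Unshelve. all: by end_near. Qed.

End comparison.
End solution_limit.

(** * Functions with bounded partial derivatives *)

Section one_variable.
Context {R : realType}.
Implicit Types (g : R -> R).

Lemma mvt_le g (a b M : R) : a <= b -> (forall x, derivable g x 1) ->
  (forall x, a <= x <= b -> `|derive1 g x| <= M) -> `|g b - g a| <= M * (b - a).
Proof.
move=> ab dg gM.
have [c cab ->] : exists2 c, c \in `[a, b]%R & g b - g a = derive1 g c * (b - a).
  apply: (MVT_segment ab) => [x _|].
    by rewrite derive1E; apply: DeriveDef; [exact: dg|].
  by apply: derivable_within_continuous => x _; exact: dg.
rewrite normrM [X in _ * X]ger0_norm ?subr_ge0// ler_wpM2r ?subr_ge0//.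
by apply: gM; rewrite in_itv/= in cab.
Qed.

Lemma derive1_cvg_seq g : derivable g 0 1 ->
  (fun n => n.+1%:R * (g n.+1%:R^-1 - g 0)) @ \oo --> derive1 g 0.
Proof.
move=> /cvg_ex[l lP]; have -> : derive1 g 0 = l.
  by rewrite derive1E; exact: cvg_lim lP.
have h : (fun n => n.+1%:R^-1 : R) @ \oo --> (0 : R)^'.
  move=> A A0; have := @invn_cvg0 R _ A0; apply: filter_app.
  by exists 0%N => // n _ /=; apply; rewrite invr_neq0.
have := cvg_comp _ _ h lP; apply: cvg_trans; apply: near_eq_cvg; near=> n => /=.
by rewrite invrK addr0 /GRing.scale/= mulr1.
Unshelve. all: by end_near. Qed.

Lemma ler_prod1D d (y : 'I_d -> R) : (forall j, 0 <= y j) ->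
  1 + \sum_(j < d) y j <= \prod_(j < d) (1 + y j).
Proof.
elim: d y => [|d IH] y y0; first by rewrite !big_ord0 addr0.
rewrite !big_ord_recl/=; have := IH _ (fun j => y0 (lift ord0 j)).
have : 0 <= \sum_(j < d) y (lift ord0 j) by exact: sumr_ge0.
by have := y0 ord0; nra.
Qed.

Lemma ler_prod_expn d (y : 'I_d -> R) (c : R) : (forall j, 0 <= y j <= c) ->
  \prod_(j < d) y j <= c ^+ d.
Proof.
move=> yc; have -> : c ^+ d = \prod_(j < d) c by rewrite prodr_const card_ord.
exact: ler_prod.
Qed.

End one_variable.

Section schwartz_class.
Context {R : realType} {d : nat}.
Local Notation Rd := (d.-tuple R).
Local Notation mu := (@leb R d).
Implicit Types (phi : Rd -> R[i]) (f : Rd -> R).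

Lemma tnth_translate (i : 'I_d) (x : Rd) (h : R) j :
  tnth (translate i x h) j = tnth x j + (if j == i then h else 0).
Proof. by rewrite tnth_mktuple. Qed.

Lemma translateD (i : 'I_d) (x : Rd) (h k : R) :
  translate i (translate i x h) k = translate i x (h + k).
Proof.
by apply: eq_from_tnth => j; rewrite !tnth_translate; case: ifP => _; rewrite ?addr0// addrA.
Qed.

Lemma translate0 (i : 'I_d) (x : Rd) : translate i x 0 = x.
Proof. by apply: eq_from_tnth => j; rewrite !tnth_translate; case: ifP => _; rewrite addr0. Qed.

Lemma derivable_translate f (i : 'I_d) (x : Rd) (h : R) :
  (forall y, derivable (fun k : R => f (translate i y k)) 0 1) ->
  derivable (fun k : R => f (translate i x k)) h 1 /\
  derive1 (fun k : R => f (translate i x k)) h = partial i f (translate i x h).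
Proof.
move=> df; have D := df (translate i x h).
have E : (fun k : R => k^-1 *: (f (translate i x (k *: 1 + h)) - f (translate i x h))) =
    (fun k : R => k^-1 *: (f (translate i (translate i x h) (k *: 1 + 0)) -
                   f (translate i (translate i x h) 0))).
  by apply/funext => k; rewrite !translateD !addr0 [h + _]addrC.
split; first by rewrite /derivable E; exact: D.
by rewrite /partial !derive1E /derive/= E.
Qed.

Lemma translate_lipschitz f (i : 'I_d) (x : Rd) (h M : R) : 0 <= h ->
  (forall y, derivable (fun k : R => f (translate i y k)) 0 1) ->
  (forall k : R, 0 <= k <= h -> `|partial i f (translate i x k)| <= M) ->
  `|f (translate i x h) - f x| <= M * h.
Proof.
move=> h0 df fM; rewrite -{2}(translate0 i x) -{2}[h]subr0.
apply: (@mvt_le R (fun k => f (translate i x k)) 0 h M h0) => [k|k kh]; first by case: (derivable_translate x k df).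
by have [_ ->] := derivable_translate x k df; exact: fM.
Qed.

(** A path from [x] to [y] that changes one coordinate at a time. *)
Definition mix (x y : Rd) (k : nat) : Rd :=
  [tuple if (j < k)%N then tnth y j else tnth x j | j < d].

Lemma lipschitz f (M : R) (x y : Rd) (e : R) :
  (forall i y, derivable (fun k : R => f (translate i y k)) 0 1) ->
  (forall i y, `|partial i f y| <= M) -> 0 <= M ->
  (forall j, `|tnth x j - tnth y j| <= e) -> `|f x - f y| <= d%:R * (M * e).
Proof.
move=> df fM M0 xy.
have step k : (k <= d)%N -> `|f x - f (mix x y k)| <= k%:R * (M * e).
  elim: k => [_|k IH kd].
    have -> : mix x y 0 = x by apply: eq_from_tnth => j; rewrite tnth_mktuple.
    by rewrite subrr normr0 mul0r.
  have {IH} := IH (ltnW kd); set z := mix x y k => IH.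
  pose i := Ordinal kd; pose h := tnth y i - tnth x i.
  have zi : tnth z i = tnth x i by rewrite tnth_mktuple ltnn.
  have E : mix x y k.+1 = translate i z h.
    apply: eq_from_tnth => j; rewrite !tnth_mktuple ltnS leq_eqVlt.
    case: eqVneq => [ji|ji] /=.
      have -> : j = i by exact: val_inj.
      by rewrite eqxx ltnn /h addrC subrK.
    rewrite (_ : (j == i) = false) ?addr0//.
    by apply/negbTE; apply: contra ji => /eqP ->.
  rewrite -natr1 mulrDl mul1r.
  rewrite (_ : f x - f _ = (f x - f z) + (f z - f (mix x y k.+1))); last by rewrite addrA subrK.
  apply: le_trans (ler_normD _ _) _; apply: lerD => //.
  have he : `|h| <= e by rewrite /h distrC.
  apply: (@le_trans _ _ (M * `|h|)); last exact: ler_wpM2l.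
  rewrite E; case: (leP 0 h) => h0.
    by rewrite distrC [X in _ * X]ger0_norm//; apply: translate_lipschitz => //.
  rewrite [X in _ * X]ltr0_norm// -{1}(translate0 i z) -[X in translate i z X](subrr h) -translateD.
  by apply: translate_lipschitz => //; rewrite oppr_ge0 ltW.
have -> : f y = f (mix x y d).
  by congr f; apply: eq_from_tnth => j; rewrite tnth_mktuple ltn_ord.
exact: step.
Qed.

(** The vector of integer parts takes countably many values, so that any
    function of it is measurable. *)
Lemma measurable_floor_fun (N : R) (F : d.-tuple int -> R) :
  measurable_fun setT (fun x : Rd => F [tuple Num.floor (N * tnth x j) | j < d]).
Proof.
move=> _ Y mY; rewrite setTI.
pose fl (x : Rd) : d.-tuple int := [tuple Num.floor (N * tnth x j) | j < d].
pose A (v : d.-tuple int) : set Rd := [set x | forall j, (tnth v j)%:~R <= N * tnth x j < (tnth v j + 1)%:~R].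
have flA x v : A v x <-> fl x = v.
  split=> [h|<- j]; last first.
    rewrite tnth_mktuple; apply/andP; split; [exact: Num.Theory.floor_le|exact: Num.Theory.floorD1_gt].
  apply: eq_from_tnth => j; rewrite tnth_mktuple; apply: Num.Theory.floor_def; exact: h.
have mA v : measurable (A v).
  rewrite (_ : A v = \bigcap_(j in [set: 'I_d]) ((fun x : Rd => N * tnth x j) @^-1`
     `[(tnth v j)%:~R, (tnth v j + 1)%:~R[)); last first.
    apply/seteqP; split => x /= h j; first by move=> _ /=; rewrite in_itv/=; exact: h.
    by have := h j Logic.I; rewrite /= in_itv.
  apply: fin_bigcap_measurable => // j _; rewrite -[X in measurable X]setTI.
  have : measurable_fun setT (fun x : Rd => N * tnth x j).
    by apply: measurable_funM => //; exact: measurable_tnth.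
  by apply => //; exact: measurable_itv.
rewrite (_ : _ @^-1` Y = \bigcup_(k in [set: nat]) (if unpickle k is Some v then
    (if F v \in Y then A v else set0) else set0)); last first.
  apply/seteqP; split => x /=.
    move=> h; exists (pickle (fl x)) => //=; rewrite pickleK mem_set//; exact/flA.
  move=> [k _]; case: (unpickle k) => [v|//]; case: ifPn => // /set_mem Fv /flA Ev.
  by rewrite -Ev in Fv.
apply: bigcup_measurable => k _; case: unpickle => [v|//]; case: ifP => // _; exact: mA.
Qed.

(** [f] is the limit of its values at the points of the grids of mesh [1 / (n +
    1)]. *)
Lemma lipschitz_measurable f (M : R) : 0 <= M -> (forall x y (e : R),
  (forall j, `|tnth x j - tnth y j| <= e) -> `|f x - f y| <= M * e) ->
  measurable_fun setT f.
Proof.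
move=> M0 lf.
pose u n (x : Rd) := f [tuple (tnth [tuple Num.floor (n.+1%:R * tnth x j) | j < d] j)%:~R / n.+1%:R | j < d].
apply: (measurable_fun_cvg (h := u)) => [n|x _].
  exact: (@measurable_floor_fun n.+1%:R (fun v => f [tuple (tnth v j)%:~R / n.+1%:R | j < d])).
have c : (fun n => M * n.+1%:R^-1 : R) @ \oo --> (M * 0 : R).
  by apply: cvgM; [exact: cvg_cst|exact: invn_cvg0].
rewrite mulr0 in c.
apply/subr_cvg0/norm_cvg0P; apply: (@squeeze_cvgr _ _ _ _ (fun=> 0) _ _ _ _ (cvg_cst 0) c).
near=> n; rewrite normr_ge0/=; apply: lf => j.
rewrite !tnth_mktuple; set y := tnth x j; set q := Num.floor _.
have n0 : (0 : R) < n.+1%:R by [].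
rewrite distrC; have -> : y - q%:~R / n.+1%:R = (n.+1%:R * y - q%:~R) / n.+1%:R.
  rewrite mulrBl; congr (_ - _); by rewrite mulrAC mulfV ?mul1r// gt_eqF.
rewrite normrM [`|_^-1|]ger0_norm ?invr_ge0// ler_piMl ?invr_ge0//.
have := Num.Theory.floor_le (n.+1%:R * y); have := Num.Theory.floorD1_gt (n.+1%:R * y).
rewrite -/q intrD => h2 h1.
rewrite ler_norml; apply/andP; split; lra.
Unshelve. all: by end_near. Qed.

End schwartz_class.

(** * Fourier transforms of Schwartz functions *)

Section schwartz_facts.
Context {R : realType} {d : nat}.
Local Notation Rd := (d.-tuple R).
Local Notation mu := (@leb R d).
Implicit Types (phi : Rd -> R[i]) (f : Rd -> R).

Definition weight (x : Rd) : R := (1 + dot x x)^-1.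
(** An integrable weight: up to a constant, the Poisson kernel with parameter
    one. *)
Definition jweight (x : Rd) : R := \prod_(j < d) (1 + tnth x j ^+ 2)^-1.

Lemma dot1_gt0 (x : Rd) : 0 < 1 + dot x x.
Proof. by rewrite ltr_pwDl// dot_ge0. Qed.

Lemma weight_gt0 x : 0 < weight x.
Proof. by rewrite invr_gt0 dot1_gt0. Qed.

Lemma jweightE x : jweight x = pi ^+ d * poisd 1 x.
Proof.
have p0 : (pi : R) != 0 by rewrite gt_eqF ?pi_gt0.
rewrite /jweight /poisd (_ : pi ^+ d = \prod_(j < d) (pi : R)); last by rewrite prodr_const card_ord.
by rewrite -big_split/=; apply: eq_bigr => j _; rewrite /pois expr1n mul1r invfM mulVKf.
Qed.

Lemma jweight_ge0 x : 0 <= jweight x.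
Proof. by apply: prodr_ge0 => j _; rewrite invr_ge0 addr_ge0// sqr_ge0. Qed.

Lemma integrable_jweight : mu.-integrable setT (EFin \o jweight).
Proof.
rewrite (_ : jweight = fun x => pi ^+ d * poisd 1 x); last exact/funext/jweightE.
exact/integrable_mull/integrable_poisd.
Qed.

Lemma weight_jweight x : weight x ^+ d <= jweight x.
Proof.
rewrite /weight /jweight exprVn prodfV lef_pV2 ?posrE ?exprn_gt0 ?dot1_gt0//; last first.
  by apply: prodr_gt0 => j _; rewrite ltr_pwDl// sqr_ge0.
apply: ler_prod_expn => j; rewrite addr_ge0 ?sqr_ge0//= lerD2l.
exact: tnth_sqr_le_dot.
Qed.

Lemma schwartz_weight phi (l : seq 'I_d) (k : nat) : schwartz phi ->
  exists2 M : R, 0 <= M & forall x, normc (cpartials l phi x) <= M * weight x ^+ k.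
Proof.
move=> [_ _ /(_ l k)[M hM]]; exists M.
  apply: le_trans (hM (tcst 0)); rewrite mulr_ge0 ?normc_ge0// exprn_ge0//.
  exact/ltW/dot1_gt0.
move=> x; rewrite /weight exprVn ler_pdivlMr ?exprn_gt0 ?dot1_gt0// mulrC.
exact: hM.
Qed.

Lemma schwartz_re phi l x : `|partials l (fun y => complex.Re (phi y)) x| <= normc (cpartials l phi x).
Proof. exact: (Re_le_normc (cpartials l phi x)). Qed.

Lemma schwartz_im phi l x : `|partials l (fun y => complex.Im (phi y)) x| <= normc (cpartials l phi x).
Proof. exact: (Im_le_normc (cpartials l phi x)). Qed.

Lemma cpartials0 phi : cpartials [::] phi = phi.
Proof. by apply/funext => x; rewrite /cpartials/=; case: (phi x). Qed.

Lemma schwartz_bound1 phi : schwartz phi -> exists2 M : R, 0 <= M & forall i x,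
  normc (cpartials [:: i] phi x) <= M.
Proof.
move=> sp.
have h i : exists M, 0 <= M /\ forall x, normc (cpartials [:: i] phi x) <= M.
  have [M M0 hM] := schwartz_weight [:: i] 0 sp.
  by exists M; split => // x; have := hM x; rewrite expr0 mulr1.
have [m hm] := choice h.
exists (\sum_i m i); first by apply: sumr_ge0 => i _; case: (hm i).
move=> i x; apply: le_trans ((hm i).2 x) _.
by rewrite (bigD1 i)//= lerDl; apply: sumr_ge0 => j _; case: (hm j).
Qed.

Lemma schwartz_lipschitz phi : schwartz phi -> exists2 M : R, 0 <= M &
  forall x y e, (forall j, `|tnth x j - tnth y j| <= e) ->
    `|complex.Re (phi x) - complex.Re (phi y)| <= M * e /\
    `|complex.Im (phi x) - complex.Im (phi y)| <= M * e.
Proof.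
move=> sp; have [M M0 hM] := schwartz_bound1 sp; have [d1 d2 _] := sp.
exists (d%:R * M); first by rewrite mulr_ge0.
move=> x y e xy; rewrite -mulrA; split.
  apply: (@lipschitz R d (fun z => complex.Re (phi z)) M x y e) => // i z; first exact: (d1 [::] i z).
  exact: le_trans (schwartz_re phi [:: i] z) (hM i z).
apply: (@lipschitz R d (fun z => complex.Im (phi z)) M x y e) => // i z; first exact: (d2 [::] i z).
exact: le_trans (schwartz_im phi [:: i] z) (hM i z).
Qed.

Lemma schwartz_cmeasurable phi : schwartz phi -> cmeasurable phi.
Proof.
move=> /schwartz_lipschitz[M M0 h].
by split; apply: (lipschitz_measurable M0) => x y e /h[].
Qed.

Lemma schwartz_good phi : schwartz phi -> good phi.
Proof.
move=> sp; split.
  have [M M0 hM] := schwartz_weight [::] d sp; rewrite cpartials0 in hM.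
  apply: (cintegrable_dom (schwartz_cmeasurable sp) (G := fun x => M * jweight x)).
    by move=> x; apply: le_trans (hM x) _; rewrite ler_wpM2l// weight_jweight.
  exact/integrable_mull/integrable_jweight.
have [M M0 hM] := schwartz_weight [::] 0 sp; rewrite cpartials0 in hM.
by exists M => x; have := hM x; rewrite expr0 mulr1.
Qed.

Lemma cvg_le_invn (u : nat -> R) (l c : R) :
  (forall n, `|u n - l| <= c * n.+1%:R^-1) -> u @ \oo --> l.
Proof.
move=> h; have cc : (fun n => c * n.+1%:R^-1 : R) @ \oo --> (c * 0 : R).
  by apply: cvgM; [exact: cvg_cst|exact: invn_cvg0].
rewrite mulr0 in cc.
apply/subr_cvg0/norm_cvg0P; apply: (@squeeze_cvgr _ _ _ _ (fun=> 0) _ _ _ _ (cvg_cst 0) cc).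
by near=> n; rewrite normr_ge0/= h.
Unshelve. all: by end_near. Qed.

Lemma schwartz_ray phi : schwartz phi -> ray_continuous phi.
Proof.
move=> /schwartz_lipschitz[M M0 h] x y.
pose s := \sum_j `|tnth y j|.
have b n : let z := tsub x (tscale n.+1%:R^-1 y) in
   `|complex.Re (phi z) - complex.Re (phi x)| <= M * s * n.+1%:R^-1 /\
   `|complex.Im (phi z) - complex.Im (phi x)| <= M * s * n.+1%:R^-1.
  rewrite -mulrA; apply: h => j; rewrite !tnthE addrAC subrr add0r normrN normrM.
  rewrite mulrC [X in _ * X <= _]ger0_norm ?invr_ge0// ler_wpM2r ?invr_ge0//.
  by rewrite /s (bigD1 j)//= lerDl; apply: sumr_ge0.
by split; apply: (cvg_le_invn (c := M * s)) => n; case: (b n).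
Qed.

Lemma partials_rcons (l : seq 'I_d) (i : 'I_d) f : partials (rcons l i) f = partials l (partial i f).
Proof. by rewrite /partials foldr_rcons. Qed.

Lemma schwartz_partial phi (i : 'I_d) : schwartz phi -> schwartz (cpartials [:: i] phi).
Proof.
move=> [d1 d2 b]; split.
- by move=> l j x; have := d1 (rcons l i) j x; rewrite partials_rcons.
- by move=> l j x; have := d2 (rcons l i) j x; rewrite partials_rcons.
- move=> l k; have [M hM] := b (rcons l i) k; exists M => x.
  by have := hM x; rewrite /cpartials !partials_rcons.
Qed.

Definition tdelta (i : 'I_d) (h : R) : Rd := translate i (tcst 0) h.

Lemma tnth_tdelta i h j : tnth (tdelta i h) j = if j == i then h else 0.
Proof. by rewrite tnth_translate tnth_mktuple add0r. Qed.

Lemma translateE i (x : Rd) h : translate i x h = tadd x (tdelta i h).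
Proof. by apply: eq_from_tnth => j; rewrite tnth_translate tnthE tnth_tdelta. Qed.

Lemma dot_tdelta i (x : Rd) h : dot x (tdelta i h) = tnth x i * h.
Proof.
rewrite /dot (bigD1 i)//= tnth_tdelta eqxx big1 ?addr0// => j ji.
by rewrite tnth_tdelta (negbTE ji) mulr0.
Qed.

Lemma weight_tsub (t v : Rd) : dot v v <= 1 -> weight t <= 3 * weight (tsub t v).
Proof.
move=> vv; have h2 := dot_ge0 (tadd t v).
rewrite /weight -[_^-1]mul1r ler_pdivrMr ?dot1_gt0// mulrAC ler_pdivlMr ?dot1_gt0//.
rewrite mul1r; move: h2; rewrite !dotBl !dotBr !dotDl !dotDr (dotC v t).
by have := dot_ge0 t; lra.
Qed.

Lemma weight_translate i (x : Rd) h : `|h| <= 1 -> weight (translate i x h) <= 3 * weight x.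
Proof.
move=> h1; rewrite translateE -{2}(taddK x (tdelta i h)); apply: weight_tsub.
by rewrite dot_tdelta tnth_tdelta eqxx -expr2 -real_normK ?num_real// expr_le1.
Qed.

Lemma phase_derivative (c : R) :
  ccvg (fun n => (n.+1%:R)%:C * (expi (- (c * n.+1%:R^-1)) - 1)) (0 +i* (- c)).
Proof.
have dc : is_derive (0 : R) 1 (fun h : R => cos (- (c * h))) 0.
  by apply: is_derive_eq; rewrite mulr0 oppr0 sin0 oppr0 ?scaler0 ?mulr0 ?scale0r ?mul0r.
have ds : is_derive (0 : R) 1 (fun h : R => sin (- (c * h))) (- c).
  by apply: is_derive_eq; rewrite mulr0 oppr0 cos0 /GRing.scale/=; ring.
have hc := derive1_cvg_seq (@ex_derive _ _ _ _ _ _ _ dc).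
have hs := derive1_cvg_seq (@ex_derive _ _ _ _ _ _ _ ds).
rewrite derive1E (@derive_val _ _ _ _ _ _ _ dc) mulr0 oppr0 cos0 in hc.
rewrite derive1E (@derive_val _ _ _ _ _ _ _ ds) mulr0 oppr0 sin0 in hs.
split => /=.
  by apply: cvg_trans hc; apply: near_eq_cvg; near=> n => /=; rewrite mul0r subr0.
by apply: cvg_trans hs; apply: near_eq_cvg; near=> n => /=; rewrite mul0r addr0 oppr0.
Unshelve. all: by end_near. Qed.

Lemma cintegral_translate phi (i : 'I_d) (x : Rd) h : cintegrable mu phi ->
  cintegral mu setT (fun y => expi (dot x y) * phi (translate i y h)) =
  expi (- (tnth x i * h)) * cintegral mu setT (fun y => expi (dot x y) * phi y).
Proof.
move=> cp; rewrite -cintegralZ; last exact: cintegrable_phase.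
rewrite -[RHS](cintegral_tadd (tdelta i h)); last by apply: cintegrableZ; exact: cintegrable_phase.
apply: eq_cintegral => y; rewrite -translateE mulrA -expiD translateE dotDr dot_tdelta.
by rewrite addrC addrK.
Qed.

(** Difference quotients of [phi] converge to the derivative under the integral,
    and their transforms are those of [phi] times a difference quotient of the
    phase. *)
Lemma inv_fourier_partial phi (i : 'I_d) (x : Rd) : schwartz phi ->
  inv_fourier (cpartials [:: i] phi) x = (0 +i* (- tnth x i)) * inv_fourier phi x.
Proof.
move=> sp; have [d1 d2 _] := sp; have [cp _] := schwartz_good sp.
have mp := schwartz_cmeasurable sp.
pose D n (y : Rd) := (n.+1%:R)%:C * (phi (translate i y n.+1%:R^-1) - phi y).
have ct h : cintegrable mu (fun y => phi (translate i y h)).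
  rewrite (_ : (fun y => _) = (fun y => phi (tadd y (tdelta i h)))).
    exact: cintegrable_tadd.
  by apply/funext => y; rewrite translateE.
have E n : cintegral mu setT (fun y => expi (dot x y) * D n y) =
    (n.+1%:R)%:C * (expi (- (tnth x i * n.+1%:R^-1)) - 1) *
      cintegral mu setT (fun y => expi (dot x y) * phi y).
  rewrite -mulrA mulrBl mul1r -cintegral_translate// -cintegralB; do ?exact: cintegrable_phase.
  rewrite -cintegralZ; last by apply: cintegrableB; exact: cintegrable_phase.
  by apply: eq_cintegral => y; rewrite /D mulrCA mulrBr.
have [M M0 hM] := schwartz_weight [:: i] d sp.
pose C := M * 3 ^+ d.
(* The decay of the derivative is uniform on translates by at most one, by
    [weight_translate]. *)
have bD n y : normc (D n y) <= 2 * C * jweight y.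
  have i0 : (0 : R) <= n.+1%:R^-1 by rewrite invr_ge0.
  have i1 : n.+1%:R^-1 <= 1 :> R by rewrite invf_le1// ler1n.
  have C0 : 0 <= C by rewrite mulr_ge0// exprn_ge0.
  have hk k : 0 <= k <= n.+1%:R^-1 -> normc (cpartials [:: i] phi (translate i y k)) <= C * jweight y.
    move=> /andP[k0 k1]; apply: le_trans (hM _) _; rewrite /C -mulrA ler_wpM2l//.
    apply: le_trans (ler_wpM2l _ (weight_jweight y)); last by rewrite exprn_ge0.
    have w0 z : 0 <= weight z by exact/ltW/weight_gt0.
    rewrite -exprMn lerXn2r ?nnegrE// ?mulr_ge0//.
    by apply: weight_translate; rewrite ger0_norm// (le_trans k1).
  have r1 := @translate_lipschitz R d (fun z => complex.Re (phi z)) i y _ (C * jweight y) i0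
    (d1 [::] i) (fun k kh => le_trans (schwartz_re phi [:: i] _) (hk k kh)).
  have r2 := @translate_lipschitz R d (fun z => complex.Im (phi z)) i y _ (C * jweight y) i0
    (d2 [::] i) (fun k kh => le_trans (schwartz_im phi [:: i] _) (hk k kh)).
  rewrite /D normcM normc_real ger0_norm//.
  rewrite -[X in _ <= X](@mulVKf _ n.+1%:R) ?pnatr_eq0// ler_wpM2l//.
  apply: le_trans (normc_le_ReIm _) _.
  move: r1 r2; case: (phi (translate _ _ _)) => a b; case: (phi y) => a' b' /= r1 r2.
  rewrite -[2 * C * _]mulrA [X in _ <= X]mulrC -mulrA mulr_natl mulr2n.
  exact: lerD r1 r2.
have cD y : ccvg (fun n => D n y) (cpartials [:: i] phi y).
  have h1 := derive1_cvg_seq (d1 [::] i y); have h2 := derive1_cvg_seq (d2 [::] i y).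
  split.
    apply: cvg_trans h1; apply: near_eq_cvg; near=> n; rewrite /D /= translate0.
    by case: (phi (translate _ _ _)) => a b; case: (phi y) => a' b' /=; rewrite mul0r subr0.
  apply: cvg_trans h2; apply: near_eq_cvg; near=> n; rewrite /D /= translate0.
  by case: (phi (translate _ _ _)) => a b; case: (phi y) => a' b' /=; rewrite mul0r addr0.
rewrite /inv_fourier mulrCA; congr (_ * _).
apply: (@ccvg_unique _ (fun n => cintegral mu setT (fun y => expi (dot x y) * D n y))).
  apply: (cintegral_cvg (G := fun y => 2 * C * jweight y)).
  - move=> n; apply: cmeasurableM; first exact: cmeasurable_phase1.
    apply: cmeasurableM; first exact: cmeasurable_cst.
    by apply: cmeasurableB => //; exact: cintegrable_cmeasurable (ct _).
  - by move=> y; apply: ccvgM => //; exact: ccvg_cst.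
  - by move=> n y; rewrite normc_expiM.
  - exact/integrable_mull/integrable_jweight.
rewrite (funext E); apply: ccvgM; last exact: ccvg_cst.
exact: phase_derivative.
Unshelve. all: by end_near. Qed.

Lemma normc_pureim (c : R) : normc (0 +i* c) = `|c|.
Proof. by rewrite /= expr0n/= add0r sqrtr_sqr. Qed.

(** Each pair of derivatives gains a factor [1 + x_j ^ 2] of decay. *)
Lemma inv_fourier_decay (l : seq 'I_d) phi : schwartz phi ->
  exists2 M : R, 0 <= M & forall x,
    (\prod_(j <- l) (1 + tnth x j ^+ 2)) * normc (inv_fourier phi x) <= M.
Proof.
elim: l phi => [|j l IH] phi sp.
  have [cp _] := schwartz_good sp.
  exists (\int[mu]_y normc (phi y)); first by apply: Rintegral_ge0 => y _; exact: normc_ge0.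
  by move=> x; rewrite big_nil mul1r; exact: normc_inv_fourier1.
have sp1 := schwartz_partial j sp; have sp2 := schwartz_partial j sp1.
have [M1 M10 h1] := IH phi sp; have [M2 M20 h2] := IH _ sp2.
exists (M1 + M2); first exact: addr_ge0.
move=> x; have := h2 x; have := h1 x; rewrite inv_fourier_partial// inv_fourier_partial//.
rewrite big_cons; move: (inv_fourier phi x) (\prod_(i <- l) _) => w p.
rewrite !normcM normc_pureim normrN -[tnth x j ^+ 2]real_normK ?num_real// => b1 b2.
have -> : (1 + `|tnth x j| ^+ 2) * p * normc w =
  p * normc w + p * (`|tnth x j| * (`|tnth x j| * normc w)) by ring.
exact: lerD.
Qed.

Lemma inv_fourier_good phi : schwartz phi -> good (inv_fourier phi).
Proof.
move=> sp; have [cp _] := schwartz_good sp.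
have mi := cmeasurable_inv_fourier (schwartz_cmeasurable sp).
split; last by exists (\int[mu]_y normc (phi y)) => x; exact: normc_inv_fourier1.
have [M M0 hM] := inv_fourier_decay (index_enum 'I_d) sp.
apply: (cintegrable_dom mi (G := fun x => M * jweight x)); last exact/integrable_mull/integrable_jweight.
move=> x; have := hM x; rewrite mulrC -ler_pdivlMr; last first.
  by apply: prodr_gt0 => j _; rewrite ltr_pwDl// sqr_ge0.
by rewrite /jweight prodfV.
Qed.

Lemma ray_cvg (x y : Rd) j : (fun n => tnth (tsub x (tscale n.+1%:R^-1 y)) j) @ \oo --> tnth x j.
Proof.
apply: (cvg_le_invn (c := `|tnth y j|)) => n.
by rewrite !tnthE addrAC subrr add0r normrN normrM mulrC [X in _ * X]ger0_norm ?invr_ge0.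
Qed.

Lemma dot_cvg (u v : nat -> Rd) (x y : Rd) : (forall j, (fun n => tnth (u n) j) @ \oo --> tnth x j) ->
  (forall j, (fun n => tnth (v n) j) @ \oo --> tnth y j) ->
  (fun n => dot (u n) (v n)) @ \oo --> dot x y.
Proof. by move=> ux vy; apply: cvg_big => [|j _]; [exact: add_continuous|exact: cvgM]. Qed.

Lemma inv_fourier_ray phi : schwartz phi -> ray_continuous (inv_fourier phi).
Proof.
move=> sp x y; have [cp _] := schwartz_good sp.
have mp := schwartz_cmeasurable sp.
rewrite /inv_fourier; apply: ccvgM; first exact: ccvg_cst.
apply: (cintegral_cvg (G := fun y => normc (phi y))).
- by move=> n; apply: cmeasurableM => //; exact: cmeasurable_phase1.
- move=> z; apply: ccvgM; last exact: ccvg_cst.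
  apply: ccvg_expi; apply: dot_cvg => j; [exact: ray_cvg|exact: cvg_cst].
- by move=> n z; rewrite normc_expiM.
- exact: integrable_normc.
Qed.

Lemma phase_good (t : R) (g : Rd -> R[i]) : good g -> good (fun x => phase t x * g x).
Proof.
move=> [cg [B gB]]; split; last by exists B => x; rewrite normc_expiM.
apply: (cintegrableMb (B := 1)) => //; last by move=> x; rewrite normc_expi.
exact: jmeas_sec jmeas_phase.
Qed.

Lemma phase_ray (t : R) (g : Rd -> R[i]) : ray_continuous g -> ray_continuous (fun x => phase t x * g x).
Proof.
move=> rg x y; apply: ccvgM => //; apply: ccvg_expi; apply: cvgM; first exact: cvg_cst.
by rewrite /quart expr2; apply: cvgM; apply: dot_cvg => j; exact: ray_cvg.
Qed.

End schwartz_facts.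

(** * From the fixed point to a solution *)

Section norms.
Context {R : realType} (d1 : measure_display) (T : measurableType d1).
Variable m : {measure set T -> \bar R}.
Implicit Types f : T -> R[i].

Lemma cLnorm2E f : cLnorm m 2%:E f = ((\int[m]_x (normc (f x) ^+ 2)%:E) `^ 2^-1)%E.
Proof.
rewrite /cLnorm unlock; congr (_ `^ _)%E; apply: eq_integral => x _ /=.
by rewrite ger0_norm ?normc_ge0// powR_mulrn ?normc_ge0.
Qed.

Lemma cLnorm2_le f (c : R) : 0 <= c -> (\int[m]_x (normc (f x) ^+ 2)%:E <= (c ^+ 2)%:E)%E ->
  (cLnorm m 2%:E f <= c%:E)%E.
Proof.
move=> c0 h; rewrite cLnorm2E.
have -> : c%:E = ((c ^+ 2)%:E `^ 2^-1)%E.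
  by rewrite poweR_EFin powR12_sqrt ?sqr_ge0// sqrtr_sqr ger0_norm.
have i0 : (0 <= \int[m]_x (normc (f x) ^+ 2)%:E)%E.
  by apply: integral_ge0 => x _; rewrite lee_fin sqr_ge0.
by apply: gt0_ler_poweR => //; rewrite in_itv/= ?lee_fin ?sqr_ge0 ?i0 leey.
Qed.

Lemma cLnormoo_le f (c : R) : 0 <= c -> (forall x, normc (f x) <= c) ->
  (cLnorm m +oo%E f <= c%:E)%E.
Proof.
move=> c0 h; rewrite /cLnorm unlock; case: ifP => _; last by rewrite lee_fin.
by apply/ess_supP/nearW => x /=; rewrite lee_fin ger0_norm ?normc_ge0.
Qed.

End norms.

Section solution_of_limit.
Context {R : realType} {d : nat}.
Local Notation Rd := (d.-tuple R).
Local Notation mu := (@leb R d).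
Local Notation lam := (@lebesgue_measure R).
Local Notation time := (measurableTypeR R).
Implicit Types (f : Rd -> R[i]) (F G : Rd -> R).

Lemma inv_fourierB f g x : cintegrable mu f -> cintegrable mu g ->
  inv_fourier f x - inv_fourier g x = inv_fourier (fun y => f y - g y) x.
Proof.
move=> cf cg; rewrite /inv_fourier -mulrBr -cintegralB; do ?exact: cintegrable_phase.
by congr (_ * _); apply: eq_cintegral => y; rewrite mulrBr.
Qed.

(** The L^2 norm comes from Plancherel's inequality, the L^oo norm from the
    mass. *)
Lemma inv_fourier_norms f (B e : R) : cintegrable mu f -> (forall x, normc (f x) <= B) ->
  0 <= B -> 0 <= e -> \int[mu]_x normc (f x) <= e ->
  (cLnorm mu 2%:E (inv_fourier f) <= (Num.sqrt (B * e))%:E)%E /\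
  (cLnorm mu +oo%E (inv_fourier f) <= e%:E)%E.
Proof.
move=> cf fB B0 e0 fe; have [i1 i2] := plancherel_le cf fB; split; last first.
  by apply: cLnormoo_le => // x; apply: le_trans fe; exact: normc_inv_fourier1.
apply: cLnorm2_le; first exact: sqrtr_ge0.
rewrite -EFin_Rintegral// lee_fin sqr_sqrtr ?mulr_ge0//.
by apply: le_trans i2 _; rewrite ler_wpM2l.
Qed.

Lemma cut_diff_le (T t r tau : R) :
  `|cut T r tau - cut T t tau| <= \1_(`[Num.min r t, Num.max r t]%classic) tau.
Proof.
rewrite /cut indicE mem_setE in_itv/= ge_min le_max.
case: (0 <= tau <= T); rewrite ?subrr ?normr0 ?ler0n//=.
case: (leP tau r) => h1; case: (leP tau t) => h2 /=; rewrite ?subrr ?subr0 ?sub0r ?normrN ?normr1 ?normr0 ?ler0n//.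
  by rewrite (ltW h2) orbT.
by rewrite (ltW h1) ?orbT.
Qed.

Lemma Rintegral_itv_le (a b : R) : a <= b ->
  lam.-integrable setT (EFin \o (\1_(`[a, b]%classic) : R -> R)) /\
  \int[lam]_x (\1_(`[a, b]%classic) x) = b - a.
Proof.
move=> ab.
have E : (\int[lam]_x (\1_(`[a, b]%classic) x)%:E = (b - a)%:E)%E.
  transitivity (lam (`[a, b]%classic `&` setT)).
    by apply: integral_indic => //; exact: measurable_itv.
  rewrite setIT lebesgue_measure_itv/= lte_fin; case: ifPn => //.
  by rewrite -leNgt => ba; rewrite (_ : b = a) ?subrr//; apply/le_anti; rewrite ba ab.
have i : lam.-integrable setT (EFin \o (\1_(`[a, b]%classic) : R -> R)).
  apply: ge0_integrableP; first exact: measurable_indic.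
    by move=> x; rewrite indicE.
  by rewrite E ltry.
by split => //; apply: EFin_inj; rewrite EFin_Rintegral.
Qed.

Section fixed.
Variables (m T K : R).
Hypothesis m1 : `|m| = 1.
Hypothesis T0 : 0 <= T.
Hypothesis K0 : 0 <= K.
Hypothesis th : theta T K <= 2^-1.
Variables (b : Rd -> R) (B : R).
Hypotheses (mb : measurable_fun setT b) (b0 : forall x, 0 <= b x)
  (bB : forall x, b x <= B) (ib : mu.-integrable setT (EFin \o b))
  (bK : \int[mu]_x b x <= K).
Variables (f : Rd -> R[i]).
Hypotheses (mf : cmeasurable f) (fb : forall x, normc (f x) <= b x).

Local Notation h := (@hlim R d m T f).
Local Notation M := (@Mlim R d T b).
Definition sol (t : R) : Rd -> R[i] := inv_fourier (h t).

Let pM := rpair_Mlim T0 K0 th mb b0 bB ib bK 0.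
Let jh : jmeas h := jmeas_hlim m1 T0 K0 th mb b0 bB ib bK mf fb.
Let mh t : cmeasurable (h t) := jmeas_sec t jh.
Let hM t x : normc (h t x) <= M x := hlim_le m1 T0 K0 th mb b0 bB ib bK mf fb t x.
Let hE t x : h t x = Phi m T f h t x := hlim_fixpoint m1 T0 K0 th mb b0 bB ib bK mf fb t x.
Let M0 := rpair_ge0 pM.
Let MB := rp_sup pM.
Let iM := rp_int pM.
Let MK := rp_mass pM.
Let pMM : rpair M M (2 * K) (2 * B) 0 0 := rpair_diag (rp_meas pM) M0 MB iM MK.
Let pQ := rpair_quint pMM.
Let ch t : cdom (h t) (h t) M M := cdom_diag (mh t) (hM t).
Let cq t := cdom_quint pMM (ch t).
Let B0 : 0 <= B. Proof. exact: le_trans (b0 (tcst 0)) (bB _). Qed.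

Let jq : jmeas (fun tau => cquint (h tau)). Proof. exact: jmeas_quint. Qed.
Let qM tau x : normc (cquint (h tau) x) <= rquint M x.
Proof. by have [_ _ q _] := cq tau; exact: q. Qed.

Lemma hlim_good t : good (h t). Proof. exact: (rpair_good pMM (mh t) (hM t)). Qed.

Lemma quint_good t : good (cquint (h t)).
Proof. exact: (rpair_good pQ (jmeas_sec t jq) (qM t)). Qed.

Lemma duh0 x : duh T (fun tau => cquint (h tau)) 0 x = 0.
Proof.
have [i e] := @Rintegral_itv_le 0 0 (lexx 0).
have h1 : normc (duh T (fun tau => cquint (h tau)) 0 x) <=
    rquint M x * \int[lam]_x (\1_(`[0, 0]%classic) x).
  rewrite -RintegralZl//; apply: normc_cintegral_le.
  - apply: (@cintegrable_cut _ _ _ _ (rquint M x)); first exact: (cmeasurable_duh_arg 0 x jq).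
    by move=> tau; rewrite normc_expiM.
  - exact: integrable_mull.
  - move=> tau; rewrite normcM normc_real ger0_norm ?cut_ge0// normc_expiM mulrC.
    apply: ler_pM; rewrite ?normc_ge0 ?cut_ge0//.
    rewrite /cut indicE mem_setE in_itv/= ler_nat.
    by case: (0 <= tau); case: (tau <= 0); case: (tau <= T).
rewrite e subrr mulr0 in h1; apply: Normc.eq0_normc; apply/le_anti.
by rewrite h1 normc_ge0.
Qed.

Lemma hlim0 x : h 0 x = f x.
Proof. by rewrite hE /Phi duh0 mulr0 addr0 /phase mul0r expi0 mul1r. Qed.

(** The Duhamel terms at times [r] and [t] differ by the rotation [phase (r -
    t)] and by the integral over the times between [r] and [t]. *)
Lemma duh_cvg (u : nat -> R) (t : R) x : u @ \oo --> t ->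
  ccvg (fun n => duh T (fun tau => cquint (h tau)) (u n) x) (duh T (fun tau => cquint (h tau)) t x).
Proof.
move=> ut; set g := fun tau => cquint (h tau).
have est r : normc (duh T g r x - phase (r - t) x * duh T g t x) <= rquint M x * `|r - t|.
  have gx tau (s : R) : normc (phase (s - tau) x * g tau x) <= rquint M x.
    by rewrite normc_expiM; exact: qM.
  have ci s := @cintegrable_cut R T s _ _ (cmeasurable_duh_arg s x jq) (fun tau => gx tau s).
  rewrite /duh -cintegralZ// -cintegralB//; last exact: cintegrableZ.
  have mm : Num.min r t <= Num.max r t by rewrite ge_min le_max lexx.
  have [i e] := Rintegral_itv_le mm.
  have -> : `|r - t| = Num.max r t - Num.min r t.
    case: (leP r t) => rt; first by rewrite distrC ger0_norm// subr_ge0.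
    by rewrite ger0_norm// subr_ge0 ltW.
  rewrite -e -RintegralZl//; apply: normc_cintegral_le.
  - by apply: cintegrableB => //; exact: cintegrableZ.
  - exact: integrable_mull.
  - move=> tau.
    have -> : (cut T r tau)%:C * (phase (r - tau) x * g tau x) -
      phase (r - t) x * ((cut T t tau)%:C * (phase (t - tau) x * g tau x)) =
      (cut T r tau - cut T t tau)%:C * (phase (r - tau) x * g tau x).
      have -> : phase (r - tau) x = phase (r - t) x * phase (t - tau) x.
        by rewrite /phase -expiD -mulrDl addrA subrK.
      rewrite (_ : (cut T r tau - cut T t tau)%:C = (cut T r tau)%:C - (cut T t tau)%:C); last by rewrite rmorphB.
      by move: ((cut T r tau)%:C) ((cut T t tau)%:C) (phase (r - t) x) (phase (t - tau) x) (g tau x) => p q a c w; ring.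
    rewrite normcM normc_real mulrC; apply: ler_pM; rewrite ?normc_ge0//.
    exact: cut_diff_le.
apply/ccvg_dist.
pose G n := rquint M x * `|u n - t| + normc (phase (u n - t) x - 1) * normc (duh T g t x).
have G0 : G @ \oo --> (rquint M x * 0 + 0 * normc (duh T g t x) : R).
  have ut0 : (fun n => u n - t) @ \oo --> (0 : R) by apply/subr_cvg0.
  apply: cvgD; apply: cvgM; try exact: cvg_cst.
    by rewrite -(normr0 R); apply: cvg_norm.
  have /ccvg_dist : ccvg (fun n => phase (u n - t) x) (phase 0 x).
    by apply: ccvg_expi; apply: cvgM => //; exact: cvg_cst.
  by rewrite {2}/phase mul0r expi0.
rewrite mulr0 mul0r addr0 in G0.
apply: (@squeeze_cvgr _ _ _ _ (fun=> 0) G) => //; last exact: cvg_cst.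
near=> n; rewrite normc_ge0/=.
have -> : duh T g (u n) x - duh T g t x = (duh T g (u n) x - phase (u n - t) x * duh T g t x) +
   (phase (u n - t) x - 1) * duh T g t x.
  by move: (duh T g t x) (duh T g (u n) x) (phase _ _) => p q w; ring.
apply: le_trans (normcD _ _) _; rewrite normcM; apply: lerD; first exact: est.
by [].
Unshelve. all: by end_near. Qed.

Lemma hlim_time_cvg (u : nat -> R) (t : R) : u @ \oo --> t ->
  (fun n => \int[mu]_x normc (h (u n) x - h t x)) @ \oo --> (0 : R).
Proof.
move=> ut.
suff : (fun n => \int[mu]_x normc (h (u n) x - h t x)) @ \oo --> \int[mu]_x (0 : R).
  by rewrite Rintegral_cst// mul0r.
apply: (Rintegral_cvg (G := fun x => 2 * M x)).
- by move=> n; apply: measurable_normc; exact: cmeasurableB.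
- move=> x; apply/ccvg_dist; rewrite (hE t).
  rewrite (_ : (fun n => _) = (fun n => Phi m T f h (u n) x)); last by apply/funext => n; exact: hE.
  apply: ccvgD; last by apply: ccvgM; [exact: ccvg_cst|exact: duh_cvg].
  apply: ccvgM; last exact: ccvg_cst.
  by apply: ccvg_expi; apply: cvgM => //; exact: cvg_cst.
- move=> n x; rewrite ger0_norm ?normc_ge0//; apply: le_trans (normcB _ _) _.
  by rewrite mulr_natl mulr2n lerD.
- exact: integrable_mull.
Qed.

Lemma hlim_time_continuous (t e : R) : 0 < e -> exists2 delta : R, 0 < delta &
  forall r, `|r - t| < delta -> \int[mu]_x normc (h r x - h t x) < e.
Proof.
move=> e0; apply: contrapT => H.
have ex n : exists r, `|r - t| < n.+1%:R^-1 /\ e <= \int[mu]_x normc (h r x - h t x).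
  apply: contrapT => nr; apply: H; exists n.+1%:R^-1; first by rewrite invr_gt0.
  by move=> r rt; rewrite ltNge; apply/negP => er; apply: nr; exists r.
have [u uP] := choice ex.
have ut : u @ \oo --> t.
  by apply: (cvg_le_invn (c := 1)) => n; rewrite mul1r ltW// (uP n).1.
suff : e <= 0 by rewrite leNgt e0.
by apply: (cvgr_to_ge (hlim_time_cvg ut)); near=> n; exact: (uP n).2.
Unshelve. all: by end_near. Qed.

Lemma sol_L2Loo t : in_L2Loo (sol t).
Proof.
have [c [C hC]] := hlim_good t.
have C0 : 0 <= C by apply: le_trans (hC (tcst 0)); exact: normc_ge0.
have i0 : 0 <= \int[mu]_x normc (h t x) by apply: Rintegral_ge0 => x _; exact: normc_ge0.
have [n1 n2] := inv_fourier_norms c hC C0 i0 (lexx _).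
split; first exact: cmeasurable_inv_fourier.
  by apply: le_lt_trans n1 _; rewrite ltry.
by apply: le_lt_trans n2 _; rewrite ltry.
Qed.

Lemma sol_continuous : continuous_L2Loo T sol.
Proof.
split=> [t _|t _ e e0]; first exact: sol_L2Loo.
(* Differences of [h] are bounded by [4 * B]; the constant is made positive in
    order to divide by it. *)
pose B4 := 4 * B + 1.
have B40 : 0 < B4 by rewrite /B4; have := B0; lra.
pose e' := Num.min (e / 2) ((e / 2) ^+ 2 / B4).
have e20 : 0 < e / 2 by rewrite divr_gt0.
have e'0 : 0 < e' by rewrite lt_min e20 divr_gt0// exprn_gt0.
have [delta d0 dP] := hlim_time_continuous t e'0.
exists delta => // r _ rt; have {}dP := ltW (dP r rt).
have [cr _] := hlim_good r; have [ct _] := hlim_good t.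
have E : (fun x => sol r x - sol t x) = inv_fourier (fun x => h r x - h t x).
  by apply/funext => x; exact: inv_fourierB.
have bd x : normc (h r x - h t x) <= B4.
  apply: le_trans (normcB _ _) _; have := hM r x; have := hM t x; have := MB x.
  by rewrite /B4; lra.
have [n1 n2] := inv_fourier_norms (cintegrableB cr ct) bd (ltW B40) (ltW e'0) dP.
rewrite E; split.
  apply: le_lt_trans n1 _; rewrite lte_fin; apply: (@le_lt_trans _ _ (e / 2)); last lra.
  rewrite -(ger0_norm (ltW e20)) -sqrtr_sqr ler_sqrt ?sqr_ge0//.
  apply: (@le_trans _ _ (B4 * ((e / 2) ^+ 2 / B4))).
    by apply: ler_wpM2l; [exact: ltW|rewrite /e' ge_min lexx orbT].
  by rewrite mulrC divfK// gt_eqF.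
apply: le_lt_trans n2 _; rewrite lte_fin; apply: (@le_lt_trans _ _ (e / 2)); last lra.
by rewrite /e' ge_min lexx.
Qed.

Lemma cintegral_itv_cut (t : R) (F : R -> R[i]) : 0 <= t <= T ->
  cintegral lam `[0, t] F = cintegral lam setT (fun tau => (cut T t tau)%:C * F tau).
Proof.
move=> /andP[t0 tT].
have c tau : (cut T t tau) = if (tau \in `[0, t]) then 1 else 0.
  rewrite /cut in_itv/=; case: (leP 0 tau) => //= h1; case: (leP tau t) => h2; rewrite ?andbF ?andbT//.
  by rewrite (le_trans h2).
Transparent cintegral.
rewrite /cintegral; congr (_ +i* _); rewrite Rintegral_mkcond; congr Rintegral;
  apply/funext => tau; rewrite /patch mem_setE c; case: ifP => _;
  by case: (F tau) => p q; rewrite /= ?mul1r ?mul0r ?subr0 ?addr0.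
Qed.

Local Opaque cintegral.

Lemma propagatorE (t : R) (v : Rd -> R[i]) phi :
  propagator t (of_fun v) phi =
  cintegral mu setT (fun x => v x * fourier (fun xi => phase t xi * inv_fourier phi xi) x).
Proof. by []. Qed.

(** Parseval's identity against the test function [phase t * inv_fourier phi].
    *)
Lemma propagator_inv_fourier (t : R) (g : Rd -> R[i]) phi : good g -> schwartz phi ->
  propagator t (of_fun (inv_fourier g)) phi =
  cintegral mu setT (fun x => g x * (phase t x * inv_fourier phi x)).
Proof.
move=> gg sp; rewrite propagatorE.
by have [_ ->] := parseval gg (phase_good t (inv_fourier_good sp)) (phase_ray t (inv_fourier_ray sp)).
Qed.

(** By Parseval each term of the formula is an integral over frequencies against
    [P = inv_fourier phi]; it remains to exchange the integrals in time and in
    frequency and to use the fixed point equation of [hlim]. *)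
Lemma sol_duhamel : duhamel m T sol.
Proof.
move=> t tT phi sp; have [cp _] := schwartz_good sp.
have gp := inv_fourier_good sp; set P := inv_fourier phi in gp *.
have [ip [CP PB]] := gp.
have mP := cintegrable_cmeasurable ip.
rewrite propagator_inv_fourier//; last exact: hlim_good.
rewrite cintegral_itv_cut//.
rewrite (_ : (fun tau => _ * propagator _ _ _) = (fun tau => (cut T t tau)%:C *
   cintegral mu setT (fun x => cquint (h tau) x * (phase (t - tau) x * P x)))); last first.
  apply/funext => tau; congr (_ * _).
  rewrite (quintic_inv_fourier (hlim_good tau)) propagator_inv_fourier//.
  exact: quint_good.
transitivity (cintegral mu setT (fun x => P x * h t x)).
  transitivity (cintegral mu setT (fun x => phi x * inv_fourier (h t) x)).
    by apply: eq_cintegral => x; rewrite mulrC.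
  rewrite (mul_inv_fourier cp (hlim_good t).1).
  by apply: eq_cintegral => x; rewrite mulrC.
have c1 : cintegrable mu (fun x => h 0 x * (phase t x * P x)).
  have [_ [C hC]] := hlim_good 0.
  apply: (cintegrableMb (B := C)) => //.
  by have [] := phase_good t gp.
have dM x : normc (duh T (fun tau => cquint (h tau)) t x) <= T * rquint M x by exact: normc_duh_le.
have c2 : cintegrable mu (fun x => duh T (fun tau => cquint (h tau)) t x * P x).
  apply: (cintegrable_dom (G := fun x => CP * (T * rquint M x))).
  - by apply: cmeasurableM => //; exact: jmeas_sec (jmeas_duh T jq).
  - by move=> x; rewrite normcM mulrC ler_pM ?normc_ge0.
  - by apply: integrable_mull; apply: integrable_mull; exact: (rp_int pQ).
transitivity (cintegral mu setT (fun x => h 0 x * (phase t x * P x)) +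
  (0 +i* m) * cintegral mu setT (fun x => duh T (fun tau => cquint (h tau)) t x * P x)).
  rewrite -cintegralZ// -cintegralD//; last exact: cintegrableZ.
  apply: eq_cintegral => x; rewrite hlim0 hE /Phi.
  by move: (phase t x) (P x) (f x) (duh _ _ _ _) => p q r w; ring.
congr (_ + _ * _).
transitivity (cintegral mu setT (fun x => cintegral lam setT (fun tau =>
   (cut T t tau)%:C * (phase (t - tau) x * cquint (h tau) x) * P x))).
  apply: eq_cintegral => x; rewrite mulrC -cintegralZ.
    by apply: eq_cintegral => tau; rewrite mulrC.
  apply: (@cintegrable_cut _ _ _ _ (rquint M x)); first exact: (cmeasurable_duh_arg t x jq).
  by move=> tau; rewrite normc_expiM.
rewrite (@cintegral_swap _ _ _ _ _ mu lam (fun z : Rd * time =>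
    (cut T t z.2)%:C * (phase (t - z.2) z.1 * cquint (h z.2) z.1) * P z.1)
    (fun z => cut T t z.2 * (CP * rquint M z.1))).
- apply: eq_cintegral => tau; rewrite -cintegralZ.
    apply: eq_cintegral => x /=; rewrite -[LHS]mulrA; congr (_ * _).
    by rewrite -mulrA mulrCA.
  have [cq1 _] := quint_good tau.
  have [g1 [C gC]] := phase_good (t - tau) gp.
  rewrite (_ : (fun x => _) = (fun x => (phase (t - tau) x * P x) * cquint (h tau) x)).
    apply: (cintegrableMb (B := C)) => //; exact: cintegrable_cmeasurable g1.
  by apply/funext => x; rewrite mulrC.
- have s1 : measurable_fun setT (fun z : Rd * time => z.1) by exact: measurable_fst.
  have s2 : measurable_fun setT (fun z : Rd * time => z.2 : time) by exact: measurable_snd.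
  apply: cmeasurableM; last exact: cmeasurable_comp.
  apply: cmeasurableM.
    apply: cmeasurable_real; apply: (measurableT_comp (measurable_cut T)
      (g := fun z : Rd * time => (t : time, z.2))).
    by apply: measurable_fun_pair => //; exact: measurable_cst.
  apply: cmeasurableM.
    apply: cmeasurable_expi; apply: measurable_funM; first by apply: measurable_funB => //; exact: measurable_cst.
    exact: (measurableT_comp measurable_quart).
  by apply: (cmeasurable_comp jq (h := fun z : Rd * time => (z.2, z.1))); exact: measurable_fun_pair.
- apply: measurable_funM.
    apply: (measurableT_comp (measurable_cut T) (g := fun z : Rd * time => (t : time, z.2))).
    by apply: measurable_fun_pair; [exact: measurable_cst|exact: measurable_snd].
  apply: measurable_funM; first exact: measurable_cst.
  by apply: measurableT_comp; [exact: (rp_meas pQ)|exact: measurable_fst].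
- move=> [x tau]; rewrite -[(x, tau).1]/x -[(x, tau).2]/tau.
  have hp := PB x; have hq := qM tau x; move: (P x) (cquint (h tau) x) hp hq => w q hp hq.
  rewrite normcM normcM normc_real ger0_norm ?cut_ge0// normc_expiM -mulrA ler_wpM2l ?cut_ge0//.
  by rewrite mulrC ler_pM ?normc_ge0.
- move=> x /=; under eq_fun do rewrite mulrC.
  exact/integrable_mull/integrable_cut.
- move=> tau /=; apply: integrable_mull; apply: integrable_mull; exact: (rp_int pQ).
- rewrite (_ : (fun x => _) = EFin \o (fun x => (\int[lam]_tau cut T t tau * CP) * rquint M x)).
    exact/integrable_mull/(rp_int pQ).
  apply/funext => x /=; congr (_%:E).
  under eq_Rintegral do rewrite mulrC.
  by rewrite RintegralZl//; [ring|exact: integrable_cut].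
Qed.

Lemma sol_solution : solution m T sol.
Proof. by split; [exact: sol_continuous|exact: sol_duhamel]. Qed.

End fixed.
End solution_of_limit.

(** * Interactions of frequency boxes *)

Section boxes.
Context {R : realType} {d : nat}.
Local Notation Rd := (d.-tuple R).
Local Notation mu := (@leb R d).
Implicit Types (F G : Rd -> R).

Definition inbox (c r : R) (x : Rd) : Prop := forall j, `|tnth x j - c| <= r.

Definition ind (c r : R) : R -> R := \1_(`[c - r, c + r]%classic).

Definition chi (c r : R) (x : Rd) : R := \prod_(j < d) ind c r (tnth x j).

Lemma ind_itv (c r y : R) : ind c r y = (nat_of_bool (`|y - c| <= r)%R)%:R.
Proof.
rewrite /ind indicE mem_setE in_itv/= ler_norml; congr (nat_of_bool _)%:R.
by apply/andP/andP => -[h1 h2]; split; lra.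
Qed.

Lemma chi_ge0 c r x : 0 <= chi c r x.
Proof. by apply: prodr_ge0 => j _; rewrite ind_itv. Qed.

Lemma chi_le1 c r x : chi c r x <= 1.
Proof.
have := @ler_prod_expn R d (fun j => ind c r (tnth x j)) 1.
by rewrite expr1n; apply => j; rewrite ind_itv ler0n lern1 leq_b1.
Qed.

Lemma chi_in c r x : inbox c r x -> chi c r x = 1.
Proof. by move=> h; rewrite /chi big1// => j _; rewrite ind_itv h. Qed.

Lemma chi_out c r x j : r < `|tnth x j - c| -> chi c r x = 0.
Proof. by move=> h; rewrite /chi (bigD1 j)//= ind_itv leNgt h mul0r. Qed.

Lemma chi_inP c r x : inbox c r x \/ chi c r x = 0.
Proof.
have [/existsP[j h]|h] := boolP [exists j, r < `|tnth x j - c|].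
  by right; exact: (chi_out h).
by left => j; rewrite leNgt; apply: contra h => h; apply/existsP; exists j.
Qed.

Lemma measurable_chi c r : measurable_fun setT (chi c r).
Proof.
apply: measurable_prod => j _; apply: (measurableT_comp (f := ind c r)).
  by apply: measurable_indic; exact: measurable_itv.
exact: measurable_tnth.
Qed.

Lemma integrable_chi c r : 0 <= r -> mu.-integrable setT (EFin \o chi c r).
Proof.
move=> r0; have cr : c - r <= c + r by lra.
apply: (integrable_prod (f := fun=> ind c r)) => [j|j x].
  by have [] := Rintegral_itv_le cr.
by rewrite ind_itv.
Qed.

Lemma Rintegral_chi c r : 0 <= r -> \int[mu]_x chi c r x = (2 * r) ^+ d.
Proof.
move=> r0; have cr : c - r <= c + r by lra.
have [i e] := Rintegral_itv_le cr.
rewrite /chi (Rintegral_prod (f := fun=> ind c r))//.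
  rewrite /ind; under eq_bigr do rewrite e.
  by rewrite prodr_const card_ord; congr (_ ^+ _); ring.
Qed.

(** If [y] runs over the box of [G] then [x - y] stays in the box of [F], whose
    radius is twice as large to leave room for this. *)
Lemma rconv_box F G (B a b p q r : R) (x : Rd) :
  measurable_fun setT F -> (forall x, 0 <= F x) -> (forall x, F x <= B) ->
  mu.-integrable setT (EFin \o G) -> (forall x, 0 <= G x) ->
  0 <= p -> 0 <= q -> 0 <= r ->
  (forall y, inbox a (2 * r) y -> p <= F y) -> (forall y, inbox b r y -> q <= G y) ->
  inbox (a + b) r x -> @cpi R d * (p * q * (2 * r) ^+ d) <= rconv F G x.
Proof.
move=> mF F0 FB iG G0 p0 q0 r0 Fp Gq hx.
rewrite /rconv; apply: ler_wpM2l; first exact/ltW/cpi_gt0.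
rewrite -(Rintegral_chi b r0) -RintegralZl//; last exact: integrable_chi.
apply: le_Rintegral => //.
- by apply: integrable_mull; exact: integrable_chi.
- exact: (integrable_rconv_sec mF F0 FB iG G0 x).
- move=> y _; have [hy|->] := chi_inP b r y; last by rewrite mulr0 mulr_ge0.
  rewrite chi_in// mulr1; apply: ler_pM => //; last exact: Gq.
  apply: Fp => j; rewrite tnthE.
  have -> : tnth x j - tnth y j - a = (tnth x j - (a + b)) - (tnth y j - b) by ring.
  apply: le_trans (ler_normB _ _) _; rewrite mulr_natl mulr2n lerD//.
Qed.

Definition supp (L : R) F := forall x j, L < `|tnth x j| -> F x = 0.

Lemma supp_rconv L L' F G : supp L F -> supp L' G -> supp (L + L') (rconv F G).
Proof.
move=> sF sG x j h; rewrite /rconv (_ : (fun y => _) = (fun=> 0)).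
  by rewrite Rintegral_cst// mul0r mulr0.
apply/funext => y; have [hy|hy] := ltP L' `|tnth y j|; first by rewrite (sG y j hy) mulr0.
rewrite (sF (tsub x y) j) ?mul0r// tnthE.
have := ler_normB (tnth x j - tnth y j) (- tnth y j); rewrite opprK subrK normrN.
by lra.
Qed.

Lemma supp_rrefl L F : supp L F -> supp L (rrefl F).
Proof. by move=> sF x j h; rewrite /rrefl (sF _ j)// tnthE normrN. Qed.

Lemma supp_rquint L F : supp L F -> supp (5 * L) (rquint F).
Proof.
move=> sF; have s2 := supp_rconv sF (supp_rrefl sF).
have := supp_rconv (supp_rconv s2 s2) sF.
by rewrite (_ : L + L + (L + L) + L = 5 * L); [|ring].
Qed.

Section two_boxes.
Variables (A N al : R).
Hypotheses (A0 : 0 < A) (N0 : 0 < N) (al0 : 0 < al) (AN : 2 * A <= N).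

(** Two frequencies are needed: a single box around [N] only produces output
    near [N] again, whereas [N - 2 N] and [N - N] combine with [N] to return to
    the origin. *)
Definition twobox (x : Rd) : R := al * (chi N A x + chi (2 * N) A x).
Definition boxmass : R := al * (2 * A) ^+ d.

Local Notation F := twobox.
Let A0' : 0 <= A := ltW A0.

Lemma twobox_ge0 x : 0 <= F x.
Proof. by apply: mulr_ge0; [exact: ltW|apply: addr_ge0; exact: chi_ge0]. Qed.

Lemma twobox_le x : F x <= 2 * al.
Proof. rewrite mulrC; apply: ler_pM => //; try exact: ltW.
  by apply: addr_ge0; exact: chi_ge0.
by have := chi_le1 N A x; have := chi_le1 (2 * N) A x; lra. Qed.

Lemma measurable_twobox : measurable_fun setT F.
Proof. by apply: measurable_funM => //; apply: measurable_funD; exact: measurable_chi. Qed.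

Lemma integrable_twobox : mu.-integrable setT (EFin \o F).
Proof. by apply: integrable_mull; apply: integrableDr; exact: integrable_chi. Qed.

Lemma Rintegral_twobox : \int[mu]_x F x = 2 * boxmass.
Proof.
rewrite /twobox RintegralZl//; last by apply: integrableDr; exact: integrable_chi.
rewrite RintegralD//; do ?exact: integrable_chi.
by rewrite !Rintegral_chi// /boxmass; ring.
Qed.

Lemma twobox_far x j : F x != 0 -> N - A <= tnth x j <= 3 * N.
Proof.
rewrite /twobox mulf_eq0 negb_or => /andP[_ h].
have [h1|h1] := chi_inP N A x.
  by have := h1 j; rewrite ler_norml => /andP[? ?]; have := AN; have := A0; lra.
have [h2|h2] := chi_inP (2 * N) A x; last by rewrite h1 h2 addr0 eqxx in h.
by have := h2 j; rewrite ler_norml => /andP[? ?]; have := AN; have := A0; lra.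
Qed.

Lemma supp_twobox : supp (3 * N) F.
Proof.
move=> x j h; apply/eqP; apply: contraTT h => /(twobox_far j) /andP[h1 h2].
by rewrite -leNgt ler_norml; have := AN; have := A0; lra.
Qed.

Lemma twobox_in c x : c = N \/ c = 2 * N -> inbox c A x -> al <= F x.
Proof.
move=> hc hx; rewrite /twobox; apply: ler_peMr; first exact: ltW.
by case: hc => e; rewrite -e (chi_in hx); [rewrite lerDl|rewrite lerDr]; exact: chi_ge0.
Qed.

Lemma trefl_in c x : c = N \/ c = 2 * N -> inbox (- c) A x -> al <= rrefl F x.
Proof.
move=> hc hx; apply: (twobox_in hc) => j; rewrite tnthE.
by rewrite -normrN opprD !opprK; have := hx j; rewrite opprK.
Qed.

Lemma inbox_le c r r' (x : Rd) : r <= r' -> inbox c r x -> inbox c r' x.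
Proof. by move=> rr h j; exact: le_trans (h j) rr. Qed.

(** The interaction [(N - 2N) + (N - N) + N = 0] of frequencies brings mass back
    to the origin. *)
Lemma rquint_twobox x : inbox 0 (A / 8) x ->
  @cpi R d ^+ 4 * (8^-1) ^+ d * (al ^+ 5 * (A ^+ d) ^+ 4) <= rquint F x.
Proof.
move=> hx; set c := @cpi R d; have c0 : 0 <= c by rewrite ltW ?cpi_gt0.
have iF := integrable_twobox; have mF := measurable_twobox; have F0 := twobox_ge0.
have FB := twobox_le.
have p := rpair_diag mF F0 FB iF (lexx _); have pr := rpair_refl p.
have p2 := rpair_conv p pr; have p4 := rpair_conv p2 p2.
have A2 : 0 <= A / 2 by have := A0; lra.
have A4 : 0 <= A / 4 by have := A0; lra.
have A8 : 0 <= A / 8 by have := A0; lra.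
have Ad : 0 <= A ^+ d by rewrite exprn_ge0.
(* The interaction [N - 2 N = - N]. *)
have h1 y : inbox (- N) (A / 2) y -> c * (al * al * A ^+ d) <= rconv F (rrefl F) y.
  move=> hy; have := @rconv_box F (rrefl F) (2 * al) N (- (2 * N)) al al (A / 2) y mF F0 FB
    (rp_int pr) (rpair_ge0 pr) (ltW al0) (ltW al0) A2.
  rewrite (_ : 2 * (A / 2) = A); last by field.
  apply => //.
  - by move=> z; apply: twobox_in; left.
  - move=> z hz; apply: (@trefl_in (2 * N)); first by right.
    by apply: inbox_le hz; have := A0; lra.
  - by rewrite (_ : N + - (2 * N) = - N)//; ring.
(* The interaction [N - N = 0]. *)
have h2 y : inbox 0 (A / 2) y -> c * (al * al * A ^+ d) <= rconv F (rrefl F) y.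
  move=> hy; have := @rconv_box F (rrefl F) (2 * al) N (- N) al al (A / 2) y mF F0 FB
    (rp_int pr) (rpair_ge0 pr) (ltW al0) (ltW al0) A2.
  rewrite (_ : 2 * (A / 2) = A); last by field.
  apply => //.
  - by move=> z; apply: twobox_in; left.
  - move=> z hz; apply: (@trefl_in N); first by left.
    by apply: inbox_le hz; have := A0; lra.
  - by rewrite subrr.
set u := c * (al * al * A ^+ d) in h1 h2.
have u0 : 0 <= u by rewrite !mulr_ge0// ltW.
(* The sum of the two preceding interactions; [N] is added to it at the end. *)
have h3 y : inbox (- N) (A / 4) y ->
    c * (u * u * (A / 2) ^+ d) <= rconv (rconv F (rrefl F)) (rconv F (rrefl F)) y.
  move=> hy; have := @rconv_box _ _ _ (- N) 0 u u (A / 4) y (rp_meas p2) (rpair_ge0 p2) (rp_sup p2)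
    (rp_int p2) (rpair_ge0 p2) u0 u0 A4.
  rewrite (_ : 2 * (A / 4) = A / 2); last by field.
  apply => //.
  - by move=> z hz; apply: h2; apply: inbox_le hz; have := A0; lra.
  - by rewrite addr0.
set w := c * (u * u * (A / 2) ^+ d) in h3.
have w0 : 0 <= w.
  have A2d : 0 <= (A / 2) ^+ d by exact: exprn_ge0.
  by apply: mulr_ge0 => //; apply: mulr_ge0 => //; exact: mulr_ge0.
have := @rconv_box _ F _ (- N) N w al (A / 8) x (rp_meas p4) (rpair_ge0 p4) (rp_sup p4)
    iF F0 w0 (ltW al0) A8.
rewrite (_ : 2 * (A / 8) = A / 4); last by field.
move=> h; apply: (le_trans _ (h h3 _ _)).
- have e8 : (8^-1 : R) ^+ d = (2 ^+ d)^-1 * (4 ^+ d)^-1.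
    by rewrite -!exprVn -exprMn; congr (_ ^+ _); field.
  have e2 : (A / 2) ^+ d = A ^+ d * (2 ^+ d)^-1 by rewrite exprMn exprVn.
  have e4 : (A / 4) ^+ d = A ^+ d * (4 ^+ d)^-1 by rewrite exprMn exprVn.
  rewrite /w /u -/c e8 e2 e4; apply: ler_eq.
  by move: (A ^+ d) (2 ^+ d)^-1 (4 ^+ d)^-1 => X Y Z; clear; move: c => c'; ring.
- move=> z hz; apply: (@twobox_in N); first by left.
  by apply: inbox_le hz; have := A0; lra.
- by rewrite addNr.
Qed.

End two_boxes.
End boxes.

(** * The second iterate *)

Section phase_estimates.
Context {R : realType}.

Lemma sin_cos_le (a : R) : 0 <= a -> `|cos a - 1| <= a /\ `|sin a| <= a.
Proof.
move=> a0.
have dc (x : R) : is_derive x 1 (@cos R) (- sin x) by exact: is_derive_cos.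
have ds (x : R) : is_derive x 1 (@sin R) (cos x) by exact: is_derive_sin.
have hc := @mvt_le R (@cos R) 0 a 1 a0 (fun x => @ex_derive _ _ _ _ _ _ _ (dc x)).
have hs := @mvt_le R (@sin R) 0 a 1 a0 (fun x => @ex_derive _ _ _ _ _ _ _ (ds x)).
rewrite cos0 subr0 mul1r in hc; rewrite sin0 !subr0 mul1r in hs.
have ns (x : R) : `|sin x| <= 1 by rewrite ler_norml sin_geN1 sin_le1.
have nc (x : R) : `|cos x| <= 1 by rewrite ler_norml cos_geN1 cos_le1.
split; [apply: hc|apply: hs] => x _; rewrite derive1E.
  by rewrite (@derive_val _ _ _ _ _ _ _ (dc x)) normrN.
by rewrite (@derive_val _ _ _ _ _ _ _ (ds x)).
Qed.

Lemma normc_expi1 (a : R) : normc (expi a - 1) <= 2 * `|a|.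
Proof.
have key (c : R) : 0 <= c -> normc (expi c - 1) <= 2 * c.
  move=> /sin_cos_le[h1 h2]; apply: le_trans (normc_le_ReIm _) _.
  by rewrite /= subr0 mulr_natl mulr2n lerD.
have [a0|a0] := leP 0 a; first by rewrite ger0_norm// key.
rewrite -normc_conj (_ : conjc (expi a - 1) = expi (- a) - 1); last first.
  by rewrite expiN rmorphB rmorph1.
by rewrite ltr0_norm// key// oppr_ge0 ltW.
Qed.

End phase_estimates.

Section first_iterates.
Context {R : realType} {d : nat}.
Local Notation Rd := (d.-tuple R).
Local Notation mu := (@leb R d).
Local Notation lam := (@lebesgue_measure R).
Local Notation time := (measurableTypeR R).
Implicit Types (f : Rd -> R[i]) (F G : Rd -> R).

Lemma alg_free (p i q r : R[i]) : p + i * q - p - i * r = i * (q - r).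
Proof. by ring. Qed.

Lemma cquint0 : cquint (fun _ : Rd => 0 : R[i]) = fun=> 0.
Proof.
apply/funext => x; rewrite /cquint {1}/cconv (_ : (fun y => _) = (fun=> (0 : R)%:C)).
  by rewrite cintegral_real Rintegral_cst// mul0r mulr0.
by apply/funext => y; rewrite mulr0.
Qed.

Lemma hn1 (m T : R) f t x : hn m T f 1 t x = phase t x * f x.
Proof.
rewrite /= /Phi /duh (_ : (fun tau => _) = (fun=> (0 : R)%:C)).
  by rewrite cintegral_real Rintegral_cst// mul0r mulr0 addr0.
by apply/funext => y; rewrite cquint0 !mulr0.
Qed.

Lemma cconv_real F G : cconv (fun x => (F x)%:C) (fun x => (G x)%:C) = fun x => (rconv F G x)%:C.
Proof.
apply/funext => x.
transitivity ((@cpi R d)%:C * (\int[mu]_y (F (tsub x y) * G y))%:C); last by rewrite -rmorphM.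
rewrite /cconv; congr (_ * _); rewrite -(cintegral_real mu).
by apply: eq_cintegral => y; rewrite rmorphM.
Qed.

Lemma crefl_real F : crefl (fun x => (F x)%:C) = fun x => (rrefl F x)%:C.
Proof. by apply/funext => x; rewrite /crefl /rrefl /= oppr0. Qed.

Lemma cquint_real F : cquint (fun x => (F x)%:C) = fun x => (rquint F x)%:C.
Proof. by rewrite /cquint crefl_real !cconv_real. Qed.

Lemma rconvZ (c c' K B del eps K' B' del' eps' : R) F G :
  rpair F F K B del eps -> rpair G G K' B' del' eps' ->
  rconv (fun x => c * F x) (fun x => c' * G x) = (fun x => c * c' * rconv F G x).
Proof.
move=> p q; apply/funext => x; rewrite /rconv [RHS]mulrCA; congr (_ * _).
rewrite -RintegralZl//; first by congr Rintegral; apply/funext => y; ring.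
exact: (integrable_rconv_sec (rp_meas p) (rpair_ge0 p) (rp_sup p) (rp_int q) (rpair_ge0 q)).
Qed.

Lemma rquintZ (c K B del eps : R) F : rpair F F K B del eps ->
  rquint (fun x => c * F x) = (fun x => c ^+ 5 * rquint F x).
Proof.
move=> p; have pr := rpair_refl p; have p2 := rpair_conv p pr; have p4 := rpair_conv p2 p2.
rewrite /rquint (_ : rrefl (fun x => c * F x) = (fun x => c * rrefl F x))//.
rewrite (rconvZ c c p pr) (rconvZ _ _ p2 p2) (rconvZ _ _ p4 p).
by apply/funext => x; congr (_ * _); ring.
Qed.

Lemma cut_full T : cut T T = \1_(`[0, T]%classic) :> (R -> R).
Proof.
apply/funext => tau; rewrite /cut indicE mem_setE in_itv/=.
by case: (0 <= tau) => //=; case: (tau <= T).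
Qed.

Lemma Rintegral_cut T (c : R) : 0 <= T -> \int[lam]_tau (c * cut T T tau) = T * c.
Proof.
move=> T0; have [i e] := Rintegral_itv_le T0.
by rewrite cut_full RintegralZl// e subr0 mulrC.
Qed.

Lemma cintegral_cut T (c : R) : 0 <= T ->
  cintegral lam setT (fun tau => (cut T T tau)%:C * c%:C) = (T * c)%:C.
Proof.
move=> T0; rewrite -(Rintegral_cut c T0) -cintegral_real.
by apply: eq_cintegral => tau; rewrite -rmorphM mulrC.
Qed.

Lemma duh_close (T : R) (g : R -> Rd -> R[i]) x (q c : R) : 0 <= T -> 0 <= q -> 0 <= c -> jmeas g ->
  (forall tau, normc (phase (T - tau) x * g tau x) <= q) ->
  (forall tau, 0 <= tau <= T -> normc (phase (T - tau) x * g tau x - q%:C) <= c) ->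
  normc (duh T g T x - (T * q)%:C) <= T * c.
Proof.
move=> T0 q0 c0 jg gb gc; rewrite -cintegral_cut//.
have cg := @cintegrable_cut R T T _ _ (cmeasurable_duh_arg T x jg) gb.
have cQ : cintegrable lam (fun tau => (cut T T tau)%:C * q%:C).
  apply: (@cintegrable_cut R T T (fun=> q%:C) q); first exact: cmeasurable_cst.
  by move=> tau; rewrite normc_real ger0_norm.
rewrite /duh -cintegralB// -Rintegral_cut//.
apply: normc_cintegral_le; [exact: cintegrableB|exact/integrable_mull/integrable_cut|].
move=> tau; rewrite -mulrBr normcM normc_real ger0_norm ?cut_ge0// mulrC.
rewrite /cut; case: (boolP (0 <= tau <= T)) => h; last by rewrite !mulr0.
by apply: ler_pM; rewrite ?normc_ge0 ?ler0n//; exact: gc.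
Qed.

Section box_data.
Variables (A N al T m : R).
Hypotheses (A0 : 0 < A) (N0 : 0 < N) (al0 : 0 < al) (AN : 2 * A <= N).
Hypotheses (T0 : 0 <= T) (m1 : `|m| = 1).
Local Notation F := (@twobox R d A N al).
Local Notation Fc := (fun x : Rd => (F x)%:C).
Local Notation Q := (rquint F).
Local Notation S := (@boxmass R d A al).
(** A bound for [|phase t x - 1|] when [0 <= t <= T] and the coordinates of [x]
    are at most [15 * N], which covers the support of [rquint F]. *)
Definition kappa : R := 2 * (T * (d%:R * (15 * N) ^+ 2) ^+ 2).
Hypothesis k1 : kappa <= 1.

Let k0 : 0 <= kappa.
Proof. by rewrite /kappa mulr_ge0// mulr_ge0// sqr_ge0. Qed.

Let mF := @measurable_twobox R d A N al.
Let F0 : forall x, 0 <= F x := twobox_ge0 A N al0.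
Let FB : forall x, F x <= 2 * al := twobox_le A N al0.
Let iF := @integrable_twobox R d A N al A0.
Let pF : rpair F F (2 * S) (2 * al) 0 0.
Proof. by apply: rpair_diag => //; rewrite Rintegral_twobox. Qed.
Let pQ := rpair_quint pF.
Let cmF : cmeasurable Fc. Proof. exact: cmeasurable_real. Qed.

Lemma phase_close t (x : Rd) : 0 <= t <= T -> (forall j, `|tnth x j| <= 15 * N) ->
  normc (phase t x - 1) <= kappa.
Proof.
move=> /andP[t0 tT] hx; apply: le_trans (normc_expi1 _) _.
rewrite ler_wpM2l// ger0_norm; last by rewrite mulr_ge0// sqr_ge0.
apply: ler_pM => //; first exact: sqr_ge0.
have q0 : 0 <= d%:R * (15 * N) ^+ 2 by apply: mulr_ge0 => //; exact: sqr_ge0.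
rewrite /quart lerXn2r ?nnegrE ?dot_ge0//.
rewrite /dot mulr_natl (_ : _ *+ d = \sum_(j < d) (15 * N) ^+ 2); last by rewrite sumr_const card_ord.
apply: ler_sum => j _; rewrite -expr2 -real_normK ?num_real// lerXn2r ?nnegrE//.
by rewrite mulr_ge0// ltW.
Qed.

Let sF : supp (3 * N) F. Proof. exact: supp_twobox. Qed.
Let sQ : supp (15 * N) Q.
Proof. by rewrite (_ : 15 * N = 5 * (3 * N)); [exact: supp_rquint|ring]. Qed.

Lemma suppP (L : R) G (x : Rd) : supp L G -> (forall j, `|tnth x j| <= L) \/ G x = 0.
Proof.
move=> sG; have [/existsP[j h]|h] := boolP [exists j, L < `|tnth x j|].
  by right; exact: sG h.
by left => j; rewrite leNgt; apply: contra h => h; apply/existsP; exists j.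
Qed.

Lemma phase_closeM (L t : R) G (x : Rd) : L <= 15 * N -> supp L G -> 0 <= G x -> 0 <= t <= T ->
  normc (phase t x * (G x)%:C - (G x)%:C) <= kappa * G x.
Proof.
move=> LN sG G0 tT; have [h|->] := suppP x sG; last first.
  by rewrite mulr0 subrr mulr0 normc0R.
rewrite -[X in _ - X]mul1r -mulrBl normcM normc_real ger0_norm// ler_wpM2r//.
by apply: phase_close => // j; exact: le_trans (h j) LN.
Qed.

Let cm_phaseF t : cmeasurable (fun x => phase t x * Fc x).
Proof. by apply: cmeasurableM => //; exact: jmeas_sec jmeas_phase. Qed.

Let phaseF_le t x : normc (phase t x * Fc x) <= F x.
Proof. by rewrite normc_expiM normc_real ger0_norm. Qed.

Lemma cdom_phase t : 0 <= t <= T ->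
  cdom (fun x => phase t x * Fc x) Fc (fun x => (1 + kappa) * F x) F.
Proof.
move=> tT; split => //.
- by move=> x; rewrite normc_real ger0_norm.
- move=> x; rewrite mulrDl mul1r addrAC subrr add0r.
  by apply: (@phase_closeM (3 * N)) => //; have := N0; lra.
Qed.

Let pFk : exists K B del eps, rpair (fun x => (1 + kappa) * F x) F K B del eps.
Proof.
exists ((1 + kappa) * (2 * S)), ((1 + kappa) * (2 * al)), (kappa * (2 * al)), (kappa * (2 * S)).
have kk : 0 <= 1 + kappa by rewrite addr_ge0.
have e x : (1 + kappa) * F x - F x = kappa * F x by ring.
split => //.
- exact: measurable_funM.
- by move=> x; rewrite ler_peMl// lerDl.
- by move=> x; rewrite ler_wpM2l.
- exact: integrable_mull.
- by rewrite RintegralZl// Rintegral_twobox.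
- by move=> x; rewrite e ler_wpM2l.
- under eq_Rintegral do rewrite e.
  by rewrite RintegralZl// Rintegral_twobox.
Qed.

(** The constant [32] is [31] for the five inner phases, from [(1 + k) ^ 5 - 1
    <= 31 k] when [k <= 1], plus one for the outer phase. *)
Lemma kernel_close t r x : 0 <= t <= T -> 0 <= r <= T ->
  normc (phase t x * cquint (fun x => phase r x * Fc x) x - (Q x)%:C) <= 32 * kappa * Q x.
Proof.
move=> tT rT; have [K [B [del [eps p]]]] := pFk.
have Q0 := rpair_ge0 pQ x.
have [_ _ _ h] := cdom_quint p (cdom_phase rT).
have {}h := h x; rewrite cquint_real (rquintZ _ pF) in h.
set w := cquint _ x in h *.
have -> : phase t x * w - (Q x)%:C = phase t x * (w - (Q x)%:C) + (phase t x * (Q x)%:C - (Q x)%:C).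
  by move: (phase t x) (Q x)%:C => p' q'; ring.
apply: le_trans (normcD _ _) _; rewrite normc_expiM.
have h2 := phase_closeM (lexx _) sQ Q0 tT.
have : (1 + kappa) ^+ 5 * Q x - Q x <= 31 * kappa * Q x.
  rewrite -{2}[Q x]mul1r -mulrBl ler_wpM2r//.
  have -> : (1 + kappa) ^+ 5 - 1 = kappa * (5 + 10 * kappa + 10 * kappa ^+ 2 + 5 * kappa ^+ 3 + kappa ^+ 4) by ring.
  rewrite mulrC ler_wpM2r//.
  have k2 : kappa ^+ 2 <= 1 by rewrite expr_le1.
  have k3 : kappa ^+ 3 <= 1 by rewrite expr_le1.
  have k4 : kappa ^+ 4 <= 1 by rewrite expr_le1.
  by have := k1; lra.
by move: h h2; lra.
Qed.

(** To second order, the solution is the free evolution plus a coherent quintic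
    contribution: all phases are close to one on the relevant time scale. *)
Lemma second_iterate x :
  normc (hn m T Fc 2 T x - phase T x * Fc x - (0 +i* m) * (T * Q x)%:C) <=
  T * (32 * kappa * Q x).
Proof.
have Q0 := rpair_ge0 pQ x.
set g := fun tau => cquint (fun x => phase tau x * Fc x).
have jg : jmeas g.
  apply: jmeas_quint; apply: cmeasurableM; first exact: jmeas_phase.
  exact: (jmeas_cst cmF).
have E : hn m T Fc 2 T x = phase T x * Fc x + (0 +i* m) * duh T g T x.
  have e1 : hn m T Fc 1 = fun tau x => phase tau x * Fc x.
    by apply/funext => tau; apply/funext => y; exact: hn1.
  by rewrite hnS e1.
rewrite E alg_free normcM normc_pureim m1 mul1r.
have gb tau : normc (phase (T - tau) x * g tau x) <= Q x.
  rewrite normc_expiM.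
  have c : cdom (fun x => phase tau x * Fc x) (fun x => phase tau x * Fc x) F F.
    exact: (cdom_diag (cm_phaseF tau) (phaseF_le tau)).
  by have [_ _ h _] := cdom_quint pF c; exact: h.
have kc tau : 0 <= tau <= T ->
    normc (phase (T - tau) x * g tau x - (Q x)%:C) <= 32 * kappa * Q x.
  move=> tT; have tT' : 0 <= T - tau <= T by move: tT => /andP[h1 h2]; apply/andP; split; lra.
  exact: (@kernel_close (T - tau) tau x tT' tT).
have kQ0 : 0 <= 32 * kappa * Q x := mulr_ge0 (mulr_ge0 (ler0n R 32) k0) Q0.
clear E; move: (Q x) Q0 (32 * kappa * Q x) kQ0 gb kc => q q0 c c0 gb kc.
exact: (duh_close T0 q0 c0 jg gb kc).
Qed.

Lemma coherent_lower (x : Rd) : inbox 0 (A / 8) x ->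
  @cpi R d ^+ 4 * (128^-1) ^+ d * (T * S ^+ 4) * al <= T * Q x.
Proof.
move=> hx; have h := rquint_twobox N A0 al0 hx.
have -> : @cpi R d ^+ 4 * (128^-1) ^+ d * (T * S ^+ 4) * al =
   T * (@cpi R d ^+ 4 * (8^-1) ^+ d * (al ^+ 5 * (A ^+ d) ^+ 4)).
  rewrite /boxmass; have -> : (128^-1 : R) ^+ d = (8^-1) ^+ d * ((2^-1) ^+ d) ^+ 4.
    by rewrite -exprM mulnC exprM -exprMn; congr (_ ^+ _); field.
  have -> : (2 * A) ^+ d = 2 ^+ d * A ^+ d by rewrite exprMn.
  have e2 : (2^-1 : R) ^+ d * 2 ^+ d = 1 by rewrite -exprMn mulVf// expr1n.
  have : ((2^-1 : R) ^+ d * 2 ^+ d) ^+ 4 = 1 by rewrite e2 expr1n.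
  move: ((2^-1 : R) ^+ d) (2 ^+ d) (A ^+ d) ((8^-1 : R) ^+ d) (@cpi R d ^+ 4) => h2 t2 X e8 c4 e.
  transitivity (T * (c4 * e8 * (al ^+ 5 * X ^+ 4)) * (h2 * t2) ^+ 4); first by ring.
  by rewrite e mulr1.
by rewrite ler_wpM2l.
Qed.

End box_data.
End first_iterates.

(** * Sobolev norms and the size of the solution *)

Section sobolev.
Context {R : realType} {d : nat}.
Local Notation Rd := (d.-tuple R).
Local Notation mu := (@leb R d).
Implicit Types (f g h : Rd -> R[i]) (F G psi : Rd -> R).

Lemma japanese_ge1 (x : Rd) : 1 <= japanese x.
Proof.
rewrite -(@sqrtr1 R) /japanese ler_sqrt ?lerDl ?dot_ge0//.
by rewrite addr_ge0 ?dot_ge0.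
Qed.

Lemma japanese_gt0 (x : Rd) : 0 < japanese x.
Proof. exact: lt_le_trans (japanese_ge1 x). Qed.

Lemma measurable_japanese : measurable_fun setT (@japanese R d).
Proof.
apply: (measurableT_comp (f := @Num.sqrt R)).
  exact: continuous_measurable_fun (@sqrt_continuous R).
by apply: measurable_funD => //; exact: measurable_dot.
Qed.

Lemma measurable_jpow (s : R) : measurable_fun setT (fun x : Rd => japanese x `^ s).
Proof. exact: (measurableT_comp (measurable_powR s) measurable_japanese). Qed.

Lemma jpow_cancel (s : R) (x : Rd) : japanese x `^ s * japanese x `^ (- s) = 1.
Proof.
rewrite -powRD; first by rewrite subrr powRr0.
by rewrite subrr eqxx gt_eqF ?japanese_gt0.
Qed.

(** By Parseval, the pairing of [h] with [psi] is also that of any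
    representative of the transform, and Hoelder's inequality bounds it by the
    product of two weighted norms. *)
Lemma Hs_norm_lower (s C W : R) h psi : good h -> schwartz (fun x => (psi x)%:C) -> 0 < W ->
  (\int[mu]_x ((japanese x `^ (- s) * psi x) ^+ 2)%:E <= (W ^+ 2)%:E)%E ->
  C * W <= normc (cintegral mu setT (fun x => h x * (psi x)%:C)) ->
  (C%:E <= Hs_norm s (of_fun (inv_fourier h)))%E.
Proof.
move=> gh sp W0 hW hC; apply: le_ereal_inf_tmp => _ [g [mg gT] <-].
have [ig eg] := gT _ sp.
have [_ pe] := parseval gh (schwartz_good sp) (schwartz_ray sp).
have {}eg : cintegral mu setT (fun x => h x * (psi x)%:C) = cintegral mu setT (fun x => g x * (psi x)%:C).
  by rewrite -pe; exact: eg.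
rewrite eg in hC; have {}hC := le_trans hC (normc_cintegral ig).
have [mpsi _] := schwartz_cmeasurable sp.
pose f1 x := japanese x `^ s * normc (g x).
pose f2 x := japanese x `^ (- s) * psi x.
have m1 : measurable_fun setT f1.
  by apply: measurable_funM; [exact: measurable_jpow|exact: measurable_normc].
have m2 : measurable_fun setT f2 by apply: measurable_funM => //; exact: measurable_jpow.
have p2 : (2^-1 + 2^-1 = 1 :> R)%R by field.
have ho := hoelder mu m1 m2 (ltr0n R 2) (ltr0n R 2) p2.
have e1 : (Lnorm mu 1 (EFin \o (f1 \* f2)%R) = (\int[mu]_x normc (g x * (psi x)%:C))%:E)%E.
  rewrite Lnorm1 EFin_Rintegral; last exact: integrable_normc.
  apply: eq_integral => x _ /=; congr (_%:E).
  rewrite /f1 /f2 mulrACA jpow_cancel mul1r normcM normc_real normrM.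
  by rewrite ger0_norm ?normc_ge0.
have e2 : Lnorm mu 2%:E (EFin \o f1) = cLnorm mu 2%:E (fun xi => ((japanese xi `^ s)%:C : R[i]) * g xi).
  apply: eq_Lnorm => x /=; congr (_%:E).
  by rewrite normcM normc_real ger0_norm ?powR_ge0.
have e3 : (Lnorm mu 2%:E (EFin \o f2) <= W%:E)%E.
  have := @cLnorm2_le _ _ _ mu (fun x => (f2 x)%:C) W (ltW W0).
  rewrite /cLnorm (_ : Lnorm _ _ _ = Lnorm mu 2%:E (EFin \o f2)).
    apply; under eq_integral do rewrite normc_real real_normK ?num_real//.
    exact: hW.
  rewrite -[RHS]Lnorm_abse; apply: eq_Lnorm => x /=; congr (_%:E).
  exact: normc_real.
rewrite e1 e2 in ho.
set n := cLnorm _ _ _ in ho *.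
have {}ho : ((C * W)%:E <= n * W%:E)%E.
  apply: le_trans (_ : (\int[mu]_x normc (g x * (psi x)%:C))%:E <= _)%E; first by rewrite lee_fin.
  by apply: le_trans ho _; apply: lee_wpmul2l => //; exact: Lnorm_ge0.
have n0 : (0 <= n)%E by exact: Lnorm_ge0.
move: n n0 ho => [n n0 ho|//|//]; last by move=> *; rewrite leey.
by move: ho; rewrite -EFinM !lee_fin ler_pM2r.
Qed.

Lemma Hs_norm_data (s : R) (u0 : distrib R d) g f (c : R) :
  dfourier_is u0 g -> good f -> 0 <= c ->
  (\int[mu]_x (normc ((japanese x `^ s)%:C * (f x - g x)) ^+ 2)%:E <= (c ^+ 2)%:E)%E ->
  (Hs_norm s (fun phi => (of_fun (inv_fourier f) phi - u0 phi)%R) <= c%:E)%E.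
Proof.
move=> [mg gT] gf c0 h.
apply: le_trans (cLnorm2_le c0 h); apply: ereal_inf_lbound.
exists (fun x => f x - g x) => //; split.
  by apply: cmeasurableB => //; exact: cintegrable_cmeasurable gf.1.
move=> phi sp; have [ig eg] := gT _ sp.
have [_ pe] := parseval gf (schwartz_good sp) (schwartz_ray sp).
have [_ [C hC]] := gf; have [cp _] := schwartz_good sp.
have cfp : cintegrable mu (fun x => f x * phi x).
  by apply: (cintegrableMb (B := C)) => //; exact: cintegrable_cmeasurable gf.1.
split.
  rewrite (_ : (fun x => _) = (fun x => f x * phi x - g x * phi x)); first exact: cintegrableB.
  by apply/funext => x; rewrite mulrBl.
transitivity (cintegral mu setT (fun x => f x * phi x) - cintegral mu setT (fun x => g x * phi x)).
  rewrite -pe; congr (_ - _); exact: eg.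
by rewrite -cintegralB//; apply: eq_cintegral => x; rewrite mulrBl.
Qed.

End sobolev.

Section core.
Context {R : realType} {d : nat}.
Local Notation Rd := (d.-tuple R).
Local Notation mu := (@leb R d).
Implicit Types (F G : Rd -> R).

Lemma integrableMb F G (B : R) : mu.-integrable setT (EFin \o F) -> measurable_fun setT G ->
  (forall x, 0 <= G x) -> (forall x, G x <= B) -> (forall x, 0 <= F x) ->
  mu.-integrable setT (EFin \o (fun x => F x * G x)).
Proof.
move=> iF mG G0 GB F0; apply: (integrable_dom (G := fun x => B * F x)).
- by apply: measurable_funM => //; case/integrableP : iF => /measurable_EFinP.
- by move=> x; rewrite ger0_norm ?mulr_ge0// mulrC ler_wpM2r.
- exact: integrable_mull.
Qed.

Variables (A N al T m Voo : R) (V : Rd -> R[i]).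
Hypotheses (A0 : 0 < A) (N0 : 0 < N) (al0 : 0 < al) (AN : 2 * A <= N).
Hypotheses (T0 : 0 <= T) (m1 : `|m| = 1).
Local Notation F := (@twobox R d A N al).
Local Notation Fc := (fun x : Rd => (F x)%:C).
Local Notation Q := (rquint F).
Local Notation S := (@boxmass R d A al).
Local Notation kappa := (@kappa R d N T).
Local Notation V1 := (\int[mu]_x normc (V x)).
Local Notation theta := (theta T (4 * S)).
Hypotheses (cV : cintegrable mu V) (VB : forall x, normc (V x) <= Voo).
Hypotheses (VS : V1 <= 2 * S) (th : theta <= 2^-1) (k1 : kappa <= 64^-1).

Definition datum (x : Rd) : R[i] := V x + (F x)%:C.
Definition majorant (x : Rd) : R := normc (V x) + F x.
(** How much the low-frequency part [V] of the datum can change the solution,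
    compared with the datum [F] alone: it is bounded in L^1 and L^oo in terms of
    [V] only. *)
Definition spread (x : Rd) : R := Mlim T majorant x - Mlim T F x.
Local Notation h := (@hlim R d m T datum).

Let S0 : 0 <= S. Proof. by rewrite /boxmass mulr_ge0 ?ltW// exprn_gt0// mulr_gt0. Qed.
Let K0 : 0 <= 4 * S. Proof. exact: mulr_ge0. Qed.
Let mF := @measurable_twobox R d A N al.
Let F0 : forall x, 0 <= F x := twobox_ge0 A N al0.
Let FB : forall x, F x <= 2 * al := twobox_le A N al0.
Let iF := @integrable_twobox R d A N al A0.
Let iV := integrable_normc cV.
Let mV := cintegrable_cmeasurable cV.
Let V0 x : 0 <= normc (V x) := normc_ge0 _.
Let Voo0 : 0 <= Voo. Proof. exact: le_trans (V0 (tcst 0)) (VB _). Qed.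
Let V10 : 0 <= V1. Proof. exact: Rintegral_ge0. Qed.
Let FK : \int[mu]_x F x <= 4 * S. Proof. by rewrite Rintegral_twobox//; have := S0; lra. Qed.
Let al0' : 0 <= 2 * al. Proof. by have := al0; lra. Qed.
Let pF : rpair F F (4 * S) (2 * al) 0 0. Proof. exact: rpair_diag. Qed.
Let pQ := rpair_quint pF.

Lemma rpair_majorant : rpair majorant F (4 * S) (Voo + 2 * al) Voo V1.
Proof.
have e x : majorant x - F x = normc (V x) by rewrite /majorant addrK.
split => //.
- by apply: measurable_funD => //; exact: measurable_normc.
- by move=> x; rewrite /majorant lerDr.
- by move=> x; rewrite /majorant lerD.
- exact: integrableDr.
- by rewrite RintegralD// Rintegral_twobox//; have := VS; lra.
- by move=> x; rewrite e.
- by under eq_Rintegral do rewrite e.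
Qed.
Let pb := rpair_majorant.

Lemma cmeasurable_datum : cmeasurable datum.
Proof. by apply: cmeasurableD => //; exact: cmeasurable_real. Qed.

Lemma datum_le x : normc (datum x) <= majorant x.
Proof.
apply: le_trans (normcD _ _) _; rewrite lerD2l normc_real ger0_norm//.
Qed.

Lemma cdom_datum : cdom datum Fc majorant F.
Proof.
split; [exact: cmeasurable_datum|exact: cmeasurable_real| |].
- by move=> x; rewrite normc_real ger0_norm.
- by move=> x; rewrite /datum /majorant !addrK.
Qed.

Let mb := rp_meas pb.
Let b0 := rpair_ge0 pb.
Let bB := rp_sup pb.
Let ib := rp_int pb.
Let bK := rp_mass pb.

Lemma core_sol_solution : solution m T (sol m T datum).
Proof. exact: (sol_solution m1 T0 K0 th mb b0 bB ib bK cmeasurable_datum datum_le). Qed.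

Lemma core_good t : good (h t).
Proof. exact: (hlim_good m1 T0 K0 th mb b0 bB ib bK cmeasurable_datum datum_le). Qed.

Lemma core_h0 x : h 0 x = datum x.
Proof. exact: (hlim0 m1 T0 K0 th mb b0 bB ib bK cmeasurable_datum datum_le). Qed.

Lemma spread_ge0 x : 0 <= spread x.
Proof.
by rewrite subr_ge0; exact: (Mlim_le_data T0 K0 th pb (addr_ge0 Voo0 al0') Voo0 V10).
Qed.

Lemma spread_sup x : spread x <= 2 * Voo.
Proof. exact: (Mlim_dsup T0 K0 th pb (addr_ge0 Voo0 al0') Voo0 V10). Qed.

Lemma spread_mass : \int[mu]_x spread x <= 2 * V1.
Proof. exact: (Mlim_dmass T0 K0 th pb (addr_ge0 Voo0 al0') Voo0 V10). Qed.

Lemma integrable_spread : mu.-integrable setT (EFin \o spread).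
Proof.
have i1 := integrable_Mlim T0 K0 th mb b0 bB ib bK.
have i2 := integrable_Mlim T0 K0 th mF F0 FB iF FK.
exact: (integrableB measurableT i1 i2).
Qed.

(** The successive errors: the free evolution of [F], the phases, the iterates
    of order three and more, and the influence of [V]. *)
Definition defect (x : Rd) : R := F x + T * (32 * kappa * Q x) + 2 * (2 * al) * theta ^+ 2 + spread x.

Lemma core_close x : normc (h T x - (0 +i* m) * (T * Q x)%:C) <= defect x.
Proof.
have k1' : kappa <= 1 by have := k1; lra.
have h1 := hlim_dist m1 T0 K0 th pb (addr_ge0 Voo0 al0') Voo0 V10 cdom_datum T x.
have cF : cmeasurable Fc by exact: cmeasurable_real.
have FcF y : normc (Fc y) <= F y by rewrite normc_real ger0_norm.
have [_ _ _ h2] := cdom_hlim m1 T0 K0 th mF F0 FB iF FK cF FcF 2 T.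
have {}h2 := le_trans (h2 x) (rp_dsup (rpair_Mlim T0 K0 th mF F0 FB iF FK 2) x).
have h3 := second_iterate A0 N0 al0 AN T0 m1 k1' x.
have h4 : normc (phase T x * Fc x) <= F x by rewrite normc_expiM.
move: h1 h2 h3 h4; rewrite /defect -/(spread x).
move: (h T x) (hlim m T Fc T x) (hn m T Fc 2 T x) (phase T x * Fc x) ((0 +i* m) * (T * Q x)%:C) => a b c p q.
move: (spread x) (2 * (2 * al) * theta ^+ 2) (T * (32 * kappa * Q x)) (F x) => r1 r2 r3 r4.
move=> h1 h2 h3 h4.
(* Replace the datum by [F], the solution by the second iterate, and the latter
    by its coherent part; the free evolution [p] remains. *)
have -> : a - q = (a - b) + (b - c) + (c - p - q) + p by ring.
apply: le_trans (normcD _ _) _; apply: le_trans (lerD (normcD _ _) (lexx _)) _.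
apply: le_trans (lerD (lerD (normcD _ _) (lexx _)) (lexx _)) _.
lra.
Qed.

Section pairing.
Variables (psi : Rd -> R) (P beta : R).
Hypotheses (mpsi : measurable_fun setT psi) (psi0 : forall x, 0 <= psi x) (psiP : forall x, psi x <= P).
Hypothesis ipsi : mu.-integrable setT (EFin \o psi).
Hypothesis bpsi : beta * \int[mu]_x psi x <= \int[mu]_x (chi 0 (A / 8) x * psi x).
Local Notation I := (\int[mu]_x psi x).
(** The constant of [rquint_twobox], with [A ^ d] expressed through the mass of
    the boxes. *)
Definition coherence : R := @cpi R d ^+ 4 * (128^-1) ^+ d.

Lemma coherence_gt0 : 0 < coherence.
Proof.
apply: mulr_gt0; apply: exprn_gt0; first exact: cpi_gt0.
by rewrite invr_gt0.
Qed.

(** The quintic term [T * Q] is real and nonnegative up to a constant phase, so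
    no cancellation occurs when it is integrated against [psi]. *)
Lemma core_lower :
  coherence * (T * S ^+ 4) * al * beta / 2 * I - 4 * al * theta ^+ 2 * I
   - \int[mu]_x (F x * psi x) - \int[mu]_x (spread x * psi x) <=
  normc (cintegral mu setT (fun x => h T x * (psi x)%:C)).
Proof.
have iFp := integrableMb iF mpsi psi0 psiP F0.
have iSp := integrableMb integrable_spread mpsi psi0 psiP spread_ge0.
have Q0 := rpair_ge0 pQ.
have iQp := integrableMb (rp_int pQ) mpsi psi0 psiP Q0.
set J := \int[mu]_x (Q x * psi x) in iQp *.
have cpsi : cintegrable mu (fun x => (psi x)%:C).
  apply: (cintegrable_dom (cmeasurable_real mpsi) _ ipsi) => x.
  by rewrite normc_real ger0_norm.
have [ch [C hC]] := core_good T.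
have chp : cintegrable mu (fun x => h T x * (psi x)%:C).
  by apply: (cintegrableMb (B := C)) => //; exact: cintegrable_cmeasurable ch.
have cQp : cintegrable mu (fun x => (0 +i* m) * (T * (Q x * psi x))%:C).
  apply: cintegrableZ; apply: (cintegrable_dom _ _ (integrable_mull T iQp)).
    by apply: cmeasurable_real; apply: measurable_funM => //; apply: measurable_funM => //; exact: (rp_meas pQ).
  move=> x; rewrite normc_real ger0_norm//.
  by apply: mulr_ge0 => //; exact: mulr_ge0.
have e1 : normc (cintegral mu setT (fun x => (0 +i* m) * (T * (Q x * psi x))%:C)) = T * J.
  rewrite cintegralZ; last first.
    apply: (cintegrable_dom _ _ (integrable_mull T iQp)).
      by apply: cmeasurable_real; apply: measurable_funM => //; apply: measurable_funM => //; exact: (rp_meas pQ).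
    move=> x; rewrite normc_real ger0_norm//.
  by apply: mulr_ge0 => //; exact: mulr_ge0.
  rewrite cintegral_real normcM normc_pureim m1 mul1r normc_real RintegralZl// ger0_norm//.
  by apply: mulr_ge0 => //; apply: Rintegral_ge0 => x _; exact: mulr_ge0.
have iD : mu.-integrable setT (EFin \o (fun x => F x * psi x + (32 * kappa * T) * (Q x * psi x) +
    (4 * al * theta ^+ 2) * psi x + spread x * psi x)).
  by apply: integrableDr => //; apply: integrableDr; [apply: integrableDr => //|]; exact: integrable_mull.
have e2 : normc (cintegral mu setT (fun x => h T x * (psi x)%:C) -
    cintegral mu setT (fun x => (0 +i* m) * (T * (Q x * psi x))%:C)) <=
  \int[mu]_x (F x * psi x) + (32 * kappa * T) * J + (4 * al * theta ^+ 2) * I + \int[mu]_x (spread x * psi x).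
  have -> : \int[mu]_x (F x * psi x) + (32 * kappa * T) * J + (4 * al * theta ^+ 2) * I + \int[mu]_x (spread x * psi x) =
     \int[mu]_x (F x * psi x + (32 * kappa * T) * (Q x * psi x) + (4 * al * theta ^+ 2) * psi x + spread x * psi x).
    rewrite RintegralD//; last by apply: integrableDr; [apply: integrableDr => //|]; exact: integrable_mull.
    rewrite RintegralD//; first last.
    - exact: integrable_mull.
    - by apply: integrableDr => //; exact: integrable_mull.
    rewrite RintegralD//; last exact: integrable_mull.
    by rewrite !RintegralZl.
  rewrite -cintegralB//; apply: normc_cintegral_le => //; first exact: cintegrableB.
  move=> x; have -> : h T x * (psi x)%:C - (0 +i* m) * (T * (Q x * psi x))%:C =
     (h T x - (0 +i* m) * (T * Q x)%:C) * (psi x)%:C.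
    rewrite (_ : (T * (Q x * psi x))%:C = (T * Q x)%:C * (psi x)%:C); last by rewrite -rmorphM mulrA.
    by rewrite mulrA -mulrBl.
  rewrite normcM normc_real ger0_norm//.
  apply: le_trans (ler_wpM2r (psi0 x) (core_close x)) _.
  by apply: ler_eq; rewrite /defect; ring.
have J0 : 0 <= J by apply: Rintegral_ge0 => x _; exact: mulr_ge0.
have lJ : coherence * (T * S ^+ 4) * al * beta * I <= T * J.
  have c0 : 0 <= coherence * (T * S ^+ 4) * al.
    apply: mulr_ge0; last exact: ltW.
    apply: mulr_ge0; first exact/ltW/coherence_gt0.
    by apply: mulr_ge0 => //; exact: exprn_ge0.
  rewrite -mulrA; apply: le_trans (ler_wpM2l c0 bpsi) _.
  rewrite -RintegralZl//; last first.
    apply: (integrableMb (integrable_chi 0 _) mpsi psi0 psiP); last exact: chi_ge0.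
    by rewrite divr_ge0// ltW.
  rewrite -RintegralZl//; apply: le_Rintegral => //.
  - apply: integrable_mull; apply: (integrableMb (integrable_chi 0 _) mpsi psi0 psiP); last exact: chi_ge0.
    by rewrite divr_ge0// ltW.
  - exact: integrable_mull.
  - move=> x _; rewrite mulrA [X in _ <= X]mulrA; apply: ler_wpM2r => //.
    have [hx|->] := chi_inP 0 (A / 8) x; last by rewrite mulr0; exact: mulr_ge0 T0 (Q0 x).
    by rewrite (chi_in hx) mulr1; exact: (coherent_lower N A0 al0 T0 hx).
move: e1 e2 lJ; set a := cintegral _ _ _; set c := cintegral _ _ _ => e1 e2 lJ.
have : T * J <= normc c + normc (c - a).
  by rewrite -e1; have := normcB c (c - a); rewrite subKr.
(* This is where [kappa <= 1 / 64] enters: the phase errors cost at most half of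
    the quintic term. *)
have : 32 * kappa * T * J <= T * J / 2.
  have : 0 <= T * J by exact: mulr_ge0.
  by have := k1; nra.
lra.
Qed.

(** The inequality between arithmetic and geometric means balances the L^2 norms
    of [spread] and [psi]; the square of [spread] is estimated by its supremum
    times its mass. *)
Lemma spread_pairing (W : R) : 0 < W -> mu.-integrable setT (EFin \o (fun x => psi x ^+ 2)) ->
  \int[mu]_x (psi x ^+ 2) <= W ^+ 2 ->
  \int[mu]_x (spread x * psi x) <= (2 * Voo * V1 + 2^-1) * W.
Proof.
move=> W0 ip2 hW; have iS := integrable_spread.
apply: (@le_trans _ _ (\int[mu]_x ((Voo * W) * spread x + (2 * W)^-1 * psi x ^+ 2))).
  apply: le_Rintegral => //.
  - exact: (integrableMb iS mpsi psi0 psiP spread_ge0).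
  - by apply: integrableDr; exact: integrable_mull.
  - move=> x _; have s1 := spread_ge0 x; have s2 := spread_sup x.
    apply: (@le_trans _ _ ((W / 2) * spread x ^+ 2 + (2 * W)^-1 * psi x ^+ 2)).
      have -> : spread x * psi x = (W / 2) * spread x ^+ 2 + (2 * W)^-1 * psi x ^+ 2 -
          (2 * W)^-1 * (W * spread x - psi x) ^+ 2 by field; rewrite gt_eqF.
      by rewrite lerBlDr lerDl mulr_ge0 ?sqr_ge0// invr_ge0 mulr_ge0// ltW.
    rewrite lerD2r expr2 mulrA ler_wpM2r//.
    by have -> : Voo * W = (W / 2) * (2 * Voo); [field|rewrite ler_wpM2l// divr_ge0// ltW].
rewrite RintegralD//; do ?exact: integrable_mull.
rewrite !RintegralZl// [X in _ <= X]mulrDl; apply: lerD.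
  rewrite (_ : 2 * Voo * V1 * W = Voo * W * (2 * V1)); last by ring.
  by rewrite ler_wpM2l ?spread_mass// mulr_ge0// ltW.
rewrite (_ : 2^-1 * W = (2 * W)^-1 * W ^+ 2); last by field; rewrite gt_eqF.
by rewrite ler_wpM2l// invr_ge0 mulr_ge0// ltW.
Qed.

End pairing.
End core.

(** * Gaussian test functions *)

Section gaussian_derivatives.
Context {R : realType}.

Global Instance is_derive_hornerE (p : {poly R}) (x : R) :
  is_derive x (1 : R) (fun y => p.[y]) p^`().[x].
Proof.
elim/poly_ind: p => [|p c IH].
  under eq_fun do rewrite horner0.
  by rewrite deriv0 horner0; exact: is_derive_cst.
under eq_fun do rewrite hornerMXaddC.
by apply: is_derive_eq; rewrite derivD derivM derivX derivC addr0 mulr1 !hornerE /GRing.scale/=; ring.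
Qed.

Fixpoint hermite (a : R) (k : nat) : {poly R} :=
  match k with
  | 0%N => 1
  | k'.+1 => (hermite a k')^`() - (2 * a) *: ('X * hermite a k')
  end.

(** The derivatives of [exp (- a x ^ 2)], as a family closed under
    differentiation. *)
Definition gauss (a : R) (k : nat) (x : R) : R := (hermite a k).[x] * expR (- (a * x ^+ 2)).

Lemma is_derive_gauss a k (x : R) : is_derive x 1 (gauss a k) (gauss a k.+1 x).
Proof.
rewrite /gauss; apply: is_derive_eq.
by rewrite /= !hornerE /GRing.scale/=; ring.
Qed.

Lemma expR_poly_decay (a : R) (m : nat) : 0 < a -> exists M : R, forall x : R,
  (1 + x ^+ 2) ^+ m * expR (- (a * x ^+ 2)) <= M.
Proof.
move=> a0; case: m => [|m].
  exists 1 => x; rewrite expr0 mul1r -expR0 ler_expR oppr_le0.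
  by rewrite mulr_ge0 ?sqr_ge0// ltW.
exists (((m.+1%:R) / a) ^+ m.+1 * expR a) => x.
set y := 1 + x ^+ 2; have y0 : 0 <= y by rewrite addr_ge0 ?sqr_ge0.
(* The elementary bound [y <= exp y], applied to [a * y / m.+1] and raised to
    the power [m.+1]. *)
have -> : - (a * x ^+ 2) = a - a * y by rewrite /y; ring.
rewrite expRD mulrCA mulrC; apply: ler_wpM2r; first exact: expR_ge0.
rewrite expRN ler_pdivrMr ?expR_gt0//.
have -> : a * y = m.+1%:R * (a * y / m.+1%:R) by rewrite [RHS]mulrC divfK// pnatr_eq0.
have ma : 0 <= m.+1%:R / a by rewrite divr_ge0// ltW.
rewrite expRM_natl -exprMn lerXn2r ?nnegrE//; first by rewrite mulr_ge0 ?expR_ge0.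
apply: (@le_trans _ _ (m.+1%:R / a * (a * y / m.+1%:R))).
  have n0 : m.+1%:R != 0 :> R by rewrite pnatr_eq0.
  apply: ler_eq; move: n0 {ma}; move: (m.+1%:R : R) => q q0; field.
  by rewrite q0 gt_eqF.
rewrite ler_wpM2l//; apply: le_trans (expR_ge1Dx _).
by rewrite lerDr.
Qed.

Lemma gauss_decay (a : R) (k n : nat) : 0 < a -> exists2 M : R, 0 <= M & forall x : R,
  (1 + x ^+ 2) ^+ n * `|gauss a k x| <= M.
Proof.
move=> a0; set p := hermite a k.
have [M hM] := expR_poly_decay (n + size p) a0.
exists (M * \sum_(i < size p) `|p`_i|).
  rewrite mulr_ge0 ?sumr_ge0//; apply: le_trans (hM 0).
  by rewrite mulr_ge0 ?expR_ge0// exprn_ge0// addr_ge0 ?sqr_ge0.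
move=> x; rewrite /gauss normrM [`|expR _|]ger0_norm ?expR_ge0//.
set y := 1 + x ^+ 2; have y1 : 1 <= y by rewrite lerDl sqr_ge0.
have hp : `|p.[x]| <= y ^+ size p * \sum_(i < size p) `|p`_i|.
  rewrite horner_coef; apply: le_trans (ler_norm_sum _ _ _) _.
  rewrite mulr_sumr; apply: ler_sum => i _; rewrite normrM mulrC ler_wpM2r//.
  rewrite normrX; apply: (@le_trans _ _ (y ^+ i)).
    have xy : `|x| <= y.
      rewrite /y -[x ^+ 2]real_normK ?num_real//.
      by have := normr_ge0 x; have := sqr_ge0 (`|x| - 1); nra.
    by rewrite lerXn2r ?nnegrE//; exact: le_trans ler01 y1.
  by apply: ler_weXn2l => //; exact: ltnW.
have yn : 0 <= y ^+ n by rewrite exprn_ge0// (le_trans _ y1).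
apply: (@le_trans _ _ (y ^+ n * (y ^+ size p * (\sum_(i < size p) `|p`_i|) * expR (- (a * x ^+ 2))))).
  by rewrite ler_wpM2l// ler_wpM2r ?expR_ge0.
have -> : y ^+ n * (y ^+ size p * (\sum_(i < size p) `|p`_i|) * expR (- (a * x ^+ 2))) =
  (y ^+ (n + size p) * expR (- (a * x ^+ 2))) * \sum_(i < size p) `|p`_i| by rewrite exprD; ring.
by apply: ler_wpM2r; [exact: sumr_ge0|exact: hM].
Qed.

End gaussian_derivatives.

Section schwartz_closure.
Context {R : realType} {d : nat}.
Local Notation Rd := (d.-tuple R).
Implicit Types (f g psi : Rd -> R).

Definition rschwartz psi := schwartz (fun x => (psi x)%:C).

Lemma partials_cst0 (l : seq 'I_d) : partials l (fun _ : Rd => 0 : R) = fun=> 0.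
Proof.
elim: l => //= i l ->; apply/funext => x; rewrite /partial derive1E.
exact: derive_cst.
Qed.

Lemma rschwartzP psi : has_partials psi ->
  (forall (l : seq 'I_d) (k : nat), exists M : R, forall x,
        (1 + dot x x) ^+ k * `|partials l psi x| <= M) -> rschwartz psi.
Proof.
move=> h b; split => //=.
  by move=> l i x /=; rewrite partials_cst0; exact: derivable_cst.
move=> l k; have [M hM] := b l k; exists M => x.
rewrite /cpartials/= partials_cst0.
by have := normc_real (partials l psi x); rewrite /= => ->; exact: hM.
Qed.

Lemma rschwartz_has psi : rschwartz psi -> has_partials psi.
Proof. by case. Qed.

Lemma rschwartz_bound psi (l : seq 'I_d) (k : nat) : rschwartz psi -> exists M : R, forall x,
        (1 + dot x x) ^+ k * `|partials l psi x| <= M.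
Proof.
move=> [_ _ b]; have [M hM] := b l k; exists M => x; apply: le_trans (hM x).
rewrite ler_wpM2l ?exprn_ge0 ?addr_ge0 ?dot_ge0//.
exact: (Re_le_normc (cpartials l (fun x => (psi x)%:C) x)).
Qed.

Lemma partialsD f g (l : seq 'I_d) : has_partials f -> has_partials g ->
  partials l (fun x => f x + g x) = fun x => partials l f x + partials l g x.
Proof.
move=> hf hg; elim: l => //= i l ->; apply/funext => x; rewrite /partial !derive1E.
by apply: deriveD; [exact: hf|exact: hg].
Qed.

Lemma partialsZ f (c : R) (l : seq 'I_d) : has_partials f ->
  partials l (fun x => c * f x) = fun x => c * partials l f x.
Proof.
move=> hf; elim: l => //= i l ->; apply/funext => x; rewrite /partial !derive1E.
by apply: deriveZ; exact: hf.
Qed.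

Lemma rschwartzD f g : rschwartz f -> rschwartz g -> rschwartz (fun x => f x + g x).
Proof.
move=> sf sg; have hf := rschwartz_has sf; have hg := rschwartz_has sg.
apply: rschwartzP => [l i x|l k].
  by rewrite partialsD//; apply: derivableD; [exact: hf|exact: hg].
have [M hM] := rschwartz_bound l k sf; have [M' hM'] := rschwartz_bound l k sg.
exists (M + M') => x; rewrite partialsD//.
apply: le_trans (lerD (hM x) (hM' x)); rewrite -mulrDr ler_wpM2l ?ler_normD//.
by rewrite exprn_ge0// addr_ge0 ?dot_ge0.
Qed.

Lemma rschwartzZ f (c : R) : rschwartz f -> rschwartz (fun x => c * f x).
Proof.
move=> sf; have hf := rschwartz_has sf.
apply: rschwartzP => [l i x|l k].
  by rewrite partialsZ//; apply: derivableZ; exact: hf.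
have [M hM] := rschwartz_bound l k sf.
exists (`|c| * M) => x; rewrite partialsZ// normrM mulrCA; apply: ler_wpM2l => //.
Qed.

(** Products of functions taken from one family closed under differentiation;
    partial derivatives only shift the indices. *)
Section tensor.
Variable F : nat -> R -> R.
Hypothesis dF : forall k (x : R), is_derive x 1 (F k) (F k.+1 x).
Hypothesis bF : forall k n, exists2 M : R, 0 <= M & forall x, (1 + x ^+ 2) ^+ n * `|F k x| <= M.

Definition tensor (c : 'I_d -> nat) (x : Rd) : R := \prod_(j < d) F (c j) (tnth x j).

Lemma tensor_partial c i (x : Rd) :
  is_derive (0 : R) 1 (fun h => tensor c (translate i x h))
    (tensor (fun j => (c j + (j == i))%N) x).
Proof.
have E : (fun h => tensor c (translate i x h)) =
    (fun h => (\prod_(j < d | j != i) F (c j) (tnth x j)) * F (c i) (tnth x i + h)).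
  apply/funext => h; rewrite /tensor (bigD1 i)//= mulrC tnth_translate eqxx; congr (_ * _).
  by apply: eq_bigr => j ji; rewrite tnth_translate (negbTE ji) addr0.
have -> : tensor (fun j => (c j + (j == i))%N) x =
    (\prod_(j < d | j != i) F (c j) (tnth x j)) * F (c i).+1 (tnth x i).
  rewrite /tensor (bigD1 i)//= mulrC eqxx addn1; congr (_ * _).
  by apply: eq_bigr => j ji; rewrite (negbTE ji) addn0.
by rewrite E; apply: is_derive_eq; rewrite addr0 add0r mulr1.
Qed.

Lemma tensor_schwartz c : rschwartz (tensor c).
Proof.
have E l : exists c', partials l (tensor c) = tensor c'.
  elim: l => [|i l [c' IH]]; first by exists c.
  exists (fun j => (c' j + (j == i))%N); rewrite /= IH; apply/funext => x.
  by rewrite /partial derive1E; have := tensor_partial c' i x => ?; rewrite derive_val.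
apply: rschwartzP => [l i x|l k].
  by have [c' ->] := E l; have := tensor_partial c' i x => ?; exact: ex_derive.
have [c' ->] := E l.
have h j : exists M, 0 <= M /\ forall x, (1 + x ^+ 2) ^+ k * `|F (c' j) x| <= M.
  by have [M M0 hM] := bF (c' j) k; exists M.
have [m hm] := choice h.
exists (\prod_(j < d) m j) => x.
apply: (@le_trans _ _ (\prod_(j < d) ((1 + tnth x j ^+ 2) ^+ k * `|F (c' j) (tnth x j)|))).
  rewrite big_split/= -normr_prod ler_wpM2r// prodrXl lerXn2r ?nnegrE ?addr_ge0 ?dot_ge0//.
    by apply: prodr_ge0 => j _; rewrite addr_ge0 ?sqr_ge0.
  have -> : dot x x = \sum_(j < d) tnth x j ^+ 2 by apply: eq_bigr => j _; rewrite expr2.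
  by apply: ler_prod1D => j; exact: sqr_ge0.
apply: ler_prod => j _; rewrite (hm j).2 andbT.
by rewrite mulr_ge0// exprn_ge0// addr_ge0 ?sqr_ge0.
Qed.

End tensor.

Definition gaussd (c : R) (x : Rd) : R := \prod_(j < d) expR (- (c * tnth x j) ^+ 2).

Lemma gaussd_schwartz c : 0 < c -> rschwartz (gaussd c).
Proof.
move=> c0; have c2 : 0 < c ^+ 2 by rewrite exprn_gt0.
have := @tensor_schwartz (gauss (c ^+ 2)) (is_derive_gauss (c ^+ 2))
  (fun k n => gauss_decay k n c2) (fun=> 0%N).
rewrite (_ : tensor _ _ = gaussd c)//; apply/funext => x; apply: eq_bigr => j _.
by rewrite /gauss/= hornerC mul1r exprMn.
Qed.

End schwartz_closure.

(** * Masses and energies of the test functions *)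

Section test_functions.
Context {R : realType} {d : nat}.
Local Notation Rd := (d.-tuple R).
Local Notation mu := (@leb R d).
Implicit Types (psi : Rd -> R).

Lemma Rintegral_tscale (c : R) psi : 0 < c -> mu.-integrable setT (EFin \o psi) ->
  mu.-integrable setT (EFin \o (fun x => psi (tscale c x))) /\
  \int[mu]_x psi (tscale c x) = (c^-1) ^+ d * \int[mu]_x psi x.
Proof.
move=> c0 ip; have ci : 0 <= (c^-1) ^+ d by rewrite exprn_ge0// invr_ge0 ltW.
have mt := measurable_tscale c (@measurable_id _ _ (@setT Rd)).
have tr u mu0 u0 := @ge0_integral_tscale R d c u c0 mu0 u0.
split; first exact: (transfer_integrable mt ci tr ip).
exact: (transfer_Rintegral mt ci tr ip).
Qed.

Lemma sqr_japanese (x : Rd) : japanese x ^+ 2 = 1 + dot x x.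
Proof. by rewrite sqr_sqrtr// addr_ge0 ?dot_ge0. Qed.

Lemma japanese_tscale (c : R) (x : Rd) : 0 < c -> c <= 1 ->
  japanese x <= c^-1 * japanese (tscale c x).
Proof.
move=> c0 c1; have j0 y := ltW (japanese_gt0 (y : Rd)).
rewrite -(@ler_pXn2r _ 2)// ?nnegrE ?mulr_ge0 ?invr_ge0 ?(ltW c0)//.
rewrite exprMn !sqr_japanese dotZl dotZr mulrDr mulr1.
have cc : c^-1 ^+ 2 * (c * (c * dot x x)) = dot x x by field; rewrite gt_eqF.
by rewrite cc lerD2r exprn_ege1// invf_ge1.
Qed.

Lemma jpow_tscale (q c : R) (x : Rd) : 0 <= q -> 0 < c -> c <= 1 ->
  japanese x `^ q <= (c^-1) `^ q * japanese (tscale c x) `^ q.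
Proof.
move=> q0 c0 c1; have j0 y := ltW (japanese_gt0 (y : Rd)).
have ci : 0 <= c^-1 by rewrite invr_ge0 ltW.
rewrite -powRM//; apply: ge0_ler_powR => //; rewrite ?nnegrE ?mulr_ge0//.
exact: japanese_tscale.
Qed.

Lemma rschwartz_measurable psi : rschwartz psi -> measurable_fun setT psi.
Proof. by move=> /schwartz_cmeasurable[]. Qed.

Lemma rschwartz_integrable psi : rschwartz psi -> mu.-integrable setT (EFin \o psi).
Proof. by move=> /schwartz_good[[]]. Qed.

Lemma integrable_jpow (q : R) psi : rschwartz psi -> (forall x, 0 <= psi x) ->
  mu.-integrable setT (EFin \o (fun x => japanese x `^ q * psi x)).
Proof.
move=> sp p0; pose n := Num.Def.archi_bound `|q|.
have qn : q <= n%:R by apply: le_trans (ler_norm q) _; exact: ltW (Num.Theory.archi_boundP (normr_ge0 q)).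
have [M M0 hM] := schwartz_weight [::] (n + d) sp.
rewrite cpartials0 in hM.
apply: (integrable_dom (G := fun x => M * jweight x)).
- by apply: measurable_funM; [exact: measurable_jpow|exact: rschwartz_measurable].
- move=> x; have w0 := ltW (weight_gt0 x).
  rewrite ger0_norm ?mulr_ge0 ?powR_ge0//.
  apply: (@le_trans _ _ ((1 + dot x x) ^+ n * (M * weight x ^+ (n + d)))).
    apply: ler_pM => //; first exact: powR_ge0.
      apply: (@le_trans _ _ (japanese x `^ n%:R)).
        by apply: ler_powR => //; exact: japanese_ge1.
      rewrite powR_mulrn; last exact/ltW/japanese_gt0.
      rewrite -sqr_japanese -exprM.
      by apply: ler_weXn2l; [exact: japanese_ge1|rewrite mul2n -addnn leq_addr].
    by apply: le_trans (hM x); rewrite normc_real ler_norm.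
  have e : (1 + dot x x) ^+ n * weight x ^+ n = 1.
    by rewrite -exprMn /weight mulfV ?expr1n// gt_eqF ?dot1_gt0.
  rewrite exprD mulrCA; apply: ler_wpM2l => //; rewrite mulrA e mul1r.
  exact: weight_jweight.
- exact/integrable_mull/integrable_jweight.
Qed.

Lemma chi_tail psi (eta : R) : mu.-integrable setT (EFin \o psi) -> (forall x, 0 <= psi x) ->
  0 < eta -> exists r0 : R, forall r, r0 <= r ->
    \int[mu]_x psi x - \int[mu]_x (chi 0 r x * psi x) <= eta.
Proof.
move=> ip p0 e0.
have mp : measurable_fun setT psi by case/integrableP : ip => /measurable_EFinP.
have ic r : mu.-integrable setT (EFin \o (fun x => chi 0 r x * psi x)).
  apply: (integrable_dom _ _ ip); first by apply: measurable_funM => //; exact: measurable_chi.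
  by move=> x; rewrite ger0_norm ?mulr_ge0 ?chi_ge0// ler_piMl// chi_le1.
have cv : (fun n => \int[mu]_x (chi 0 n%:R x * psi x)) @ \oo --> \int[mu]_x psi x.
  apply: (Rintegral_cvg (G := psi)) => //.
  - by move=> n; apply: measurable_funM => //; exact: measurable_chi.
  - move=> x; apply: cvg_near_cst.
    pose s := \sum_j `|tnth x j|.
    exists (Num.Def.archi_bound s) => // n /= sn.
    rewrite chi_in ?mul1r// => j; rewrite subr0.
    apply: (@le_trans _ _ s); first by rewrite /s (bigD1 j)//= lerDl; exact: sumr_ge0.
    have s0 : 0 <= s by exact: sumr_ge0.
    by apply: (le_trans (ltW (Num.Theory.archi_boundP s0))); rewrite ler_nat.
  - by move=> n x; rewrite ger0_norm ?mulr_ge0 ?chi_ge0// ler_piMl// chi_le1.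
have [n _ hn] : \forall n \near \oo, `|\int[mu]_x psi x - \int[mu]_x (chi 0 n%:R x * psi x)| < eta.
  by move/cvgrPdist_lt : cv => /(_ _ e0).
exists n%:R => r nr; have := hn n (leqnn n); rewrite /= => h.
apply: ltW; apply: le_lt_trans h; apply: le_trans (ler_norm _); rewrite lerD2l lerN2.
apply: le_Rintegral => // x _; apply: ler_wpM2r => //.
have [hx|->] := chi_inP 0 n%:R x; last exact: chi_ge0.
by rewrite (chi_in hx) chi_in// => j; exact: le_trans (hx j) nr.
Qed.

Lemma gaussd_gt0 (c : R) (x : Rd) : 0 < gaussd c x.
Proof. by apply: prodr_gt0 => j _; exact: expR_gt0. Qed.

Lemma gaussd_le1 (c : R) (x : Rd) : gaussd c x <= 1.
Proof.
have := @ler_prod_expn R d (fun j => expR (- (c * tnth x j) ^+ 2)) 1.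
rewrite expr1n; apply => j; rewrite expR_ge0/=.
by rewrite -expR0 ler_expR oppr_le0 sqr_ge0.
Qed.

Lemma gaussd_tscale (c : R) (x : Rd) : gaussd c x = gaussd 1 (tscale c x).
Proof. by apply: eq_bigr => j _; rewrite tnthE mul1r. Qed.

Lemma Rintegral_pos psi : mu.-integrable setT (EFin \o psi) -> (forall x, 0 < psi x) ->
  forall r p : R, 0 < r -> 0 < p -> (forall x, inbox 0 r x -> p <= psi x) ->
  0 < \int[mu]_x (chi 0 r x * psi x).
Proof.
move=> ip p0 r p r0 pp hp.
have mp : measurable_fun setT psi by case/integrableP : ip => /measurable_EFinP.
apply: (@lt_le_trans _ _ (p * \int[mu]_x chi 0 r x)).
  rewrite Rintegral_chi ?(ltW r0)// mulr_gt0// exprn_gt0// mulr_gt0//.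
rewrite -RintegralZl//; last by apply: integrable_chi; exact: ltW.
apply: le_Rintegral => //.
- by apply: integrable_mull; apply: integrable_chi; exact: ltW.
- apply: (integrable_dom _ _ ip); first by apply: measurable_funM => //; exact: measurable_chi.
  by move=> x; rewrite ger0_norm ?mulr_ge0 ?chi_ge0 ?(ltW (p0 x))// ler_piMl ?chi_le1// ltW.
- move=> x _; have [hx|->] := chi_inP 0 r x; last by rewrite mulr0 mul0r.
  by rewrite (chi_in hx) mulr1 mul1r; exact: hp.
Qed.

Lemma gaussd_box (x : Rd) : inbox 0 8^-1 x -> expR (- 1) ^+ d <= gaussd 1 x.
Proof.
move=> hx; rewrite /gaussd (_ : expR (- 1) ^+ d = \prod_(j < d) expR (- 1)); last first.
  by rewrite prodr_const card_ord.
apply: ler_prod => j _; rewrite expR_ge0/= ler_expR lerN2 mul1r.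
have := hx j; rewrite subr0 => h; rewrite -real_normK ?num_real// expr_le1//.
by apply: le_trans h _; rewrite invf_le1// ler1n.
Qed.

Lemma gaussd_box_gt0 : 0 < \int[mu]_x (chi 0 8^-1 x * gaussd 1 x).
Proof.
apply: (Rintegral_pos _ _ _ _ gaussd_box).
- exact/rschwartz_integrable/gaussd_schwartz.
- exact: gaussd_gt0.
- by rewrite invr_gt0.
- by rewrite exprn_gt0// expR_gt0.
Qed.

Lemma gaussd_int_gt0 : 0 < \int[mu]_x gaussd 1 x.
Proof.
apply: lt_le_trans gaussd_box_gt0 _.
have ig := rschwartz_integrable (gaussd_schwartz (ltr01 : 0 < 1 :> R)).
apply: le_Rintegral => //.
  apply: (integrable_dom _ _ ig).
    by apply: measurable_funM; [exact: measurable_chi|case/integrableP : ig => /measurable_EFinP].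
  move=> x; rewrite ger0_norm; last by rewrite mulr_ge0 ?chi_ge0// ltW ?gaussd_gt0.
  by rewrite ler_piMl ?chi_le1// ltW// gaussd_gt0.
by move=> x _; rewrite ler_piMl ?chi_le1// ltW// gaussd_gt0.
Qed.

Lemma chi_tscale (c r : R) (x : Rd) : 0 < c -> chi 0 (r / c) x = chi 0 r (tscale c x).
Proof.
move=> c0; apply: eq_bigr => j _; rewrite !ind_itv tnthE !subr0 normrM gtr0_norm//.
by rewrite ler_pdivlMr// mulrC.
Qed.

Definition gmass : R := \int[mu]_x gaussd 1 x.
(** The share of the mass of a Gaussian that lies in the box of radius one
    eighth of its scale, where the quintic term is bounded below. *)
Definition gbeta : R := (\int[mu]_x (chi 0 8^-1 x * gaussd 1 x)) / gmass.
Definition genergy (q : R) : R := \int[mu]_x (japanese x `^ q * gaussd 1 x ^+ 2).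

Lemma integrable_jpow_sq (q : R) psi (P : R) : rschwartz psi -> (forall x, 0 <= psi x) ->
  (forall x, psi x <= P) ->
  mu.-integrable setT (EFin \o (fun x => japanese x `^ q * psi x ^+ 2)).
Proof.
move=> sp p0 pP; have i := integrable_mull P (integrable_jpow q sp p0).
apply: (integrable_dom _ _ i).
  apply: measurable_funM; first exact: measurable_jpow.
  by apply: measurable_funX; exact: rschwartz_measurable.
move=> x; rewrite ger0_norm ?mulr_ge0 ?powR_ge0 ?sqr_ge0//.
rewrite [X in _ <= X]mulrCA; apply: ler_wpM2l; first exact: powR_ge0.
by rewrite expr2 ler_wpM2r.
Qed.

Let g0 (c : R) x : 0 <= @gaussd R d c x := ltW (gaussd_gt0 c x).

Lemma gaussd_mass (c : R) : 0 < c -> \int[mu]_x gaussd c x = (c^-1) ^+ d * gmass.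
Proof.
move=> c0; rewrite (_ : (fun x => gaussd c x) = (fun x => gaussd 1 (tscale c x))).
  by have [] := Rintegral_tscale c0 (rschwartz_integrable (gaussd_schwartz ltr01)).
exact/funext/gaussd_tscale.
Qed.

Lemma gaussd_chi (c r : R) : 0 < c -> \int[mu]_x (chi 0 (r / c) x * gaussd c x) =
  (c^-1) ^+ d * \int[mu]_x (chi 0 r x * gaussd 1 x).
Proof.
move=> c0; rewrite (_ : (fun x => chi 0 (r / c) x * gaussd c x) =
    (fun x => (fun y => chi 0 r y * gaussd 1 y) (tscale c x))); last first.
  by apply/funext => x; rewrite chi_tscale// gaussd_tscale.
have ig := rschwartz_integrable (gaussd_schwartz (ltr01 : 0 < 1 :> R)).
have i : mu.-integrable setT (EFin \o (fun y => chi 0 r y * gaussd 1 y)).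
  apply: (integrable_dom _ _ ig).
    by apply: measurable_funM; [exact: measurable_chi|case/integrableP : ig => /measurable_EFinP].
  by move=> x; rewrite ger0_norm ?mulr_ge0 ?chi_ge0// ler_piMl ?chi_le1.
by have [] := Rintegral_tscale c0 i.
Qed.

Lemma gaussd_energy (q c : R) : 0 <= q -> 0 < c -> c <= 1 ->
  \int[mu]_x (japanese x `^ q * gaussd c x ^+ 2) <= (c^-1) `^ q * ((c^-1) ^+ d * genergy q).
Proof.
move=> q0 c0 c1.
have i := integrable_jpow_sq q (gaussd_schwartz ltr01) (g0 1) (gaussd_le1 1).
have [i2 <-] := Rintegral_tscale c0 i.
rewrite -RintegralZl//; apply: le_Rintegral => //.
- exact: integrable_jpow_sq (gaussd_schwartz c0) (g0 c) (gaussd_le1 c).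
- exact: integrable_mull.
- move=> x _; rewrite gaussd_tscale mulrA ler_wpM2r ?sqr_ge0//.
  exact: jpow_tscale.
Qed.

Lemma genergy_gt0 (q : R) : 0 <= q -> 0 < genergy q.
Proof.
move=> q0; have i := integrable_jpow_sq q (gaussd_schwartz ltr01) (g0 1) (gaussd_le1 1).
have p0 (x : Rd) : 0 < japanese x `^ q * gaussd 1 x ^+ 2.
  by rewrite mulr_gt0 ?powR_gt0 ?japanese_gt0// exprn_gt0// gaussd_gt0.
have e0 : 0 < (expR (- 1) ^+ d) ^+ 2 :> R by rewrite !exprn_gt0// expR_gt0.
have r8 : 0 < (8^-1 : R) by rewrite invr_gt0.
apply: lt_le_trans (@Rintegral_pos _ i p0 8^-1 _ r8 e0 _) _.
- move=> x hx; rewrite -[X in X <= _]mul1r; apply: ler_pM; [exact: ler01|exact: ltW| |].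
    by rewrite -(powRr0 (japanese x)); apply: ler_powR => //; exact: japanese_ge1.
  by rewrite lerXn2r ?nnegrE// ?gaussd_box// exprn_ge0// expR_ge0.
- apply: le_Rintegral => //; last by move=> x _; rewrite ler_piMl ?chi_le1// ltW.
  apply: (integrable_dom _ _ i).
    by apply: measurable_funM; [exact: measurable_chi|case/integrableP : i => /measurable_EFinP].
  move=> x; rewrite ger0_norm; last by apply: mulr_ge0; [exact: chi_ge0|exact/ltW/p0].
  by rewrite ler_piMl ?chi_le1// ltW.
Qed.

End test_functions.

Section multiscale.
Context {R : realType}.
Local Notation mu := (@leb R 1).
Local Notation Rd := (1.-tuple R).

(** A superposition of Gaussians at all dyadic scales up to [2 ^ J]: at the
    endpoint regularity its weighted L^2 norm grows only like the square root of
    its mass. *)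
Fixpoint multi (J : nat) : Rd -> R :=
  match J with
  | 0%N => fun=> 0
  | J'.+1 => fun x => multi J' x + (2^-1) ^+ J' * gaussd ((2^-1) ^+ J') x
  end.

Let h0 J : 0 < (2^-1 : R) ^+ J. Proof. by rewrite exprn_gt0// invr_gt0. Qed.
Let h1 J : (2^-1 : R) ^+ J <= 1. Proof. by rewrite exprn_ile1// invf_le1// ler1n. Qed.
Let hV J : ((2^-1 : R) ^+ J)^-1 = 2 ^+ J. Proof. by rewrite exprVn invrK. Qed.
Let hK J : (2^-1 : R) ^+ J * 2 ^+ J = 1. Proof. by rewrite -exprMn mulVf ?expr1n. Qed.

Let g0 (c : R) x : 0 <= @gaussd R 1 c x := ltW (gaussd_gt0 c x).

Lemma multi_schwartz J : rschwartz (multi J.+1).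
Proof.
elim: J => [|J IH].
  rewrite (_ : multi 1 = gaussd 1); first exact: gaussd_schwartz.
  by apply/funext => x; rewrite /= add0r expr0 mul1r.
exact: rschwartzD IH (rschwartzZ _ (gaussd_schwartz (h0 _))).
Qed.

Lemma multi_ge0 J x : 0 <= multi J x.
Proof. by elim: J => //= J IH; rewrite addr_ge0// mulr_ge0// ltW. Qed.

Lemma multi_le J x : multi J x <= J%:R.
Proof.
elim: J => [//|J IH]; rewrite -[J.+1%:R]natr1; apply: lerD => //.
exact: (mulr_ile1 (ltW (h0 J)) (g0 _ x) (h1 J) (gaussd_le1 _ x)).
Qed.

Let ig (q : R) c : 0 < c -> mu.-integrable setT (EFin \o (fun x => japanese x `^ q * gaussd c x)).
Proof. by move=> c0; apply: integrable_jpow => //; exact: gaussd_schwartz. Qed.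

Let im (q : R) J : mu.-integrable setT (EFin \o (fun x => japanese x `^ q * multi J x)).
Proof.
case: J => [|J]; last exact: integrable_jpow (multi_schwartz J) (multi_ge0 _).
by under eq_fun do rewrite mulr0; exact: integrable0.
Qed.

Let im0 J : mu.-integrable setT (EFin \o multi J).
Proof.
case: J => [|J]; first exact: integrable0.
exact/rschwartz_integrable/multi_schwartz.
Qed.

Lemma multi_mass J : \int[mu]_x multi J x = J%:R * @gmass R 1.
Proof.
elim: J => [|J IH]; first by rewrite Rintegral_cst// !mul0r.
have i := rschwartz_integrable (gaussd_schwartz (h0 J)) : mu.-integrable _ _.
rewrite /= RintegralD//; last exact: integrable_mull.
rewrite IH RintegralZl// gaussd_mass// expr1 mulrA hV hK -natr1 mulrDl mul1r//.
Qed.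

Definition jenergy : R := \int[mu]_x (japanese x `^ 1 * gaussd 1 x).

Let gj J : \int[mu]_x (japanese x `^ 1 * gaussd ((2^-1) ^+ J) x) <= 2 ^+ J * (2 ^+ J * jenergy).
Proof.
have i := ig 1 (ltr01 : 0 < 1 :> R).
have [i2] := Rintegral_tscale (h0 J) i; rewrite expr1 hV => e.
rewrite /jenergy -e -RintegralZl//; apply: le_Rintegral => //.
- exact: ig.
- exact: integrable_mull.
- move=> x _; rewrite gaussd_tscale mulrA ler_wpM2r//.
  have := jpow_tscale x (ler01 : 0 <= 1 :> R) (h0 J) (h1 J).
  by rewrite hV (powRr1 (exprn_ge0 J (ler0n R 2))).
Qed.

Let jen0 : 0 <= jenergy.
Proof. by apply: Rintegral_ge0 => x _; rewrite mulr_ge0 ?powR_ge0. Qed.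

Lemma multi_jenergy J : \int[mu]_x (japanese x `^ 1 * multi J x) <= 2 ^+ J * jenergy.
Proof.
elim: J => [|J IH].
  under eq_Rintegral do rewrite mulr0.
  by rewrite Rintegral_cst// mul0r mulr_ge0.
have e (x : Rd) : japanese x `^ 1 * multi J.+1 x = japanese x `^ 1 * multi J x +
   (2^-1) ^+ J * (japanese x `^ 1 * gaussd ((2^-1) ^+ J) x) by rewrite /=; ring.
under eq_Rintegral do rewrite e.
rewrite RintegralD//; last by apply: integrable_mull; exact: ig.
rewrite RintegralZl//; last exact: ig.
rewrite (_ : 2 ^+ J.+1 * jenergy = 2 ^+ J * jenergy + 2 ^+ J * jenergy); last by rewrite exprS; ring.
apply: lerD => //.
apply: le_trans (ler_wpM2l (ltW (h0 J)) (gj J)) _.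
by rewrite [X in X <= _]mulrA hK mul1r.
Qed.

(** The scale [J] contributes a bounded amount: its interaction with the
    preceding scales is controlled by [multi_jenergy], which is a geometric sum
    dominated by its last term. *)
Lemma multi_energy J : \int[mu]_x (japanese x `^ 1 * multi J x ^+ 2) <= J%:R * (3 * jenergy).
Proof.
elim: J => [|J IH].
  under eq_Rintegral do rewrite expr0n mulr0.
  by rewrite Rintegral_cst// !mul0r.
have i2 : mu.-integrable setT (EFin \o (fun x => japanese x `^ 1 * multi J x ^+ 2)).
  case: J {IH} => [|J]; last exact: integrable_jpow_sq (multi_schwartz J) (multi_ge0 _) (multi_le _).
  by under eq_fun do rewrite expr0n mulr0; exact: integrable0.
have i3 : mu.-integrable setT (EFin \o (fun x => japanese x `^ 1 * multi J.+1 x ^+ 2)).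
  exact: integrable_jpow_sq (multi_schwartz J) (multi_ge0 _) (multi_le _).
set c := (2^-1 : R) ^+ J.
apply: (@le_trans _ _ (\int[mu]_x (japanese x `^ 1 * multi J x ^+ 2 +
   ((2 * c) * (japanese x `^ 1 * multi J x) + c ^+ 2 * (japanese x `^ 1 * gaussd c x))))).
  apply: le_Rintegral => //.
    apply: integrableDr => //; apply: integrableDr; apply: integrable_mull => //.
    exact: ig (h0 J).
  move=> x _; rewrite /= -/c.
  have jp : 0 <= japanese x `^ 1 by exact: powR_ge0.
  have := g0 c x; have := gaussd_le1 c x; have := multi_ge0 J x; have c0 := ltW (h0 J).
  move: jp; move: (japanese x `^ 1) (multi J x) (gaussd c x) => p f e p0 f0 e1 e0.
  have -> : p * f ^+ 2 + (2 * c * (p * f) + c ^+ 2 * (p * e)) =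
     p * (f ^+ 2 + 2 * c * f + c ^+ 2 * e) by ring.
  apply: ler_wpM2l => //.
  have -> : (f + c * e) ^+ 2 = f ^+ 2 + 2 * c * f * e + c ^+ 2 * e * e by ring.
  apply: lerD; first by rewrite lerD2l ler_piMr// !mulr_ge0.
  by rewrite ler_piMr// mulr_ge0// sqr_ge0.
rewrite RintegralD//; last first.
  by apply: integrableDr; apply: integrable_mull => //; exact: ig (h0 J).
rewrite RintegralD//; do ?(apply: integrable_mull => //; exact: ig (h0 J)).
rewrite !RintegralZl//; last exact: ig (h0 J).
rewrite (_ : J.+1%:R * (3 * jenergy) = J%:R * (3 * jenergy) + 3 * jenergy); last first.
  by rewrite -[J.+1%:R]natr1 mulrDl mul1r.
apply: lerD => //.
have a1 : (2 * c) * \int[mu]_x (japanese x `^ 1 * multi J x) <= 2 * jenergy.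
  rewrite -mulrA ler_wpM2l//.
  by apply: le_trans (ler_wpM2l (ltW (h0 J)) (multi_jenergy J)) _; rewrite [X in X <= _]mulrA hK mul1r.
have a2 : c ^+ 2 * \int[mu]_x (japanese x `^ 1 * gaussd c x) <= jenergy.
  apply: le_trans (ler_wpM2l (sqr_ge0 c) (gj J)) _.
  rewrite (_ : c ^+ 2 * _ = (c * 2 ^+ J) * ((c * 2 ^+ J) * jenergy)); last by ring.
  by rewrite hK !mul1r.
by lra.
Qed.

End multiscale.

(** * Norm inflation for given parameters *)

Section inflation.
Context {R : realType} {d : nat}.
Local Notation Rd := (d.-tuple R).
Local Notation mu := (@leb R d).

(** [g] is truncated to the set where both [|g|] and [dot x x] are at most [n],
    and dominated convergence gives the approximation as [n] grows. *)
Lemma bounded_dense (s delta : R) (u0 : distrib R d) : in_Hs s u0 -> 0 < delta ->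
  exists (g : Rd -> R[i]) (V : Rd -> R[i]) (C : R), [/\ dfourier_is u0 g,
    cintegrable mu V, forall x, normc (V x) <= C &
    (\int[mu]_x (normc ((japanese x `^ s)%:C * (V x - g x)) ^+ 2)%:E <= delta%:E)%E].
Proof.
move=> [_ /ereal_inf_lt[_ [g gT <-] goo]] d0; have [mg _] := gT.
pose h (x : Rd) := normc ((japanese x `^ s)%:C * g x) ^+ 2.
have mj : cmeasurable (fun x : Rd => (japanese x `^ s)%:C : R[i]).
  by apply: cmeasurable_real; exact: measurable_jpow.
have mh : measurable_fun setT h.
  by apply: measurable_funX; apply: measurable_normc; exact: cmeasurableM.
have ih : mu.-integrable setT (EFin \o h).
  apply: ge0_integrableP => //; first by move=> x; exact: sqr_ge0.
  rewrite ltey; apply/eqP => hoo; move: goo; rewrite cLnorm2E hoo poweRyr ?ltxx//.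
pose b n (x : Rd) : R := ((normc (g x) <= n%:R) && (dot x x <= n%:R))%:R.
pose V n (x : Rd) : R[i] := (b n x)%:C * g x.
have mb n : measurable_fun setT (b n).
  apply: (measurableT_comp (f := fun c : bool => c%:R : R)) => //.
  apply: measurable_and; apply: measurable_fun_ler => //; try exact: measurable_cst.
    exact: measurable_normc.
  exact: measurable_dot.
have mV n : cmeasurable (V n) by apply: cmeasurableM => //; exact: cmeasurable_real.
have Vn n x : normc (V n x) <= n%:R.
  rewrite /V normcM normc_real /b; case: (boolP (normc (g x) <= n%:R)) => /= h1.
    by case: (dot x x <= n%:R); rewrite ?normr1 ?mul1r// normr0 mul0r.
  by rewrite normr0 mul0r.
have iV n : cintegrable mu (V n).
  apply: (cintegrable_dom (mV n) (G := fun x => (n%:R * (1 + n%:R) ^+ d) * jweight x)); last first.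
    exact/integrable_mull/integrable_jweight.
  move=> x; have [h1|h1] := leP (dot x x) n%:R; last first.
    rewrite {1}/V {1}/b (lt_geF h1) andbF mul0r normc0R.
    by rewrite mulr_ge0 ?jweight_ge0// mulr_ge0// exprn_ge0// addr_ge0.
  apply: le_trans (Vn n x) _; rewrite -mulrA ler_peMr//.
  apply: (@le_trans _ _ ((1 + n%:R) ^+ d * weight x ^+ d)); last first.
    by apply: ler_wpM2l (weight_jweight x); rewrite exprn_ge0// addr_ge0.
  rewrite -exprMn exprn_ege1// /weight -[X in X <= _](@mulfV _ (1 + dot x x)) ?gt_eqF ?dot1_gt0//.
  by rewrite ler_wpM2r ?invr_ge0 ?(ltW (dot1_gt0 x))// lerD2l.
pose e n (x : Rd) := normc ((japanese x `^ s)%:C * (V n x - g x)) ^+ 2.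
have me n : measurable_fun setT (e n).
  by apply: measurable_funX; apply: measurable_normc; apply: cmeasurableM => //; exact: cmeasurableB.
have eh n x : `|e n x| <= h x.
  rewrite ger0_norm ?sqr_ge0// lerXn2r ?nnegrE ?normc_ge0//.
  rewrite !normcM ler_wpM2l ?normc_ge0// /V /b.
  case: (_ && _); rewrite ?mul1r ?subrr ?normc0R ?normc_ge0// mul0r sub0r normcN.
  exact: lexx.
have ec x : (fun n => e n x) @ \oo --> (0 : R).
  apply: cvg_near_cst.
  exists (maxn (Num.Def.archi_bound (normc (g x))) (Num.Def.archi_bound (dot x x))) => // n /=.
  rewrite geq_max => /andP[n1 n2].
  have h1 : normc (g x) <= n%:R.
    by apply: (le_trans (ltW (Num.Theory.archi_boundP (normc_ge0 _)))); rewrite ler_nat.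
  have h2 : dot x x <= n%:R.
    by apply: (le_trans (ltW (Num.Theory.archi_boundP (dot_ge0 _)))); rewrite ler_nat.
  by rewrite /e /V /b h1 h2 mul1r subrr mulr0 normc0R expr0n.
have cv : (fun n => \int[mu]_x e n x) @ \oo --> \int[mu]_x (0 : R).
  exact: (Rintegral_cvg me ec eh ih).
rewrite Rintegral_cst// mul0r in cv.
have [n _ hn] : \forall n \near \oo, `|0 - \int[mu]_x e n x| < delta.
  by move/cvgrPdist_lt : cv => /(_ _ d0).
exists g, (V n), n%:R; split => //.
rewrite -EFin_Rintegral ?lee_fin; last exact: (integrable_dom (me n) (eh n) ih).
have := hn n (leqnn n); rewrite /= sub0r normrN => /ltW; apply: le_trans.
exact: ler_norm.
Qed.

(** The ratio between the smallness parameter [theta] of the Picard iteration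
    and the size [T * S ^+ 4] of the quintic interaction. *)
Definition amp : R := 5 * 8 ^+ 4.

Lemma theta_amp (T S : R) : theta T (4 * S) = amp * (T * S ^+ 4).
Proof.
rewrite /theta /amp (_ : 2 * (4 * S) = 8 * S); last by ring.
by rewrite exprMn; move: (8 ^+ 4) => c; ring.
Qed.

Lemma amp_gt0 : 0 < amp.
Proof. by rewrite /amp mulr_gt0// exprn_gt0. Qed.

Definition inflation (m s eps : R) (u0 : distrib R d) : Prop :=
  exists (T0 : R) (u : R -> Rd -> R[i]) (t : R),
    [/\ solution m T0 u, 0 < t < eps, t <= T0,
        (Hs_norm s (fun phi => (of_fun (u 0) phi - u0 phi)%R) < eps%:E)%E
      & (eps^-1%:E < Hs_norm s (of_fun (u t)))%E].

Section parameters.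
Variables (m s eps rho A N al beta P W Voo : R) (u0 : distrib R d).
Variables (g V : Rd -> R[i]) (psi : Rd -> R) (j0 : 'I_d).
Local Notation S := (@boxmass R d A al).
Local Notation V1 := (\int[mu]_x normc (V x)).
Local Notation I := (\int[mu]_x psi x).
Local Notation F := (@twobox R d A N al).
Local Notation q := (- (s + s)).
(** A quarter of the lower bound for the quintic term, relative to [al] times
    the mass of the test function; the other quarters absorb the errors. *)
Definition gain : R := @coherence R d * rho * beta / 8.

Hypotheses (m1 : `|m| = 1) (s0 : s < 0) (eps0 : 0 < eps) (rho0 : 0 < rho).
Hypotheses (A0 : 0 < A) (N0 : 0 < N) (al0 : 0 < al) (AN : 2 * A <= N).
Hypotheses (u0g : dfourier_is u0 g) (cV : cintegrable mu V) (VB : forall x, normc (V x) <= Voo).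
Hypothesis Vg : (\int[mu]_x (normc ((japanese x `^ s)%:C * (V x - g x)) ^+ 2)%:E <= (eps ^+ 2 / 16)%:E)%E.
Hypothesis data_size : al ^+ 2 * (2 * A) ^+ d = (eps / 8) ^+ 2 * (N / 2) `^ q.
Hypothesis V_small : V1 <= 2 * S.
Hypothesis short_time : rho / S ^+ 4 < eps.
Hypothesis phases : 128 * rho * (d%:R * (15 * N) ^+ 2) ^+ 2 <= S ^+ 4.
Hypotheses (rho1 : amp * rho <= 2^-1) (rho2 : rho * 16 * amp ^+ 2 <= @coherence R d * beta).
Hypotheses (spsi : rschwartz psi) (psi0 : forall x, 0 <= psi x) (psiP : forall x, psi x <= P).
Hypothesis bpsi : beta * I <= \int[mu]_x (chi 0 (A / 8) x * psi x).
Hypothesis W0 : 0 < W.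
Hypothesis hW : \int[mu]_x (japanese x `^ q * psi x ^+ 2) <= W ^+ 2.
Hypothesis far : \int[mu]_x (F x * psi x) <= gain * al * I.
Hypothesis large : (eps^-1 + 1 + (2 * Voo * V1 + 2^-1)) * W <= gain * al * I.

(** The datum is [V + F] and the time is [T = rho / S ^+ 4]. The quintic term
    paired with [psi] is at least four times [gain * al * I]: two are spent on
    the later iterates, one on the free evolution of [F], and the last one
    exceeds the target and the influence of [V]. *)
Lemma inflation_of_parameters : inflation m s eps u0.
Proof.
have S0 : 0 < S by rewrite /boxmass mulr_gt0// exprn_gt0// mulr_gt0.
have S4 : 0 < S ^+ 4 by rewrite exprn_gt0.
pose T := rho / S ^+ 4.
have Tpos : 0 < T by rewrite divr_gt0.
have T0 : 0 <= T := ltW Tpos.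
have TS : T * S ^+ 4 = rho by rewrite /T divfK// gt_eqF.
have eth : theta T (4 * S) = amp * rho by rewrite theta_amp TS.
have th : theta T (4 * S) <= 2^-1 by rewrite eth.
have k1 : @kappa R d N T <= 64^-1.
  rewrite /kappa; have := phases; set D := (_ * _) ^+ 2; rewrite -{1}TS => h.
  have {}h : (128 * (T * D)) * S ^+ 4 <= 1 * S ^+ 4 by rewrite mul1r; apply: le_trans h; apply: ler_eq; ring.
  by rewrite ler_pM2r// in h; lra.
have mpsi := rschwartz_measurable spsi; have ipsi := rschwartz_integrable spsi.
have hlow := core_lower A0 N0 al0 AN T0 m1 cV VB V_small th k1 mpsi psi0 psiP ipsi bpsi.
have q0 : 0 <= q by have := s0; lra.
have ij2 := integrable_jpow_sq q spsi psi0 psiP.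
have jq x : psi x ^+ 2 <= japanese x `^ q * psi x ^+ 2.
  rewrite ler_peMl ?sqr_ge0// -(powRr0 (japanese x)); apply: ler_powR => //.
  exact: japanese_ge1.
have ip2 : mu.-integrable setT (EFin \o (fun x => psi x ^+ 2)).
  apply: (integrable_dom _ _ ij2); first exact: measurable_funX.
  by move=> x; rewrite ger0_norm ?sqr_ge0.
have p2W : \int[mu]_x (psi x ^+ 2) <= W ^+ 2.
  by apply: le_trans hW; apply: le_Rintegral.
have hsp := spread_pairing N A0 al0 T0 cV VB V_small th mpsi psi0 psiP W0 ip2 p2W.
exists T, (sol m T (datum A N al V)), T; split => //.
- exact: (core_sol_solution N A0 al0 T0 m1 cV VB V_small th).
- by rewrite Tpos.
- apply: (@le_lt_trans _ _ (eps / 2)%:E); last by rewrite lte_fin; have := eps0; lra.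
  have e20 : 0 <= eps / 2 by have := eps0; lra.
  apply: (Hs_norm_data u0g _ e20).
    exact: (core_good N A0 al0 T0 m1 cV VB V_small th _).
  have hh : hlim m T (datum A N al V) 0 = datum A N al V.
    by apply/funext => x; exact: (core_h0 N A0 al0 T0 m1 cV VB V_small th x).
  rewrite hh; have ds := data_size; set n := (N / 2) `^ q in ds.
  have n0 : 0 < n by rewrite powR_gt0// divr_gt0.
  have iF := integrable_twobox N al A0 : mu.-integrable setT (EFin \o F).
  have F0 := twobox_ge0 A N al0.
  (* On the support of [F] the weight is at most [(N / 2) ^ s], and [F ^ 2 <= 2
      al F], so that the square norm of [F] is controlled by its mass. *)
  have pt x : normc ((japanese x `^ s)%:C * (datum A N al V x - g x)) ^+ 2 <=
     2 * normc ((japanese x `^ s)%:C * (V x - g x)) ^+ 2 + (4 * al / n) * F x.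
    have jF : (japanese x `^ s * F x) ^+ 2 <= (2 * al / n) * F x.
      have [->|Fx] := eqVneq (F x) 0; first by rewrite mulr0 expr0n mulr0.
      have [h1 h2] := andP (twobox_far A0 AN j0 Fx).
      have jN : N / 2 <= japanese x.
        apply: (@le_trans _ _ (tnth x j0)); first by have := AN; lra.
        rewrite -(@ler_pXn2r _ 2)// ?nnegrE ?(ltW (japanese_gt0 x))//; last by have := A0; have := AN; lra.
        by rewrite sqr_japanese; apply: le_trans (tnth_sqr_le_dot x j0) _; rewrite lerDr.
      rewrite exprMn expr2 -powRD; last by rewrite (gt_eqF (japanese_gt0 x)) implybT.
      have -> : japanese x `^ (s + s) = (japanese x `^ q)^-1 by rewrite -powRN opprK.
      have hj : (japanese x `^ q)^-1 <= n^-1.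
        have jp := powR_gt0 q (japanese_gt0 x); rewrite lef_pV2 ?posrE//.
        by apply: ge0_ler_powR => //; rewrite nnegrE ?divr_ge0 ?(ltW N0) ?(ltW (japanese_gt0 x)).
      apply: le_trans (ler_wpM2r (sqr_ge0 _) hj) _.
      rewrite mulrC [2 * al / n * _]mulrAC; apply: ler_wpM2r; first by rewrite invr_ge0 ltW.
      by rewrite expr2 ler_wpM2r// twobox_le.
    have tri : normc ((japanese x `^ s)%:C * (datum A N al V x - g x)) <=
        normc ((japanese x `^ s)%:C * (V x - g x)) + japanese x `^ s * F x.
      have -> : (japanese x `^ s)%:C * (datum A N al V x - g x) =
         (japanese x `^ s)%:C * (V x - g x) + (japanese x `^ s * F x)%:C.
        rewrite (_ : (japanese x `^ s * F x)%:C = (japanese x `^ s)%:C * (F x)%:C); last by rewrite -rmorphM.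
        rewrite /datum; move: ((japanese x `^ s)%:C) (V x) (g x) ((F x)%:C) => a b c f.
        by ring.
      apply: le_trans (normcD _ _) _; rewrite lerD2l normc_real ger0_norm//.
      by rewrite mulr_ge0 ?powR_ge0.
    move: tri jF; set a := normc _; set b := normc _; set c := japanese x `^ s * F x => tri jF.
    have a0 : 0 <= a by exact: normc_ge0.
    have b0 : 0 <= b by exact: normc_ge0.
    have c0 : 0 <= c by rewrite mulr_ge0 ?powR_ge0.
    apply: (@le_trans _ _ (2 * b ^+ 2 + 2 * c ^+ 2)).
      by have := sqr_ge0 (b - c); nra.
    rewrite lerD2l; apply: le_trans (ler_wpM2l (ler0n R 2) jF) _.
    by apply: ler_eq; ring.
  have mj : cmeasurable (fun x : Rd => (japanese x `^ s)%:C : R[i]).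
    by apply: cmeasurable_real; exact: measurable_jpow.
  have mVg : measurable_fun setT (fun x => normc ((japanese x `^ s)%:C * (V x - g x)) ^+ 2).
    apply: measurable_funX; apply: measurable_normc; apply: cmeasurableM => //.
    by apply: cmeasurableB; [exact: cintegrable_cmeasurable cV|case: u0g].
  have mD : measurable_fun setT (fun x => normc ((japanese x `^ s)%:C * (datum A N al V x - g x)) ^+ 2).
    apply: measurable_funX; apply: measurable_normc; apply: cmeasurableM => //.
    apply: cmeasurableB; last by case: u0g.
    exact: (cmeasurable_datum A N al cV).
  have mF2 : measurable_fun setT (fun x => (4 * al / n) * F x).
    by apply: measurable_funM => //; exact: measurable_twobox.
  have c0 : 0 <= 4 * al / n by rewrite divr_ge0 ?(ltW n0)// mulr_ge0// ltW.
  apply: (@le_trans _ _ (\int[mu]_x (2 * normc ((japanese x `^ s)%:C * (V x - g x)) ^+ 2 + (4 * al / n) * F x)%:E)%E).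
    apply: ge0_le_integral => //.
    - by move=> x _; rewrite lee_fin sqr_ge0.
    - exact/measurable_EFinP.
    - by apply/measurable_EFinP; apply: measurable_funD => //; exact: measurable_funM.
    - by move=> x _; rewrite lee_fin pt.
  under eq_integral do rewrite EFinD EFinM.
  rewrite ge0_integralD//; first last.
  - exact/measurable_EFinP.
  - by move=> x _; rewrite lee_fin mulr_ge0.
  - by apply: measurable_funeM; exact/measurable_EFinP.
  - by move=> x _; rewrite mule_ge0// lee_fin ?sqr_ge0.
  rewrite ge0_integralZl_EFin//; first last.
  - exact/measurable_EFinP.
  - by move=> x _; rewrite lee_fin sqr_ge0.
  rewrite -[X in (_ + X)%E]EFin_Rintegral; last exact: integrable_mull.
  rewrite RintegralZl// (Rintegral_twobox N al A0).
  apply: le_trans (leeD2r _ (lee_wpmul2l _ Vg)) _; first by rewrite lee_fin.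
  rewrite -EFinM -EFinD lee_fin.
  have -> : 4 * al / n * (2 * S) = eps ^+ 2 / 8.
    rewrite /boxmass (_ : 4 * al / n * (2 * (al * (2 * A) ^+ d)) = 8 * (al ^+ 2 * (2 * A) ^+ d) / n); last by ring.
    by rewrite ds; field; rewrite gt_eqF.
  by apply: ler_eq; field.
- apply: (@lt_le_trans _ _ (eps^-1 + 1)%:E); first by rewrite lte_fin ltrDl.
  apply: (@Hs_norm_lower _ _ _ _ W _ psi) => //.
  + exact: (core_good N A0 al0 T0 m1 cV VB V_small th _).
  + rewrite (_ : (\int[mu]_x ((japanese x `^ (- s) * psi x) ^+ 2)%:E)%E = (\int[mu]_x (japanese x `^ q * psi x ^+ 2)%:E)%E).
      by rewrite -EFin_Rintegral// lee_fin.
    apply: eq_integral => x _; congr (_%:E); rewrite exprMn expr2 -powRD ?(gt_eqF (japanese_gt0 x)) ?implybT//.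
    by rewrite opprD.
  + apply: le_trans hlow; rewrite TS eth.
    have gE : @coherence R d * rho * al * beta / 2 * I = 4 * (gain * al * I) by rewrite /gain; field.
    have I0 : 0 <= I by exact: Rintegral_ge0.
    have g2 : 4 * al * (amp * rho) ^+ 2 * I <= 2 * (gain * al * I).
      have aI : 0 <= al * I by rewrite mulr_ge0// ltW.
      have -> : 4 * al * (amp * rho) ^+ 2 * I = (4 * amp ^+ 2 * rho ^+ 2) * (al * I) by ring.
      have -> : 2 * (gain * al * I) = (2 * gain) * (al * I) by ring.
      apply: ler_wpM2r => //; rewrite /gain.
      have := ler_wpM2l (ltW rho0) rho2.
      have -> : rho * (rho * 16 * amp ^+ 2) = 4 * (4 * amp ^+ 2 * rho ^+ 2) by ring.
      have -> : rho * (@coherence R d * beta) = 4 * (2 * (@coherence R d * rho * beta / 8)) by field.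
      by rewrite ler_pM2l.
    rewrite gE; have := far; have := large; have := hsp; have := g2.
    rewrite [(eps^-1 + 1 + _) * W]mulrDl; lra.
Qed.

End parameters.
End inflation.

(** * Choice of the parameters *)

Section selection.
Context {R : realType}.

Lemma powR_large (q K : R) : 0 < q -> exists2 n0 : R, 1 <= n0 & forall n, n0 <= n -> K <= n `^ q.
Proof.
move=> q0; pose M := Num.max K 1.
have M1 : 1 <= M by rewrite le_max lexx orbT.
have M0 : 0 <= M := le_trans ler01 M1.
exists (M `^ q^-1).
  by rewrite -(powRr0 M); apply: ler_powR => //; rewrite invr_ge0 ltW.
move=> n h; apply: (@le_trans _ _ M); first by rewrite le_max lexx.
have {1}-> : M = (M `^ q^-1) `^ q by rewrite -powRrM mulVf ?gt_eqF// powRr1.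
have p0 := powR_ge0 M q^-1.
by apply: ge0_ler_powR => //; rewrite ?nnegrE ?(ltW q0)//; exact: le_trans h.
Qed.

Lemma small_rho (b r : R) : 0 < b -> 0 < r ->
  exists rho : R, [/\ 0 < rho, rho <= r, amp * rho <= 2^-1 & rho * 16 * amp ^+ 2 <= b].
Proof.
move=> b0 r0; have c0 := @amp_gt0 R; move: (@amp R) c0 => c c0.
have c16 : 0 < 16 * c ^+ 2 by rewrite mulr_gt0// exprn_gt0.
have c2 : 0 < 2 * c by rewrite mulr_gt0.
exists (Num.min r (Num.min (2 * c)^-1 (b / (16 * c ^+ 2)))); set rho := Num.min _ _.
have h1 : rho <= r by rewrite ge_min lexx.
have h2 : rho <= (2 * c)^-1 by rewrite ge_min orbC ge_min lexx.
have h3 : rho <= b / (16 * c ^+ 2) by rewrite ge_min orbC ge_min lexx orbT.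
split => //; first by rewrite !lt_min r0 invr_gt0 c2 divr_gt0.
- apply: le_trans (ler_wpM2l (ltW c0) h2) _; apply: ler_eq.
  by field; rewrite gt_eqF.
- by rewrite -mulrA -ler_pdivlMr.
Qed.

Section profile.
Context {d : nat}.
Local Notation Rd := (d.-tuple R).
Local Notation mu := (@leb R d).
Variables (m s eps rho n a beta P W Voo : R) (u0 : distrib R d).
Variables (g V : Rd -> R[i]) (psi : Rd -> R) (j0 : 'I_d).
Local Notation V1 := (\int[mu]_x normc (V x)).
Local Notation I := (\int[mu]_x psi x).
Local Notation q := (- (s + s)).
Local Notation gain := (@gain R d rho beta).
Hypotheses (m1 : `|m| = 1) (s0 : s < 0) (eps0 : 0 < eps) (rho0 : 0 < rho) (beta0 : 0 < beta).
Hypotheses (a0 : 0 < a) (an : a <= n).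
Hypotheses (u0g : dfourier_is u0 g) (cV : cintegrable mu V) (VB : forall x, normc (V x) <= Voo).
Hypothesis Vg : (\int[mu]_x (normc ((japanese x `^ s)%:C * (V x - g x)) ^+ 2)%:E <= (eps ^+ 2 / 16)%:E)%E.
Hypothesis mass : V1 ^+ 2 <= (eps / 8) ^+ 2 * (n `^ q * a ^+ d).
Hypothesis time : rho < eps * ((eps / 8) ^+ 4 * (n `^ q * a ^+ d) ^+ 2).
Hypothesis phases : 128 * rho * (d%:R * (30 * n) ^+ 2) ^+ 2 <= (eps / 8) ^+ 4 * (n `^ q * a ^+ d) ^+ 2.
Hypotheses (rho1 : amp * rho <= 2^-1) (rho2 : rho * 16 * amp ^+ 2 <= @coherence R d * beta).
Hypotheses (spsi : rschwartz psi) (psi0 : forall x, 0 <= psi x) (psiP : forall x, psi x <= P).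
Hypothesis bpsi : beta * I <= \int[mu]_x (chi 0 (a / 16) x * psi x).
Hypothesis tail : 2 * (I - \int[mu]_x (chi 0 n x * psi x)) <= gain * I.
Hypothesis W0 : 0 < W.
Hypothesis hW : \int[mu]_x (japanese x `^ q * psi x ^+ 2) <= W ^+ 2.
Hypothesis large : (eps^-1 + 1 + (2 * Voo * V1 + 2^-1)) ^+ 2 * W ^+ 2 * a ^+ d <=
  gain ^+ 2 * ((eps / 8) ^+ 2 * n `^ q) * I ^+ 2.

Let n0 : 0 < n. Proof. exact: lt_le_trans a0 an. Qed.
Let e0 : 0 < eps / 8. Proof. by rewrite divr_gt0. Qed.
Let ad0 : 0 < a ^+ d. Proof. exact: exprn_gt0. Qed.
Let nq0 : 0 < n `^ q. Proof. exact: powR_gt0. Qed.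
Let X0 : 0 < n `^ q * a ^+ d. Proof. exact: mulr_gt0. Qed.
Let gain0 : 0 < gain.
Proof. by apply: divr_gt0 => //; apply: mulr_gt0 => //; apply: mulr_gt0 => //; exact: coherence_gt0. Qed.

(** The parameters are normalized by [A = a / 2], [N = 2 n], and by choosing
    [al] such that the part of the datum carried by the boxes has size [eps /
    4]. *)
Lemma inflation_of_profile : inflation m s eps u0.
Proof.
pose al := eps / 8 * Num.sqrt (n `^ q / a ^+ d).
have al0 : 0 < al by rewrite mulr_gt0// sqrtr_gt0 divr_gt0.
have al2 : al ^+ 2 * a ^+ d = (eps / 8) ^+ 2 * n `^ q.
  rewrite /al exprMn sqr_sqrtr; last by rewrite divr_ge0// ltW.
  by rewrite -mulrA divfK// gt_eqF.
have SE : @boxmass R d (a / 2) al = al * a ^+ d.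
  by rewrite /boxmass (_ : 2 * (a / 2) = a)//; field.
clearbody al.
have Sp : 0 < al * a ^+ d by exact: mulr_gt0.
have S2 : (al * a ^+ d) ^+ 2 = (eps / 8) ^+ 2 * (n `^ q * a ^+ d).
  by rewrite mulrA -al2; ring.
have S4 : (al * a ^+ d) ^+ 4 = (eps / 8) ^+ 4 * (n `^ q * a ^+ d) ^+ 2.
  by rewrite (exprM _ 2 2) S2; ring.
have ipsi := rschwartz_integrable spsi.
have I0 : 0 <= I by exact: Rintegral_ge0.
have A0 : 0 < a / 2 by rewrite divr_gt0.
have N0 : 0 < 2 * n by rewrite mulr_gt0.
have AN : 2 * (a / 2) <= 2 * n by have := an; have := a0; lra.
apply: (@inflation_of_parameters R d m s eps rho (a / 2) (2 * n) al beta P W Voo u0 g V psi j0) => //.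
- rewrite (_ : 2 * (a / 2) = a); last by field.
  by rewrite (_ : 2 * n / 2 = n)//; field.
- rewrite SE -(@ler_pXn2r _ 2)// ?nnegrE; first last.
  + by rewrite mulr_ge0// ltW.
  + by apply: Rintegral_ge0 => x _; exact: normc_ge0.
  + rewrite exprMn S2; apply: le_trans mass _.
    have : 0 <= (eps / 8) ^+ 2 * (n `^ q * a ^+ d) by rewrite mulr_ge0 ?sqr_ge0// ltW.
    by lra.
- rewrite SE ltr_pdivrMr ?exprn_gt0//; rewrite S4; exact: time.
- rewrite SE S4 (_ : 15 * (2 * n) = 30 * n); [exact: phases|ring].
- by rewrite (_ : a / 2 / 8 = a / 16)//; field.
- have mpsi := rschwartz_measurable spsi.
  have icp : mu.-integrable setT (EFin \o (fun x => chi 0 n x * psi x)).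
    by apply: (integrableMb (integrable_chi 0 (ltW n0)) mpsi psi0 psiP); exact: chi_ge0.
  have iF : mu.-integrable setT (EFin \o (fun x => twobox (a / 2) (2 * n) al x * psi x)).
    apply: (integrableMb (integrable_twobox (2 * n) al A0) mpsi psi0 psiP).
    exact: twobox_ge0.
  have pt x : twobox (a / 2) (2 * n) al x * psi x <= 2 * al * (psi x - chi 0 n x * psi x).
    have [hx|hx] := chi_inP 0 n x.
      have [->|Fx] := eqVneq (twobox (a / 2) (2 * n) al x) 0.
        rewrite mul0r; apply: mulr_ge0; first by rewrite mulr_ge0// ltW.
        by rewrite subr_ge0 ler_piMl// chi_le1.
      have := andP (twobox_far A0 AN j0 Fx).
      have := hx j0; rewrite subr0 ler_norml => /andP[_ h1] [h2 _].
      by have := an; have := a0; lra.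
    rewrite hx mul0r subr0; apply: ler_wpM2r => //; exact: twobox_le.
  apply: (@le_trans _ _ (2 * al * (I - \int[mu]_x (chi 0 n x * psi x)))).
    have iB : mu.-integrable setT (EFin \o (fun x => psi x - chi 0 n x * psi x)).
      exact: (integrableB measurableT ipsi icp).
    rewrite -RintegralB// -RintegralZl//.
    apply: le_Rintegral => //; exact: integrable_mull.
  have := ler_wpM2l (ltW al0) tail; move: (gain) => k h.
  by apply: (le_trans _ (le_trans h _)); apply: ler_eq; ring.
- have lg := large; set C := _ + _ in lg *; have C0 : 0 <= C.
    rewrite /C addr_ge0// ?addr_ge0 ?invr_ge0 ?(ltW eps0)//.
    apply: mulr_ge0; last by apply: Rintegral_ge0 => x _; exact: normc_ge0.
    apply: mulr_ge0 => //; exact: le_trans (normc_ge0 _) (VB (tcst 0)).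
  rewrite -(@ler_pXn2r _ 2)// ?nnegrE; first last.
  + by apply: mulr_ge0 => //; exact/ltW/mulr_gt0.
  + by apply: mulr_ge0 => //; exact: ltW.
  rewrite -(ler_pM2r ad0) [(C * W) ^+ 2]exprMn.
  apply: le_trans lg _; rewrite -al2; move: (gain) (a ^+ d) => k D; apply: ler_eq.
  by ring.
Qed.

End profile.

Section high_dimension.
Context {d : nat}.
Local Notation Rd := (d.-tuple R).
Local Notation mu := (@leb R d).

(** [L] is chosen first, large enough for the pairing to exceed the target and
    for the boxes to be far out in the tail of [psi]; then [n], large enough for
    the mass of the boxes to dominate that of [V], for the time to be small and
    for the phases to be coherent. *)
Lemma inflation_high (m s eps : R) (u0 : distrib R d) (j0 : 'I_d) :
  `|m| = 1 -> s < 0 -> (2 <= d)%N -> in_Hs s u0 -> 0 < eps -> inflation m s eps u0.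
Proof.
move=> m1 s0 d2 hu0 eps0.
have e2 : 0 < eps ^+ 2 / 16 by rewrite divr_gt0// exprn_gt0.
have [g [V [Voo [u0g cV VB Vg]]]] := bounded_dense hu0 e2.
set V1 := \int[mu]_x normc (V x).
pose q := - (s + s); have q0 : 0 < q by rewrite /q; have := s0; lra.
set I1 := @gmass R d; have I1p : 0 < I1 := gaussd_int_gt0.
set H := @genergy R d q; have Hp : 0 < H := genergy_gt0 (ltW q0).
set beta := @gbeta R d; have betap : 0 < beta by exact: divr_gt0 gaussd_box_gt0 I1p.
have cb : 0 < @coherence R d * beta := mulr_gt0 coherence_gt0 betap.
have [rho [rho0 _ rho1 rho2]] := small_rho cb ltr01.
set k := @gain R d rho beta.
have k0 : 0 < k.
  by apply: divr_gt0 => //; apply: mulr_gt0 => //; apply: mulr_gt0 => //; exact: coherence_gt0.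
set e := eps / 8; have e0 : 0 < e by rewrite divr_gt0.
set C := eps^-1 + 1 + (2 * Voo * V1 + 2^-1).
have ig : mu.-integrable setT (EFin \o gaussd 1) := rschwartz_integrable (gaussd_schwartz ltr01).
have g0 c (x : Rd) : 0 <= gaussd c x := ltW (gaussd_gt0 c x).
have eta0 : 0 < k * I1 / 2 by rewrite divr_gt0// mulr_gt0.
have [r0 hr0] := chi_tail ig (g0 1) eta0.
have [L1 L1p hL1] := powR_large (C ^+ 2 * H * 2 ^+ d / (k ^+ 2 * e ^+ 2 * I1 ^+ 2)) q0.
pose L := Num.max L1 r0.
have L11 : L1 <= L by rewrite le_max lexx.
have Lr0 : r0 <= 2 * L.
  have : r0 <= L by rewrite le_max lexx orbT.
  by have := L1p; move: L11; lra.
have L1' : 1 <= L := le_trans L1p L11.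
have L0 : 0 < L := lt_le_trans ltr01 L1'.
have Ld0 : 0 < L ^+ d by rewrite exprn_gt0.
(* The mass, the time and the phases each ask for [n `^ q] to exceed a constant
    multiple of [L ^+ d]; the exponent [d >= 2] is used to compare [n ^+ d] with
    [n ^+ 2]. *)
pose Y := 1 + V1 ^+ 2 / e ^+ 2 + rho / (eps * e ^+ 4) + 128 * rho * (d%:R * 30 ^+ 2) ^+ 2 / e ^+ 4.
have [n1 n11 hn1] := powR_large (L ^+ d * Y) q0.
pose n := Num.max n1 (2 * L).
have nn1 : n1 <= n by rewrite le_max lexx.
have n2L : 2 * L <= n by rewrite le_max lexx orbT.
have n1' : 1 <= n := le_trans n11 nn1.
have n0 : 0 < n := lt_le_trans ltr01 n1'.
pose a := n / L; have a2 : 2 <= a by rewrite ler_pdivlMr.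
have a0 : 0 < a := lt_le_trans (ltr0n R 2) a2.
have an : a <= n by rewrite ler_pdivrMr// ler_peMr// ltW.
have c0 : 0 < 2 / a by rewrite divr_gt0.
have c1 : 2 / a <= 1 by rewrite ler_pdivrMr// mul1r.
have ci : (2 / a)^-1 = a / 2 by rewrite invf_div.
have X1 : Y * n ^+ 2 <= n `^ q * a ^+ d.
  rewrite (_ : a ^+ d = n ^+ d / L ^+ d); last by rewrite /a exprMn exprVn.
  rewrite [X in _ <= X]mulrA ler_pdivlMr// mulrAC; apply: ler_pM.
  - apply: mulr_ge0; last exact: ltW.
    rewrite /Y !addr_ge0//; first by rewrite divr_ge0// sqr_ge0.
      by rewrite divr_ge0 ?(ltW rho0)// mulr_ge0 ?(ltW eps0)// exprn_ge0// ltW.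
    rewrite divr_ge0//; last by rewrite exprn_ge0// ltW.
    by rewrite mulr_ge0 ?sqr_ge0// mulr_ge0// ltW.
  - exact: sqr_ge0.
  - by rewrite mulrC; exact: hn1.
  - exact: ler_weXn2l.
have e20 : 0 < e ^+ 2 by rewrite exprn_gt0.
have e40 : 0 < e ^+ 4 by rewrite exprn_gt0.
pose y1 := V1 ^+ 2 / e ^+ 2; pose y2 := rho / (eps * e ^+ 4).
pose y3 := 128 * rho * (d%:R * 30 ^+ 2) ^+ 2 / e ^+ 4.
have y10 : 0 <= y1 by rewrite divr_ge0 ?sqr_ge0.
have y20 : 0 < y2 by rewrite divr_gt0// mulr_gt0.
have y30 : 0 <= y3.
  rewrite divr_ge0 ?(ltW e40)// mulr_ge0 ?sqr_ge0//.
  by rewrite mulr_ge0// ltW.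
have YE : Y = 1 + y1 + y2 + y3 by [].
have nn : 1 <= n ^+ 2 by rewrite exprn_ege1.
set X := n `^ q * a ^+ d in X1.
have Xy1 : y1 <= X.
  apply: le_trans X1; rewrite YE.
  by move: (y1) (y2) (y3) (n ^+ 2) y10 y20 y30 nn; clear; move=> *; nra.
have Xs : (1 + y2 + y3) * n ^+ 4 <= X ^+ 2.
  apply: (@le_trans _ _ ((Y * n ^+ 2) ^+ 2)).
    rewrite exprMn -exprM; apply: ler_wpM2r; first by rewrite exprn_ge0// ltW.
    by rewrite YE; nra.
  rewrite lerXn2r ?nnegrE//; last by rewrite mulr_ge0 ?powR_ge0// exprn_ge0// ltW.
  apply: mulr_ge0; last exact: sqr_ge0.
  by rewrite YE; move: y10 y20 y30; clear; lra.
have n4 : 1 <= n ^+ 4 by rewrite exprn_ege1.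
pose W := Num.sqrt ((a / 2) `^ q * ((a / 2) ^+ d * H)).
have W2 : 0 < (a / 2) `^ q * ((a / 2) ^+ d * H).
  by rewrite mulr_gt0 ?powR_gt0 ?divr_gt0// mulr_gt0// exprn_gt0// divr_gt0.
have WE : W ^+ 2 = (a / 2) `^ q * ((a / 2) ^+ d * H) by rewrite sqr_sqrtr// ltW.
have mE : \int[mu]_x gaussd (2 / a) x = (a / 2) ^+ d * I1 by rewrite gaussd_mass// ci.
have ad : 0 < (a / 2) ^+ d by rewrite exprn_gt0// divr_gt0.
apply: (@inflation_of_profile d m s eps rho n a beta 1 W Voo u0 g V (gaussd (2 / a)) j0) => //.
- by rewrite -/V1 -/e -/q -/X -ler_pdivrMl// mulrC.
- rewrite -/e -/q -/X mulrA -ltr_pdivrMl ?mulr_gt0// mulrC.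
  apply: lt_le_trans Xs; rewrite -/y2.
  by move: (y2) (y3) (n ^+ 4) y20 y30 n4; clear; move=> *; nra.
- rewrite -/e -/q -/X -ler_pdivrMl// mulrC.
  have -> : 128 * rho * (d%:R * (30 * n) ^+ 2) ^+ 2 / e ^+ 4 = y3 * n ^+ 4.
    by rewrite /y3; field; rewrite gt_eqF.
  apply: le_trans Xs; apply: ler_wpM2r; first exact: le_trans ler01 n4.
  by move: y20; clear; lra.
- exact: gaussd_schwartz.
- exact: gaussd_le1.
- rewrite mE (_ : a / 16 = 8^-1 / (2 / a)); last by field; rewrite gt_eqF.
  rewrite gaussd_chi// ci mulrCA; apply: ler_wpM2l; first exact: ltW.
  by rewrite /beta /gbeta divfK// gt_eqF.
- rewrite mE (_ : n = (2 * L) / (2 / a)); last by rewrite /a; field; rewrite !gt_eqF.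
  rewrite gaussd_chi// ci -mulrBr [2 * _]mulrCA [X in _ <= X]mulrCA.
  apply: ler_wpM2l; first exact: ltW.
  have := hr0 _ Lr0; rewrite -/k -/I1 -[\int[mu]_x gaussd 1 x]/I1.
  by move: (I1 - _) (k * I1); clear; move=> *; lra.
- by rewrite sqrtr_gt0.
- by rewrite WE -ci; exact: gaussd_energy (ltW q0) c0 c1.
- rewrite -/V1 -/C -/e -/q -/k mE WE.
  have hq : (a / 2) `^ q * (C ^+ 2 * H * 2 ^+ d) <= k ^+ 2 * e ^+ 2 * I1 ^+ 2 * n `^ q.
    have -> : n = (a / 2) * (2 * L) by rewrite /a; field; rewrite gt_eqF.
    have h2 : 0 <= a / 2 by rewrite divr_ge0// ltW.
    have h3 : 0 <= 2 * L by rewrite mulr_ge0// ltW.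
    rewrite (powRM _ h2 h3).
    rewrite [X in _ <= X]mulrCA; apply: ler_wpM2l; first exact: powR_ge0.
    have kp : 0 < k ^+ 2 * e ^+ 2 * I1 ^+ 2.
      exact: mulr_gt0 (mulr_gt0 (exprn_gt0 2 k0) e20) (exprn_gt0 2 I1p).
    rewrite -(ler_pdivrMl _ _ kp).
    by rewrite mulrC; apply: hL1; move: L0 L11; clear; lra.
  have e3 : a ^+ d = 2 ^+ d * (a / 2) ^+ d by rewrite -exprMn; congr (_ ^+ _); field.
  rewrite e3; move: hq ad; move: ((a / 2) ^+ d) ((a / 2) `^ q) (n `^ q) (2 ^+ d) (k) (e) (I1) (H) (C)
    => D aq nq t k' e' I' H' C' hq D0.
  have := ler_wpM2l (ltW (mulr_gt0 D0 D0)) hq.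
  by move=> h; apply: (le_trans _ (le_trans h _)); apply: ler_eq; ring.
Qed.

End high_dimension.

Section one_dimension.
Local Notation Rd := (1.-tuple R).
Local Notation mu := (@leb R 1).

(** With [a = n] the two sides of the condition on the phases have the same
    order [n ^+ 4] at the endpoint, so it is met through the choice of [rho]
    rather than of [n]. The test function depends on whether [q = 1], the
    endpoint. *)
Lemma inflation_one (m s eps : R) (u0 : distrib R 1) :
  `|m| = 1 -> s <= - (1 / 2) -> in_Hs s u0 -> 0 < eps -> inflation m s eps u0.
Proof.
move=> m1 s2 hu0 eps0.
have s0 : s < 0 by have := s2; lra.
have e2 : 0 < eps ^+ 2 / 16 by rewrite divr_gt0// exprn_gt0.
have [g [V [Voo [u0g cV VB Vg]]]] := bounded_dense hu0 e2.
set V1 := \int[mu]_x normc (V x).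
pose q := - (s + s); have q1 : 1 <= q by rewrite /q; have := s2; lra.
have q0 : 0 < q := lt_le_trans ltr01 q1.
have I1p : 0 < @gmass R 1 := gaussd_int_gt0.
set e := eps / 8; have e0 : 0 < e by rewrite divr_gt0.
have e20 : 0 < e ^+ 2 by rewrite exprn_gt0.
have e40 : 0 < e ^+ 4 by rewrite exprn_gt0.
pose beta : R := 2^-1; have betap : 0 < beta by rewrite invr_gt0.
have cb : 0 < @coherence R 1 * beta := mulr_gt0 coherence_gt0 betap.
have r0 : 0 < e ^+ 4 / (128 * (30 ^+ 2) ^+ 2) by rewrite divr_gt0// mulr_gt0// !exprn_gt0.
have [rho [rho0 rhor rho1 rho2]] := small_rho cb r0.
set k := @gain R 1 rho beta.
have k0 : 0 < k.
  by apply: divr_gt0 => //; apply: mulr_gt0 => //; apply: mulr_gt0 => //; exact: coherence_gt0.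
set C := eps^-1 + 1 + (2 * Voo * V1 + 2^-1).
have ke0 : 0 < k ^+ 2 * e ^+ 2 by rewrite mulr_gt0// exprn_gt0.
have [psi [P [W2 [n1 [spsi psi0 psiP Ip [W20 hW n11 lg]]]]]] :
  exists (psi : Rd -> R) (P W2 n1 : R), [/\ rschwartz psi, (forall x, 0 <= psi x),
    (forall x, psi x <= P), 0 < \int[mu]_x psi x &
    [/\ 0 < W2, \int[mu]_x (japanese x `^ q * psi x ^+ 2) <= W2, 1 <= n1 &
     forall n, n1 <= n -> C ^+ 2 * W2 * n <= k ^+ 2 * (e ^+ 2 * n `^ q) * (\int[mu]_x psi x) ^+ 2]].
  have [q1'|q1'] := eqVneq q 1.
    have jE : 0 < 3 * @jenergy R + 1.
      rewrite ltr_wpDl// mulr_ge0// Rintegral_ge0// => x _.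
      by rewrite mulr_ge0 ?powR_ge0// ltW// gaussd_gt0.
    set E := 3 * _ + 1 in jE.
    pose B := C ^+ 2 * E / (k ^+ 2 * e ^+ 2 * @gmass R 1 ^+ 2).
    have B0 : 0 <= B.
      rewrite divr_ge0//; first by rewrite mulr_ge0 ?sqr_ge0// ltW.
      by rewrite mulr_ge0 ?sqr_ge0// ltW.
    (* The number of scales is what makes the pairing large at the endpoint. *)
    pose J := Num.Def.archi_bound B.
    have hJ : B <= J.+1%:R.
      by apply: le_trans (ltW (Num.Theory.archi_boundP B0)) _; rewrite ler_nat.
    exists (multi J.+1), J.+1%:R, (J.+1%:R * E), 1.
    split; [exact: multi_schwartz|exact: multi_ge0|exact: multi_le|by rewrite multi_mass mulr_gt0|].
    split => //; first by rewrite mulr_gt0.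
      rewrite q1'; apply: le_trans (multi_energy _) _; apply: ler_wpM2l => //.
      by rewrite /E lerDl.
    move=> n n1; have n0 : 0 <= n := le_trans ler01 n1.
    rewrite q1' powRr1// multi_mass.
    have h : C ^+ 2 * E <= (k ^+ 2 * e ^+ 2 * @gmass R 1 ^+ 2) * J.+1%:R.
      by rewrite -ler_pdivrMl 1?mulrC// mulr_gt0// exprn_gt0.
    have j0 : 0 <= J.+1%:R * n :> R by rewrite mulr_ge0.
    move: h j0; move: (J.+1%:R : R) (@gmass R 1) (C) (E) (k) (e) => j I' C' E' k' e' h j0.
    have {}h := ler_wpM2l j0 h.
    by apply: (le_trans _ (le_trans h _)); apply: ler_eq; ring.
  have q1p : 0 < q - 1 by rewrite subr_gt0 lt_neqAle eq_sym q1' q1.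
  have Hp : 0 < @genergy R 1 q := genergy_gt0 (ltW q0).
  have [n1 n11 hn1] := powR_large (C ^+ 2 * @genergy R 1 q / (k ^+ 2 * e ^+ 2 * @gmass R 1 ^+ 2)) q1p.
  exists (gaussd 1), 1, (@genergy R 1 q), n1; split.
  - exact: gaussd_schwartz.
  - by move=> x; exact/ltW/gaussd_gt0.
  - exact: gaussd_le1.
  - exact: I1p.
  split => //.
  move=> n hn; have n0 : 0 < n := lt_le_trans ltr01 (le_trans n11 hn).
  have -> : n `^ q = n `^ (q - 1) * n.
    by rewrite -[X in _ = _ * X](powRr1 (ltW n0)) -powRD ?subrK// (gt_eqF n0) implybT.
  have := hn1 _ hn; rewrite ler_pdivrMr; last by rewrite mulr_gt0// exprn_gt0.
  rewrite -/(@gmass R 1); move: (n `^ (q - 1)) (@gmass R 1) (@genergy R 1 q) (k) (e) (C) => N I' H' k' e' C' h.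
  have {}h := ler_wpM2r (ltW n0) h.
  by apply: (le_trans _ (le_trans h _)); apply: ler_eq; ring.
set I := \int[mu]_x psi x in Ip lg.
have eta0 : 0 < Num.min (I / 2) (k * I / 2) by rewrite lt_min !divr_gt0// mulr_gt0.
have [r1 hr1] := chi_tail (rschwartz_integrable spsi) psi0 eta0.
pose Y := V1 ^+ 2 / e ^+ 2 + rho / (eps * e ^+ 4) + 1.
pose n := Num.max n1 (Num.max (16 * `|r1|) Y).
have nn1 : n1 <= n by rewrite le_max lexx.
have nr1 : 16 * `|r1| <= n by rewrite !le_max lexx !orbT.
have nY : Y <= n by rewrite !le_max lexx !orbT.
have n1' : 1 <= n := le_trans n11 nn1.
have n0 : 0 < n := lt_le_trans ltr01 n1'.
pose y1 := V1 ^+ 2 / e ^+ 2; pose y2 := rho / (eps * e ^+ 4).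
have y10 : 0 <= y1 by rewrite divr_ge0 ?sqr_ge0.
have y20 : 0 < y2 by rewrite divr_gt0// mulr_gt0.
have YE : Y = y1 + y2 + 1 by [].
have nq : n <= n `^ q by rewrite -[X in X <= _](powRr1 (ltW n0)) ler_powR.
set X := n `^ q * n ^+ 1.
have Xn : n ^+ 2 <= X by rewrite expr2 /X expr1 ler_wpM2r// ltW.
have n2 : n <= n ^+ 2 by rewrite expr2 ler_peMr// ltW.
have X2 : n ^+ 4 <= X ^+ 2.
  rewrite (_ : n ^+ 4 = (n ^+ 2) ^+ 2); last by rewrite -exprM.
  by rewrite lerXn2r ?nnegrE ?sqr_ge0//; exact: le_trans (sqr_ge0 n) Xn.
have n24 : n ^+ 2 <= n ^+ 4 by rewrite ler_weXn2l.
have rn : r1 <= n / 16 by move: (ler_norm r1) nr1; clear; lra.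
have rn' : r1 <= n by move: (ler_norm r1) (normr_ge0 r1) nr1; clear; lra.
have WE : Num.sqrt W2 ^+ 2 = W2 by rewrite sqr_sqrtr// ltW.
apply: (@inflation_of_profile 1 m s eps rho n n beta P (Num.sqrt W2) Voo u0 g V psi ord0) => //.
- rewrite -/V1 -/e -/q -/X -ler_pdivrMl// mulrC -/y1.
  by apply: le_trans Xn; apply: le_trans n2; move: nY y20; rewrite YE; clear; lra.
- rewrite -/e -/q -/X mulrA -ltr_pdivrMl ?mulr_gt0// mulrC -/y2.
  apply: lt_le_trans X2; apply: lt_le_trans n24; apply: lt_le_trans n2.
  by move: nY y10; rewrite YE; clear; lra.
- rewrite -/e -/q -/X; move: rhor; rewrite ler_pdivlMr; last by rewrite mulr_gt0// !exprn_gt0.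
  move=> h; apply: le_trans (ler_wpM2l (ltW e40) X2).
  have n40 : 0 <= n ^+ 4 by rewrite exprn_ge0// ltW.
  have {}h := ler_wpM2r n40 h.
  by apply: (le_trans _ h); apply: ler_eq; ring.
- have := hr1 _ rn; rewrite le_min => /andP[h _]; rewrite -/I /beta.
  by move: h; rewrite -/I; clear; lra.
- have := hr1 _ rn'; rewrite le_min => /andP[_ h]; rewrite -/I -/k.
  by move: h; rewrite -/I; clear; lra.
- by rewrite sqrtr_gt0.
- by rewrite WE.
- by rewrite -/V1 -/C -/e -/q -/k -/I WE expr1; exact: lg.
Qed.

End one_dimension.
End selection.

(** * Norm inflation *)

Theorem theorem1p2 (R : realType) (mu : R) (d : nat) (s : R)
    (hmu : mu = 1 \/ mu = -1) (hd : (1 <= d)%N)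
    (hs1 : d = 1%N -> s <= - (1 / 2)) (hs2 : (2 <= d)%N -> s < 0)
    (u0 : distrib R d) (hu0 : in_Hs s u0)
    (eps : R) (heps : 0 < eps) :
  exists (T0 : R) (u : R -> d.-tuple R -> R[i]) (t : R),
    [/\ solution mu T0 u,
        0 < t < eps,
        t <= T0,
        (Hs_norm s (fun phi => (of_fun (u 0) phi - u0 phi)%R)
           < eps%:E)%E
      & (eps^-1%:E < Hs_norm s (of_fun (u t)))%E].
Proof.
have m1 : `|mu| = 1 by case: hmu => ->; rewrite ?normrN normr1.
case: d hd hs1 hs2 u0 hu0 => [//|[|d]] _ hs1 hs2 u0 hu0.
  exact: inflation_one m1 (hs1 erefl) hu0 heps.
exact: (@inflation_high R d.+2 mu s eps u0 ord0 m1 (hs2 isT) isT hu0 heps).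
Qed.
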